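(* Let $0\leqslant\gamma\leqslant 1/2$, $0\leqslant\beta\leqslant 1$ and $f\in{}_0H^{\gamma}(0,T;\dot H^{-\beta}(\Omega))$. Then the weak solution $u$ (with zero initial value) of the time fractional subdiffusion problem with right-hand side $f$ satisfies $$u'-\mathrm D_{0+}^{1-\alpha}\Delta u=f\quad\text{in }L^2(0,T;\dot H^{-\beta}(\Omega))$$ and $$\|u\|_{{}_0H^{1+\gamma}(0,T;\dot H^{-\beta}(\Omega))}+\|u\|_{{}_0H^{1+\gamma-\alpha}(0,T;\dot H^{2-\beta}(\Omega))}\leqslant C_{\alpha,\gamma}\|f\|_{{}_0H^{\gamma}(0,T;\dot H^{-\beta}(\Omega))},$$ where $C_{\alpha,\gamma}>0$ depends only on $\alpha$ and $\gamma$. In addition, if $\gamma=0$ and $1/2\leqslant\alpha<1$, then for all $0<\epsilon\leqslant 2$, $$\|u\|_{C([0,T];\dot H^{1/\alpha-\sigma\epsilon-\beta}(\Omega))}\leqslant\frac{C_{\alpha,T}}{\epsilon^{\sigma/2}}\|f\|_{L^2(0,T;\dot H^{-\beta}(\Omega))},$$ where $\sigma=0$ if $1/2<\alpha<1$, $\sigma=1$ if $\alpha=1/2$, and $C_{\alpha,T}>0$ depends only on $\alpha$ and $T$.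
   Context: Setting: $\alpha\in(0,1)$, $T>0$, $\Omega\subset\mathbb R^d$ ($d=1,2,3$) is a convex polyhedral domain, $\Omega_T=\Omega\times(0,T)$. The problem is $u'-\mathrm D_{0+}^{1-\alpha}\Delta u=f$ in $\Omega_T$, $u=0$ on $\partial\Omega\times(0,T)$, $u(\cdot,0)=0$. Spatial spaces: $\{\phi_n\}_{n\in\mathbb N}\subset H_0^1(\Omega)\cap H^2(\Omega)$ is an orthonormal basis of $L^2(\Omega)$ with $-\Delta\phi_n=\lambda_n\phi_n$, $\lambda_n>0$ non-decreasing, $\lambda_n\to\infty$. For $r\in\mathbb R$, $\dot H^r(\Omega)=\{\sum_n c_n\phi_n:\sum_n\lambda_n^rc_n^2<\infty\}$ with norm $\|\sum_n c_n\phi_n\|_{\dot H^r(\Omega)}=(\sum_n\lambda_n^rc_n^2)^{1/2}$; $\dot H^{-r}(\Omega)$ is the dual of $\dot H^{r}(\Omega)$ via $\langle\sum c_n\phi_n,\sum d_n\phi_n\rangle=\sum c_nd_n$; $-\Delta\sum c_n\phi_n=\sum\lambda_nc_n\phi_n$. Time spaces: for $m\in\mathbb N$, ${}_0H^m(0,T)=\{v\in H^m(0,T):v^{(k)}(0)=0,\ 0\leqslant k<m\}$ and ${}^0\!H^m(0,T)=\{v\in H^m(0,T):v^{(k)}(T)=0,\ 0\leqslant k<m\}$, both with norm $\|v^{(m)}\|_{L^2(0,T)}$ (so both equal $L^2(0,T)$ when $m=0$). For non-integer $r>0$, with $r=m\theta$, $m\in\mathbb N$, $0<\theta<1$: ${}_0H^r(0,T)=[L^2(0,T),{}_0H^m(0,T)]_{\theta,2}$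 and ${}^0\!H^r(0,T)=[L^2(0,T),{}^0\!H^m(0,T)]_{\theta,2}$ ($K$-method real interpolation, with the interpolation norms). For a separable Hilbert space $X$ with orthonormal basis $\{e_i\}$, ${}_0H^r(0,T;X)=\{v\in L^2(0,T;X):\sum_i\|(v,e_i)_X\|_{{}_0H^r(0,T)}^2<\infty\}$ with norm the square root of this sum, and similarly for ${}^0\!H^r(0,T;X)$. Fractional operators: for $\gamma>0$, $(\mathrm I_{0+}^\gamma v)(t)=\frac1{\Gamma(\gamma)}\int_0^t(t-s)^{\gamma-1}v(s)\,ds$, $(\mathrm I_{T-}^\gamma v)(t)=\frac1{\Gamma(\gamma)}\int_t^T(s-t)^{\gamma-1}v(s)\,ds$; for $0<\gamma<1$, $\mathrm D_{0+}^\gamma=\frac{d}{dt}\mathrm I_{0+}^{1-\gamma}$, $\mathrm D_{T-}^\gamma=-\frac{d}{dt}\mathrm I_{T-}^{1-\gamma}$ (distributional derivative). Weak solution: let $\mathcal X={}_0H^{\alpha/2}(0,T;L^2(\Omega))\cap L^2(0,T;\dot H^1(\Omega))$ and $\mathcal Y={}^0\!H^{1-\alpha/2}(0,T;L^2(\Omega))\cap{}^0\!H^{1-\alpha}(0,T;\dot H^1(\Omega))$. For $f\in\mathcal Y^*$ (which contains $L^2(0,T;\dot H^{-1}(\Omega))$), the weak solution is the unique $u\in\mathcal X$ such that for all $v\in\mathcal X$ $$\langle\mathrm D_{0+}^\alpha u,v\rangle_{{}_0H^{\alpha/2}(0,T;L^2(\Omega))}+\langle\nabla u,\nabla v\rangle_{\Omega_T}=\langle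 f,\mathrm I_{T-}^{1-\alpha}v\rangle_{\mathcal Y},$$ where $\langle\cdot,\cdot\rangle_X$ is the duality pairing between $X^*$ and $X$, the first term equals $\langle\mathrm D_{0+}^{\alpha/2}u,\mathrm D_{T-}^{\alpha/2}v\rangle_{\Omega_T}$, and $\langle p,q\rangle_{\Omega_T}=\int_{\Omega_T}pq$. *)

(* Defs.v *)
From HB Require Import structures.
From mathcomp Require Import all_boot all_order all_algebra.
From mathcomp Require Import all_classical all_reals all_analysis.

Set Implicit Arguments.
Unset Strict Implicit.
Unset Printing Implicit Defensive.

Import Order.TTheory GRing.Theory Num.Theory.
Import numFieldNormedType.Exports.

Local Open Scope classical_set_scope.
Local Open Scope ring_scope.

(* Lebesgue measure on R^d, realized on row vectors: the sigma-algebra is the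
   one generated by the coordinates (as for tuples in the library), the
   measure is the d-fold product of the Lebesgue measure on the line. *)

Definition rv_display : measure_display. Proof. exact. Qed.

Section measurable_rv.
Context {R : realType}.
Variable n : nat.

Let coors : 'I_n -> 'rV[R]_n -> R := fun i x => x 0 i.

Let rv_set0 : g_sigma_preimage coors set0.
Proof. exact: sigma_algebra0. Qed.

Let rv_setC A : g_sigma_preimage coors A -> g_sigma_preimage coors (~` A).
Proof. exact: sigma_algebraC. Qed.

Let rv_bigcup (F : _^nat) : (forall i, g_sigma_preimage coors (F i)) ->
  g_sigma_preimage coors (\bigcup_i (F i)).
Proof. exact: sigma_algebra_bigcup. Qed.

HB.instance Definition _ := @isMeasurable.Build rv_display
  'rV[R]_n (g_sigma_preimage coors) rv_set0 rv_setC rv_bigcup.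

End measurable_rv.

Definition snoc_rv {R : realType} n (p : 'rV[R]_n * measurableTypeR R) : 'rV[R]_n.+1 :=
  \row_(i < n.+1) (if unlift ord_max i is Some j then p.1 0 j else p.2).

Lemma measurable_rv_coor {R : realType} n (i : 'I_n) :
  measurable_fun setT (fun x : 'rV[R]_n => x 0 i).
Proof.
move=> _ Y mY; rewrite setTI; apply: sub_sigma_algebra => /=.
rewrite -bigcup_seq/=; exists i => /=; first by rewrite mem_index_enum.
by exists Y => //; rewrite setTI.
Qed.

Lemma measurable_rvP {R : realType} d (T : measurableType d) n
    (f : T -> 'rV[R]_n) :
  (forall i, measurable_fun setT (fun x => f x 0 i)) -> measurable_fun setT f.
Proof.
move=> mf; pose c := fun (i : 'I_n) (x : 'rV[R]_n) => x 0 i.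
suff : g_sigma_preimage (fun i => c i \o f) `<=` measurable.
  rewrite g_sigma_preimage_comp => prefS _ A mA.
  by apply: prefS; exists A.
apply: smallest_sub; first exact: sigma_algebra_measurable.
case: n => [|n] in f mf c *; first by rewrite big_ord0.
rewrite -bigcup_mkord_ord; apply: bigcup_sub => i Ii.
by move=> A [B mB <-]; exact: mf.
Qed.

Lemma measurable_snoc_rv {R : realType} n :
  measurable_fun setT (@snoc_rv R n).
Proof.
apply: measurable_rvP => i; rewrite /snoc_rv.
under eq_fun do rewrite mxE.
case: (unlift ord_max i) => [j|]; last exact: measurable_snd.
exact: (measurableT_comp (measurable_rv_coor j) measurable_fst).
Qed.

Definition pushforward_snoc {R : realType} n
    (mu : {measure set ('rV[R]_n * measurableTypeR R) -> \bar R}) :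
  {measure set 'rV[R]_n.+1 -> \bar R}.
Proof.
refine [the {measure set _ -> \bar R} of pushforward mu (@snoc_rv R n)].
exact: measurable_snoc_rv.
Defined.

Fixpoint lebesgue_rv (R : realType) (d : nat) :
    {measure set 'rV[R]_d -> \bar R} :=
  match d with
  | 0 => \d_ (0 : 'rV[R]_0)
  | d'.+1 => pushforward_snoc (lebesgue_rv R d' \x @lebesgue_measure R)%E
  end.

Definition square_integrable {R : realType} d (X : measurableType d)
    (mu : {measure set X -> \bar R}) (D : set X) (g : X -> R) : Prop :=
  measurable_fun D g /\ (\int[mu]_(x in D) (g x ^+ 2)%:E < +oo)%E.

Section space.
Context {R : realType} {d : nat}.
Implicit Types (Omega : set 'rV[R]_d) (g psi S : 'rV[R]_d -> R)
  (G : 'I_d -> 'rV[R]_d -> R) (phi : nat -> 'rV[R]_d -> R)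
  (lam c : nat -> R).

Local Notation leb := (lebesgue_rv R d).

Definition convex_polyhedral_domain Omega : Prop :=
  [/\ Omega !=set0, bounded_set Omega &
    exists (k : nat) (a : 'I_k -> 'rV[R]_d) (b : 'I_k -> R),
      Omega = [set x | forall i, \sum_(j < d) a i 0 j * x 0 j < b i] ].

Definition partial (j : 'I_d) g : 'rV[R]_d -> R :=
  fun x => 'D_('e_j) g x.

Definition smooth_rv g : Prop :=
  forall s : seq 'I_d, let h := foldr partial g s in
    continuous h /\ forall (j : 'I_d) x, derivable h x 'e_j.

Definition test_rv Omega psi : Prop :=
  smooth_rv psi /\
  exists K, [/\ compact K, K `<=` Omega & forall x, ~ K x -> psi x = 0].

Definition weak_partial Omega (j : 'I_d) g h : Prop :=
  [/\ square_integrable leb Omega g, square_integrable leb Omega h &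
    forall psi, test_rv Omega psi ->
      \int[leb]_(x in Omega) (g x * partial j psi x) =
      - \int[leb]_(x in Omega) (h x * psi x)].

Definition cvg_L2 Omega (gk : nat -> 'rV[R]_d -> R) g : Prop :=
  (\int[leb]_(x in Omega) ((gk k x - g x) ^+ 2)%:E @[k --> \oo] --> 0)%E.

(* [g] lies in H^1_0(Omega), the H^1-closure of the test functions, and [G]
   is its weak gradient. *)
Definition H10 Omega g G : Prop :=
  (forall j, weak_partial Omega j g (G j)) /\
  exists psi : nat -> 'rV[R]_d -> R,
    [/\ forall k, test_rv Omega (psi k), cvg_L2 Omega psi g &
        forall j, cvg_L2 Omega (fun k => partial j (psi k)) (G j)].

Definition dirichlet_eigenfunction Omega (l : R) g : Prop :=
  exists (G : 'I_d -> 'rV[R]_d -> R) (H : 'I_d -> 'I_d -> 'rV[R]_d -> R),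
    [/\ H10 Omega g G,
        forall i j, weak_partial Omega j (G i) (H i j) &
        {ae leb, forall x, Omega x -> - (\sum_(j < d) H j j x) = l * g x}].

Definition orthonormal_basis_L2 Omega phi : Prop :=
  [/\ forall n, square_integrable leb Omega (phi n),
      forall m n, \int[leb]_(x in Omega) (phi m x * phi n x) = (m == n)%:R &
      forall g, square_integrable leb Omega g ->
        cvg_L2 Omega
          (fun N x => \sum_(0 <= n < N)
             (\int[leb]_(y in Omega) (g y * phi n y)) * phi n x) g].

Definition dirichlet_eigenbasis Omega phi lam : Prop :=
  [/\ orthonormal_basis_L2 Omega phi,
      forall n, dirichlet_eigenfunction Omega (lam n) (phi n),
      forall n, 0 < lam n,
      {homo lam : m n / (m <= n)%N >-> m <= n} &
      lam n @[n --> \oo] --> +oo].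

(* An element sum_n c_n phi_n of any of the spaces dot H^r(Omega) (a formal
   series when r < 0) is represented by its coefficient sequence [c]. *)

Definition dotH_norm lam (r : R) c : \bar R :=
  sqrte (\sum_(0 <= n <oo) (lam n `^ r * c n ^+ 2)%:E)%E.

Definition pairing c e : R := limn (series (fun n => c n * e n)).

(* The function sum_n c_n phi_n lies in H^1_0(Omega) and has gradient [G]. *)
Definition is_gradient Omega phi c G : Prop :=
  exists2 S, H10 Omega S G &
    forall n, \int[leb]_(x in Omega) (S x * phi n x) = c n.

End space.

Section time.
Context {R : realType}.
Implicit Types (T r gam t : R) (v g psi : R -> R) (m : nat).

Local Notation leb := (@lebesgue_measure R).

Definition smooth psi : Prop :=
  forall n t, derivable (psi^`(n))%classic t 1.

Definition test_time T psi : Prop :=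
  smooth psi /\
  exists K, [/\ compact K, K `<=` `]0, T[ & forall t, ~ K t -> psi t = 0].

Definition weak_deriv T v g : Prop :=
  [/\ leb.-integrable `]0, T[ (EFin \o v),
      leb.-integrable `]0, T[ (EFin \o g) &
      forall psi, test_time T psi ->
        \int[leb]_(t in `]0, T[) (v t * (psi^`())%classic t) =
        - \int[leb]_(t in `]0, T[) (g t * psi t)].

(* The continuous representative of [v] on [0,T] vanishes at 0. *)
Definition zero_at_0 T v : Prop :=
  exists w : R -> R,
    [/\ {within `[0, T], continuous w},
        {ae leb, forall t, t \in `]0, T[ -> w t = v t} & w 0 = 0].

(* [g 0%N] lies in 0H^m(0,T), and [g k] is its k-th derivative for k <= m. *)
Definition H0_derivs T m (g : nat -> R -> R) : Prop :=
  (forall k, (k <= m)%N -> square_integrable leb `]0, T[ (g k)) /\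
  (forall k, (k < m)%N -> weak_deriv T (g k) (g k.+1) /\ zero_at_0 T (g k)).

(* The norm of 0H^m(0,T), with value +oo outside of the space: all the
   admissible [g m] agree a.e., so the infimum is over at most one value. *)
Definition H0int_norm T m v : \bar R :=
  ereal_inf [set sqrte (\int[leb]_(t in `]0%R, T[) (g m t ^+ 2)%:E)%E
            | g in [set g | H0_derivs T m g /\ g 0%N = v]].

Definition Kfun T m t v : \bar R :=
  ereal_inf [set (H0int_norm T 0 (v \- w)%R + t%:E * H0int_norm T m w)%E
            | w in [set: R -> R]].

(* The norm of [L^2(0,T), 0H^m(0,T)]_{theta,2}, +oo outside of the space. *)
Definition interp_norm T m (theta : R) v : \bar R :=
  sqrte (\int[leb]_(t in `]0%R, +oo[)
           (((t `^ (- theta))%:E * Kfun T m t v) ^+ 2 * (t^-1)%:E))%E.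

(* The norm of 0H^r(0,T) for r >= 0. For non-integer r the interpolation
   space [L^2, 0H^m]_{theta,2} with m * theta = r does not depend on m, up to
   equivalence of norms; the least possible m is used. *)
Definition H0_norm T r v : \bar R :=
  let m := Num.truncn r in
  if m%:R == r then H0int_norm T m v
  else interp_norm T m.+1 (r / m.+1%:R) v.

Definition Gamma (z : R) : R :=
  \int[leb]_(x in `]0, +oo[) (x `^ (z - 1) * expR (- x)).

Definition I0 gam v : R -> R := fun t =>
  (Gamma gam)^-1 * \int[leb]_(s in `]0, t[) ((t - s) `^ (gam - 1) * v s).

Definition IT gam T v : R -> R := fun t =>
  (Gamma gam)^-1 * \int[leb]_(s in `]t, T[) ((s - t) `^ (gam - 1) * v s).

(* D_{0+}^gam v and D_{T-}^gam v as distributional derivatives on (0,T); the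
   sign in [is_DT] is that of D_{T-}^gam = - d/dt I_{T-}^(1-gam). *)
Definition is_D0 gam T v g : Prop := weak_deriv T (I0 (1 - gam) v) g.

Definition is_DT gam T v g : Prop :=
  weak_deriv T (IT (1 - gam) T v) (fun t => - g t).

End time.

(* A function v : (0,T) -> dot H^s(Omega) is represented by the sequence of its
   coefficient functions, [v n t] being the coefficient of v(t) on phi_n. *)

Section evolution.
Context {R : realType}.
Implicit Types (T r s : R) (lam : nat -> R) (u v w : nat -> R -> R).

Local Notation leb := (@lebesgue_measure R).

(* The norm of 0H^r(0,T; dot H^s(Omega)): lam_n^(s/2) * v_n is the component of
   v on the vector lam_n^(-s/2) * phi_n of an orthonormal basis of
   dot H^s(Omega). *)
Definition H0X_norm lam T r s v : \bar R :=
  sqrte (\sum_(0 <= n <oo)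
           (H0_norm T r (fun t => (lam n `^ (s / 2) * v n t)%R)) ^+ 2)%E.

Definition L2X lam T s v : Prop := (H0X_norm lam T 0 s v < +oo)%E.

Definition H0X lam T r s v : Prop :=
  L2X lam T s v /\ (H0X_norm lam T r s v < +oo)%E.

Definition XX lam (alpha T : R) v : Prop :=
  H0X lam T (alpha / 2) 0 v /\ L2X lam T 1 v.

(* Int_0^T <v(t), w(t)> dt: the L^2(Omega_T) inner product of elements of
   L^2(0,T; L^2(Omega)), and the pairing of L^2(0,T; dot H^(-1)(Omega)) with
   L^2(0,T; dot H^1(Omega)). *)
Definition time_pairing T v w : R :=
  \int[leb]_(t in `]0, T[) pairing (v^~ t) (w^~ t).

(* [w] is a continuous function [0,T] -> dot H^s(Omega) equal to [v] a.e. *)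
Definition continuous_version lam T s v w : Prop :=
  [/\ forall n, {ae leb, forall t, t \in `]0, T[ -> w n t = v n t},
      forall t, t \in `[0, T] -> (dotH_norm lam s (w^~ t) < +oo)%E &
      forall t, t \in `[0, T] ->
        dotH_norm lam s (fun n => w n t' - w n t)
          @[t' --> within `[0, T] (nbhs t)] --> 0%E].

Definition CX_norm lam T s w : \bar R :=
  ereal_sup [set dotH_norm lam s (w^~ t) | t in `[0, T]].

(* u' - D_{0+}^(1-alpha) Delta u = f in L^2(0,T; dot H^s(Omega)), where
   Delta u has coefficients - lam_n u_n. *)
Definition solves_in_L2 lam (alpha T s : R) (f u : nat -> R -> R) : Prop :=
  exists p q : nat -> R -> R,
    [/\ L2X lam T s p /\ L2X lam T s q,
        forall n, weak_deriv T (u n) (p n),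
        forall n, is_D0 (1 - alpha) T (fun t => - (lam n * u n t)) (q n) &
        forall n, {ae leb, forall t, t \in `]0, T[ -> p n t - q n t = f n t}].

Context {d : nat}.
Implicit Types (Omega : set 'rV[R]_d) (phi : nat -> 'rV[R]_d -> R)
  (G H : 'I_d -> 'rV[R]_d * measurableTypeR R -> R).

(* [G] in L^2(Omega_T)^d is the spatial gradient of [v]. *)
Definition is_gradient_T Omega phi T v G : Prop :=
  (forall j, square_integrable (lebesgue_rv R d \x leb)%E
               (Omega `*` `]0, T[) (G j)) /\
  {ae leb, forall t, t \in `]0, T[ ->
    is_gradient Omega phi (v^~ t) (fun j x => G j (x, t))}.

Definition gradient_pairing Omega T G H : R :=
  \sum_(j < d) \int[(lebesgue_rv R d \x leb)%E]_(z in Omega `*` `]0, T[)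
     (G j z * H j z).

(* D_{0+}^(alpha/2) u, D_{T-}^(alpha/2) v and the gradients are determined a.e.
   by u and v; [f] is assumed to lie in L^2(0,T; dot H^(-1)(Omega)), so that its
   action on the space of the I_{T-}^(1-alpha) v is the L^2-in-time pairing. *)
Definition weak_solution Omega phi lam (alpha T : R) (f u : nat -> R -> R) :
    Prop :=
  XX lam alpha T u /\
  exists (Du : nat -> R -> R) (Gu : 'I_d -> 'rV[R]_d * measurableTypeR R -> R),
    [/\ L2X lam T 0 Du, forall n, is_D0 (alpha / 2) T (u n) (Du n),
        is_gradient_T Omega phi T u Gu &
        forall (v Dv : nat -> R -> R) (Gv : 'I_d -> 'rV[R]_d * measurableTypeR R -> R),
          XX lam alpha T v ->
          L2X lam T 0 Dv -> (forall n, is_DT (alpha / 2) T (v n) (Dv n)) ->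
          is_gradient_T Omega phi T v Gv ->
          time_pairing T Du Dv + gradient_pairing Omega T Gu Gv =
          time_pairing T f (fun n => IT (1 - alpha) T (v n))].

End evolution.

(* Main.v *)
(* Expansion in the eigenbasis decouples the problem. Testing the weak formulation
   with psi(t) phi_n, where psi is a primitive of an arbitrary function of mean 0,
   yields  u_n + lam_n a_alpha * u_n = 1 * f_n,  with a_g(t) = t^(g-1) / Gamma(g) and
   the causal convolution on (0,T); the constants left free by the distributional
   derivatives multiply some a_g with g <= 1/2, which is not in L^2, so they vanish.

   The estimates take place in the convolution algebra of (0,T). There
   y = (1 + lam a_alpha)^-1 is a contraction of L^2, because a_alpha is of positive
   type. Hence u = 1 * w with w = y f, and lam u = a_(1-alpha) * g with g = f - w. The
   interpolation norms are dyadic sums of K-functionals; y preserves these, and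
   a_(1-alpha) gains the order 1 - alpha, as a frequency decomposition by the
   resolvents J_s = (1 + s d/dt)^-1 shows, together with the square function bound
   sum_k |(J_(2^k) - J_(2^(k+1))) g|^2 <= |g|^2.

   For the supremum bound, u(t) is compared with its mean over (t-h,t), where
   h = lam^(-1/alpha). They differ by at most sqrt h |w|, and lam times the mean is the
   convolution of g with an averaged a_(1-alpha), whose L^2 norm is of order
   h^(1/2-alpha). If alpha = 1/2 then the square of this norm is logarithmic in lam,
   hence at most a multiple of lam^eps / eps. *)
Require Import Defs.
From HB Require Import structures.
From mathcomp Require Import all_boot all_order all_algebra.
From mathcomp Require Import all_classical all_reals all_analysis.
From mathcomp Require Import measurable_realfun.
From mathcomp Require Import ring lra.
Set Implicit Arguments.
Unset Strict Implicit.
Unset Printing Implicit Defensive.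
Import Order.TTheory GRing.Theory Num.Theory.
Import numFieldNormedType.Exports.
Local Open Scope classical_set_scope.
Local Open Scope ring_scope.

(** * Convolution on (0,T) *)

(** The constant of the norm estimate may depend neither on [T] nor on the eigenvalue. So a bound in
    an interpolation norm is traded for explicit decompositions [split] at the dyadic scales
    [dy s j], whose weighted square sum is comparable to the norm with numerical constants. The
    order 1 + gamma - alpha of the second norm shapes the proof. Below 1 it belongs to the couple
    (L^2, 0H^1), above 1 to (L^2, 0H^2). For gamma = alpha it is the integer 1: the geometric
    factors that sum the scales in the first case degenerate, and the bound on |lam w| comes by
    duality from the square function of the adjoints. The case gamma = 0 is separate as well: the
    norm of f is then the plain L^2 norm, and the square function takes the place of its
    K-functional. Algebra is kept apart from measure theory. Classes of functions form a commutative
    ring with Leibniz equality, so that kernel identities are proved by [ring], and the estimates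
    are stated for an arbitrary [time_calculus], which makes the independence of [T] visible in the
    order of the quantifiers. *)

Section lebesgue_invariance.
Context {R : realType}.
Local Notation mu := (@lebesgue_measure R).
Local Open Scope ereal_scope.

Let affm (c a : R) : measurableTypeR R -> measurableTypeR R :=
  fun x : R => (c * x + a)%R.

Let measurable_aff (c a : R) : measurable_fun setT (affm c a).
Proof.
apply: measurable_funD => //; exact: measurable_funM.
Qed.

Let aff_push (c a : R) : {measure set (measurableTypeR R) -> \bar R}.
Proof.
refine [the {measure set _ -> \bar R} of pushforward mu (affm c a)].
exact: measurable_aff.
Defined.

Let aff_measure (c a : R) (c0 : (0 < c)%R) :
    {measure set (measurableTypeR R) -> \bar R} :=
  [the {measure set _ -> \bar R} of mscale (NngNum (ltW c0)) (aff_push c a)].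

(** The pushforward under x -> c x + a, scaled by [c], has the right value on half-open intervals,
    and these values determine Lebesgue measure. *)
Let aff_mu (c a : R) (c0 : (0 < c)%R) : forall A, measurable A ->
  aff_measure a c0 A = mu A.
Proof.
move=> A mA; apply/esym/lebesgue_measure_unique => //= _ [[x y]] _ <-.
rewrite /mscale/= /aff_push/= /pushforward.
have -> : affm c a @^-1` `]x, y] = [set` `]((x - a) / c)%R, ((y - a) / c)%R]].
  apply/seteqP; split => z /=; rewrite !in_itv/= /affm;
  by rewrite ltr_pdivrMr// ler_pdivlMr// ltrBlDr lerBrDr mulrC.
rewrite !lebesgue_measure_itv/= !lte_fin ltr_pM2r ?invr_gt0// ltrBlDr subrK.
case: ifP => // _; last by rewrite mule0.
rewrite -EFinB -EFinM; congr EFin; field.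
exact: lt0r_neq0.
Qed.

Lemma ge0_integral_affine (c a : R) (f : R -> \bar R) : (0 < c)%R ->
  measurable_fun setT f -> (forall x, 0 <= f x) ->
  c%:E * \int[mu]_x f (c * x + a)%R = \int[mu]_x f x.
Proof.
move=> c0 mf f0.
have := @ge0_integral_pushforward _ _ _ _ R _ (measurable_aff c a) mu setT f
  measurableT mf (fun y _ => f0 y).
rewrite preimage_setT => /esym/= ->.
rewrite -(ge0_integral_mscale _ measurableT (NngNum (ltW c0)))//.
apply: eq_measure_integral => A mA _; exact: (aff_mu a c0).
Qed.

Lemma ge0_integral_opp (f : R -> \bar R) :
  measurable_fun setT f -> (forall x, 0 <= f x) ->
  \int[mu]_x f (- x)%R = \int[mu]_x f x.
Proof.
move=> mf f0.
have := @ge0_integral_pushforward _ _ _ _ R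
  (-%R : measurableTypeR R -> measurableTypeR R) (@oppr_measurable R _) mu setT f
  measurableT mf (fun y _ => f0 y).
rewrite preimage_setT => /esym/= ->.
apply: eq_measure_integral => A mA _; exact: lebesgue_measureN.
Qed.

End lebesgue_invariance.

Section Rintegral_extra.
Context {R : realType}.
Local Notation mu := (@lebesgue_measure R).
Implicit Types (f g : R -> R).

(** If the integral of |f| is infinite, the extended integral of [f] is one of the two infinities,
    and [fine] sends both to 0. *)
Lemma Rintegral_not_integrable d (X : measurableType d)
    (m : {measure set X -> \bar R}) (D : set X) (f : X -> R) : measurable D ->
  measurable_fun D f -> ~ m.-integrable D (EFin \o f) ->
  Rintegral m D f = 0.
Proof.
move=> mD mf nf; rewrite /Rintegral.
have mEf : measurable_fun D (EFin \o f) by exact/measurable_EFinP.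
have := @integral_fin_num_abs _ _ _ m _ f mD mf.
have -> : (\int[m]_(x in D) `|(f x)%:E| < +oo)%E = false.
  by apply/negbTE/negP => h; apply: nf; apply/integrableP.
rewrite /=; move: (integral _ _ _) => [r||] //.
Qed.

(** For [c != 0] the functions [f] and [c * f] are integrable together, and otherwise both sides are
    the default value 0. Scalars can thus be moved through inner integrals at every point, before
    Fubini says where these converge. *)
Lemma RintegralZ d (X : measurableType d)
    (m : {measure set X -> \bar R}) (D : set X) (f : X -> R) (c : R) : measurable D ->
  measurable_fun D f ->
  \int[m]_(x in D) (c * f x) = c * \int[m]_(x in D) f x.
Proof.
move=> mD mf; have [h|h] := pselect (m.-integrable D (EFin \o f)).
  exact: RintegralZl.
rewrite (Rintegral_not_integrable mD mf h) mulr0.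
have [->|c0] := eqVneq c 0.
  by under eq_Rintegral do rewrite mul0r; rewrite Rintegral_cst// mul0r.
apply: Rintegral_not_integrable => //.
  by apply: measurable_funM => //; exact: measurable_cst.
move=> h'; apply: h.
have := integrableZl mD c^-1 h'; apply: eq_integrable => //.
by move=> x _ /=; rewrite -EFinM mulKf.
Qed.

Lemma integral_shift (a : R) (f : R -> \bar R) : measurable_fun setT f ->
  (\int[mu]_x f (x + a)%R = \int[mu]_x f x)%E.
Proof.
move=> mf; rewrite integralE [RHS]integralE.
rewrite -(ge0_integral_affine a ltr01 (measurable_funepos mf))//.
rewrite -(ge0_integral_affine a ltr01 (measurable_funeneg mf))//.
by rewrite !mul1e; congr (_ - _)%E; apply: eq_integral => x _;
  rewrite mul1r ?funeposE ?funenegE.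
Qed.

Lemma integral_opp (f : R -> \bar R) : measurable_fun setT f ->
  (\int[mu]_x f (- x)%R = \int[mu]_x f x)%E.
Proof.
move=> mf; rewrite integralE [RHS]integralE.
rewrite -(ge0_integral_opp (measurable_funepos mf))//.
rewrite -(ge0_integral_opp (measurable_funeneg mf))//.
by congr (_ - _)%E; apply: eq_integral => x _; rewrite ?funeposE ?funenegE.
Qed.

Lemma integral_reflect (a : R) (f : R -> \bar R) : measurable_fun setT f ->
  (\int[mu]_x f (a - x)%R = \int[mu]_x f x)%E.
Proof.
move=> mf; rewrite -[RHS](integral_shift a)//.
rewrite -[RHS]integral_opp; first by under [RHS]eq_integral do rewrite addrC.
by apply: measurableT_comp => //; exact: measurable_funD.
Qed.

Lemma Rintegral_shift (a : R) f : measurable_fun setT f ->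
  \int[mu]_x f (x + a) = \int[mu]_x f x.
Proof. by move=> mf; congr fine;
apply: (@integral_shift a (EFin \o f)); exact/measurable_EFinP. Qed.

Lemma Rintegral_reflect (a : R) f : measurable_fun setT f ->
  \int[mu]_x f (a - x) = \int[mu]_x f x.
Proof. by move=> mf; congr fine;
apply: (@integral_reflect a (EFin \o f)); exact/measurable_EFinP. Qed.

End Rintegral_extra.

Section Rfubini.
Context d1 d2 (X : measurableType d1) (Y : measurableType d2) {R : realType}.
Variables (m1 : {sigma_finite_measure set X -> \bar R})
  (m2 : {sigma_finite_measure set Y -> \bar R}).

Section slices.
Variable k : X * Y -> R.
Hypothesis ik : (m1 \x m2)%E.-integrable setT (EFin \o k).

(** Real and extended slice integrals agree only where the slice is integrable; elsewhere the real
    one is a default value. This is why the Fubini statements below go through almost everywhere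
    equality. *)
Let slice_fin : {ae m1, forall x,
  (\int[m2]_y k (x, y))%:E = fubini_F m2 (EFin \o k) x}.
Proof.
move: (ae_integrable1 ik); apply: filterS => x ix.
rewrite /Rintegral fineK//.
exact: integrable_fin_num ix.
Qed.

Lemma measurable_Rfubini : measurable_fun setT (fun x => \int[m2]_y k (x, y)).
Proof.
have mF := measurable_fubini_F ik.
exact: (measurableT_comp (@fine_measurable R setT measurableT) mF).
Qed.

Lemma integrable_Rfubini :
  m1.-integrable setT (EFin \o (fun x => \int[m2]_y k (x, y))).
Proof.
have iF := integrable_fubini_F ik.
have mF : measurable_fun setT (EFin \o (fun x => \int[m2]_y k (x, y))).
  exact/measurable_EFinP/measurable_Rfubini.
apply/integrableP; split => //.
case/integrableP: (iF) => mF' iF'; apply: le_lt_trans iF'.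
rewrite le_eqVlt; apply/orP; left; apply/eqP.
apply: ae_eq_integral => //; try exact: measurableT_comp.
by move: slice_fin; apply: filterS => x h _; exact: (congr1 abse h).
Qed.

Lemma Rintegral_fubini_F :
  ((\int[m1]_x \int[m2]_y k (x, y))%:E = \int[(m1 \x m2)%E]_z (k z)%:E)%E.
Proof.
rewrite /Rintegral fineK; last exact: (integrable_fin_num measurableT integrable_Rfubini).
rewrite -(integral12_prod_meas1 ik); apply: ae_eq_integral => //.
- exact: measurable_int integrable_Rfubini.
- exact: (measurable_fubini_F ik).
- by move: slice_fin; apply: filterS => x h _; exact: h.
Qed.

End slices.

End Rfubini.

Section Rfubini_swap.
Context d1 d2 (X : measurableType d1) (Y : measurableType d2) {R : realType}.
Variables (m1 : {sigma_finite_measure set X -> \bar R})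
  (m2 : {sigma_finite_measure set Y -> \bar R}).
Variable k : X * Y -> R.
Hypothesis ik : (m1 \x m2)%E.-integrable setT (EFin \o k).

Lemma integrable_Rfubini_G :
  m2.-integrable setT (EFin \o (fun y => \int[m1]_x k (x, y))).
Proof.
have mF : measurable_fun setT (EFin \o (fun y => \int[m1]_x k (x, y))).
  have mF := measurable_fubini_G ik.
  by apply/measurable_EFinP; exact: (measurableT_comp (@fine_measurable R setT measurableT) mF).
have mk : measurable_fun setT (EFin \o k) := measurable_int _ ik.
apply/integrableP; split => //.
apply: le_lt_trans ((integrable21ltyP m1 m2 mk).1 ik).
apply: ae_ge0_le_integral => //.
- exact: measurableT_comp.
- by move=> y _; exact: integral_ge0.
- apply: (measurable_fun_fubini_tonelli_G (abse \o (EFin \o k))) => //=.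
  exact: measurableT_comp.
- move: (ae_integrable2 ik); apply: filterS => y iy _ /=.
  by rewrite EFin_normr_Rintegral//; apply: le_abse_integral => //; exact: measurable_int iy.
Qed.

Lemma Rfubini : \int[m1]_x \int[m2]_y k (x, y) = \int[m2]_y \int[m1]_x k (x, y).
Proof.
apply: EFin_inj; rewrite (Rintegral_fubini_F ik).
rewrite [X in _ = X%:E]/Rintegral fineK; last exact: (integrable_fin_num measurableT integrable_Rfubini_G).
rewrite -(integral21_prod_meas1 ik); apply: ae_eq_integral => //.
- exact: (measurable_fubini_G ik).
- exact: measurable_int integrable_Rfubini_G.
- move: (ae_integrable2 ik); apply: filterS => y iy _.
  by rewrite /= /Rintegral fineK//; exact: integrable_fin_num iy.
Qed.

Lemma norm_Rfubini : (\int[m1]_x `|\int[m2]_y k (x, y)|%:E <=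
  \int[m1]_x \int[m2]_y `|k (x, y)|%:E)%E.
Proof.
apply: ae_ge0_le_integral => //.
- apply/measurable_EFinP; apply: measurableT_comp => //.
  exact: measurable_Rfubini ik.
- by move=> x _; exact: integral_ge0.
- apply: (measurable_fun_fubini_tonelli_F (fun z => `|k z|%:E))%E => //.
  apply/measurable_EFinP; apply: measurableT_comp => //; apply/measurable_EFinP.
  exact: measurable_int ik.
- move: (ae_integrable1 ik); apply: filterS => x ix _ /=.
  by rewrite EFin_normr_Rintegral//; apply: le_abse_integral => //; exact: measurable_int ix.
Qed.

End Rfubini_swap.

Section convolution.
Context {R : realType}.
Local Notation mu := (@lebesgue_measure R).
Implicit Types (f g h : R -> R).

Lemma aeW (P Q : R -> Prop) : (forall x, P x -> Q x) ->
  {ae mu, forall x, P x} -> {ae mu, forall x, Q x}.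
Proof. by move=> PQ; apply: filterS; first exact: (ae_filter_ringOfSetsType mu). Qed.

Lemma aeI (P Q : R -> Prop) : {ae mu, forall x, P x} -> {ae mu, forall x, Q x} ->
  {ae mu, forall x, P x /\ Q x}.
Proof. by move=> aP aQ; apply: (@filterI _ _ (ae_filter_ringOfSetsType mu)). Qed.

Definition conv f g (x : R) : R := \int[mu]_y (f (x - y) * g y).

Definition L1 f := mu.-integrable setT (EFin \o f).

Lemma L1_measurable f : L1 f -> measurable_fun setT f.
Proof. by move=> /measurable_int /measurable_EFinP. Qed.

Definition norm1 f : R := \int[mu]_x `|f x|.

Lemma norm1_ge0 f : 0 <= norm1 f.
Proof. exact: Rintegral_ge0. Qed.

Lemma norm1E f : L1 f -> (\int[mu]_x `|f x|%:E)%E = (norm1 f)%:E.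
Proof.
move=> /integrable_abse/integrable_fin_num h; rewrite /norm1 /Rintegral fineK//.
exact: h.
Qed.

Lemma L1P f : measurable_fun setT f ->
  L1 f <-> (\int[mu]_x `|f x|%:E < +oo)%E.
Proof.
move=> mf; split => [/integrableP[]//|h]; apply/integrableP; split => //.
exact/measurable_EFinP.
Qed.

Lemma measurable_subl f : measurable_fun setT f ->
  measurable_fun setT (fun z : measurableTypeR R * measurableTypeR R => f (z.1 - z.2)).
Proof.
by move=> mf; apply: measurableT_comp => //; exact: measurable_funB.
Qed.

Lemma measurable_conv_kernel f g :
  measurable_fun setT f -> measurable_fun setT g ->
  measurable_fun setT (fun z : measurableTypeR R * measurableTypeR R => f (z.1 - z.2) * g z.2).
Proof.
move=> mf mg; apply: measurable_funM; first exact: measurable_subl.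
exact: measurableT_comp.
Qed.

(** Tonelli, followed by translation invariance of the inner integral. *)
Lemma ge0_integral_conv (F G : R -> \bar R) :
  measurable_fun setT F -> measurable_fun setT G ->
  (forall x, 0 <= F x)%E -> (forall x, 0 <= G x)%E ->
  (\int[mu]_x \int[mu]_y (F (x - y)%R * G y) = (\int[mu]_x F x) * (\int[mu]_x G x))%E.
Proof.
move=> mF mG F0 G0.
rewrite (@fubini_tonelli _ _ _ _ _ mu mu
  (fun z : measurableTypeR R * measurableTypeR R => F (z.1 - z.2)%R * G z.2)%E)/=; last 2 first.
- apply: emeasurable_funM; last exact: measurableT_comp.
  by apply: measurableT_comp => //; exact: measurable_funB.
- by move=> z; exact: mule_ge0.
rewrite -ge0_integralZl//; last exact: integral_ge0.
apply: eq_integral => y _.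
rewrite ge0_integralZr//; last first.
  by apply: measurableT_comp => //; exact: measurable_funB.
by rewrite (integral_shift (- y)).
Qed.

Lemma integrable_conv_kernel f g : L1 f -> L1 g ->
  (mu \x mu)%E.-integrable setT
    (EFin \o (fun z : measurableTypeR R * measurableTypeR R => f (z.1 - z.2) * g z.2)).
Proof.
move=> Lf Lg; have mf := L1_measurable Lf; have mg := L1_measurable Lg.
apply/integrable12ltyP.
  by apply/measurable_EFinP; exact: (measurable_conv_kernel mf mg).
under eq_integral do under eq_integral do rewrite /= normrM EFinM.
rewrite (@ge0_integral_conv (fun x => `|f x|%:E) (fun x => `|g x|%:E))//;
  try by apply/measurable_EFinP; exact: measurableT_comp.
by rewrite !norm1E// -EFinM ltry.
Qed.

Lemma L1_conv f g : L1 f -> L1 g -> L1 (conv f g).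
Proof. by move=> Lf Lg; exact: (integrable_Rfubini (integrable_conv_kernel Lf Lg)). Qed.

Lemma norm1_conv f g : L1 f -> L1 g -> norm1 (conv f g) <= norm1 f * norm1 g.
Proof.
move=> Lf Lg; have mf := L1_measurable Lf; have mg := L1_measurable Lg.
rewrite -lee_fin -norm1E; last exact: L1_conv.
apply: le_trans (norm_Rfubini (integrable_conv_kernel Lf Lg)) _ => /=.
under eq_integral do under eq_integral do rewrite /= normrM EFinM.
rewrite (@ge0_integral_conv (fun x => `|f x|%:E) (fun x => `|g x|%:E))//;
  try by apply/measurable_EFinP; exact: measurableT_comp.
by rewrite !norm1E// -EFinM.
Qed.

Lemma convC f g : measurable_fun setT f -> measurable_fun setT g -> conv f g = conv g f.
Proof.
move=> mf mg; apply/funext => x; rewrite /conv -(Rintegral_reflect x).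
  by apply: eq_Rintegral => y _; rewrite opprB addrC subrK mulrC.
apply: measurable_funM => //; apply: measurableT_comp => //.
exact: measurable_funB.
Qed.

Lemma ae_conv_integrable f g : L1 f -> L1 g ->
  {ae mu, forall x, L1 (fun y => f (x - y) * g y)}.
Proof.
by move=> Lf Lg; exact: (ae_integrable1 (integrable_conv_kernel Lf Lg)).
Qed.

Lemma ae_sub (P : R -> Prop) (x : R) : {ae mu, forall y, P y} ->
  {ae mu, forall y, P (x - y)}.
Proof.
move=> [N [mN N0 PN]].
pose B := [set y | N (x - y)].
have mB : measurable (B : set (measurableTypeR R)).
  rewrite -[B]setTI; suff: measurable_fun setT (fun y : measurableTypeR R => x - y : measurableTypeR R) by apply.
  exact: measurable_funB.
exists B; split => //; last by move=> y /= /PN.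
have EI C : measurable (C : set (measurableTypeR R)) ->
    mu C = (\int[mu]_y (\1_C y)%:E)%E.
  by move=> mC; rewrite integral_indic// setIT.
rewrite -N0 !EI// -[RHS](integral_reflect x).
  by apply: eq_integral => y _; rewrite !indicE.
exact/measurable_EFinP/measurable_indic.
Qed.

Lemma eq_conv_ae f f' g g' :
  measurable_fun setT f -> measurable_fun setT f' ->
  measurable_fun setT g -> measurable_fun setT g' ->
  {ae mu, forall x, f x = f' x} -> {ae mu, forall x, g x = g' x} -> conv f g = conv f' g'.
Proof.
move=> mf mf' mg mg' ff gg; apply/funext => x; congr fine.
apply: ae_eq_integral => //.
- by apply/measurable_EFinP; apply: measurable_funM => //; apply: measurableT_comp => //; exact: measurable_funB.
- by apply/measurable_EFinP; apply: measurable_funM => //; apply: measurableT_comp => //; exact: measurable_funB.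
- by move: (aeI (ae_sub x ff) gg); apply: aeW => y [/= -> ->].
Qed.

End convolution.

Section convolution_assoc.
Context {R : realType}.
Local Notation mu := (@lebesgue_measure R).
Implicit Types (f g h : R -> R).

Lemma ae_fin_num (F : R -> \bar R) : measurable_fun setT F ->
  (forall x, 0 <= F x)%E -> (\int[mu]_x F x < +oo)%E ->
  {ae mu, forall x, (F x < +oo)%E}.
Proof.
move=> mF F0 iF.
have iF' : mu.-integrable setT F.
  by apply/integrableP; split => //; under eq_integral do rewrite gee0_abs//.
move: (integrable_ae measurableT iF'); apply: aeW => x /(_ I).
by rewrite ge0_fin_numE.
Qed.

(** The iterated convolution [E] of the absolute values has a finite integral, hence is finite at
    almost every [x]. At such an [x] the kernel [K] is integrable on the plane and Fubini exchanges
    the two inner integrations. *)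
Lemma convA f g h : L1 f -> L1 g -> L1 h ->
  {ae mu, forall x, conv (conv f g) h x = conv f (conv g h) x}.
Proof.
move=> Lf Lg Lh; have mf := L1_measurable Lf; have mg := L1_measurable Lg.
have mh := L1_measurable Lh.
pose a (k : R -> R) (x : R) := `|k x|%:E : \bar R.
have ma k : measurable_fun setT k -> measurable_fun setT (a k).
  by move=> mk; apply/measurable_EFinP; exact: measurableT_comp.
have a0 k x : (0 <= a k x)%E by rewrite lee_fin.
pose e w := (\int[mu]_y (a g (w - y)%R * a h y))%E.
have me : measurable_fun setT e.
  apply: (measurable_fun_fubini_tonelli_F (fun z : measurableTypeR R * measurableTypeR R =>
    a g (z.1 - z.2)%R * a h z.2)%E) => /=; last first.
    by move=> z; exact: mule_ge0.
  apply: emeasurable_funM; last by apply: measurableT_comp => //; exact: ma.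
  by apply: measurableT_comp => //; [exact: ma|exact: measurable_funB].
have e0 w : (0 <= e w)%E by apply: integral_ge0 => y _; exact: mule_ge0.
pose E x := (\int[mu]_w (a f (x - w)%R * e w))%E.
have mE : measurable_fun setT E.
  apply: (measurable_fun_fubini_tonelli_F (fun z : measurableTypeR R * measurableTypeR R =>
    a f (z.1 - z.2)%R * e z.2)%E) => /=; last first.
    by move=> z; exact: mule_ge0.
  apply: emeasurable_funM; last by apply: measurableT_comp => //; exact: me.
  by apply: measurableT_comp => //; [exact: ma|exact: measurable_funB].
have : {ae mu, forall x, (E x < +oo)%E}.
  apply: ae_fin_num => //; first by move=> x; apply: integral_ge0 => y _; exact: mule_ge0.
  rewrite /E ge0_integral_conv//; try exact: ma.
  rewrite /e ge0_integral_conv//; try exact: ma.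
  by rewrite /a !norm1E// -!EFinM ltry.
apply: aeW => x Ex.
pose K (z : measurableTypeR R * measurableTypeR R) := f (x - z.1) * (g (z.1 - z.2) * h z.2).
have mK : measurable_fun setT K.
  apply: measurable_funM; last exact: measurable_conv_kernel.
  by apply: measurableT_comp => //; exact: measurable_funB.
have iK : (mu \x mu)%E.-integrable setT (EFin \o K).
  apply/integrable12ltyP; first exact/measurable_EFinP.
  apply: le_lt_trans Ex; rewrite le_eqVlt; apply/orP; left; apply/eqP.
  apply: eq_integral => w _ /=; rewrite /e -ge0_integralZl//.
    by apply: eq_integral => y _; rewrite /K /a/= !normrM !EFinM.
  by apply: emeasurable_funM; [apply: measurableT_comp; [exact: ma|exact: measurable_funB]|exact: ma].
  by move=> y _; exact: mule_ge0.
rewrite /conv.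
transitivity (\int[mu]_y \int[mu]_w K (w, y)).
  apply: eq_Rintegral => y _.
  rewrite -(Rintegral_shift (- y)); last first.
    by apply: measurable_funM => //; apply: measurableT_comp => //; exact: measurable_funB.
  rewrite mulrC -RintegralZ//; last first.
    apply: measurable_funM; apply: measurableT_comp => //.
      by apply: measurable_funB => //; exact: measurable_funB.
    exact: measurable_funB.
  apply: eq_Rintegral => w _; rewrite /K/=.
  rewrite (_ : x - y - (w - y) = x - w); last by ring.
  ring.
rewrite -(Rfubini iK); apply: eq_Rintegral => w _; rewrite /K/= RintegralZ//.
by apply: measurable_funM => //; apply: measurableT_comp => //; exact: measurable_funB.
Qed.

End convolution_assoc.

(** * Square integrable functions, the Cauchy-Schwarz and Young inequalities *)

Section square_integrable.
Context d (X : measurableType d) {R : realType} (m : {measure set X -> \bar R}).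
Variables (D : set X) (mD : measurable D).
Implicit Types (f g : X -> R).

Lemma sqiP f : square_integrable m D f <->
  measurable_fun D f /\ m.-integrable D (EFin \o (fun x => f x ^+ 2)).
Proof.
split=> [[mf lf]|[mf /integrableP[_ lf]]]; split => //.
- apply/integrableP; split; first exact/measurable_EFinP/measurable_funX.
  by under eq_integral do rewrite /= ger0_norm ?sqr_ge0//.
- apply: le_lt_trans lf; rewrite le_eqVlt; apply/orP; left; apply/eqP.
  by apply: eq_integral => x _ /=; rewrite ger0_norm ?sqr_ge0.
Qed.

Lemma sqi_integrable f : square_integrable m D f ->
  m.-integrable D (EFin \o (fun x => f x ^+ 2)).
Proof. by case/sqiP. Qed.

Lemma sqi_mul f g : square_integrable m D f -> square_integrable m D g ->
  m.-integrable D (EFin \o (fun x => f x * g x)).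
Proof.
move=> /sqiP[mf if2] /sqiP[mg ig2].
apply: le_integrable (integrableD mD if2 ig2) => //.
  exact/measurable_EFinP/measurable_funM.
move=> x _ /=; rewrite lee_fin [leRHS]ger0_norm ?addr_ge0 ?sqr_ge0//.
rewrite ler_norml; apply/andP; split; nra.
Qed.

Lemma sqiZ (c : R) f : square_integrable m D f -> square_integrable m D (fun x => c * f x).
Proof.
move=> /sqiP[mf if2]; apply/sqiP; split.
  by apply: measurable_funM => //; exact: measurable_cst.
by apply: eq_integrable (integrableZl mD (c ^+ 2) if2) => // x _ /=; rewrite exprMn EFinM.
Qed.

Lemma sqiD f g : square_integrable m D f -> square_integrable m D g ->
  square_integrable m D (fun x => f x + g x).
Proof.
move=> sf sg; have ifg := sqi_mul sf sg.
case/sqiP: sf => mf if2; case/sqiP: sg => mg ig2; apply/sqiP; split.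
  exact: measurable_funD.
apply: eq_integrable (integrableD mD (integrableD mD if2 ig2) (integrableZl mD 2 ifg)) => // x _ /=.
by rewrite -!EFinM -!EFinD; congr EFin; ring.
Qed.

(** The quadratic polynomial in t given by the integral of (f + t g)^2 is nonnegative; its value at
    the minimum t = -b/c is the claim. *)
Lemma cauchy_schwarz f g : square_integrable m D f -> square_integrable m D g ->
  (\int[m]_(x in D) (f x * g x)) ^+ 2 <=
  (\int[m]_(x in D) (f x ^+ 2)) * (\int[m]_(x in D) (g x ^+ 2)).
Proof.
move=> sf sg.
set a := \int[m]_(x in D) (f x ^+ 2); set b := \int[m]_(x in D) (f x * g x).
set c := \int[m]_(x in D) (g x ^+ 2).
have if2 := sqi_integrable sf; have ig2 := sqi_integrable sg.
have ifg := sqi_mul sf sg.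
have key t : 0 <= a + 2 * t * b + t ^+ 2 * c.
  have -> : a + 2 * t * b + t ^+ 2 * c = \int[m]_(x in D) ((f x + t * g x) ^+ 2).
    rewrite /a /b /c -RintegralZl// -RintegralZl// -RintegralD//; last first.
      exact: (integrableZl mD (2 * t) ifg).
    rewrite -RintegralD//; last 2 first.
    - exact: (integrableD mD if2 (integrableZl mD (2 * t) ifg)).
    - exact: (integrableZl mD (t ^+ 2) ig2).
    by apply: eq_Rintegral => x _; ring.
  by apply: Rintegral_ge0 => x _; exact: sqr_ge0.
have a0 : 0 <= a by apply: Rintegral_ge0 => x _; exact: sqr_ge0.
have c0 : 0 <= c by apply: Rintegral_ge0 => x _; exact: sqr_ge0.
have [c0'|cn0] := eqVneq c 0.
  have [->|bn0] := eqVneq b 0; first by rewrite expr0n/= mulr_ge0.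
  (* For [c = 0] the polynomial is affine, and at this point it would equal -1. *)
  have := key (- (a + 1) / (2 * b)); rewrite c0' mulr0 addr0.
  rewrite (_ : 2 * _ * b = - (a + 1)); last by field.
  by rewrite opprD addNKr ler0N1.
have := key (- b / c).
rewrite (_ : _ + _ = (a * c - b ^+ 2) / c); last by field.
rewrite pmulr_lge0 ?invr_gt0 ?lt_def ?cn0//; lra.
Qed.

End square_integrable.

Section young.
Context {R : realType}.
Local Notation mu := (@lebesgue_measure R).
Implicit Types (f g h : R -> R).

Lemma measurable_sqrt : measurable_fun setT (@Num.sqrt R).
Proof. apply: continuous_measurable_fun; exact: sqrt_continuous. Qed.

(** With |f g| written as sqrt|f| times sqrt|f| |g|, Cauchy-Schwarz bounds the square of the
    convolution, almost everywhere, by |f|_1 times the convolution of |f| and g^2. By Fubini the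
    latter has integral |f|_1 times that of g^2. *)
Lemma young f g : L1 f -> L1 g -> square_integrable mu setT g ->
  square_integrable mu setT (conv f g) /\
  \int[mu]_x (conv f g x ^+ 2) <= norm1 f ^+ 2 * \int[mu]_x (g x ^+ 2).
Proof.
move=> Lf Lg sg; have mf := L1_measurable Lf; have [mg ig2] := (sqiP _ _ _).1 sg.
pose k (z : measurableTypeR R * measurableTypeR R) := `|f (z.1 - z.2)| * g z.2 ^+ 2.
have Laf : L1 (fun x => `|f x|) by apply: (integrable_abse Lf).
have ik : (mu \x mu)%E.-integrable setT (EFin \o k).
  exact: (integrable_conv_kernel Laf ig2).
have ax : {ae mu, forall x, conv f g x ^+ 2 <= norm1 f * \int[mu]_y k (x, y)}.
  move: (ae_integrable1 ik); apply: aeW => x ikx.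
  have mfx : measurable_fun setT (fun y : measurableTypeR R => f (x - y)).
    by apply: measurableT_comp => //; exact: measurable_funB.
  have su : square_integrable mu setT (fun y => Num.sqrt `|f (x - y)|).
    apply/sqiP; split.
      apply: measurableT_comp; first exact: measurable_sqrt.
      exact: measurableT_comp.
    have : mu.-integrable setT (fun y => `|f (x - y)|%:E).
      apply/integrableP; split; first by apply/measurable_EFinP; exact: measurableT_comp.
      rewrite (integral_reflect x (f := fun y => `| `|f y|%:E |%E)).
        by case/integrableP: Laf.
      by apply: measurableT_comp => //; exact: measurable_int Laf.
    by apply: eq_integrable => // y _ /=; rewrite sqr_sqrtr.
  have sv : square_integrable mu setT (fun y => Num.sqrt `|f (x - y)| * `|g y|).
    apply/sqiP; split.
      apply: measurable_funM; last exact: measurableT_comp.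
      apply: measurableT_comp; first exact: measurable_sqrt.
      exact: measurableT_comp.
    by move: ikx; apply: eq_integrable => // y _ /=; rewrite /k/= exprMn sqr_sqrtr// real_normK// num_real.
  have := cauchy_schwarz measurableT su sv.
  have -> : \int[mu]_y (Num.sqrt `|f (x - y)| ^+ 2) = norm1 f.
    rewrite /norm1 -(@Rintegral_reflect _ x (fun z => `|f z|)); last exact: measurableT_comp.
    by apply: eq_Rintegral => y _; rewrite sqr_sqrtr.
  have -> : \int[mu]_y ((Num.sqrt `|f (x - y)| * `|g y|) ^+ 2) = \int[mu]_y k (x, y).
    by apply: eq_Rintegral => y _; rewrite exprMn sqr_sqrtr// /k/= real_normK// num_real.
  apply: le_trans; rewrite -[leLHS]ger0_norm ?sqr_ge0// normrX lerXn2r ?nnegrE//.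
    by apply: Rintegral_ge0 => y _; rewrite !mulr_ge0// sqrtr_ge0.
  have iuv := sqi_mul measurableT su sv.
  have uvE y : Num.sqrt `|f (x - y)| * (Num.sqrt `|f (x - y)| * `|g y|) = `|f (x - y) * g y|.
    by rewrite mulrA -expr2 sqr_sqrtr// normrM.
  have ifg : mu.-integrable setT (EFin \o (fun y => f (x - y) * g y)).
    apply: le_integrable iuv => //.
      by apply/measurable_EFinP; exact: measurable_funM.
    by move=> y _ /=; rewrite uvE lee_fin normr_id.
  apply: le_trans (le_normr_Rintegral measurableT ifg) _.
  rewrite le_eqVlt; apply/orP; left; apply/eqP.
  by apply: eq_Rintegral => y _; rewrite uvE.
have iF := integrable_Rfubini ik.
have mc : measurable_fun setT (conv f g) by apply: L1_measurable; exact: L1_conv.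
have iC : mu.-integrable setT (EFin \o (fun x => norm1 f * \int[mu]_y k (x, y))).
  exact: (integrableZl measurableT (norm1 f) iF).
have mC := measurable_int _ iC.
have mc2 : measurable_fun setT (fun x => (conv f g x ^+ 2)%:E).
  by apply/measurable_EFinP; exact: measurable_funX.
have leC : (\int[mu]_x (conv f g x ^+ 2)%:E <=
    \int[mu]_x (norm1 f * \int[mu]_y k (x, y))%:E)%E.
  apply: ae_ge0_le_integral => //.
  - by move=> x _; rewrite lee_fin sqr_ge0.
  - move=> x _; rewrite lee_fin mulr_ge0 ?norm1_ge0//.
    by apply: Rintegral_ge0 => y _; rewrite /k mulr_ge0 ?sqr_ge0.
  - by move: ax; apply: aeW => x h _; rewrite lee_fin.
have fC := integrable_fin_num measurableT iC.
have sc : square_integrable mu setT (conv f g).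
  split => //; apply: le_lt_trans leC _.
  by rewrite -ge0_fin_numE// integral_ge0// => x _; rewrite lee_fin mulr_ge0 ?norm1_ge0//;
    apply: Rintegral_ge0 => y _; rewrite /k mulr_ge0 ?sqr_ge0.
split => //.
have -> : norm1 f ^+ 2 * \int[mu]_x (g x ^+ 2) = \int[mu]_x (norm1 f * \int[mu]_y k (x, y)).
  rewrite [RHS]RintegralZl//.
  rewrite (Rfubini ik) expr2 -mulrA; congr (_ * _).
  rewrite -RintegralZl//; apply: eq_Rintegral => y _.
  transitivity (\int[mu]_x (g y ^+ 2 * `|f (x - y)|)); last first.
    by apply: eq_Rintegral => x _; rewrite /k mulrC.
  rewrite RintegralZ//; last first.
    by apply: measurableT_comp => //; apply: measurableT_comp => //; exact: measurable_funB.
  rewrite mulrC; congr (_ * _); rewrite -[RHS](@Rintegral_shift _ y)//.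
    by apply: eq_Rintegral => x _; rewrite addrK.
  by apply: measurableT_comp => //; apply: measurableT_comp => //; exact: measurable_funB.
apply: (fine_le _ fC leC).
by apply: integrable_fin_num => //; exact: sqi_integrable.
Qed.

End young.

(** * Causal convolution, truncated to (0,T) *)

Section truncation.
Context {R : realType}.
Local Notation mu := (@lebesgue_measure R).
Variable T : R.
Local Notation DT := (`]0, T[%classic : set R).
Implicit Types (f g h k : R -> R).

Definition tr f : R -> R := f \_ DT.

Definition L1T f := mu.-integrable DT (EFin \o f).

Definition supported f := forall x, ~ DT x -> f x = 0.

Lemma measurable_DT : measurable (DT : set (measurableTypeR R)).
Proof. exact: measurable_itv. Qed.
Local Hint Resolve measurable_DT : core.

Lemma trE f x : DT x -> tr f x = f x.
Proof. by move=> h; rewrite /tr patchE mem_set. Qed.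

Lemma tr_supported f : supported (tr f).
Proof. by move=> x h; rewrite /tr patchE memNset. Qed.

Lemma tr_id f : supported f -> tr f = f.
Proof.
move=> sf; apply/funext => x; rewrite /tr patchE; case: ifPn => //.
by rewrite notin_setE => /sf.
Qed.

Lemma L1_tr f : L1T f -> L1 (tr f).
Proof.
move=> h; have := (integrable_mkcond (mu := mu) (EFin \o f) measurable_DT).1 h.
by rewrite restrict_EFin.
Qed.

Lemma L1_L1T f : L1 f -> L1T f.
Proof. by apply: integrableS. Qed.

Lemma L1T_tr f : L1 (tr f) -> L1T f.
Proof.
by move=> h; apply/(integrable_mkcond (mu := mu) (EFin \o f) measurable_DT); rewrite restrict_EFin.
Qed.

Definition good f := L1 f /\ supported f.

Lemma good_tr f : L1T f -> good (tr f).
Proof. by move=> h; split; [exact: L1_tr|exact: tr_supported]. Qed.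

Lemma good_L1 f : good f -> L1 f. Proof. by case. Qed.

Lemma good_meas f : good f -> measurable_fun setT f.
Proof. by case=> /L1_measurable. Qed.

Lemma good_causal f x : good f -> x <= 0 -> f x = 0.
Proof. by case=> _ s x0; apply: s => /=; rewrite in_itv/= ltNge x0. Qed.

Lemma good0 : good (cst 0).
Proof. by split => //; exact: integrable0. Qed.

Lemma goodD f g : good f -> good g -> good (fun x => f x + g x).
Proof.
move=> [Lf sf] [Lg sg]; split; first exact: (integrableD measurableT Lf Lg).
by move=> x nx; rewrite sf// sg// addr0.
Qed.

Lemma goodZ c f : good f -> good (fun x => c * f x).
Proof.
move=> [Lf sf]; split; last by move=> x nx; rewrite sf// mulr0.
exact: (integrableZl measurableT c Lf).
Qed.

Definition cv f g := tr (conv f g).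

Lemma good_cv f g : good f -> good g -> good (cv f g).
Proof.
by move=> [Lf _] [Lg _]; apply: good_tr; apply: L1_L1T; exact: L1_conv.
Qed.

Lemma conv_causal f g x : good f -> good g -> x <= 0 -> conv f g x = 0.
Proof.
move=> gf gg x0; rewrite /conv; transitivity (\int[mu]_(y in setT) (0 : R)).
  apply: eq_Rintegral => y _; have [y0|y0] := leP y 0.
    by rewrite (good_causal gg y0) mulr0.
  by rewrite (good_causal gf) ?mul0r// subr_le0 (le_trans x0)// ltW.
by rewrite Rintegral_cst// mul0r.
Qed.

(** By causality the value at [x < T] sees [f] only on (0, x), so cutting [f] off outside (0,T)
    changes nothing there. This makes the truncated product [cv] associative. *)
Lemma conv_tr_l f h x : good h -> (forall z, z <= 0 -> f z = 0) -> x < T ->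
  conv (tr f) h x = conv f h x.
Proof.
move=> gh cf xT; apply: eq_Rintegral => y _.
have [y0|y0] := leP y 0; first by rewrite (good_causal gh y0) !mulr0.
have [xy|xy] := leP (x - y) 0; first by rewrite (cf _ xy) tr_supported ?mul0r//= in_itv/= ltNge xy.
by rewrite trE//= in_itv/= xy/=; lra.
Qed.

Lemma cvC f g : good f -> good g -> cv f g = cv g f.
Proof. by move=> gf gg; rewrite /cv convC//; exact: good_meas. Qed.

Lemma cvA f g h : good f -> good g -> good h ->
  {ae mu, forall x, cv (cv f g) h x = cv f (cv g h) x}.
Proof.
move=> gf gg gh; move: (convA (good_L1 gf) (good_L1 gg) (good_L1 gh)).
apply: aeW => x Ex; rewrite /cv /tr !patchE; case: ifPn => //.
rewrite inE/= in_itv/= => /andP[x0 xT].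
rewrite -!/(tr _) conv_tr_l//; last by move=> z; exact: conv_causal.
have mgh := good_meas (good_cv gg gh).
rewrite Ex (convC (good_meas gf) mgh) conv_tr_l//; last by move=> z; exact: conv_causal.
rewrite convC//; first exact: good_meas gf.
by apply: L1_measurable; apply: L1_conv; [exact: good_L1 gg|exact: good_L1 gh].
Qed.

Lemma conv_linear f g g' c x : good f -> good g -> good g' ->
  L1 (fun y => f (x - y) * g y) -> L1 (fun y => f (x - y) * g' y) ->
  conv f (fun y => c * g y + g' y) x = c * conv f g x + conv f g' x.
Proof.
move=> gf gg gg' i1 i2; rewrite /conv -RintegralZl// -RintegralD//.
  by apply: eq_Rintegral => y _; ring.
exact: (integrableZl measurableT c i1).
Qed.

Lemma cv_linear f g g' c : good f -> good g -> good g' ->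
  {ae mu, forall x, cv f (fun y => c * g y + g' y) x = c * cv f g x + cv f g' x}.
Proof.
move=> gf gg gg'.
move: (aeI (ae_conv_integrable (good_L1 gf) (good_L1 gg))
  (ae_conv_integrable (good_L1 gf) (good_L1 gg'))).
apply: aeW => x [i1 i2]; rewrite /cv /tr !patchE.
by case: ifPn => _; [exact: conv_linear|rewrite mulr0 addr0].
Qed.

Lemma eq_cv f f' g g' : good f -> good f' -> good g -> good g' ->
  {ae mu, forall x, f x = f' x} -> {ae mu, forall x, g x = g' x} -> cv f g = cv f' g'.
Proof.
by move=> gf gf' gg gg' ff ggg; rewrite /cv (@eq_conv_ae _ f f' g g')//; exact: good_meas.
Qed.

Lemma ae_DT_tr f g : {ae mu, forall x, DT x -> f x = g x} <->
  {ae mu, forall x, tr f x = tr g x}.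
Proof.
split; apply: aeW => x.
- by move=> h; rewrite /tr !patchE; case: ifPn => //; rewrite inE.
- by move=> h Dx; rewrite !trE in h.
Qed.

End truncation.

(* The convolution algebra of (0,T): multiples of the Dirac mass at 0 plus
   integrable functions modulo a.e. equality; [rep] chooses a representative
   of each class so that equality of classes is Leibniz equality. *)
Section convolution_algebra.
Context {R : realType} (T : R).
Local Notation mu := (@lebesgue_measure R).
Local Notation DT := (`]0, T[%classic : set R).
Implicit Types (f g h k : R -> R).

Definition rep f : R -> R :=
  (* Functions that are not [good] are sent to the class of 0, so that [rep] is total and
     idempotent. *)
  let f' := if `[< good T f >] then f else cst 0 in
  get [set g | good T g /\ {ae mu, forall x, f' x = g x}].

Lemma rep_spec f : good T (rep f) /\ (good T f -> {ae mu, forall x, f x = rep f x}).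
Proof.
rewrite /rep; set f' := (X in get [set g | _ /\ {ae mu, forall x, X x = g x}]).
have gf' : good T f' by rewrite /f'; case: asboolP => // _; exact: good0.
have : [set g | good T g /\ {ae mu, forall x, f' x = g x}] f'.
  by split => //; exact: nearW.
move=> /getI [g1 g2]; split => // gf.
by move: g2; rewrite /f'; case: asboolP.
Qed.

Lemma eq_rep f g : good T f -> good T g -> {ae mu, forall x, f x = g x} -> rep f = rep g.
Proof.
move=> gf gg fg; rewrite /rep; case: asboolP => // _; case: asboolP => // _.
congr get; apply/seteqP; split => h [gh fh]; split => //.
  by move: (aeI fg fh); apply: aeW => x [<- <-].
by move: (aeI fg fh); apply: aeW => x [-> <-].
Qed.

Lemma rep_rep f : rep (rep f) = rep f.
Proof.
have [gr ar] := rep_spec f.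
have [gf|ngf] := pselect (good T f).
  by apply: eq_rep => //; move: (ar gf); apply: aeW.
have -> : rep f = rep (cst 0).
  by rewrite /rep; case: asboolP => // _; case: asboolP => //.
have [gr0 /(_ (good0 T)) ar0] := rep_spec (cst 0).
by apply: eq_rep => //; [exact: good0|move: ar0; apply: aeW => x ->].
Qed.

Record calg := MkCalg { cst_part : R ; fun_part : R -> R ; _ : rep fun_part = fun_part }.

Definition mk c f := MkCalg c (rep_rep f).

Lemma calg_eq (x y : calg) : cst_part x = cst_part y -> fun_part x = fun_part y -> x = y.
Proof.
case: x => c f p; case: y => c' f' p' /= cc ff; subst c' f'.
by congr MkCalg; exact: Prop_irrelevance.
Qed.

Lemma good_fun x : good T (fun_part x).
Proof. by case: x => c f /= <-; case: (rep_spec f). Qed.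

Lemma fun_part_mk c f : good T f -> {ae mu, forall x, fun_part (mk c f) x = f x}.
Proof. by move=> gf; have [_ /(_ gf)] := rep_spec f; apply: aeW. Qed.

Lemma mk_eq c c' f f' : good T f -> good T f' -> c = c' ->
  {ae mu, forall x, f x = f' x} -> mk c f = mk c' f'.
Proof. by move=> gf gf' -> ff; apply: calg_eq => //=; exact: eq_rep. Qed.

Lemma mk_eqE c c' f f' : good T f -> good T f' ->
  mk c f = mk c' f' -> {ae mu, forall x, f x = f' x}.
Proof.
move=> gf gf' E; have := fun_part_mk c gf; rewrite E => h.
by move: (aeI h (fun_part_mk c' gf')); apply: aeW => x [-> ->].
Qed.

Lemma mk_parts x : mk (cst_part x) (fun_part x) = x.
Proof. by apply: calg_eq => //=; case: x. Qed.

Definition cadd x y := mk (cst_part x + cst_part y) (fun z => fun_part x z + fun_part y z).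
Definition copp x := mk (- cst_part x) (fun z => -1 * fun_part x z).
Definition czero := mk 0 (cst 0).
Definition cone := mk 1 (cst 0).
(** With the Dirac mass delta, this is the function part in the expansion of the product of a delta
    + f and b delta + g; the remaining part is a b delta. *)
Definition pmul (a b : R) f g := fun z => b * f z + (a * g z + cv T f g z).
Definition cmul x y := mk (cst_part x * cst_part y)
  (pmul (cst_part x) (cst_part y) (fun_part x) (fun_part y)).

Lemma good_pmul a b f g : good T f -> good T g -> good T (pmul a b f g).
Proof.
move=> gf gg; apply: goodD; first exact: goodZ.
by apply: goodD; [exact: goodZ|exact: good_cv].
Qed.

Lemma mkD c c' f f' : good T f -> good T f' ->
  cadd (mk c f) (mk c' f') = mk (c + c') (fun z => f z + f' z).
Proof.
move=> gf gf'; apply: mk_eq => //; try apply: goodD => //; try exact: good_fun.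
by move: (aeI (fun_part_mk c gf) (fun_part_mk c' gf')); apply: aeW => x [-> ->].
Qed.

Lemma mkN c f : good T f -> copp (mk c f) = mk (- c) (fun z => -1 * f z).
Proof.
move=> gf; apply: mk_eq => //; try apply: goodZ => //; try exact: good_fun.
by move: (fun_part_mk c gf); apply: aeW => x ->.
Qed.

Lemma mkM c c' f f' : good T f -> good T f' ->
  cmul (mk c f) (mk c' f') = mk (c * c') (pmul c c' f f').
Proof.
move=> gf gf'; apply: mk_eq => //; try apply: good_pmul => //; try exact: good_fun.
have E : cv T (fun_part (mk c f)) (fun_part (mk c' f')) = cv T f f'.
  by apply: eq_cv => //; try exact: good_fun; exact: fun_part_mk.
move: (aeI (fun_part_mk c gf) (fun_part_mk c' gf')); apply: aeW => x [h1 h2].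
by rewrite /pmul E h1 h2.
Qed.

Lemma mk_ind (P : calg -> Prop) : (forall c f, good T f -> P (mk c f)) -> forall x, P x.
Proof. by move=> h x; rewrite -(mk_parts x); apply: h; exact: good_fun. Qed.

Lemma ae_all (P : R -> Prop) : (forall x, P x) -> {ae mu, forall x, P x}.
Proof. by move=> h; exact: nearW. Qed.

Let caddA : associative cadd.
Proof.
elim/mk_ind => c f gf; elim/mk_ind => c' f' gf'; elim/mk_ind => c'' f'' gf''.
rewrite !mkD//; try exact: goodD; apply: mk_eq; rewrite ?addrA//; try by do !apply: goodD.
by apply: ae_all => x; rewrite addrA.
Qed.

Let caddC : commutative cadd.
Proof.
elim/mk_ind => c f gf; elim/mk_ind => c' f' gf'.
rewrite !mkD//; apply: mk_eq; rewrite 1?addrC//; try by do !apply: goodD.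
by apply: ae_all => x; rewrite addrC.
Qed.

Let cadd0 : left_id czero cadd.
Proof.
elim/mk_ind => c f gf; have g0 := good0 T; rewrite mkD//; apply: mk_eq; rewrite ?add0r//.
  exact: goodD.
by apply: ae_all => x; rewrite add0r.
Qed.

Let caddN : left_inverse czero copp cadd.
Proof.
elim/mk_ind => c f gf; have g0 := good0 T; rewrite mkN// mkD//; last exact: goodZ.
apply: mk_eq; rewrite ?addNr//; first by apply: goodD => //; exact: goodZ.
by apply: ae_all => x; rewrite mulN1r addNr.
Qed.

HB.instance Definition _ := gen_eqMixin calg.
HB.instance Definition _ := gen_choiceMixin calg.
HB.instance Definition _ := GRing.isZmodule.Build calg caddA caddC cadd0 caddN.

Lemma cvl_linear f f' g c : good T f -> good T f' -> good T g ->
  {ae mu, forall x, cv T (fun y => c * f y + f' y) g x = c * cv T f g x + cv T f' g x}.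
Proof.
move=> gf gf' gg; have gl : good T (fun y => c * f y + f' y) by apply: goodD => //; exact: goodZ.
by rewrite (cvC gl gg) (cvC gf gg) (cvC gf' gg); exact: cv_linear.
Qed.

Let cmulC : commutative cmul.
Proof.
elim/mk_ind => c f gf; elim/mk_ind => c' f' gf'.
rewrite !mkM//; apply: mk_eq; rewrite 1?mulrC//; try exact: good_pmul.
by apply: ae_all => x; rewrite /pmul (cvC gf gf') addrCA.
Qed.

Let cmul1 : left_id cone cmul.
Proof.
elim/mk_ind => c f gf; have g0 := good0 T; rewrite mkM//; apply: mk_eq; rewrite ?mul1r//.
  exact: good_pmul.
move: (cv_linear (-1) gf g0 g0); rewrite -(cvC g0 gf); apply: aeW => x.
rewrite (_ : (fun y : R => _) = cst 0); last by apply/funext => y /=; rewrite mulr0 addr0.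
by rewrite /pmul/= (cvC gf g0) mulN1r addNr mulr0 mul1r add0r => ->; rewrite addr0.
Qed.

Let cmulDl : left_distributive cmul cadd.
Proof.
elim/mk_ind => c f gf; elim/mk_ind => c' f' gf'; elim/mk_ind => c'' f'' gf''.
have gff : good T (fun z => f z + f' z) by exact: goodD.
rewrite (mkM c c'' gf gf'') (mkM c' c'' gf' gf'') !mkD//; try exact: good_pmul.
rewrite mkM//.
apply: mk_eq; rewrite ?mulrDl//; try exact: good_pmul.
  by apply: goodD; exact: good_pmul.
move: (cvl_linear 1 gf gf' gf''); apply: aeW => x.
rewrite (_ : (fun y : R => _) = (fun z => f z + f' z)); last by apply/funext => y; rewrite mul1r.
by rewrite /pmul => ->; ring.
Qed.

Let cmulA : associative cmul.
Proof.
elim/mk_ind => c f gf; elim/mk_ind => c' f' gf'; elim/mk_ind => c'' f'' gf''.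
rewrite !mkM//; try exact: good_pmul; apply: mk_eq; rewrite ?mulrA//; try by do !apply: good_pmul.
have gv := good_cv gf gf'; have gv' := good_cv gf' gf''.
have gz1 k a : good T k -> good T (fun z => a * k z) by exact: goodZ.
have gzd k k' a : good T k -> good T k' -> good T (fun z => a * k z + k' z).
  by move=> *; apply: goodD => //; exact: goodZ.
have h1 := @cv_linear _ _ f f' (fun z => c' * f'' z + cv T f' f'' z) c'' gf gf' (gzd _ _ _ gf'' gv').
have h2 := @cv_linear _ _ f f'' (cv T f' f'') c' gf gf'' gv'.
have h3 := @cvl_linear f (fun z => c * f' z + cv T f f' z) f'' c' gf (gzd _ _ _ gf' gv) gf''.
have h4 := @cvl_linear f' (cv T f f') f'' c gf' gv gf''.
move: (aeI (aeI h1 h2) (aeI (aeI h3 h4) (cvA gf gf' gf''))).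
apply: aeW => x [[e1 e2] [[e3 e4] e5]].
by rewrite /pmul e1 e2 e3 e4 e5; ring.
Qed.

Let cone_neq0 : cone != czero.
Proof. by apply/eqP => /(congr1 cst_part)/= /eqP; rewrite oner_eq0. Qed.

HB.instance Definition _ := GRing.Zmodule_isComNzRing.Build calg
  cmulA cmulC cmul1 cmulDl cone_neq0.

End convolution_algebra.

Section calg_theory.
Context {R : realType} (T : R).
Local Notation mu := (@lebesgue_measure R).
Local Notation DT := (`]0, T[%classic : set R).
Local Notation A := (calg T).
Implicit Types (f g h k : R -> R) (c : R).

Let mDT : measurable (DT : set (measurableTypeR R)) := measurable_DT T.
Local Hint Resolve mDT : core.

Definition cst_alg c : A := mk T c (cst 0).
Definition emb f : A := mk T 0 (tr T f).

Lemma addE (x y : A) : x + y = cadd x y. Proof. by []. Qed.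
Lemma mulE (x y : A) : x * y = cmul x y. Proof. by []. Qed.
Lemma oppE (x : A) : - x = copp x. Proof. by []. Qed.

Let cst_zmod : zmod_morphism cst_alg.
Proof.
move=> a b; have g0 := good0 T; rewrite addE oppE mkN// mkD//; last exact: goodZ.
apply: mk_eq => //; first by apply: goodD => //; exact: goodZ.
by apply: ae_all => x; rewrite mulr0 addr0.
Qed.

Let cst_monoid : monoid_morphism cst_alg.
Proof.
split => // a b; have g0 := good0 T; rewrite mulE mkM//.
apply: mk_eq => //; first exact: good_pmul.
move: (cv_linear (-1) g0 g0 g0); apply: aeW => x.
rewrite (_ : (fun y : R => _) = cst 0); last by apply/funext => y /=; rewrite mulr0 addr0.
by rewrite /pmul/= mulN1r addNr !mulr0 !add0r.
Qed.

HB.instance Definition _ := GRing.isZmodMorphism.Build R A cst_alg cst_zmod.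
HB.instance Definition _ := GRing.isMonoidMorphism.Build R A cst_alg cst_monoid.

Lemma cst_mk (c c' : R) f : good T f -> cst_alg c * mk T c' f = mk T (c * c') (fun z => c * f z).
Proof.
move=> gf; have g0 := good0 T; rewrite mulE mkM//; apply: mk_eq => //; try exact: goodZ.
  exact: good_pmul.
move: (cv_linear (-1) gf g0 g0); rewrite -(cvC g0 gf); apply: aeW => x.
rewrite (_ : (fun y : R => _) = cst 0); last by apply/funext => y /=; rewrite mulr0 addr0.
by rewrite /pmul/= (cvC gf g0) mulN1r addNr mulr0 add0r => ->; rewrite addr0.
Qed.

Lemma emb_eq f g : L1T T f -> L1T T g ->
  {ae mu, forall x, DT x -> f x = g x} <-> emb f = emb g.
Proof.
move=> /good_tr gf /good_tr gg; split => [h|].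
  by apply: mk_eq => //; apply/ae_DT_tr.
by move=> /(mk_eqE gf gg) /ae_DT_tr.
Qed.

Lemma embE f : L1T T f -> {ae mu, forall x, DT x -> fun_part (emb f) x = f x}.
Proof.
move=> /good_tr gf; move: (fun_part_mk 0 gf); apply: aeW => x h Dx.
by rewrite h trE.
Qed.

Lemma L1T_fun_part (x : A) : L1T T (fun_part x).
Proof. by apply: L1_L1T; case: (good_fun x). Qed.

Lemma emb_fun_part (x : A) : cst_part x = 0 -> emb (fun_part x) = x.
Proof.
move=> c0; rewrite /emb tr_id; last by case: (good_fun x).
by rewrite -c0 mk_parts.
Qed.

Lemma L1TD f g : L1T T f -> L1T T g -> L1T T (fun x => f x + g x).
Proof. by move=> hf hg; exact: (integrableD mDT hf hg). Qed.

Lemma L1TZ c f : L1T T f -> L1T T (fun x => c * f x).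
Proof. by move=> hf; exact: (integrableZl mDT c hf). Qed.

Lemma embD f g : L1T T f -> L1T T g -> emb f + emb g = emb (fun x => f x + g x).
Proof.
move=> hf hg; rewrite addE mkD; try exact: good_tr.
apply: mk_eq; rewrite ?addr0//; first by apply: goodD; exact: good_tr.
  by apply: good_tr; exact: L1TD.
by apply: ae_all => x; rewrite /tr !patchE; case: ifP; rewrite ?addr0.
Qed.

Lemma embZ c f : L1T T f -> cst_alg c * emb f = emb (fun x => c * f x).
Proof.
move=> hf; rewrite cst_mk; last exact: good_tr.
apply: mk_eq; rewrite ?mulr0//; first by apply: goodZ; exact: good_tr.
  by apply: good_tr; exact: L1TZ.
by apply: ae_all => x; rewrite /tr !patchE; case: ifP; rewrite ?mulr0.
Qed.

Lemma embN f : L1T T f -> - emb f = emb (fun x => - f x).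
Proof.
move=> hf; rewrite -mulN1r -(rmorphN1 cst_alg) embZ//; congr emb.
by apply/funext => x; rewrite mulN1r.
Qed.

Lemma embM f g : L1T T f -> L1T T g -> emb f * emb g = emb (conv (tr T f) (tr T g)).
Proof.
move=> /good_tr gf /good_tr gg; rewrite mulE mkM//.
apply: mk_eq; rewrite ?mulr0//; first exact: good_pmul.
  by have := good_cv gf gg.
by apply: ae_all => x; rewrite /pmul !mul0r !add0r.
Qed.

Lemma L1T_conv f g : L1T T f -> L1T T g -> L1T T (conv (tr T f) (tr T g)).
Proof. by move=> /L1_tr hf /L1_tr hg; apply: L1_L1T; exact: L1_conv. Qed.

Definition Lsq (x : A) := cst_part x = 0 /\ square_integrable mu setT (fun_part x).

Definition ip (x y : A) := \int[mu]_z (fun_part x z * fun_part y z).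
Definition N (x : A) := Num.sqrt (ip x x).

Lemma ipC (x y : A) : ip x y = ip y x.
Proof. by apply: eq_Rintegral => z _; rewrite mulrC. Qed.

Lemma ipE f g : L1T T f -> L1T T g -> measurable_fun DT (fun z => f z * g z) ->
  ip (emb f) (emb g) = \int[mu]_(z in DT) (f z * g z).
Proof.
move=> hf hg mfg; rewrite Rintegral_mkcond; congr fine.
have gm : measurable_fun setT ((fun z => f z * g z) \_ DT).
  exact: ((measurable_restrictT (fun z => f z * g z) mDT).1 mfg).
apply: ae_eq_integral => //.
- by apply/measurable_EFinP; apply: measurable_funM; apply: good_meas; exact: good_fun.
- exact/measurable_EFinP.
- move: (aeI (fun_part_mk 0 (good_tr hf)) (fun_part_mk 0 (good_tr hg))).
  apply: aeW => x [h1 h2] _; rewrite h1 h2 /tr !patchE.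
  by case: ifP => //; rewrite mulr0.
Qed.

Lemma sqi_ae f g : square_integrable mu setT f -> measurable_fun setT g ->
  {ae mu, forall x, g x = f x} -> square_integrable mu setT g.
Proof.
move=> [mf lf] mg fg; split => //; apply: le_lt_trans lf.
rewrite le_eqVlt; apply/orP; left; apply/eqP; apply: ae_eq_integral => //.
- exact/measurable_EFinP/measurable_funX.
- exact/measurable_EFinP/measurable_funX.
- by move: fg; apply: aeW => x ->.
Qed.

Lemma Lsq0 : Lsq 0.
Proof.
split => //; apply: (@sqi_ae (cst 0)); last exact: (fun_part_mk 0 (good0 T)).
  split => //; rewrite (eq_integral (cst 0%E)) ?integral0//.
  by move=> x _; rewrite expr0n.
by apply: good_meas; exact: (good_fun (0 : A)).
Qed.

Lemma LsqD (x y : A) : Lsq x -> Lsq y -> Lsq (x + y).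
Proof.
move=> [cx sx] [cy sy]; split; first by rewrite /= cx cy addr0.
apply: (sqi_ae (sqiD measurableT sx sy)); first exact: good_meas (good_fun _).
by apply: fun_part_mk; apply: goodD; exact: good_fun.
Qed.

Lemma fun_part_cst c (x : A) : {ae mu, forall z, fun_part (cst_alg c * x) z = c * fun_part x z}.
Proof.
have gx := good_fun x.
have E : cst_alg c * x = mk T (c * cst_part x) (fun z => c * fun_part x z).
  by rewrite -{1}(mk_parts x) cst_mk.
move: (fun_part_mk (c * cst_part x) (goodZ c gx)); apply: aeW => z h.
by rewrite E h.
Qed.

Lemma fun_partD (x y : A) : {ae mu, forall z, fun_part (x + y) z = fun_part x z + fun_part y z}.
Proof. by apply: fun_part_mk; apply: goodD; exact: good_fun. Qed.

Lemma LsqZ c (x : A) : Lsq x -> Lsq (cst_alg c * x).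
Proof.
move=> [cx sx]; split; first by rewrite /= cx mulr0.
apply: (sqi_ae (sqiZ measurableT c sx)); first exact: good_meas (good_fun _).
exact: fun_part_cst.
Qed.

Lemma LsqN (x : A) : Lsq x -> Lsq (- x).
Proof. by move=> /(LsqZ (-1)); rewrite rmorphN1 mulN1r. Qed.

Lemma LsqB (x y : A) : Lsq x -> Lsq y -> Lsq (x - y).
Proof. by move=> hx hy; apply: LsqD => //; exact: LsqN. Qed.

Lemma measurable_ip (x y : A) : measurable_fun setT (fun z => fun_part x z * fun_part y z).
Proof. by apply: measurable_funM; apply: good_meas; exact: good_fun. Qed.

Lemma ip_ae (x y : A) f : measurable_fun setT f ->
  {ae mu, forall z, fun_part x z * fun_part y z = f z} -> ip x y = \int[mu]_z f z.
Proof.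
move=> mf h; congr fine; apply: ae_eq_integral => //.
- by apply/measurable_EFinP; exact: measurable_ip.
- exact/measurable_EFinP.
- by move: h; apply: aeW => z ->.
Qed.

Lemma ipDl (x y z : A) : Lsq x -> Lsq y -> Lsq z -> ip (x + y) z = ip x z + ip y z.
Proof.
move=> [_ sx] [_ sy] [_ sz]; rewrite -RintegralD//; try exact: sqi_mul.
apply: ip_ae; first by apply: measurable_funD; exact: measurable_ip.
by move: (fun_partD x y); apply: aeW => t ->; rewrite mulrDl.
Qed.

Lemma ipZl c (x y : A) : ip (cst_alg c * x) y = c * ip x y.
Proof.
rewrite -RintegralZ//; last exact: measurable_ip.
apply: ip_ae; first by apply: measurable_funM => //; exact: measurable_ip.
by move: (fun_part_cst c x); apply: aeW => t ->; rewrite mulrA.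
Qed.

Lemma ipNl (x y : A) : ip (- x) y = - ip x y.
Proof. by have := ipZl (-1) x y; rewrite rmorphN1 !mulN1r. Qed.

Lemma ipDr (x y z : A) : Lsq x -> Lsq y -> Lsq z -> ip z (x + y) = ip z x + ip z y.
Proof. by move=> *; rewrite ipC ipDl// !(ipC z). Qed.

Lemma ipZr c (x y : A) : ip x (cst_alg c * y) = c * ip x y.
Proof. by rewrite ipC ipZl ipC. Qed.

Lemma ipNr (x y : A) : ip x (- y) = - ip x y.
Proof. by rewrite ipC ipNl ipC. Qed.

Lemma ip_ge0 (x : A) : 0 <= ip x x.
Proof. by apply: Rintegral_ge0 => z _; rewrite -expr2 sqr_ge0. Qed.

Lemma N_ge0 (x : A) : 0 <= N x. Proof. exact: sqrtr_ge0. Qed.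

Lemma sqr_N (x : A) : N x ^+ 2 = ip x x.
Proof. by rewrite sqr_sqrtr// ip_ge0. Qed.

Lemma ip_le (x y : A) : Lsq x -> Lsq y -> `|ip x y| <= N x * N y.
Proof.
move=> [_ sx] [_ sy]; rewrite -(@ler_pXn2r _ 2)// ?nnegrE ?mulr_ge0 ?N_ge0//.
rewrite exprMn !sqr_N -normrX ger0_norm ?sqr_ge0//.
apply: le_trans (cauchy_schwarz measurableT sx sy) _.
by rewrite le_eqVlt; apply/orP; left; apply/eqP; congr (_ * _); apply: eq_Rintegral => z _; rewrite expr2.
Qed.

Lemma N_triangle (x y : A) : Lsq x -> Lsq y -> N (x + y) <= N x + N y.
Proof.
move=> hx hy; rewrite -(@ler_pXn2r _ 2)// ?nnegrE ?addr_ge0 ?N_ge0//.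
have hxy := LsqD hx hy.
rewrite sqr_N ipDl// !ipDr// (ipC y x) sqrrD !sqr_N.
have := le_trans (ler_norm _) (ip_le hx hy); lra.
Qed.

Lemma NZ c (x : A) : N (cst_alg c * x) = `|c| * N x.
Proof. by rewrite /N ipZl ipZr mulrA -expr2 sqrtrM ?sqr_ge0// sqrtr_sqr. Qed.

Lemma NN (x : A) : N (- x) = N x.
Proof. by rewrite /N ipNl ipNr opprK. Qed.

Lemma N_triangleB (x y : A) : Lsq x -> Lsq y -> N (x - y) <= N x + N y.
Proof. by move=> hx hy; rewrite -(NN y); apply: N_triangle => //; exact: LsqN. Qed.

Lemma Lsq_emb f : square_integrable mu DT f -> Lsq (emb f) /\ L1T T f.
Proof.
move=> sf; have hf : L1T T f.
  have [mf if2] := (sqiP _ _ _).1 sf.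
  have i1 : mu.-integrable DT (EFin \o cst (1 : R)).
    apply/integrableP; split; first exact/measurable_EFinP.
    rewrite /= normr1 integral_cst//= mul1e lebesgue_measure_itv/=.
    by case: ifP => _; rewrite ?ltry.
  apply: le_integrable (integrableD mDT i1 if2) => //; first exact/measurable_EFinP.
  move=> x _ /=; rewrite lee_fin [leRHS]ger0_norm ?addr_ge0 ?sqr_ge0//.
  rewrite ler_norml; apply/andP; split; nra.
split => //; split => //; have gf := good_tr hf.
apply: (@sqi_ae (tr T f)); last exact: (fun_part_mk 0 gf).
  case: sf => mf lf; split; first exact: good_meas gf.
  apply: le_lt_trans lf; rewrite [leRHS]integral_mkcond.
  rewrite le_eqVlt; apply/orP; left; apply/eqP; apply: eq_integral => z _.
  by rewrite /tr !patchE; case: ifP => //; rewrite expr0n.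
exact: good_meas (good_fun _).
Qed.

Lemma Lsq_sqi (x : A) : Lsq x -> square_integrable mu DT (fun_part x).
Proof.
case=> _ /sqiP[m i]; apply/sqiP; split; first exact: measurable_funTS.
exact: integrableS i.
Qed.

Lemma sqi_of_Lsq f : L1T T f -> Lsq (emb f) -> square_integrable mu DT f.
Proof.
move=> hf [_ [m i]].
have mf : measurable_fun DT f by apply/measurable_EFinP; exact: measurable_int hf.
split => //; apply: le_lt_trans i; rewrite integral_mkcond.
rewrite le_eqVlt; apply/orP; left; apply/eqP; apply: ae_eq_integral => //.
- have := good_meas (good_tr hf).
  rewrite (_ : ((fun x => (f x ^+ 2)%:E) \_ DT) = (fun x => (tr T f x ^+ 2)%:E)).
    by move=> h; exact/measurable_EFinP/measurable_funX.
  by apply/funext => z; rewrite /tr !patchE; case: ifP => //; rewrite expr0n.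
- exact/measurable_EFinP/measurable_funX.
- move: (fun_part_mk 0 (good_tr hf)); apply: aeW => z h _; rewrite h /tr !patchE.
  by case: ifP => //; rewrite expr0n.
Qed.

Lemma N_emb f : square_integrable mu DT f ->
  (\int[mu]_(z in DT) (f z ^+ 2)%:E)%E = (N (emb f) ^+ 2)%:E.
Proof.
move=> sf; have [_ hf] := Lsq_emb sf; have [mf if2] := (sqiP _ _ _).1 sf.
rewrite sqr_N ipE//; last exact: measurable_funM.
rewrite /Rintegral fineK; last first.
  by apply: integrable_fin_num => //; apply: eq_integrable if2 => // z _ /=; rewrite expr2.
by apply: eq_integral => z _; rewrite expr2.
Qed.

Lemma Lsq_fun0 (x : A) : cst_part x = 0 -> {ae mu, forall z, fun_part x z = 0} -> x = 0.
Proof.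
move=> cx h; rewrite -(mk_parts x) cx; apply: mk_eq => //; [exact: good_fun|exact: good0].
Qed.

Lemma N_eq0 (x : A) : Lsq x -> N x = 0 -> x = 0.
Proof.
move=> [cx sx] /eqP; rewrite sqrtr_eq0 => n0.
apply: Lsq_fun0 => //.
have [m i] := (sqiP _ _ _).1 sx.
have : (\int[mu]_z `|(fun_part x z ^+ 2)%:E| = 0)%E.
  transitivity ((ip x x)%:E); last by congr EFin; apply/eqP; rewrite eq_le n0 ip_ge0.
  rewrite /ip /Rintegral fineK; last first.
    by apply: integrable_fin_num => //; apply: eq_integrable i => // z _ /=; rewrite expr2.
  by apply: eq_integral => z _ /=; rewrite ger0_norm ?sqr_ge0// expr2.
move/(ae_eq_integral_abs mu measurableT (measurable_int _ i)); apply: aeW => z /(_ I) /= [].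
by move/eqP; rewrite sqrf_eq0 => /eqP.
Qed.

Lemma young_alg k (y : A) : L1T T k -> Lsq y ->
  Lsq (emb k * y) /\ N (emb k * y) <= norm1 (tr T k) * N y.
Proof.
move=> hk [cy sy]; have gk := good_tr hk; have gy := good_fun y.
have E : emb k * y = mk T 0 (cv T (tr T k) (fun_part y)).
  rewrite -{1}(mk_parts y) mulE mkM//; apply: mk_eq; rewrite ?mul0r//.
  - exact: good_pmul.
  - exact: good_cv.
  - by apply: ae_all => z; rewrite /pmul cy !mul0r !add0r.
have gc := good_cv gk gy.
have [sc le] := young (good_L1 gk) (good_L1 gy) sy.
have scv : square_integrable mu setT (cv T (tr T k) (fun_part y)).
  split; first exact: good_meas gc.
  case: sc => mc lc; apply: le_lt_trans lc; apply: ge0_le_integral => //.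
  - by move=> z _; rewrite lee_fin sqr_ge0.
  - by apply/measurable_EFinP; apply: measurable_funX; exact: good_meas gc.
  - exact/measurable_EFinP/measurable_funX.
  - move=> z _; rewrite lee_fin /cv /tr patchE; case: ifP => // _.
    by rewrite expr0n sqr_ge0.
have hL : Lsq (emb k * y).
  rewrite E; split => //; apply: (sqi_ae scv); first exact: good_meas (good_fun _).
  exact: fun_part_mk.
split => //; rewrite -(@ler_pXn2r _ 2)// ?nnegrE ?mulr_ge0 ?N_ge0 ?norm1_ge0//.
rewrite exprMn !sqr_N; have -> : ip y y = \int[mu]_z (fun_part y z ^+ 2).
  by apply: eq_Rintegral => z _; rewrite expr2.
apply: le_trans le; rewrite E.
rewrite (@ip_ae _ _ (fun z => cv T (tr T k) (fun_part y) z ^+ 2)); last first.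
- by move: (fun_part_mk 0 gc); apply: aeW => z ->; rewrite expr2.
- by apply: measurable_funX; exact: good_meas gc.
apply: le_Rintegral => //; try exact: sqi_integrable.
move=> z _; rewrite /cv /tr patchE; case: ifP => // _.
by rewrite expr0n sqr_ge0.
Qed.

Lemma emb_part (x : A) : x = cst_alg (cst_part x) + emb (fun_part x).
Proof.
have gx := good_fun x; have g0 := good0 T.
rewrite /emb tr_id; last by case: gx.
rewrite addE mkD// -{1}(mk_parts x); apply: mk_eq; rewrite ?addr0//; first exact: goodD.
by apply: ae_all => z; rewrite add0r.
Qed.

(** The Dirac part of [x] acts as a scalar and its function part is handled by Young's inequality.
    Thus the square integrable elements form an ideal on which the whole algebra acts. *)
Lemma LsqM (x y : A) : Lsq y -> Lsq (x * y).
Proof.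
move=> hy; rewrite (emb_part x) mulrDl; apply: LsqD; first exact: LsqZ.
by case: (young_alg (L1T_fun_part x) hy).
Qed.

End calg_theory.

(** * Time reversal and adjoints *)

Section reflection.
Context {R : realType} (T : R).
Local Notation mu := (@lebesgue_measure R).
Local Notation DT := (`]0, T[%classic : set R).
Local Notation A := (calg T).
Implicit Types (f g h k : R -> R) (c : R).

Let mDT : measurable (DT : set (measurableTypeR R)) := measurable_DT T.
Local Hint Resolve mDT : core.

Lemma conv_trE k f t : DT t ->
  conv (tr T k) (tr T f) t = \int[mu]_(s in `]0, t[) (k (t - s) * f s).
Proof.
rewrite /= in_itv/= => /andP[t0 tT]; rewrite Rintegral_mkcond; apply: eq_Rintegral => s _.
rewrite [RHS]patchE; case: ifPn.
  rewrite inE/= in_itv/= => /andP[s0 st].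
  by rewrite !trE//= in_itv/=; lra.
rewrite notin_setE/= in_itv/= => /negP; rewrite negb_and -!leNgt => /orP[s0|ts].
  by rewrite (@tr_supported _ _ f s) ?mulr0//= in_itv/= ltNge s0.
by rewrite (@tr_supported _ _ k) ?mul0r//= in_itv/= ltNge subr_le0 ts.
Qed.

Lemma good_reflect f : good T f -> good T (fun t => f (T - t)).
Proof.
move=> [Lf sf]; split.
  have mf := L1_measurable Lf.
  have mf' : measurable_fun setT (fun t : measurableTypeR R => f (T - t)).
    by apply: measurableT_comp => //; exact: measurable_funB.
  apply/L1P => //; rewrite (@integral_reflect _ T (fun t => `|f t|%:E)).
    exact/L1P.
  by apply/measurable_EFinP; exact: measurableT_comp.
by move=> x /=; rewrite in_itv/= => nx; apply: sf => /=; rewrite in_itv/=; lra.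
Qed.

Definition refl (x : A) : A := mk T (cst_part x) (fun t => fun_part x (T - t)).

Lemma fun_part_refl (x : A) : {ae mu, forall t, fun_part (refl x) t = fun_part x (T - t)}.
Proof. exact: (fun_part_mk _ (good_reflect (good_fun x))). Qed.

Lemma sqi_reflect f : square_integrable mu setT f ->
  square_integrable mu setT (fun t => f (T - t)).
Proof.
move=> [mf lf]; split.
  by apply: measurableT_comp => //; exact: measurable_funB.
rewrite (@integral_reflect _ T (fun t => (f t ^+ 2)%:E))//.
exact/measurable_EFinP/measurable_funX.
Qed.

Lemma Lsq_refl (x : A) : Lsq x -> Lsq (refl x).
Proof.
move=> [cx sx]; split => //; apply: (sqi_ae (sqi_reflect sx)).
  exact: good_meas (good_fun _).
exact: fun_part_refl.
Qed.

Lemma ip_refl (x y : A) : ip (refl x) (refl y) = ip x y.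
Proof.
rewrite /ip -[RHS](Rintegral_reflect T); last exact: measurable_ip.
apply: ip_ae; last first.
  by move: (aeI (fun_part_refl x) (fun_part_refl y)); apply: aeW => t [-> ->].
by apply: (measurableT_comp (measurable_ip x y)) => //; exact: measurable_funB.
Qed.

Lemma reflK (x : A) : refl (refl x) = x.
Proof.
rewrite -[RHS]mk_parts; apply: mk_eq => //; try exact: good_fun.
  exact: good_reflect (good_fun _).
move: (ae_sub T (fun_part_refl x)); apply: aeW => t ->.
by rewrite subKr.
Qed.

Lemma fun_part_mul (x y : A) : cst_part y = 0 -> {ae mu, forall t,
  fun_part (x * y) t = cst_part x * fun_part y t + cv T (fun_part x) (fun_part y) t}.
Proof.
move=> cy; have gx := good_fun x; have gy := good_fun y.
move: (fun_part_mk (cst_part x * cst_part y) (good_pmul (cst_part x) (cst_part y) gx gy)).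
apply: aeW => t h; apply: etrans h _; by rewrite /pmul cy mul0r add0r.
Qed.

Lemma reflD (x y : A) : refl (x + y) = refl x + refl y.
Proof.
have gx := good_reflect (good_fun x); have gy := good_reflect (good_fun y).
rewrite [RHS]addE mkD//; apply: mk_eq => //.
- exact: (good_reflect (good_fun _)).
- exact: goodD.
- by move: (ae_sub T (fun_partD x y)); apply: aeW.
Qed.

Lemma refl_cst c (x : A) : refl (cst_alg T c * x) = cst_alg T c * refl x.
Proof.
have gx := good_reflect (good_fun x).
rewrite [X in _ = _ * X]/refl cst_mk//; apply: mk_eq => //.
- exact: (good_reflect (good_fun _)).
- exact: goodZ.
- by move: (ae_sub T (fun_part_cst c x)); apply: aeW.
Qed.

(** The adjoint of a causal convolution is the anticausal one with the same kernel, that is, the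
    conjugate by time reversal. The Dirac part is self-adjoint. For the function part both sides are
    iterated integrals of h(t) f(t-s) g(s), which is integrable on the plane by Young's inequality
    for the absolute values. *)
Lemma adjoint (x y z : A) : Lsq y -> Lsq z -> ip (x * y) z = ip y (refl (x * refl z)).
Proof.
move=> hy hz; have hrz := Lsq_refl hz.
rewrite (emb_part x) !mulrDl reflD.
set k := emb T (fun_part x).
have hkz : Lsq (refl (k * refl z)) by apply: Lsq_refl; exact: LsqM.
have hcz : Lsq (refl (cst_alg T (cst_part x) * refl z)) by apply: Lsq_refl; exact: LsqM.
have h1 : Lsq (cst_alg T (cst_part x) * y) := LsqM _ hy.
have h2 : Lsq (k * y) := LsqM _ hy.
rewrite (ipDl h1 h2 hz) (ipDr hcz hkz hy) refl_cst reflK ipZl ipZr; congr (_ + _).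
pose f := fun_part k; pose g := fun_part y; pose h := fun_part z.
have gf : good T f := good_fun k.
have [Lf _] := gf; have [Lg _] := good_fun y; have gh := good_fun z.
have mf := good_meas gf; have mg := good_meas (good_fun y); have mh := good_meas gh.
pose K (w : measurableTypeR R * measurableTypeR R) := h w.1 * (f (w.1 - w.2) * g w.2).
have mK : measurable_fun setT K.
  apply: measurable_funM; first exact: measurableT_comp.
  exact: measurable_conv_kernel.
have [_ sg] := hy; have [_ sh] := hz.
have Laf : L1 (fun t => `|f t|) by exact: (integrable_abse Lf).
have Lag : L1 (fun t => `|g t|) by exact: (integrable_abse Lg).
have sag : square_integrable mu setT (fun t => `|g t|).
  case: sg => _ lg; split; first exact: measurableT_comp.
  by under eq_integral do rewrite real_normK ?num_real//.
have sah : square_integrable mu setT (fun t => `|h t|).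
  case: sh => _ lh; split; first exact: measurableT_comp.
  by under eq_integral do rewrite real_normK ?num_real//.
have [sc _] := young Laf Lag sag.
have iK : (mu \x mu)%E.-integrable setT (EFin \o K).
  apply/integrable12ltyP; first exact/measurable_EFinP.
  have [_ +] := integrableP _ _ _ (sqi_mul measurableT sah sc).
  apply: le_lt_trans; apply: ae_ge0_le_integral => //.
  - by move=> t _; exact: integral_ge0.
  - apply: (measurable_fun_fubini_tonelli_F (fun w => `|K w|%:E)%E) => //.
    by apply/measurable_EFinP; exact: measurableT_comp.
  - apply: measurableT_comp => //; apply/measurable_EFinP; apply: measurable_funM.
      exact: measurableT_comp.
    by case: sc.
  move: (ae_conv_integrable Laf Lag); apply: aeW => t it _ /=.
  have -> : (\int[mu]_s `|K (t, s)|%:E = `|h t|%:E * \int[mu]_s (`|f (t - s)| * `|g s|)%:E)%E.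
    rewrite -ge0_integralZl//.
    - by apply: eq_integral => s _; rewrite /K/= !normrM EFinM.
    - exact: measurable_int it.
  rewrite normrM EFinM normr_id lee_pmul//.
    by apply: integral_ge0 => s _; rewrite lee_fin mulr_ge0.
  rewrite -[X in (X <= _)%E]fineK; last exact: integrable_fin_num it.
  by rewrite lee_fin; exact: ler_norm.
have E1 : ip (k * y) z = \int[mu]_t \int[mu]_s K (t, s).
  transitivity (\int[mu]_t (h t * conv f g t)).
    apply: ip_ae.
      apply: measurable_funM => //; apply: L1_measurable; exact: L1_conv.
    case: hy => cy _; move: (fun_part_mul k cy); apply: aeW => t ->.
    have -> : cst_part k = 0 by [].
    rewrite mul0r add0r mulrC /cv /tr patchE; case: ifPn => //.
    by rewrite notin_setE => nt; case: gh => _ /(_ _ nt); rewrite -/h => ->; rewrite !mul0r.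
  apply: eq_Rintegral => t _; rewrite /conv -RintegralZ//.
  apply: measurable_funM => //; apply: measurableT_comp => //; exact: measurable_funB.
have E2 : ip y (refl (k * refl z)) = \int[mu]_s \int[mu]_t K (t, s).
  have mE : measurable_fun setT (fun s => g s * \int[mu]_t (f (t - s) * h t)).
    have -> : (fun s => g s * \int[mu]_t (f (t - s) * h t)) =
      (fun s => \int[mu]_t K (t, s)).
      apply/funext => s; rewrite -RintegralZ//.
        by apply: eq_Rintegral => t _; rewrite /K/=; ring.
      apply: measurable_funM => //; apply: measurableT_comp => //; exact: measurable_funB.
    exact: L1_measurable (integrable_Rfubini_G iK).
  transitivity (\int[mu]_s (g s * \int[mu]_t (f (t - s) * h t))).
    apply: ip_ae => //.
    have crz : cst_part (refl z) = 0 by case: hrz.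
    move: (aeI (fun_part_refl (k * refl z)) (ae_sub T (fun_part_mul k crz))).
    apply: aeW => s [-> ->].
    have -> : cst_part k = 0 by [].
    rewrite mul0r add0r; have [Ds|nDs] := pselect (DT s); last first.
      by have [_ /(_ _ nDs)] := good_fun y; rewrite -/g => ->; rewrite !mul0r.
    congr (_ * _); rewrite /cv trE; last by move: Ds; rewrite /= !in_itv/=; lra.
    have -> : conv (fun_part k) (fun_part (refl z)) = conv f (fun t => h (T - t)).
      apply: eq_conv_ae => //; try exact: good_meas (good_fun _).
        exact: good_meas (good_reflect gh).
        exact: ae_all.
      exact: fun_part_refl.
    rewrite /conv -(Rintegral_reflect T).
      by apply: eq_Rintegral => r _; rewrite subKr; congr (f _ * _); ring.
    apply: measurable_funM; last exact: good_meas (good_reflect gh).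
    by apply: measurableT_comp => //; exact: measurable_funB.
  apply: eq_Rintegral => s _; rewrite -RintegralZ//.
    by apply: eq_Rintegral => t _; rewrite /K/=; ring.
  apply: measurable_funM => //; apply: measurableT_comp => //; exact: measurable_funB.
by rewrite E1 E2; exact: Rfubini.
Qed.

End reflection.

(** * The integration operator *)

Section integration.
Context {R : realType} (T : R).
Local Notation mu := (@lebesgue_measure R).
Local Notation DT := (`]0, T[%classic : set R).
Local Notation A := (calg T).
Implicit Types (f g h k : R -> R) (c : R).

Let mDT : measurable (DT : set (measurableTypeR R)) := measurable_DT T.
Local Hint Resolve mDT : core.

Lemma sqi_bounded f (M : R) : measurable_fun DT f -> (forall t, DT t -> `|f t| <= M) ->
  square_integrable mu DT f.
Proof.
move=> mf hf; split => //.
apply: (@le_lt_trans _ _ (\int[mu]_(t in DT) (M ^+ 2)%:E)%E).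
  apply: ge0_le_integral => //.
  - by move=> t _; rewrite lee_fin sqr_ge0.
  - exact/measurable_EFinP/measurable_funX.
  - move=> t Dt; rewrite lee_fin -real_normK ?num_real// lerXn2r ?nnegrE//; last exact: hf.
    by apply: le_trans (hf _ Dt).
rewrite integral_cst//= lebesgue_measure_itv/=.
by case: ifP => _; rewrite ?mule0 -?EFinM ltry.
Qed.

Lemma sqi_cst c : square_integrable mu DT (cst c).
Proof. by apply: (@sqi_bounded _ `|c|) => //; exact: measurable_cst. Qed.

Lemma L1T_cst c : L1T T (cst c).
Proof. by have [_] := Lsq_emb (sqi_cst c). Qed.

Definition Ic : A := emb T (cst 1).

Lemma Lsq_Ic : Lsq Ic. Proof. by have [] := Lsq_emb (sqi_cst 1). Qed.

Lemma Ic_emb f : L1T T f -> Ic * emb T f = emb T (fun t => \int[mu]_(s in `]0, t[) f s).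
Proof.
move=> hf; rewrite /Ic embM//; last exact: L1T_cst.
congr mk; apply/funext => t; rewrite /tr !patchE; case: ifPn => //; rewrite inE => Dt.
by rewrite -!/(tr _ _) conv_trE//; apply: eq_Rintegral => s _; rewrite /= mul1r.
Qed.

Lemma L1T_primitive f : L1T T f -> L1T T (fun t => \int[mu]_(s in `]0, t[) f s).
Proof.
move=> hf; have := L1T_conv (L1T_cst 1) hf.
apply: eq_integrable => // t; rewrite inE => Dt /=.
by rewrite conv_trE//; congr EFin; apply: eq_Rintegral => s _; rewrite /= mul1r.
Qed.

Lemma ae_nonempty_itv (P : R -> Prop) (a b : R) : a < b ->
  {ae mu, forall x, P x} -> exists2 x, a < x < b & P x.
Proof.
move=> ab [N [mN N0 PN]]; apply: contrapT => /forall2NP h.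
have sub : `]a, b[%classic `<=` N.
  move=> x /=; rewrite in_itv/= => xab; apply: PN => /= Px.
  by have [] := h x.
have : (mu `]a, b[ <= mu N)%E by apply: le_measure => //; rewrite inE.
rewrite N0 lebesgue_measure_itv/= lte_fin ab -EFinB lee_fin subr_le0 leNgt ab//.
Qed.

(** Conjugation by time reversal turns integration over (0,t) into integration over (t,T); the two
    integrals add up to the constant total integral. *)
Lemma Ic_refl (x : A) : cst_part x = 0 ->
  Ic * x + refl (Ic * refl x) = cst_alg T (\int[mu]_t fun_part x t) * Ic.
Proof.
move=> cx; have gx := good_fun x; have grx := good_reflect gx.
have [Lx sx] := gx.
rewrite -(emb_fun_part cx).
set f := fun_part x in gx grx Lx sx *.
have hf : L1T T f by exact: L1_L1T.
have hfr : L1T T (fun t => f (T - t)) by apply: L1_L1T; case: grx.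
have Er : refl (emb T f) = emb T (fun t => f (T - t)).
  rewrite /refl; apply: mk_eq => //.
  - exact: good_reflect (good_fun _).
  - exact: good_tr.
  - move: (ae_sub T (fun_part_mk 0 (good_tr hf))); apply: aeW => t ->.
    by rewrite !tr_id//; case: grx.
have Err g : L1T T g -> refl (emb T g) = emb T (fun t => g (T - t)).
  move=> hg; have gg := good_tr hg; have ggr := good_reflect gg.
  have E : tr T (fun t => g (T - t)) = (fun t => tr T g (T - t)).
    apply/funext => t; rewrite /tr !patchE.
    have -> : (T - t \in DT) = (t \in DT); last by [].
    by apply/idP/idP; rewrite !inE/= !in_itv/=; lra.
  rewrite /refl /emb E; apply: mk_eq => //.
    exact: good_reflect (good_fun _).
  by move: (ae_sub T (fun_part_mk 0 gg)); apply: aeW => t ->.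
have E0 : \int[mu]_t f t = \int[mu]_(t in DT) f t.
  by rewrite [RHS]Rintegral_mkcond -/(tr T f) tr_id.
have h1 := L1T_primitive hf; have h2 := L1T_primitive hfr.
have h2' : L1T T (fun t => \int[mu]_(s in `]0, T - t[) f (T - s)).
  have := good_reflect (good_tr h2); case=> /(@L1_L1T _ T) + _.
  apply: eq_integrable => // t; rewrite inE => Dt /=; congr EFin.
  by rewrite trE//; move: Dt; rewrite /= !in_itv/=; lra.
have -> : fun_part (emb T f) = fun_part x by rewrite /f emb_fun_part.
rewrite Er !Ic_emb// Err// embD// embZ; last exact: L1T_cst.
apply/emb_eq; [exact: L1TD|by apply: L1TZ; exact: L1T_cst|].
apply: ae_all => t; rewrite /= in_itv/= => /andP[t0 tT].
rewrite mulr1 -/f E0.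
have -> : \int[mu]_(s in `]0, T - t[) f (T - s) = \int[mu]_(s in `]t, T[) f s.
  rewrite Rintegral_mkcond [RHS]Rintegral_mkcond -[RHS](Rintegral_reflect T).
    apply: eq_Rintegral => s _; rewrite !patchE.
    have -> : (T - s \in `]t, T[%classic) = (s \in `]0, T - t[%classic); last by [].
    by apply/idP/idP; rewrite !inE/= !in_itv/=; lra.
  apply: (measurable_restrictT _ _).1 => //; apply: measurable_funTS; exact: L1_measurable.
have Dsub : `]0, t[%classic `<=` DT.
  by move=> s /=; rewrite !in_itv/=; lra.
have i1 : mu.-integrable `]0, t[ (EFin \o f) by exact: integrableS hf.
have i2 : mu.-integrable `[t, T[ (EFin \o f).
  by apply: integrableS hf => //; move=> s /=; rewrite !in_itv/=; lra.
have i3 : mu.-integrable `]t, T[ (EFin \o f).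
  by apply: integrableS hf => //; move=> s /=; rewrite !in_itv/=; lra.
rewrite (Rintegral_itv_obnd_cbnd i3) -Rintegral_setU//.
- congr Rintegral; apply/seteqP; split => s /=; rewrite !in_itv/=.
    by case; lra.
  move=> /andP[s0 sT]; have [st|st] := ltP s t; [left|right]; lra.
- apply: integrableS hf => //; first exact: measurableU.
  by move=> s [] /=; rewrite !in_itv/=; lra.
- by apply/disj_setPS => s [] /=; rewrite !in_itv/=; lra.
Qed.

(** By [adjoint] and [Ic_refl], twice the left-hand pairing is the square of the integral of [x]. *)
Lemma ip_Ic (x : A) : Lsq x -> 0 <= ip (Ic * x) x.
Proof.
move=> hx; have [cx sx] := hx.
have hI : Lsq (Ic * x) := LsqM _ hx.
have hIr : Lsq (refl (Ic * refl x)) by apply: Lsq_refl; apply: LsqM; exact: Lsq_refl.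
have e1 := adjoint Ic hx hx.
have e2 : ip (Ic * x + refl (Ic * refl x)) x = ip (cst_alg T (\int[mu]_t fun_part x t) * Ic) x.
  by rewrite Ic_refl.
rewrite (ipDl hI hIr hx) (ipC (refl _)) -e1 ipZl in e2.
have e3 : ip Ic x = \int[mu]_t fun_part x t.
  rewrite -{1}(emb_fun_part cx) ipE; [|exact: L1T_cst|exact: L1T_fun_part|].
    rewrite Rintegral_mkcond; have [_ s] := good_fun x.
    rewrite -[in RHS](tr_id s); apply: eq_Rintegral => t _; rewrite /tr !patchE.
    by case: ifP => // _; rewrite mul1r.
  by apply: measurable_funTS; apply: measurable_funM => //; exact: good_meas (good_fun x).
rewrite e3 -expr2 in e2.
have := sqr_ge0 (\int[mu]_t fun_part x t); lra.
Qed.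

End integration.

(** * Neumann series and invertibility *)

Section neumann.
Context {R : realType} (T : R).
Local Notation mu := (@lebesgue_measure R).
Local Notation DT := (`]0, T[%classic : set R).
Local Notation A := (calg T).
Implicit Types (f g h k : R -> R) (c : R).

Let mDT : measurable (DT : set (measurableTypeR R)) := measurable_DT T.
Local Hint Resolve mDT : core.

Lemma good_series (u : nat -> R -> R) n : (forall n, good T (u n)) ->
  good T (fun t => series (u ^~ t) n).
Proof.
move=> gu; elim: n => [|n ih].
  rewrite (_ : (fun _ => _) = cst 0); first exact: good0.
  by apply/funext => t; rewrite /series/= big_nil.
rewrite (_ : (fun _ => _) = fun t => series (u ^~ t) n + u n t); first exact: goodD.
by apply/funext => t; rewrite /series/= big_nat_recr.
Qed.

(** Monotone convergence bounds the integral of the sum of the |u_i| by [M], so this sum is finite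
    almost everywhere and dominates all partial sums. *)
Lemma L1_series_cvg (u : nat -> R -> R) (M : R) : (forall n, good T (u n)) ->
  (forall n, \sum_(0 <= i < n) norm1 (u i) <= M) ->
  exists2 y, good T y &
    norm1 (fun t => series (u ^~ t) n - y t) @[n --> \oo] --> 0.
Proof.
move=> gu uM; have mu_ n := good_meas (gu n).
have mau n : measurable_fun setT (fun t => `|u n t|%:E).
  by apply/measurable_EFinP; exact: measurableT_comp.
pose G t := (\sum_(0 <= i <oo) `|u i t|%:E)%E.
have mG : measurable_fun setT G by apply: ge0_emeasurable_sum => // i t _ _; rewrite lee_fin.
have G0 t : (0 <= G t)%E by apply: nneseries_ge0 => i _ _; rewrite lee_fin.
have iG : (\int[mu]_t G t < +oo)%E.
  rewrite integral_nneseries//.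
  apply: (@le_lt_trans _ _ M%:E); last exact: ltry.
  apply: lime_le; first by apply: is_cvg_nneseries => i _ _; exact: integral_ge0.
  apply: nearW => n; rewrite (eq_bigr (fun i => (norm1 (u i))%:E)).
    by rewrite sumEFin lee_fin.
  by move=> i _; apply: norm1E; case: (gu i).
pose E := [set t | (G t < +oo)%E].
have mE : measurable (E : set (measurableTypeR R)).
  rewrite -[E]setTI; have := emeasurable_fun_infty_o measurableT mG +oo%E; exact.
pose S n t := series (u ^~ t) n.
have mS n : measurable_fun setT (S n).
  by rewrite /S /series/=; apply: measurable_sum.
have SE t : E t -> cvgn (S ^~ t).
  move=> Et; apply: normed_cvg; apply: nondecreasing_is_cvgn.
    apply/nondecreasing_seqP => n; rewrite /= /series/= big_nat_recr//= lerDl//.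
  exists (fine (G t)) => _ [n _ <-]; rewrite -lee_fin fineK; last by rewrite ge0_fin_numE.
  rewrite /series/= -sumEFin; apply: nneseries_lim_ge => i _ _; by rewrite lee_fin.
(* The partial sums are set to 0 on the exceptional null set, so that the limit exists everywhere
   and is measurable. *)
pose v n := (S n) \_ E.
have vcvg t : cvgn (v ^~ t).
  have [Et|nEt] := pselect (E t).
    have -> : v ^~ t = S ^~ t by apply/funext => n; rewrite /v patchE mem_set.
    exact: SE.
  have -> : v ^~ t = cst 0 by apply/funext => n; rewrite /v patchE memNset.
  exact: is_cvg_cst.
pose y t := limn (v ^~ t).
have my : measurable_fun setT y.
  apply: (@measurable_fun_cvg _ _ _ _ v y) => [n|t _]; last exact: vcvg.
  exact: (measurable_restrictT _ mE).1 (measurable_funTS (mS n)).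
have aeE : {ae mu, forall t, E t} by exact: ae_fin_num.
have iG' : mu.-integrable setT G.
  by apply/integrableP; split => //; under eq_integral do rewrite gee0_abs//.
have ySt t : E t -> S ^~ t @ \oo --> y t.
  move=> Et; have -> : y t = limn (S ^~ t).
    by congr (limn _); apply/funext => n; rewrite /v patchE mem_set.
  exact: SE.
have [] := @dominated_convergence _ _ _ mu setT measurableT
  (fun n => EFin \o S n) (EFin \o y) G.
- by move=> n; apply/measurable_EFinP; exact: mS.
- by apply/measurable_EFinP; exact: my.
- move: aeE; apply: aeW => t Et _; apply: cvg_EFin; last exact: ySt.
  exact: nearW.
- exact: iG'.
- apply: ae_all => t n _; rewrite /= /S /series/=.
  apply: (@le_trans _ _ (\sum_(0 <= i < n) `|u i t|)%:E).
    by rewrite lee_fin; exact: ler_norm_sum.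
  by rewrite -sumEFin; apply: nneseries_lim_ge.
move=> i1 i2 _; exists y.
  split => // t nt; rewrite /y; have -> : v ^~ t = cst 0.
    apply/funext => n; rewrite /v patchE; case: ifP => // _.
    by rewrite /S /series/= big1// => i _; case: (gu i) => _ ->.
  exact: lim_cst.
have iS n : L1 (S n).
  by case: (good_series n gu).
have idf n : L1 (fun t => S n t - y t) by exact: (integrableB measurableT (iS n) i1).
by move/fine_cvgP: i2 => [_].
Qed.

Lemma norm1_cv f g : good T f -> good T g -> norm1 (cv T f g) <= norm1 f * norm1 g.
Proof.
move=> gf gg; have [Lf _] := gf; have [Lg _] := gg.
apply: le_trans (norm1_conv Lf Lg).
have Lc := L1_conv Lf Lg; have [Lcv _] := good_cv gf gg.
apply: le_Rintegral => //; try exact: (integrable_abse (_ : L1 _)).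
by move=> t _; rewrite /cv /tr patchE; case: ifP => //; rewrite normr0.
Qed.

Lemma norm1_eq0 f : L1 f -> norm1 f = 0 -> {ae mu, forall t, f t = 0}.
Proof.
move=> Lf n0; have : (\int[mu]_t `|(f t)%:E| = 0)%E by rewrite norm1E// n0.
move/(ae_eq_integral_abs mu measurableT (measurable_int _ Lf)).
by apply: aeW => t /(_ I) /= [].
Qed.

Lemma norm1D f g : L1 f -> L1 g -> norm1 (fun t => f t + g t) <= norm1 f + norm1 g.
Proof.
move=> Lf Lg; rewrite -RintegralD//; [|exact: (integrable_abse Lf)|exact: (integrable_abse Lg)].
apply: le_Rintegral => //.
- exact: (integrable_abse (integrableD measurableT Lf Lg)).
- exact: (integrableD measurableT (integrable_abse Lf) (integrable_abse Lg)).
- by move=> t _; exact: ler_normD.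
Qed.

Lemma norm1Z c f : L1 f -> norm1 (fun t => c * f t) = `|c| * norm1 f.
Proof.
move=> Lf; rewrite -RintegralZl//; last exact: (integrable_abse Lf).
by apply: eq_Rintegral => t _; rewrite normrM.
Qed.

(* Neumann series [- k + k * k - ...] in L^1 *)
Lemma neumann_small k : good T k -> norm1 k <= 2^-1 ->
  exists2 y, good T y & {ae mu, forall t, k t + y t + cv T k y t = 0}.
Proof.
move=> gk k2.
pose u := fix u n := if n is n'.+1 then (fun t => -1 * cv T k (u n') t)
  else (fun t => -1 * k t).
have gu n : good T (u n).
  by elim: n => [|n ih]; apply: goodZ => //; exact: good_cv.
have nu n : norm1 (u n) <= 2^-1 ^+ n.+1.
  elim: n => [|n ih].
    by rewrite norm1Z ?normrN1 ?mul1r ?expr1//; case: gk.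
  rewrite norm1Z ?normrN1 ?mul1r; last by case: (good_cv gk (gu n)).
  rewrite [leRHS]exprS.
  apply: le_trans (norm1_cv gk (gu n)) _; apply: ler_pM => //; exact: norm1_ge0.
have [|y gy hy] := @L1_series_cvg u 1 gu.
  move=> n; apply: (@le_trans _ _ (1 - 2^-1 ^+ n)).
    elim: n => [|n ih]; first by rewrite big_nil expr0 subrr.
    rewrite big_nat_recr//=; have := nu n; move: ih; rewrite exprS.
    by move: (_ ^+ n) (norm1 _) (bigop _ _ _) => q a b; lra.
  by rewrite gerBl exprn_ge0.
exists y => //.
pose S n t := series (u ^~ t) n.
have gS n : good T (S n) := good_series n gu.
have rS n : {ae mu, forall t, S n.+1 t = - k t - cv T k (S n) t}.
  elim: n => [|n ih].
    have := cv_linear (-1) gk (good0 T) (good0 T); apply: aeW => t.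
    rewrite (_ : (fun y : R => _) = cst 0); last by apply/funext => s /=; rewrite mulr0 addr0.
    rewrite mulN1r addNr => e0; rewrite (_ : S 0%N = cst 0); last first.
      by apply/funext => s; rewrite /S /series/= big_nil.
    by rewrite e0 subr0 /S /series/= big_nat_recl// big_nil/= addr0 mulN1r.
  have gn := gS n; have gn1 := gS n.+1; have gun := gu n.
  move: (aeI ih (cv_linear 1 gk gn gun)); apply: aeW => t [e1 e2].
  have E1 s : S n.+1 s = S n s + u n s by rewrite /S /series/= big_nat_recr.
  rewrite [LHS](_ : _ = S n.+1 t + u n.+1 t); last by rewrite /S /series/= big_nat_recr.
  rewrite e1 /= (_ : S n.+1 = (fun s => 1 * S n s + u n s)).
    by rewrite e2; ring.
  by apply/funext => s; rewrite mul1r.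
have gz : good T (fun t => k t + y t + cv T k y t).
  by apply: goodD; [exact: goodD|exact: good_cv].
apply: norm1_eq0; first by case: gz.
apply/eqP; rewrite eq_le norm1_ge0 andbT; apply/ler_addgt0Pr => e e0; rewrite add0r.
have [/= m _ hm] : \forall n \near \oo, norm1 (fun t => series (u ^~ t) n - y t) < e / 2.
  by apply: (cvgr_lt 0) => //; lra.
have gd n : good T (fun t => S n t + -1 * y t) by apply: goodD => //; exact: goodZ.
have nd n : (m <= n)%N -> norm1 (fun t => S n t + -1 * y t) <= e / 2.
  move=> mn; apply/ltW; apply: le_lt_trans (hm n mn).
  by rewrite le_eqVlt; apply/orP; left; apply/eqP; congr norm1; apply/funext => t; rewrite mulN1r.
have gd1 := gd m.+1; have gd0 := gd m.
have gc := good_cv gk gd0.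
(* By the recursion [rS], the residual k + y + k * y equals -(S_(m+1) - y) - k * (S_m - y), whose
   two terms are truncation errors of the series. *)
apply: (@le_trans _ _ (norm1 (fun t => -1 * (S m.+1 t + -1 * y t) + -1 * cv T k (fun t => S m t + -1 * y t) t))).
  rewrite le_eqVlt; apply/orP; left; apply/eqP; congr fine; apply: ae_eq_integral => //.
  - by apply/measurable_EFinP; apply: measurableT_comp => //; exact: good_meas gz.
  - apply/measurable_EFinP; apply: measurableT_comp => //.
    by apply: (@good_meas _ T); apply: goodD; exact: goodZ.
  move: (aeI (rS m) (cv_linear (-1) gk gy (gS m))); apply: aeW => t [e1 e2] _.
  rewrite e1 (_ : (fun t => S m t + -1 * y t) = (fun t => -1 * y t + S m t)).
    by rewrite e2; congr (`| _ |%:E); ring.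
  by apply/funext => s; rewrite addrC.
apply: le_trans (norm1D _ _) _; try by case: (goodZ (-1) gd1).
  by case: (goodZ (-1) gc).
rewrite !norm1Z; [|by case: gc|by case: gd1].
rewrite !normrN1 !mul1r.
have h1 := nd _ (leqnSn m); have h0 := nd _ (leqnn m).
have h2 := norm1_cv gk gd0; have h3 := norm1_ge0 (fun t => S m t + -1 * y t).
have h4 := norm1_ge0 k.
have : norm1 k * norm1 (fun t => S m t + -1 * y t) <= 1 * (e / 2).
  by apply: ler_pM => //; lra.
lra.
Qed.

End neumann.

Section invertibility.
Context {R : realType} (T : R).
Local Notation mu := (@lebesgue_measure R).
Local Notation DT := (`]0, T[%classic : set R).
Local Notation A := (calg T).
Implicit Types (f g h k : R -> R) (c : R).

Let mDT : measurable (DT : set (measurableTypeR R)) := measurable_DT T.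
Local Hint Resolve mDT : core.

Definition ew c f : R -> R := fun t => expR (c * t) * f t.

Lemma good_ew c f : good T f -> good T (ew c f).
Proof.
move=> [Lf sf]; split; last by move=> t nt; rewrite /ew sf// mulr0.
have mf := L1_measurable Lf.
apply: (le_integrable measurableT _ _ (integrableZl measurableT (expR (`|c| * T)) (integrable_abse Lf))).
  apply/measurable_EFinP; apply: measurable_funM => //.
  apply: measurableT_comp => //; exact: measurable_funM.
move=> t _ /=; have [Dt|nDt] := pselect (DT t); last first.
  by rewrite /ew sf// normr0 !mulr0.
rewrite lee_fin /ew !normrM normr_id; apply: ler_wpM2r => //.
rewrite [leLHS]ger0_norm ?expR_ge0// [leRHS]ger0_norm ?expR_ge0// ler_expR.
move: Dt; rewrite /= in_itv/= => /andP[t0 tT].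
apply: (le_trans (ler_norm _)); rewrite normrM (gtr0_norm t0).
by apply: ler_wpM2l => //; exact: ltW.
Qed.

(** The weight is multiplicative, exp(c t) = exp(c (t-s)) exp(c s), so weighting is an automorphism
    of the convolution product. *)
Lemma cv_ew c f g : good T f -> good T g -> cv T (ew c f) (ew c g) = ew c (cv T f g).
Proof.
move=> gf gg; have mf := good_meas gf; have mg := good_meas gg.
apply/funext => t; rewrite /cv /tr /ew !patchE; case: ifP => _; last by rewrite mulr0.
rewrite /conv -RintegralZ//.
  apply: eq_Rintegral => s _.
  rewrite mulrACA -expRD -mulrDr subrK//.
by apply: measurable_funM => //; apply: measurableT_comp => //; exact: measurable_funB.
Qed.

Lemma ewK c f : ew c (ew (- c) f) = f.
Proof.
by apply/funext => t; rewrite /ew mulrA -expRD -mulrDl subrr mul0r expR0 mul1r.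
Qed.

Lemma norm1_ew_cvg f : good T f -> norm1 (ew (- n%:R) f) @[n --> \oo] --> 0.
Proof.
move=> gf; have [Lf sf] := gf; have mf := L1_measurable Lf.
have mew n : measurable_fun setT (fun t => `|ew (- n%:R) f t|).
  by apply: measurableT_comp => //; exact: good_meas (good_ew _ gf).
have [] := @dominated_convergence _ _ _ mu setT measurableT
  (fun n => EFin \o (fun t => `|ew (- n%:R) f t|)) (EFin \o cst 0) (fun t => `|f t|%:E).
- by move=> n; apply/measurable_EFinP; exact: mew.
- exact/measurable_EFinP.
- apply: ae_all => t _; apply: cvg_EFin; first exact: nearW.
  have [Dt|nDt] := pselect (DT t); last first.
    rewrite (_ : _ \o _ = cst 0); first exact: cvg_cst.
    by apply/funext => n /=; rewrite /ew sf// mulr0 normr0.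
  move: Dt; rewrite /= in_itv/= => /andP[t0 tT].
  rewrite (_ : _ \o _ = (fun n => (geometric `|f t| (expR (- t))) n)).
    apply: cvg_geometric; rewrite ger0_norm ?expR_ge0//.
    by rewrite -expR0 ltr_expR; lra.
  apply/funext => n /=; rewrite /ew normrM mulrC (ger0_norm (expR_ge0 _)).
  by rewrite -expRM_natl; congr (_ * expR _); rewrite mulNr mulrN.
- exact: (integrable_abse Lf).
- apply: ae_all => t n _ /=; rewrite lee_fin normr_id /ew normrM.
  rewrite (ger0_norm (expR_ge0 _)).
  have [Dt|nDt] := pselect (DT t); last by rewrite sf// normr0 mulr0.
  move: Dt; rewrite /= in_itv/= => /andP[t0 tT].
  rewrite ler_piMl// -expR0 ler_expR mulNr oppr_le0 mulr_ge0// ltW//.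
move=> _ /fine_cvgP[_ +] _; apply: cvg_trans; apply: near_eq_cvg; apply: nearW => n /=.
by congr fine; apply: eq_integral => t _ /=; rewrite subr0 normr_id.
Qed.

Lemma one_plus_inv k : L1T T k ->
  exists2 y : A, cst_part y = 0 & (1 + emb T k) * (1 + y) = 1.
Proof.
move=> /good_tr; set f := tr T k => gf.
have [/= m _ hm] : \forall n \near \oo, norm1 (ew (- n%:R) f) < 2^-1.
  by apply: (cvgr_lt 0) => //; exact: norm1_ew_cvg.
have gfm := good_ew (- m%:R) gf.
have [y gy hy] := neumann_small gfm (ltW (hm _ (leqnn m))).
pose y1 := ew m%:R y; have gy1 : good T y1 := good_ew _ gy.
exists (mk T 0 y1) => //.
have g0 := good0 T.
have e1 g : good T g -> (1 : A) + mk T 0 g = mk T 1 g.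
  move=> gg; rewrite [LHS](mkD 1 0 g0 gg) addr0; apply: mk_eq => //; first exact: goodD.
  by apply: ae_all => t; rewrite add0r.
rewrite /emb -/f !e1// mulE mkM//.
apply: mk_eq => //; [exact: good_pmul|by rewrite mulr1|].
move: hy; apply: aeW => t ht; rewrite /pmul !mul1r addrA.
have fE : f = ew m%:R (ew (- m%:R) f) by rewrite ewK.
rewrite [in cv T f]fE cv_ew// {1}fE /y1 /ew -!mulrDr.
by rewrite -/(ew _ _) ht mulr0.
Qed.

End invertibility.

(** * Fractional kernels *)

Section calculus.
Context {R : realType}.
Local Notation mu := (@lebesgue_measure R).
Implicit Types (f F : R -> R) (a b c t x : R).

Lemma FTC_itv f F a b : a < b ->
  (forall x, a <= x <= b -> is_derive x 1 F (f x)) ->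
  (forall x, a <= x <= b -> {for x, continuous f}) ->
  (\int[mu]_(x in `[a, b]) (f x)%:E = (F b - F a)%:E)%E.
Proof.
move=> ab dF cf; rewrite EFinB; apply: continuous_FTC2 => //.
- apply: continuous_in_subspaceT => x; rewrite inE/= in_itv/= => axb; exact: cf.
- have cF x : a <= x <= b -> {for x, continuous F}.
    move=> axb; apply: differentiable_continuous; apply/derivable1_diffP.
    by have [] := dF _ axb.
  split.
  + move=> x; rewrite in_itv/= => /andP[ax xb].
    by have [] := dF x; rewrite ?(ltW ax) ?(ltW xb).
  + by apply: cvg_at_right_filter; apply: cF; rewrite lexx ltW.
  + by apply: cvg_at_left_filter; apply: cF; rewrite lexx ltW.
- move=> x; rewrite in_itv/= => /andP[ax xb]; rewrite derive1E.
  have h : a <= x <= b by rewrite (ltW ax) (ltW xb).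
  by have [_ ->] := dF x h.
Qed.

(* The derivative may be unbounded at the left end point. *)
Lemma FTC_left_open f F b : 0 < b ->
  (forall x, 0 < x -> 0 <= f x) ->
  (forall x, 0 < x -> is_derive x 1 F (f x)) ->
  (forall x, 0 < x -> {for x, continuous f}) ->
  F x @[x --> 0^'+] --> F 0 ->
  (\int[mu]_(x in `]0%R, b]) (f x)%:E = (F b - F 0)%:E)%E.
Proof.
move=> b0 f0 dF cf F0.
pose E (n : nat) : set (measurableTypeR R) := `[b / n.+2%:R, b]%classic.
have -> : `]0, b]%classic = \bigcup_n E n.
  apply/seteqP; split => x /=.
    rewrite in_itv/= => /andP[x0 xb]; exists (Num.truncn (b / x)) => //=.
    rewrite /E/= in_itv/= xb andbT ler_pdivrMr// mulrC -ler_pdivrMr//.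
    have := truncnS_gt (b / x); move/ltW/le_trans; apply.
    by rewrite ler_nat.
  move=> [n _]; rewrite /E/= !in_itv/= => /andP[bx ->]; rewrite andbT.
  by apply: lt_le_trans bx; rewrite divr_gt0.
have mf : measurable_fun (`]0, +oo[%classic : set R) f.
  apply: open_continuous_measurable_fun; first exact: interval_open.
  by move=> x; rewrite inE/= in_itv/= andbT => x0; exact: cf.
have ndE : {homo E : n m / (n <= m)%N >-> (n <= m)%O}.
  move=> n m nm; apply/subsetPset => x; rewrite /E/= !in_itv/= => /andP[bx ->]; rewrite andbT.
  apply: le_trans bx; rewrite ler_pM2l// lef_pV2 ?posrE// ler_nat.
  by rewrite !ltnS.
have mU : measurable_fun (\bigcup_n E n) f.
  apply: measurable_funS mf => //.
  move=> x [n _]; rewrite /E/= !in_itv/= andbT => /andP[bx _].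
  by apply: lt_le_trans bx; rewrite divr_gt0.
have E0 n x : E n x -> 0 < x.
  by rewrite /E/= in_itv/= => /andP[bx _]; apply: lt_le_trans bx; rewrite divr_gt0.
have C := @ge0_nondecreasing_set_cvg_integral _ _ _ E (EFin \o f) mu ndE
  (fun n => measurable_itv _) _ _.
have /C{}C : forall i, measurable_fun (E i) (EFin \o f).
  move=> i; apply/measurable_EFinP; apply: measurable_funS mU.
    by apply: bigcup_measurable => k _; exact: measurable_itv.
  exact: bigcup_sup.
have /C{}C : forall i x, E i x -> (0 <= (EFin \o f) x)%E.
  by move=> i x /E0 x0; rewrite lee_fin f0.
apply: (cvg_unique _ C) => //.
have -> : (fun i => \int[mu]_(x in E i) (EFin \o f) x)%E =
  (fun n : nat => (F b - F (b / n.+2%:R))%:E).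
  apply/funext => n; apply: FTC_itv.
  - by rewrite ltr_pdivrMr// ltr_pMr// ltr1n.
  - by move=> x xb; apply: dF; apply: (E0 n); rewrite /E/= in_itv/=.
  - by move=> x xb; apply: cf; apply: (E0 n); rewrite /E/= in_itv/=.
apply: cvg_EFin; first exact: nearW.
apply: cvgB; first exact: cvg_cst.
move/cvg_at_rightP : F0; apply; split; first by move=> n; rewrite divr_gt0.
rewrite -[X in _ --> X](mulr0 b); apply: cvgM; first exact: cvg_cst.
by rewrite (_ : (fun n : nat => n.+2%:R^-1) = [sequence (@harmonic R) n.+1]_n) // cvg_shiftS; exact: cvg_harmonic.
Qed.

Lemma continuous_powR_gt0 (p x : R) : 0 < x -> {for x, continuous (fun y => y `^ p)}.
Proof.
move=> x0; apply: differentiable_continuous; apply/derivable1_diffP.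
by apply: derivable_powR; rewrite in_itv/= x0.
Qed.

Lemma int_powR (p b : R) : 0 < p -> 0 < b ->
  (\int[mu]_(x in `]0%R, b]) (x `^ (p - 1))%:E = (b `^ p / p)%:E)%E.
Proof.
move=> p0 b0; pose F (x : R) := x `^ p / p.
have -> : b `^ p / p = F b - F 0 by rewrite /F powR0 ?gt_eqF// mul0r subr0.
refine (@FTC_left_open (fun x => x `^ (p - 1)) F b b0 _ _ _ _); rewrite /F.
- by move=> x x0; exact: powR_ge0.
- move=> x x0; have h := is_derive1_powR p x0.
  rewrite (_ : (fun y => y `^ p / p) = p^-1 \*: (@powR R ^~ p)); last first.
    by apply/funext => y /=; rewrite mulrC.
  by apply: is_derive_eq; rewrite /GRing.scale/= mulrA mulVf ?mul1r// gt_eqF.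
- by move=> x x0; exact: continuous_powR_gt0.
- rewrite powR0 ?gt_eqF// mul0r -[X in _ --> X](mul0r p^-1); apply: cvgM; last exact: cvg_cst.
  exact: powR_cvg0.
Qed.

End calculus.

(** * Gamma function and beta integral *)

Section gamma_function.
Context {R : realType}.
Local Notation mu := (@lebesgue_measure R).
Implicit Types (f F : R -> R) (a b c t x z : R).

Lemma int_expR c b : 0 < c -> 0 < b ->
  (\int[mu]_(x in `]0%R, b]) (expR (- (c * x)))%:E = (c^-1 * (1 - expR (- (c * b))))%:E)%E.
Proof.
move=> c0 b0; pose F (x : R) := - (c^-1 * expR (- (c * x))).
have dE x : is_derive x 1 (fun y : R => expR (- (c * y))) (- c * expR (- (c * x))).
  rewrite (_ : (fun y : R => expR (- (c * y))) = expR \o (fun y : R => - c * y)); last first.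
    by apply/funext => y /=; rewrite mulNr.
  have h1 : is_derive x 1 (fun y : R => - c * y) (- c).
    rewrite (_ : (fun y : R => - c * y) = (- c) \*: (fun y : R => y))//.
    by apply: is_derive_eq; rewrite /GRing.scale/= mulr1.
  have h2 := is_derive1_comp (is_derive_expR (- c * x)) h1.
  by apply: (is_derive_eq h2); rewrite -(mulNr c x) mulrC.
have -> : (\int[mu]_(x in `]0%R, b]) (expR (- (c * x)))%:E = (F b - F 0)%:E)%E.
  refine (@FTC_left_open R (fun x => expR (- (c * x))) F b b0 _ _ _ _).
  - by move=> x _; exact: expR_ge0.
  - move=> x x0; rewrite /F.
    rewrite (_ : (fun y : R => _) = (- c^-1) \*: (fun y : R => expR (- (c * y)))); last first.
      by apply/funext => y /=; rewrite /GRing.scale/= mulNr.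
    have := dE x => h; apply: is_derive_eq; rewrite /GRing.scale/= mulrA mulrNN mulVf ?mul1r// gt_eqF//.
  - move=> x _; apply: differentiable_continuous; apply/derivable1_diffP.
    by have [] := dE x.
  - apply: cvg_at_right_filter; apply: cvgN; apply: cvgM; first exact: cvg_cst.
    have : {for (0 : R), continuous (fun y : R => expR (- (c * y)))}.
      apply: differentiable_continuous; apply/derivable1_diffP.
      by have [] := dE 0.
    exact.
by rewrite /F mulr0 oppr0 expR0 mulr1 opprK mulrBr mulr1 addrC.
Qed.

Lemma int_expR_le c b : 0 < c -> 0 < b ->
  (\int[mu]_(x in `]0%R, b]) (expR (- (c * x)))%:E <= (c^-1)%:E)%E.
Proof.
move=> c0 b0; rewrite int_expR// lee_fin mulrBr mulr1 gerBl.
by rewrite mulr_ge0 ?expR_ge0// invr_ge0 ltW.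
Qed.

Lemma le_integral_bound f (M : R) : measurable_fun (`]0, +oo[%classic : set R) f ->
  (forall x, 0 < x -> 0 <= f x) ->
  (forall b, 0 < b -> (\int[mu]_(x in `]0%R, b]) (f x)%:E <= M%:E)%E) ->
  (\int[mu]_(x in `]0%R, +oo[) (f x)%:E <= M%:E)%E.
Proof.
move=> mf f0 fM; pose E (n : nat) : set (measurableTypeR R) := `]0, n.+1%:R]%classic.
have -> : `]0, +oo[%classic = \bigcup_n E n.
  apply/seteqP; split => x /=; rewrite in_itv/= ?andbT.
    move=> x0; exists (Num.truncn x) => //=; rewrite /E/= in_itv/= x0/=.
    by rewrite ltW// truncnS_gt.
  by move=> [n _]; rewrite /E/= in_itv/= => /andP[].
have E0 n x : E n x -> 0 < x by rewrite /E/= in_itv/= => /andP[].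
have C := @ge0_nondecreasing_set_cvg_integral _ _ _ E (EFin \o f) mu _
  (fun n => measurable_itv _).
have ndE : {homo E : n m / (n <= m)%N >-> (n <= m)%O}.
  move=> n m nm; apply/subsetPset => x; rewrite /E/= !in_itv/= => /andP[-> xn]/=.
  by apply: le_trans xn _; rewrite ler_nat.
have {}C := C ndE.
have /C{}C : forall i, measurable_fun (E i) (EFin \o f).
  move=> i; apply/measurable_EFinP; apply: measurable_funS mf => //.
  by move=> x /E0 x0; rewrite /= in_itv/= x0.
have /C{}C : forall i x, E i x -> (0 <= (EFin \o f) x)%E.
  by move=> i x /E0 x0; rewrite lee_fin f0.
rewrite -(cvg_lim _ C)//; apply: lime_le; first by apply/cvg_ex; eexists; exact: C.
by apply: nearW => n; exact: fM.
Qed.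

(** The value 0 for x <= 0 makes the kernel causal, so that integrals over the whole line of
    products such as [pw a (x - y) * pw b y] range over (0, x). *)
Definition pw a x : R := if 0 < x then x `^ (a - 1) else 0.

Lemma pw_ge0 a x : 0 <= pw a x.
Proof. by rewrite /pw; case: ifP => // _; exact: powR_ge0. Qed.

Lemma measurable_pw a : measurable_fun setT (pw a).
Proof.
by apply: measurable_fun_ifT => //; first [exact: measurable_fun_ltr | exact: measurable_powR].
Qed.

Lemma pwM a c x : 0 < c -> pw a (c * x) = c `^ (a - 1) * pw a x.
Proof.
move=> c0; rewrite /pw pmulr_rgt0//; case: ifP => [x0|]; last by rewrite mulr0.
by rewrite powRM// ltW.
Qed.

Definition gpw a x : R := pw a x * expR (- x).

Lemma gpw_ge0 a x : 0 <= gpw a x.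
Proof. by rewrite mulr_ge0 ?pw_ge0 ?expR_ge0. Qed.

Lemma measurable_gpw a : measurable_fun setT (gpw a).
Proof.
apply: measurable_funM; first exact: measurable_pw.
by apply: measurableT_comp => //; exact: measurable_funN.
Qed.

Lemma integral_gpw a : (\int[mu]_x (gpw a x)%:E =
  \int[mu]_(x in `]0%R, +oo[) (x `^ (a - 1) * expR (- x))%:E)%E.
Proof.
rewrite [RHS]integral_mkcond; apply: eq_integral => x _.
rewrite patchE mem_setE in_itv/= andbT /gpw /pw.
by case: ifP => // _; rewrite mul0r.
Qed.

(** On (0,1] the exponential is at most 1. Beyond 1, [a <= 2] gives x^(a-1) <= x <= 2 exp(x/2), so 2
    exp(-x/2) is a majorant. *)
Lemma integral_gpw_lty a : 0 < a <= 2 -> (\int[mu]_x (gpw a x)%:E < +oo)%E.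
Proof.
move=> /andP[a0 a2].
pose h1 (x : R) : R := if 0 < x <= 1 then x `^ (a - 1) else 0.
pose h2 (x : R) : R := if 0 < x then 2 * expR (- (2^-1 * x)) else 0.
have mh1 : measurable_fun setT h1.
  apply: measurable_fun_ifT => //; first [exact: measurable_powR | idtac].
  by apply: measurable_and; [exact: measurable_fun_ltr|exact: measurable_fun_ler].
have mh2 : measurable_fun setT h2.
  apply: measurable_fun_ifT => //; first [exact: measurable_fun_ltr | idtac].
  apply: measurable_funM => //; apply: measurableT_comp => //; apply: measurable_funN.
  exact: measurable_funM.
have h10 x : 0 <= h1 x by rewrite /h1; case: ifP => // _; exact: powR_ge0.
have h20 x : 0 <= h2 x by rewrite /h2; case: ifP => // _; rewrite mulr_ge0 ?expR_ge0.
apply: (@le_lt_trans _ _ (\int[mu]_x ((h1 x)%:E + (h2 x)%:E))%E).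
  apply: ge0_le_integral => //.
  - by move=> x _; rewrite lee_fin gpw_ge0.
  - by apply/measurable_EFinP; exact: measurable_gpw.
  - by apply/measurable_EFinP; exact: measurable_funD.
  move=> x _; rewrite -EFinD lee_fin /gpw /pw /h1 /h2.
  case: ifPn => x0 /=; last by rewrite mul0r addr0.
  have [x1|x1] := leP x 1.
    apply: (@le_trans _ _ (x `^ (a - 1))); last by rewrite lerDl mulr_ge0 ?expR_ge0.
    by rewrite ler_piMr ?powR_ge0// -expR0 ler_expR oppr_le0 ltW.
  rewrite add0r.
  have h : x `^ (a - 1) <= x.
    have a1 : a - 1 <= 1 by lra.
    by have := ler_powR (ltW x1) a1; rewrite (powRr1 (ltW x0)); apply.
  have -> : expR (- x) = expR (- (2^-1 * x)) * expR (- (2^-1 * x)).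
    by rewrite -expRD; congr expR; field.
  rewrite mulrA ler_pM2r ?expR_gt0//.
  apply: (@le_trans _ _ (x * expR (- (2^-1 * x)))).
    by rewrite ler_wpM2r// expR_ge0.
  rewrite expRN ler_pdivrMr ?expR_gt0//.
  have := expR_ge1Dx (2^-1 * x); lra.
rewrite ge0_integralD//; try by [apply/measurable_EFinP|move=> x _; rewrite lee_fin].
apply: lte_add_pinfty.
  have -> : (\int[mu]_x (h1 x)%:E = \int[mu]_(x in `]0%R, 1%R]) (x `^ (a - 1))%:E)%E.
    rewrite [RHS]integral_mkcond; apply: eq_integral => x _; rewrite patchE /h1.
    by rewrite mem_setE in_itv/=; case: ifP.
  by rewrite int_powR// ltry.
have -> : (\int[mu]_x (h2 x)%:E = \int[mu]_(x in `]0%R, +oo[) (2 * expR (- (2^-1 * x)))%:E)%E.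
  rewrite [RHS]integral_mkcond; apply: eq_integral => x _; rewrite patchE /h2.
  by rewrite mem_setE in_itv/= andbT; case: ifP.
apply: (@le_lt_trans _ _ 4%:E); last exact: ltry.
have me : measurable_fun setT (fun x : R => expR (- (2^-1 * x))).
  by apply: measurableT_comp => //; apply: measurable_funN; exact: measurable_funM.
apply: le_integral_bound.
- by apply: measurable_funTS; exact: measurable_funM.
- by move=> x _; rewrite mulr_ge0 ?expR_ge0.
move=> b b0; under eq_integral do rewrite EFinM.
rewrite ge0_integralZl//;
  try by [apply/measurable_EFinP; exact: measurable_funTS|move=> x _; rewrite lee_fin expR_ge0].
rewrite (_ : 4%:E = 2%:E * 2%:E)%E; last by rewrite -EFinM; congr EFin; ring.
rewrite lee_pmul2l//.
by have := int_expR_le (_ : 0 < 2^-1) b0; rewrite invrK; apply.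
Qed.

Lemma GammaE a : 0 < a <= 2 -> (\int[mu]_x (gpw a x)%:E = (Gamma a)%:E)%E.
Proof.
move=> ha; have := integral_gpw_lty ha; rewrite integral_gpw => h.
rewrite /Gamma /Rintegral fineK// ge0_fin_numE//.
apply: integral_ge0 => x _; rewrite lee_fin mulr_ge0 ?powR_ge0 ?expR_ge0//.
Qed.

Lemma Gamma_gt0 a : 0 < a <= 2 -> 0 < Gamma a.
Proof.
move=> ha; have /andP[a0 _] := ha; rewrite -lte_fin -GammaE//.
apply: (@lt_le_trans _ _ (\int[mu]_(x in `]0%R, 1%R]) (expR (-1) * x `^ (a - 1))%:E)%E).
  under eq_integral do rewrite EFinM.
  rewrite ge0_integralZl//; try by
    [apply/measurable_EFinP; apply: measurable_funTS; exact: measurable_powR|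
     move=> x _; rewrite lee_fin powR_ge0|rewrite lee_fin expR_ge0].
  by rewrite int_powR// -EFinM lte_fin mulr_gt0 ?expR_gt0// divr_gt0 ?powR_gt0.
rewrite integral_mkcond; apply: ge0_le_integral => //.
- by move=> x _; rewrite patchE; case: ifP => // _; rewrite lee_fin mulr_ge0 ?expR_ge0 ?powR_ge0.
- apply: (measurable_restrictT _ _).1 => //; apply/measurable_EFinP; apply: measurable_funTS.
  by apply: measurable_funM => //; exact: measurable_powR.
- by apply/measurable_EFinP; exact: measurable_gpw.
move=> x _; rewrite patchE; case: ifPn; last by rewrite lee_fin gpw_ge0.
rewrite inE/= in_itv/= => /andP[x0 x1]; rewrite lee_fin /gpw /pw x0 mulrC.
by rewrite ler_wpM2l ?powR_ge0// ler_expR lerN2.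
Qed.

Lemma laplace a t : 0 < a <= 2 -> 0 < t ->
  (\int[mu]_s (pw a s * expR (- (t * s)))%:E = (Gamma a * t `^ (- a))%:E)%E.
Proof.
move=> ha t0; rewrite mulrC EFinM -GammaE//.
rewrite -(@ge0_integral_affine R t 0 (fun s => (gpw a s)%:E) t0); last 2 first.
- by apply/measurable_EFinP; exact: measurable_gpw.
- by move=> x; rewrite lee_fin gpw_ge0.
have mg : measurable_fun setT (fun s : R => gpw a (t * s + 0)).
  apply: (measurableT_comp (measurable_gpw a)).
  by apply: measurable_funD => //; exact: measurable_funM.
rewrite muleA -EFinM -ge0_integralZl//; try by
  [apply/measurable_EFinP; exact: mg|move=> s _; rewrite lee_fin gpw_ge0|
   rewrite lee_fin mulr_ge0 ?powR_ge0// ltW].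
apply: eq_integral => s _; rewrite -EFinM addr0 /gpw pwM//; congr EFin.
have -> : t `^ (- a) * t * (t `^ (a - 1) * pw a s * expR (- (t * s))) =
    t `^ (- a) * t `^ 1 * t `^ (a - 1) * (pw a s * expR (- (t * s))).
  by rewrite powRr1 ?(ltW t0)//; ring.
rewrite -!powRD ?(gt_eqF t0) ?implybT//.
by rewrite (_ : - a + 1 + (a - 1) = 0) ?powRr0 ?mul1r//; ring.
Qed.

Local Opaque Gamma.

(** Scaling gives S(z) = z^(a+b-1) S(1), and S(1) is found by integrating the convolution of the two
    Gamma integrands: it equals Gamma(a) Gamma(b) by Tonelli, and Gamma(a+b) S(1) since the
    exponentials multiply to exp(-z). The range [a + b <= 2] is that of [GammaE]. *)
Lemma beta_integral a b x : 0 < a -> 0 < b -> a + b <= 2 -> 0 < x ->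
  (\int[mu]_y (pw a (x - y) * pw b y)%:E =
   (Gamma a * Gamma b / Gamma (a + b) * x `^ (a + b - 1))%:E)%E.
Proof.
move=> a0 b0 ab2 x0.
have ha : 0 < a <= 2 by lra.
have hb : 0 < b <= 2 by lra.
have hab : 0 < a + b <= 2 by lra.
pose S (z : R) : \bar R := (\int[mu]_y (pw a (z - y) * pw b y)%:E)%E.
have mS (z : R) : measurable_fun setT (fun y : R => pw a (z - y) * pw b y).
  apply: measurable_funM; last exact: measurable_pw.
  by apply: (measurableT_comp (measurable_pw a)) => //; exact: measurable_funB.
have S1 (z : R) : 0 < z -> S z = ((z `^ (a + b - 1))%:E * S (1%R : R))%E.
  move=> z0; rewrite /S -(@ge0_integral_affine R z 0 (fun y => (pw a (z - y) * pw b y)%:E) z0); last 2 first.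
  - by apply/measurable_EFinP; exact: mS.
  - by move=> y; rewrite lee_fin mulr_ge0 ?pw_ge0.
  have -> : (z `^ (a + b - 1) = z * (z `^ (a - 1) * z `^ (b - 1)))%R.
    rewrite (_ : a + b - 1 = 1 + (a - 1 + (b - 1))); last by ring.
    by rewrite !powRD ?(gt_eqF z0) ?implybT// powRr1// ltW.
  rewrite EFinM -muleA; congr (_ * _)%E.
  rewrite -ge0_integralZl//; try by
    [apply/measurable_EFinP; exact: mS|move=> y _; rewrite lee_fin mulr_ge0 ?pw_ge0|
     rewrite lee_fin mulr_ge0 ?powR_ge0].
  apply: eq_integral => y _; rewrite -EFinM; congr EFin.
  rewrite addr0 (_ : z - z * y = z * (1 - y)); last by ring.
  by rewrite !pwM//; ring.
have E : ((Gamma a * Gamma b)%:E = (Gamma (a + b))%:E * S (1%R : R))%E.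
  rewrite EFinM -(GammaE ha) -(GammaE hb) -(GammaE hab).
  rewrite -(@ge0_integral_conv _ (fun z => (gpw a z)%:E) (fun z => (gpw b z)%:E)); last 4 first.
  - by apply/measurable_EFinP; exact: measurable_gpw.
  - by apply/measurable_EFinP; exact: measurable_gpw.
  - by move=> z; rewrite lee_fin gpw_ge0.
  - by move=> z; rewrite lee_fin gpw_ge0.
  rewrite -ge0_integralZr//; try by
    [apply/measurable_EFinP; exact: measurable_gpw|move=> z _; rewrite lee_fin gpw_ge0|
     apply: integral_ge0 => y _; rewrite lee_fin mulr_ge0 ?pw_ge0].
  apply: eq_integral => z _.
  transitivity ((expR (- z))%:E * S z)%E.
    rewrite /S -ge0_integralZl//; try by
      [apply/measurable_EFinP; exact: mS|move=> y _; rewrite lee_fin mulr_ge0 ?pw_ge0|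
       rewrite lee_fin expR_ge0].
    apply: eq_integral => y _; rewrite -!EFinM /gpw; congr EFin.
    rewrite (_ : - z = - (z - y) + - y); last by ring.
    by rewrite expRD; ring.
  have [z0|z0] := ltP 0 z.
    by rewrite S1// muleA /gpw /pw z0 -EFinM mulrC.
  rewrite /gpw {1}/pw ltNge z0 mul0r mul0e /S (eq_integral (cst 0%E)) ?integral0 ?mule0//.
  move=> y _; rewrite /pw; case: ifPn => //; rewrite ?mul0r// subr_gt0 => yz.
  by rewrite (ltNge 0 y) (ltW (lt_le_trans yz z0)) /= mulr0.
have G := Gamma_gt0 hab.
rewrite -/(S x) S1//.
have -> : S (1%R : R) = (Gamma a * Gamma b / Gamma (a + b))%:E.
  have -> : S (1%R : R) = (((Gamma (a + b))^-1)%:E * ((Gamma (a + b))%:E * S (1%R : R)))%E.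
    by rewrite muleA -EFinM mulVf ?mul1e// gt_eqF.
  by rewrite -E -EFinM; congr EFin; rewrite mulrC.
by rewrite -EFinM mulrC.
Qed.

End gamma_function.

(** * Continuity and uniqueness of primitives *)

Section primitives.
Context {R : realType}.
Local Notation mu := (@lebesgue_measure R).
Implicit Types (f w : R -> R) (a b c t T : R).

(** A deviation from [c] at one point would keep a neighbouring subinterval off the value [c], and
    that subinterval has positive measure. *)
Lemma within_ae_cst w a b c : a < b -> {within `[a, b], continuous w} ->
  {ae mu, forall t, a < t < b -> w t = c} -> forall t, a <= t <= b -> w t = c.
Proof.
move=> ab /subspace_continuousP cw wc t tab; apply: contrapT => wtc.
have e0 : 0 < `|w t - c| by rewrite normr_gt0 subr_eq0; exact/eqP.
have : `[a, b]%classic t by rewrite /= in_itv/=.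
move=> /cw /cvgrPdist_lt /(_ _ e0); rewrite near_withinE => /nbhs_ballP[d /= d0 hd].
have /andP[ta tb] := tab.
have hab : Num.max a (t - d) < Num.min b (t + d).
  by rewrite lt_min !gt_max ab/=; apply/andP; split; [lra|apply/andP; split; lra].
have [x] := ae_nonempty_itv hab wc.
rewrite gt_max lt_min => /andP[/andP[ax dx] /andP[xb xd]] /(_ _)-/(_ _)wx.
have {}wx : w x = c by apply: wx; rewrite ax xb.
have : `|w t - w x| < `|w t - c|.
  apply: hd; last by rewrite /= in_itv/= !ltW.
  by rewrite /ball/= ltr_distl; apply/andP; split; lra.
by rewrite wx ltxx.
Qed.

Lemma primitiveE f t : L1 f ->
  \int[mu]_(s in `]0, t[) f s = \int[mu]_(s in `]0, t]) f s /\
  \int[mu]_(s in `]0, t[) f s = \int[mu]_(s in `[0, t]) f s.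
Proof.
move=> Lf.
have h (E : set (measurableTypeR R)) : measurable E -> mu.-integrable E (EFin \o f).
  by move=> mE; apply: integrableS Lf.
have e1 : \int[mu]_(s in `]0, t[) f s = \int[mu]_(s in `]0, t]) f s.
  by rewrite Rintegral_itv_bndo_bndc//; exact: h.
by split => //; rewrite e1 Rintegral_itv_obnd_cbnd//; exact: h.
Qed.

Lemma continuous_primitive f T : L1 f -> 0 <= T ->
  {within `[0, T], continuous (fun t => \int[mu]_(s in `]0, t[) f s)}.
Proof.
move=> Lf T0.
rewrite (_ : (fun t => _) = (fun t => parameterized_integral mu 0 t f)); last first.
  by apply/funext => t; rewrite (primitiveE t Lf).2.
by apply: parameterized_integral_continuous => //; exact: integrableS Lf.
Qed.

(** The primitive is continuous, hence constant at every point of [0,T], and its derivative is [f]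
    almost everywhere by Lebesgue's differentiation theorem. *)
Lemma ae_cst_primitive f T c : 0 < T -> good T f ->
  {ae mu, forall t, 0 < t < T -> \int[mu]_(s in `]0, t[) f s = c} ->
  {ae mu, forall t, f t = 0}.
Proof.
move=> T0 gf h; have Lf := good_L1 gf.
have h' := within_ae_cst T0 (continuous_primitive Lf (ltW T0)) h.
have li : locally_integrable setT f := open_integrable_locally openT Lf.
have := @FTC1 R f (BRight 0) (fun y => ltac:(by apply: integrableS Lf)) li.
apply: aeW => x /= hx.
have [xT|nxT] := pselect (0 < x < T); last first.
  by apply: gf.2 => /=; rewrite in_itv/=.
have [x0 xT'] := andP xT.
have [_ <-] : _ := hx x0.
rewrite derive1E -[RHS](derive_cst c x (1 : R)).
apply: near_eq_derive; near=> y.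
rewrite -(primitiveE y Lf).1; apply: h'.
have : y \in `]0, T[ by near: y; apply: near_in_itvoo; rewrite in_itv/= xT.
by rewrite in_itv/= => /andP[y0 yT]; rewrite !ltW.
Unshelve. all: by end_near. Qed.

End primitives.

Section Ic_injective.
Context {R : realType} (T : R).
Hypothesis T0 : 0 < T.
Local Notation mu := (@lebesgue_measure R).
Local Notation A := (calg T).
Local Notation DT := `]0, T[%classic.

(* The constant function [c] is [c * Ic]. *)
Lemma Ic_cst_inj (x : A) c : cst_part x = 0 -> Ic T * x = cst_alg T c * Ic T -> x = 0.
Proof.
move=> x0; have gx := good_fun x.
have Lx := L1T_fun_part x.
rewrite -{1}(emb_fun_part x0) Ic_emb// /Ic embZ; last exact: L1T_cst.
move/emb_eq => h.
have : {ae mu, forall t, DT t -> \int[mu]_(s in `]0, t[) fun_part x s = c * 1}.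
  by apply: h; [exact: L1T_primitive|apply: L1TZ; exact: L1T_cst].
move=> {}h; rewrite -(emb_fun_part x0).
have : {ae mu, forall t, fun_part x t = 0}.
  apply: (@ae_cst_primitive _ _ T (c * 1)) => //.
by move=> f0; rewrite emb_fun_part//; exact: Lsq_fun0.
Qed.

Lemma Ic_inj (x y : A) : cst_part x = cst_part y -> Ic T * x = Ic T * y -> x = y.
Proof.
move=> xy h; apply/eqP; rewrite -subr_eq0; apply/eqP.
apply: (@Ic_cst_inj _ 0); last by rewrite mulrBr h subrr rmorph0 mul0r.
have -> : cst_part (x - y) = cst_part x - cst_part y by [].
by rewrite xy subrr.
Qed.

End Ic_injective.

(** * Riemann-Liouville kernels *)

Section fractional_kernels.
Context {R : realType} (T : R).
Hypothesis T0 : 0 < T.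
Local Notation mu := (@lebesgue_measure R).
Local Notation A := (calg T).
Local Notation DT := `]0, T[%classic.
Implicit Types (a b : R).
Local Opaque Gamma.

(** The Riemann-Liouville kernel: causal convolution with it is the fractional integral of order
    [a]. *)
Definition rl a (t : R) : R := (Gamma a)^-1 * pw a t.

Lemma integrable_pw a b : 0 < a -> 0 < b -> mu.-integrable `]0, b] (EFin \o pw a).
Proof.
move=> a0 b0; apply/integrableP; split.
  by apply/measurable_EFinP; apply: measurable_funTS; exact: measurable_pw.
rewrite (_ : integral _ _ _ = (b `^ a / a)%:E) ?ltry// -int_powR//.
apply: eq_integral => x; rewrite inE/= in_itv/= => /andP[x0 _].
by rewrite ger0_norm ?pw_ge0// /pw x0.
Qed.

Lemma L1T_rl a : 0 < a -> L1T T (rl a).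
Proof.
move=> a0; apply: L1TZ; apply: integrableS (integrable_pw a0 T0) => //.
by move=> x /=; rewrite !in_itv/= => /andP[-> /ltW].
Qed.

Definition fr a : A := emb T (rl a).

Lemma Gamma1 : Gamma (1 : R) = 1.
Proof.
apply: EFin_inj; rewrite -GammaE ?ltr01 ?ler1n//.
rewrite -[RHS](@integral_exponential_pdf R 1 ltr01) integral_gpw.
rewrite integral_itv_obnd_cbnd; last first.
  apply/measurable_EFinP; apply: measurable_funTS; apply: measurable_funM.
    exact: measurable_powR.
  by apply: measurableT_comp => //; exact: measurable_funN.
rewrite integral_mkcond; apply: eq_integral => x _; rewrite patchE /exponential_pdf patchE.
case: ifP => // _; rewrite subrr powRr0; congr EFin.
by rewrite !mul1r mulN1r.
Qed.

Lemma fr1 : fr 1 = Ic T.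
Proof.
apply/emb_eq; [exact: L1T_rl|exact: L1T_cst|apply: ae_all => t].
rewrite /= in_itv/= => /andP[t0 _]; rewrite /rl /pw t0 subrr powRr0 Gamma1.
by rewrite invr1 mulr1.
Qed.

(** The semigroup law of fractional integration is the beta integral, read as a convolution of
    kernels. *)
Lemma frM a b : 0 < a -> 0 < b -> a + b <= 2 -> fr a * fr b = fr (a + b).
Proof.
move=> a0 b0 ab; have ha := L1T_rl a0; have hb := L1T_rl b0.
have hab : 0 < a + b by rewrite addr_gt0.
rewrite /fr embM//; apply/emb_eq; [exact: L1T_conv|exact: L1T_rl|apply: ae_all => t].
move=> Dt; rewrite conv_trE//; have /andP[t0 _] : 0 < t < T by move: Dt; rewrite /= in_itv.
rewrite Rintegral_mkcond.
transitivity (\int[mu]_s ((Gamma a)^-1 * (Gamma b)^-1 * (pw a (t - s) * pw b s))).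
  apply: eq_Rintegral => s _; rewrite patchE mem_setE in_itv/= /rl.
  case: ifP => h; first by rewrite mulrACA.
  rewrite /pw subr_gt0; case: ifP => h1; last by rewrite !(mul0r, mulr0).
  by case: ifP => h2; rewrite ?(mul0r, mulr0)//; move: h; rewrite h1 h2.
rewrite RintegralZ//; last first.
  apply: measurable_funM; last exact: measurable_pw.
  by apply: (measurableT_comp (measurable_pw a)) => //; exact: measurable_funB.
rewrite [Rintegral _ _ _]/Rintegral beta_integral//= /rl /pw t0.
have ga : Gamma a != 0 by rewrite gt_eqF// Gamma_gt0; lra.
have gb : Gamma b != 0 by rewrite gt_eqF// Gamma_gt0; lra.
move: (Gamma a) (Gamma b) (Gamma (a + b)) (_ `^ _) ga gb => x y g p x0 y0.
rewrite !mulrA; congr (_ * _); by rewrite [x^-1 / _]mulrC mulfVK// mulVf// mul1r.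
Qed.

(** The square of t^(a-1) is at least 1/t near 0 when [a <= 2^-1]. This is what annihilates the free
    constants left by distributional derivatives. *)
Lemma fr_nLsq a c (x : A) : 0 < a -> a <= 2^-1 -> Lsq x ->
  x = cst_alg T c * fr a -> c = 0.
Proof.
move=> a0 a2 hx xE; apply/eqP; apply: contraT => c0.
have : Lsq (fr a).
  have -> : fr a = cst_alg T c^-1 * x.
    by rewrite xE mulrA -rmorphM mulVf// rmorph1 mul1r.
  exact: LsqZ.
move/(sqi_of_Lsq (L1T_rl a0)) => [_ h].
have ga : 0 < Gamma a by rewrite Gamma_gt0//; lra.
pose k := (Gamma a)^-1 ^+ 2.
have k0 : 0 < k by rewrite exprn_gt0// invr_gt0.
pose M := fine (\int[mu]_(t in DT) (rl a t ^+ 2)%:E)%E.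
have hM : (\int[mu]_(t in DT) (rl a t ^+ 2)%:E)%E = M%:E.
  by rewrite fineK// ge0_fin_numE//; apply: integral_ge0 => t _; rewrite lee_fin sqr_ge0.
pose q := 2 * a - 2.
have q1 : q <= -1 by rewrite /q; lra.
pose b := Num.min (T / 2) (2^-1 : R).
have b0 : 0 < b by rewrite lt_min divr_gt0//= invr_gt0 ltr0n.
have bT : b < T by rewrite gt_min ltr_pdivrMr// ltr_pMr// ltr1n.
have b1 : b < 1 by rewrite gt_min invf_lt1 ?ltr1n ?orbT.
(* 1/t is not integrable at 0: compare with t `^ (e - 1) for small e *)
have key e : 0 < e -> k * (b `^ e / e) <= M.
  move=> e0; rewrite -lee_fin -hM EFinM -int_powR// -ge0_integralZl//; try by
    [apply/measurable_EFinP; apply: measurable_funTS; exact: measurable_powR|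
     move=> x0 _; rewrite lee_fin powR_ge0|rewrite lee_fin ltW].
  apply: (@le_trans _ _ (\int[mu]_(t in `]0%R, b]) (rl a t ^+ 2)%:E)%E).
    apply: ge0_le_integral => //.
    - by move=> t _; rewrite lee_fin mulr_ge0 ?powR_ge0// ltW.
    - by apply/measurable_EFinP; apply: measurable_funTS; apply: measurable_funM => //; exact: measurable_powR.
    - apply/measurable_EFinP; apply: measurable_funTS; apply: measurable_funX.
      by apply: measurable_funM => //; exact: measurable_pw.
    move=> t; rewrite /= in_itv/= => /andP[t0 tb].
    rewrite lee_fin /rl /pw t0 exprMn ler_pM2l// -powR_mulrn ?powR_ge0// -powRrM.
    by apply: ger_powR; [rewrite t0/= (le_trans tb)// ltW|lra].
  apply: ge0_subset_integral => //.
  - apply/measurable_EFinP; apply: measurable_funTS; apply: measurable_funX.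
    by apply: measurable_funM => //; exact: measurable_pw.
  - by move=> t _; rewrite lee_fin sqr_ge0.
  - by move=> t /=; rewrite !in_itv/= => /andP[-> /le_lt_trans->].
have M0 : 0 <= M.
  by rewrite -lee_fin -hM; apply: integral_ge0 => t _; rewrite lee_fin sqr_ge0.
have kb : 0 < k * b by rewrite mulr_gt0.
(* This makes k b / e at least M + 1, and b <= b^e because b < 1 and e <= 1; so [key] is
   violated. *)
pose e := Num.min 1 (k * b / (M + 1)).
have e0 : 0 < e by rewrite lt_min ltr01 divr_gt0//; lra.
suff : M < k * (b `^ e / e) by rewrite ltNge key.
have e1 : e <= 1 by rewrite ge_min lexx.
apply: (@lt_le_trans _ _ (k * (b / e))).
  rewrite mulrA ltr_pdivlMr//; apply: (@le_lt_trans _ _ (M * (k * b / (M + 1)))).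
    by rewrite ler_wpM2l// ge_min lexx orbT.
  by rewrite mulrCA -ltr_pdivlMl// mulVf ?gt_eqF// ltr_pdivrMr ?mul1r; lra.
rewrite ler_pM2l// ler_pM2r ?invr_gt0//.
rewrite -{1}[b]powRr1 ?(ltW b0)//; apply: ger_powR => //.
by rewrite b0 ltW.
Qed.

End fractional_kernels.

(** * Resolvents of the time derivative *)

Section time_resolvent.
Context {R : realType} (T : R).
Hypothesis T0 : 0 < T.
Local Notation mu := (@lebesgue_measure R).
Local Notation A := (calg T).
Local Notation DT := `]0, T[%classic.
Local Notation cst := (cst_alg T).
Local Notation Ic := (Ic T).
Implicit Types (s t : R).
Local Opaque Gamma.

(** The kernel of (1 + s d/dt)^-1 with zero initial value. *)
Definition jk s t : R := s^-1 * expR (- (s^-1 * t)).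

Lemma measurable_jk s : measurable_fun setT (jk s).
Proof.
apply: measurable_funM => //; apply: measurableT_comp => //; apply: measurable_funN.
exact: measurable_funM.
Qed.

Lemma jk_ge0 s t : 0 < s -> 0 <= jk s t.
Proof. by move=> s0; rewrite mulr_ge0 ?expR_ge0// invr_ge0 ltW. Qed.

Lemma sqi_jk s : 0 < s -> square_integrable mu DT (jk s).
Proof.
move=> s0; apply: (@sqi_bounded _ _ _ s^-1).
  by apply: measurable_funTS; exact: measurable_jk.
move=> t /=; rewrite in_itv/= => /andP[t0 _]; rewrite ger0_norm ?jk_ge0//.
by rewrite /jk ler_piMr ?invr_ge0 ?ltW// -expR0 ltr_expR oppr_lt0 mulr_gt0// invr_gt0//.
Qed.

Definition J s : A := emb T (jk s).

Lemma L1T_jk s : 0 < s -> L1T T (jk s).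
Proof. by move=> s0; have [] := Lsq_emb (sqi_jk s0). Qed.

Lemma primitive_jk s t : 0 < s -> 0 < t ->
  \int[mu]_(r in `]0, t[) jk s r = 1 - expR (- (s^-1 * t)).
Proof.
move=> s0 t0; rewrite /Rintegral integral_itv_bndo_bndc; last first.
  by apply/measurable_EFinP; apply: measurable_funTS; exact: measurable_jk.
under eq_integral do rewrite EFinM.
have si : 0 < s^-1 by rewrite invr_gt0.
rewrite ge0_integralZl//; try by
  [apply/measurable_EFinP; apply: measurable_funTS; apply: measurableT_comp => //;
   apply: measurable_funN; exact: measurable_funM|move=> x _; rewrite lee_fin expR_ge0|
   rewrite lee_fin ltW].
by rewrite int_expR//= mulrA mulfV ?mul1r// gt_eqF.
Qed.

(** The resolvent equation in integrated form, free of derivatives: s times the kernel at t is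
    exp(-t/s), which is 1 minus the integral of the kernel over (0,t). *)
Lemma J_Ic s : 0 < s -> cst s * J s = Ic * (1 - J s).
Proof.
move=> s0; have h := L1T_jk s0.
rewrite mulrBr mulr1 /J Ic_emb// embZ// [Ic]/(emb T _) embN; last exact: L1T_primitive.
rewrite embD; [|exact: L1T_cst|]; last first.
  have := L1TZ (-1) (L1T_primitive h); apply: eq_integrable => // t _.
  by rewrite /= mulN1r.
apply/emb_eq; first exact: L1TZ.
  apply: L1TD; first exact: L1T_cst.
  have := L1TZ (-1) (L1T_primitive h); apply: eq_integrable => // t _.
  by rewrite /= mulN1r.
apply: ae_all => t; rewrite /= in_itv/= => /andP[t0 _]; rewrite primitive_jk//.
by rewrite /jk mulrA mulfV ?gt_eqF// mul1r opprB addrC subrK.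
Qed.

Lemma cstK s : 0 < s -> cst s * cst s^-1 = 1.
Proof. by move=> s0; rewrite -rmorphM mulfV ?rmorph1// gt_eqF. Qed.

Lemma J_IcV s : 0 < s -> J s = cst s^-1 * Ic * (1 - J s).
Proof. by move=> s0; rewrite -mulrA -J_Ic// mulrA [cst _ * cst s]mulrC cstK// mul1r. Qed.

(** Split the second argument into J x and y = (1 - J) x. The first part contributes a square. As J
    x = s^-1 Ic y, the second contributes a multiple of the pairing of Ic y with y, which is
    nonnegative by [ip_Ic]. *)
Lemma ip_J s (x : A) : 0 < s -> Lsq x -> 0 <= ip (J s * x) x.
Proof.
move=> s0 hx; have h1 := @LsqM _ T (J s) _ hx; have h2 := @LsqM _ T (1 - J s) _ hx.
have {2}-> : x = J s * x + (1 - J s) * x by rewrite -mulrDl addrC subrK mul1r.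
rewrite (ipDr h1 h2 h1); apply: addr_ge0; first exact: ip_ge0.
rewrite {1}J_IcV// -!mulrA ipZl; apply: mulr_ge0; first by rewrite invr_ge0 ltW.
exact: ip_Ic.
Qed.

Lemma N_mul_norm1 (x y : A) : cst_part x = 0 -> Lsq y -> N (x * y) <= norm1 (fun_part x) * N y.
Proof.
move=> x0 hy; have [_] := young_alg (L1T_fun_part x) hy.
rewrite emb_fun_part// tr_id//; exact: (good_fun x).2.
Qed.

Lemma norm1_tr f : L1T T f -> (norm1 (tr T f))%:E = (\int[mu]_(t in DT) `|f t|%:E)%E.
Proof.
move=> hf; rewrite -norm1E ?L1_tr// [RHS]integral_mkcond; apply: eq_integral => t _.
by rewrite /tr !patchE; case: ifP => //; rewrite normr0.
Qed.

Lemma norm1_J s : 0 < s -> norm1 (tr T (jk s)) <= 1.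
Proof.
move=> s0; have h := L1T_jk s0; rewrite -lee_fin norm1_tr//.
have -> : (\int[mu]_(t in DT) `|jk s t|%:E = \int[mu]_(t in DT) (jk s t)%:E)%E.
  by apply: eq_integral => t _; rewrite ger0_norm ?jk_ge0.
have := primitive_jk s0 T0; rewrite /Rintegral => E.
rewrite -[X in (X <= _)%E]fineK; last exact: integrable_fin_num h.
by rewrite E lee_fin gerBl expR_ge0.
Qed.

(* The kernel [k] of [(1 - J s) * fr r] satisfies [k <= rl r * e] with
   [e t = exp (- t / s)], because [rl r] decreases, and its integral over ]0, T[
   is nonnegative. *)
Lemma norm1_1J_fr s r : 0 < s -> 0 < r <= 1 ->
  norm1 (fun_part ((1 - J s) * fr T r)) <= 2 * s `^ r.
Proof.
move=> s0 /andP[r0 r1]; have hJ := L1T_jk s0; have ha := L1T_rl T0 r0.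
have gr : 0 < Gamma r by rewrite Gamma_gt0//; lra.
pose B := conv (tr T (jk s)) (tr T (rl r)).
have hB : L1T T B := L1T_conv hJ ha.
have rl0 t : 0 <= rl r t by rewrite mulr_ge0 ?pw_ge0// invr_ge0 ltW.
have E : (1 - J s) * fr T r = emb T (fun t => rl r t + -1 * B t).
  rewrite mulrBl mul1r /J /fr embM// -embD//; last exact: L1TZ.
  by congr (_ + _); rewrite -embZ// rmorphN rmorph1 mulN1r.
have mB t : DT t -> rl r t * (1 - expR (- (s^-1 * t))) <= B t.
  move=> Dt; have /andP[t0 tT] : 0 < t < T by move: Dt; rewrite /= in_itv.
  have iB : mu.-integrable `]0, t[ (EFin \o (fun y => jk s (t - y) * rl r y)).
    pose M := s^-1.
    have iM : mu.-integrable `]0, t[ (EFin \o (fun y => M * rl r y)).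
      apply: (@integrableS _ _ _ mu DT) => //; last exact: (L1TZ M ha).
      by move=> y /=; rewrite !in_itv/= => /andP[-> /lt_trans->].
    apply: (le_integrable _ _ _ iM) => //.
      apply/measurable_EFinP; apply: measurable_funTS; apply: measurable_funM.
        apply: (measurableT_comp (measurable_jk s)) => //; exact: measurable_funB.
      by apply: measurable_funM => //; exact: measurable_pw.
    move=> y /=; rewrite in_itv/= => /andP[y0 yt]; rewrite lee_fin !normrM.
    rewrite ler_wpM2r// /M !ger0_norm ?jk_ge0 ?invr_ge0 ?(ltW s0)//.
    by rewrite /jk ler_piMr ?invr_ge0 ?(ltW s0)// -expR0 ler_expR oppr_le0 mulr_ge0 ?invr_ge0 ?(ltW s0)// subr_ge0 ltW.
  have -> : 1 - expR (- (s^-1 * t)) = \int[mu]_(y in `]0, t[) jk s (t - y).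
    rewrite -(primitive_jk s0 t0) Rintegral_mkcond [RHS]Rintegral_mkcond.
    rewrite -[LHS](Rintegral_reflect t); last first.
      by apply: (measurable_restrictT _ _).1 => //; apply: measurable_funTS; exact: measurable_jk.
    apply: eq_Rintegral => y _; rewrite !patchE !mem_setE !in_itv/= subr_gt0.
    by rewrite ltrBlDr ltrDl andbC.
  have mj : measurable_fun `]0, t[ (fun y => jk s (t - y)).
    apply: measurable_funTS; apply: (measurableT_comp (measurable_jk s)) => //.
    exact: measurable_funB.
  rewrite -RintegralZ// /B conv_trE//; apply: le_Rintegral => //.
    have : mu.-integrable `]0, t[ (EFin \o (fun=> rl r t * s^-1)).
      by apply: (@integrableS _ _ _ mu DT) => //; [move=> y /=; rewrite !in_itv/= => /andP[-> /lt_trans->]|exact: (L1T_cst T)].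
    apply: le_integrable => //; first by apply/measurable_EFinP; exact: measurable_funM.
    move=> y /=; rewrite in_itv/= => /andP[y0 yt]; rewrite lee_fin !normrM.
    rewrite ler_wpM2l// !ger0_norm ?jk_ge0 ?invr_ge0 ?(ltW s0)//.
    by rewrite /jk ler_piMr ?invr_ge0 ?(ltW s0)// -expR0 ler_expR oppr_le0 mulr_ge0 ?invr_ge0 ?(ltW s0)// subr_ge0 ltW.
  move=> y /=; rewrite in_itv/= => /andP[y0 yt]; rewrite mulrC ler_wpM2l ?jk_ge0//.
  rewrite /rl ler_wpM2l ?invr_ge0 ?(ltW gr)// /pw t0 y0.
  rewrite -[r - 1]opprB !powRN lef_pV2 ?posrE ?powR_gt0//.
  by apply: ge0_ler_powR; rewrite ?nnegrE ?(ltW t0) ?(ltW y0) ?(ltW yt) ?subr_ge0.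
pose e t := expR (- (s^-1 * t)).
have me : measurable_fun setT e.
  apply: measurableT_comp => //; apply: measurable_funN; exact: measurable_funM.
have hle : L1T T (fun t => rl r t * e t).
  apply: (le_integrable _ _ _ ha) => //.
    apply/measurable_EFinP; apply: measurable_funM; last exact: measurable_funTS.
    by apply: measurable_funTS; apply: measurable_funM => //; exact: measurable_pw.
  move=> t /=; rewrite in_itv/= => /andP[t0 _]; rewrite lee_fin normrM.
  by rewrite ler_piMr// /e ger0_norm ?expR_ge0// -expR0 ler_expR oppr_le0 mulr_ge0 ?invr_ge0 ?ltW.
have hk : L1T T (fun t => rl r t + -1 * B t) by apply: L1TD => //; exact: L1TZ.
have -> : norm1 (fun_part ((1 - J s) * fr T r)) = \int[mu]_(t in DT) `|rl r t + -1 * B t|.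
  apply: EFin_inj; rewrite E; have gx := good_fun (emb T (fun t => rl r t + -1 * B t)).
  have := norm1_tr (L1T_fun_part (emb T (fun t => rl r t + -1 * B t))).
  rewrite tr_id; last by case: gx.
  move=> ->; rewrite /Rintegral fineK; last first.
    exact: (integrable_fin_num _ (integrable_abse hk)).
  apply: ae_eq_integral => //.
  - apply/measurable_EFinP; apply: measurableT_comp => //; apply: measurable_funTS.
    exact: good_meas gx.
  - apply/measurable_EFinP; apply: measurableT_comp => //.
    by apply/measurable_EFinP; exact: measurable_int hk.
  - by have := embE hk; apply: aeW => t ht /ht ->.
have i1 : \int[mu]_(t in DT) (rl r t * e t) <= s `^ r.
  rewrite /Rintegral.
  have -> : s `^ r = fine ((Gamma r)^-1%:E * (Gamma r * (s^-1) `^ (- r))%:E)%E.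
    rewrite -EFinM/= mulrA mulVf ?gt_eqF// mul1r -powR_inv1 ?ltW// -powRrM.
    by rewrite mulrNN mul1r.
  apply: fine_le; [exact: integrable_fin_num hle|by rewrite -EFinM|].
  have h2 : 0 < r <= 2 by lra.
  have hs : 0 < s^-1 by rewrite invr_gt0.
  have mp : measurable_fun setT (fun t => pw r t * e t).
    by apply: measurable_funM => //; exact: measurable_pw.
  rewrite -(laplace h2 hs) -ge0_integralZl//; try by
    [apply/measurable_EFinP; exact: mp|move=> t _; rewrite lee_fin mulr_ge0 ?pw_ge0 ?expR_ge0|
     rewrite lee_fin invr_ge0 ltW].
  under eq_integral do rewrite /rl -mulrA EFinM.
  apply: ge0_subset_integral => //.
  - by apply: measurable_funeM; apply/measurable_EFinP; exact: mp.
  - move=> t _; rewrite -EFinM lee_fin mulr_ge0 ?invr_ge0 ?(ltW gr)//.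
    by rewrite mulr_ge0 ?pw_ge0 ?expR_ge0.
have i2 : \int[mu]_(t in DT) B t <= \int[mu]_(t in DT) rl r t.
  apply: (@le_trans _ _ (norm1 (tr T (jk s)) * norm1 (tr T (rl r)))).
    apply: le_trans (norm1_cv (good_tr hJ) (good_tr ha)).
    rewrite Rintegral_mkcond /norm1; apply: le_Rintegral => //.
    - exact: (L1_tr hB).
    - exact: integrable_norm (good_L1 (good_cv (good_tr hJ) (good_tr ha))).
    - by move=> t _; exact: ler_norm.
  apply: (@le_trans _ _ (norm1 (tr T (rl r)))).
    by rewrite ler_piMl ?norm1_ge0 ?norm1_J.
  rewrite -lee_fin norm1_tr// /Rintegral fineK; last exact: integrable_fin_num ha.
  by rewrite le_eqVlt; apply/orP; left; apply/eqP; apply: eq_integral => t _; rewrite ger0_norm.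
(* The integrand on the right is 2 (rl r) e - k. It dominates |k|: for k >= 0 this says k <= (rl r)
   e, and for k < 0 it is clear. *)
apply: (@le_trans _ _ (\int[mu]_(t in DT) (2 * (rl r t * e t) + (B t + -1 * rl r t)))).
  apply: le_Rintegral => //.
  - exact: integrable_norm hk.
  - by apply: L1TD; [exact: L1TZ|apply: L1TD => //; exact: L1TZ].
  move=> t Dt; have := mB _ Dt; rewrite -/(e t) => h.
  rewrite ler_norml; apply/andP; split.
    have : 0 <= rl r t * e t by rewrite mulr_ge0// expR_ge0.
    by lra.
  by lra.
have hZ c f : L1T T f -> \int[mu]_(t in DT) (c * f t) = c * \int[mu]_(t in DT) f t.
  by move=> hf; exact: RintegralZl.
have hD f f' : L1T T f -> L1T T f' -> \int[mu]_(t in DT) (f t + f' t) =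
    \int[mu]_(t in DT) f t + \int[mu]_(t in DT) f' t.
  by move=> hf hf'; exact: RintegralD.
have n1 := L1TZ (-1) ha; have n2 := L1TZ 2 hle.
rewrite (hD _ _ n2 (L1TD hB n1)) (hD _ _ hB n1) (hZ 2 _ hle) (hZ (-1) _ ha).
by rewrite -[leRHS]addr0 lerD// ?ler_pM2l// mulN1r subr_le0.
Qed.

Lemma N_1J_fr s r (x : A) : 0 < s -> 0 < r <= 1 -> Lsq x ->
  N ((1 - J s) * fr T r * x) <= 2 * s `^ r * N x.
Proof.
move=> s0 hr hx; apply: le_trans (N_mul_norm1 _ hx) _.
  by rewrite mulE /= mulr0.
by rewrite ler_wpM2r ?N_ge0// norm1_1J_fr.
Qed.

End time_resolvent.

(** * Positive type of the fractional kernels *)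

Section sigma_finite_pack.
Context d (X : measurableType d) {R : realType} (m : {measure set X -> \bar R}).
(** The same measure, indexed by a proof of sigma-finiteness so that the corresponding structure can
    be attached and Fubini applied. *)
Definition sf_measure (h : sigma_finite setT m) : set X -> \bar R := m.
Variable h : sigma_finite setT m.
HB.instance Definition _ := Measure.on (sf_measure h).
HB.instance Definition _ := Measure_isSigmaFinite.Build _ _ _ (sf_measure h) h.
End sigma_finite_pack.

Lemma product_sigma_finite d1 d2 (X1 : measurableType d1) (X2 : measurableType d2) (R : realType)
  (m1 : {sigma_finite_measure set X1 -> \bar R}) (m2 : {sigma_finite_measure set X2 -> \bar R}) :
  sigma_finite setT (m1 \x m2)%E.
Proof.
have [F FT Ff] := sigma_finiteT m1; have [G GT Gf] := sigma_finiteT m2.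
pose p (k : nat) : nat * nat := odflt (0, 0)%N (unpickle k).
exists (fun k => F (p k).1 `*` G (p k).2).
  apply/seteqP; split => // -[x y] _.
  have [i _ Fx] : (\bigcup_i F i) x by rewrite -FT.
  have [j _ Gy] : (\bigcup_i G i) y by rewrite -GT.
  by exists (pickle (i, j)) => //; rewrite /p pickleK.
move=> k; have [mF fF] := Ff (p k).1; have [mG fG] := Gf (p k).2.
split; first exact: measurableX.
rewrite product_measure1E//; apply: lte_mul_pinfty => //.
by rewrite ge0_fin_numE.
Qed.

Section mixture.
Context d (X : measurableType d) {R : realType} (m : {sigma_finite_measure set X -> \bar R}).
Local Notation mu := (@lebesgue_measure R).

(** The condition on the absolute values makes [G] integrable on the product, so Fubini allows
    integrating over [z] first, where each slice contributes a nonnegative amount. *)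
Lemma sf_mixture_ge0 (G : X * measurableTypeR R -> R) (F : X -> R) :
  measurable_fun setT G -> m.-integrable setT (EFin \o F) ->
  (forall z, (\int[mu]_s `|G (z, s)|%:E = `|F z|%:E)%E) ->
  (forall z, \int[mu]_s G (z, s) = F z) -> (forall s, 0 <= \int[m]_z G (z, s)) ->
  0 <= \int[m]_z F z.
Proof.
move=> mG iF aF eF G0.
have iG : (m \x mu)%E.-integrable setT (EFin \o G).
  apply/integrableP; split; first exact/measurable_EFinP.
  rewrite fubini_tonelli1//; last by apply/measurable_EFinP; exact: measurableT_comp.
  rewrite (eq_integral (fun z => `|F z|%:E)%E); last by move=> z _; exact: aF.
  by have /integrableP[] := iF.
have -> : \int[m]_z F z = \int[m]_z \int[mu]_s G (z, s).
  by apply: eq_Rintegral => z _; rewrite eF.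
rewrite (Rfubini iG); exact: Rintegral_ge0.
Qed.

End mixture.

Lemma mixture_ge0 d (X : measurableType d) {R : realType} (m : {measure set X -> \bar R}) (h : sigma_finite setT m) (mu := @lebesgue_measure R)
 (G : X * measurableTypeR R -> R) (F : X -> R) :
  measurable_fun setT G -> m.-integrable setT (EFin \o F) ->
  (forall z, (\int[mu]_s `|G (z, s)|%:E)%E = `|F z|%:E)%E ->
  (forall z, \int[mu]_s G (z, s) = F z) -> (forall s, 0 <= \int[m]_z G (z, s)) ->
  0 <= \int[m]_z F z.
Proof. exact: (@sf_mixture_ge0 _ _ R (sf_measure h)). Qed.

Section fractional_positivity.
Context {R : realType} (T : R).
Hypothesis T0 : 0 < T.
Local Notation mu := (@lebesgue_measure R).
Local Notation A := (calg T).
Local Notation DT := `]0, T[%classic.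
Implicit Types (a s t : R).
Local Opaque Gamma.

Definition ek s t : R := expR (- (s * t)).

Lemma L1T_ek s : 0 < s -> L1T T (ek s).
Proof.
move=> s0; have h : 0 < s^-1 by rewrite invr_gt0.
have := L1TZ s^-1 (@L1T_jk _ T _ h); apply: eq_integrable => // t _; congr EFin.
by rewrite /jk invrK mulrA mulVf ?mul1r// gt_eqF.
Qed.

Lemma ip_ek s (x : A) : 0 < s -> Lsq x -> 0 <= ip (emb T (ek s) * x) x.
Proof.
move=> s0 hx; have h : 0 < s^-1 by rewrite invr_gt0.
have -> : emb T (ek s) = cst_alg T s^-1 * J T s^-1.
  rewrite /J embZ; last exact: L1T_jk.
  apply/emb_eq; [exact: L1T_ek|apply: L1TZ; exact: L1T_jk|apply: ae_all => t _].
  by rewrite /jk invrK mulrA mulVf ?mul1r// gt_eqF.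
rewrite -mulrA ipZl; apply: mulr_ge0; first exact: ltW.
exact: ip_J.
Qed.

Lemma ip_conv f (x : A) : L1T T f -> Lsq x ->
  ip (emb T f * x) x = \int[mu]_t (fun_part x t * conv (tr T f) (fun_part x) t).
Proof.
move=> hf [x0 _]; have gx := good_fun x; have gf := good_tr hf.
apply: ip_ae.
  apply: measurable_funM; first exact: good_meas gx.
  exact: L1_measurable (L1_conv (good_L1 gf) (good_L1 gx)).
have := fun_part_mul (emb T f) x0; have := fun_part_mk 0 gf.
move=> h1; have E : cv T (fun_part (emb T f)) (fun_part x) = cv T (tr T f) (fun_part x).
  by apply: eq_cv => //; [exact: good_fun|exact: ae_all].
apply: aeW => t ->; rewrite E /= mul0r add0r mulrC /cv /tr patchE.
case: ifPn => //; rewrite notin_setE => h.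
by rewrite (gx.2 _ h) !mul0r.
Qed.

(** After Tonelli, the absolute value integrates to the pairing of |f| with k * |f|, which is finite
    by Young and Cauchy-Schwarz. *)
Lemma integrable_pair (k f : R -> R) : L1 k -> L1 f -> square_integrable mu setT f -> (forall t, 0 <= k t) ->
  (mu \x mu)%E.-integrable setT (EFin \o (fun z => f z.1 * f z.2 * k (z.1 - z.2))).
Proof.
move=> Lk Lf [_ f2] k0; have mf := L1_measurable Lf.
pose ff (z : measurableTypeR R * measurableTypeR R) : R := f z.1 * f z.2.
have mff : measurable_fun setT ff.
  by apply: measurable_funM; apply: measurableT_comp => //; first [exact: measurable_fst|exact: measurable_snd].
have mk : measurable_fun setT (fun z : measurableTypeR R * measurableTypeR R => k (z.1 - z.2)).
  apply: (measurableT_comp (L1_measurable Lk)).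
  by apply: measurable_funB.
have mF : measurable_fun setT (fun z => `|ff z| * k (z.1 - z.2)).
  by apply: measurable_funM => //; exact: measurableT_comp.
apply/integrableP; split; first by apply/measurable_EFinP; exact: measurable_funM.
rewrite (_ : integral _ _ _ = \int[(mu \x mu)%E]_z (`|ff z| * k (z.1 - z.2))%:E)%E; last first.
  by apply: eq_integral => z _ /=; rewrite normrM (ger0_norm (k0 _)).
rewrite (@fubini_tonelli1 _ _ _ _ _ _ _ (fun z => (`|ff z| * k (z.1 - z.2))%:E))//=; last 2 first.
- exact/measurable_EFinP.
- by move=> z; rewrite lee_fin mulr_ge0.
pose g t := `|f t|.
have Lg : L1 g by exact: integrable_norm Lf.
have sg : square_integrable mu setT g.
  split; first exact: measurableT_comp.
  by under eq_integral do rewrite /g -normrX ger0_norm ?sqr_ge0//.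
have [sc _] := young Lk Lg sg.
have ig := sqi_mul measurableT sg sc.
apply: (@le_lt_trans _ _ (\int[mu]_t (g t * conv k g t)%:E)%E); last first.
  have /integrableP[_] := ig; apply: le_lt_trans.
  have gc t : 0 <= g t * conv k g t.
    apply: mulr_ge0; first exact: normr_ge0.
    by apply: Rintegral_ge0 => y _; apply: mulr_ge0; [exact: k0|exact: normr_ge0].
  by apply: ge0_le_integral => //; try by [move=> t _; rewrite lee_fin gc|exact: measurable_int ig|
    apply: measurableT_comp => //; exact: measurable_int ig|move=> t _; exact: lee_abs].
apply: ae_ge0_le_integral; first by [].
- by move=> t _; apply: integral_ge0 => y _; rewrite lee_fin mulr_ge0.
- by apply: measurable_fun_fubini_tonelli_F => //; [exact/measurable_EFinP|move=> z; rewrite lee_fin mulr_ge0].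
- move=> t _; rewrite lee_fin; apply: mulr_ge0; first exact: normr_ge0.
  by apply: Rintegral_ge0 => y _; apply: mulr_ge0; [exact: k0|exact: normr_ge0].
- exact: measurable_int ig.
have := ae_conv_integrable Lk Lg.
apply: aeW => t it _; rewrite /fubini_F /conv EFinM /Rintegral fineK; last exact: integrable_fin_num it.
have kg y : 0 <= k (t - y) * g y by apply: mulr_ge0; [exact: k0|exact: normr_ge0].
rewrite -ge0_integralZl//; try by [exact: measurable_int it|move=> y _; rewrite lee_fin kg|rewrite lee_fin normr_ge0].
apply: ge0_le_integral => //; try by
  [move=> y _; rewrite lee_fin mulr_ge0|
   apply/measurable_EFinP; apply: (measurableT_comp mF) => //; exact: measurable_pair1|
   apply: measurable_funeM; exact: measurable_int it].
by move=> y _; rewrite -EFinM lee_fin /ff/= normrM /g mulrCA mulrA mulrC mulrA.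
Qed.

(* [rl a] is a positive mixture of the exponentials [ek s], each of which is of
   positive type. *)
Lemma ip_fr a (x : A) : 0 < a < 1 -> Lsq x -> 0 <= ip (fr T a * x) x.
Proof.
move=> /andP[a0 a1] hx; have ha := L1T_rl T0 a0.
have b0 : 0 < 1 - a by lra.
have ga : 0 < Gamma a by rewrite Gamma_gt0//; lra.
have gb : 0 < Gamma (1 - a) by rewrite Gamma_gt0//; lra.
(* By [laplace] with exponent 1 - a, the integral of s^(-a) exp(-s t) is Gamma(1-a) t^(a-1);
   multiplied by [c] it is the kernel [rl a]. *)
pose c := (Gamma a)^-1 * (Gamma (1 - a))^-1.
have c0 : 0 < c by apply: mulr_gt0; rewrite invr_gt0; [exact: ga|exact: gb].
set f := fun_part x; have gf : good T f := good_fun x.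
have mf : measurable_fun setT f := good_meas gf.
pose w s := c * pw (1 - a) s.
have mw : measurable_fun setT w by apply: measurable_funM => //; exact: measurable_pw.
have w0 s : 0 <= w s by rewrite mulr_ge0 ?pw_ge0// ltW.
(* The same cutoff of the difference variable to (0,T) serves [rl a] and every [ek s], so the
   mixture identity survives the truncation of the kernels. *)
pose D (z : measurableTypeR R * measurableTypeR R) : R := \1_DT (z.1 - z.2).
have mD : measurable_fun setT D.
  apply: (measurableT_comp (measurable_indic (measurable_itv `]0, T[))).
  by apply: measurable_funB.
pose ff (z : measurableTypeR R * measurableTypeR R) : R := f z.1 * f z.2.
have mff : measurable_fun setT ff.
  by apply: measurable_funM; apply: measurableT_comp => //; first [exact: measurable_fst|exact: measurable_snd].
pose G (q : (measurableTypeR R * measurableTypeR R) * measurableTypeR R) : R :=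
  ff q.1 * (D q.1 * (w q.2 * ek q.2 (q.1.1 - q.1.2))).
have mek : measurable_fun setT
    (fun q : (measurableTypeR R * measurableTypeR R) * measurableTypeR R => ek q.2 (q.1.1 - q.1.2)).
  apply: measurableT_comp => //; apply: measurable_funN; apply: measurable_funM => //.
  apply: measurable_funB; first exact: (measurableT_comp measurable_fst measurable_fst).
  exact: (measurableT_comp measurable_snd measurable_fst).
have mG : measurable_fun setT G.
  apply: measurable_funM; first exact: (measurableT_comp mff measurable_fst).
  apply: measurable_funM; first exact: (measurableT_comp mD measurable_fst).
  by apply: measurable_funM => //; exact: (measurableT_comp mw measurable_snd).
have mixe t : 0 < t -> (\int[mu]_s (w s * ek s t)%:E = (rl a t)%:E)%E.
  move=> t0; under eq_integral do rewrite /w -mulrA EFinM.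
  have mp : measurable_fun setT (fun s : measurableTypeR R => pw (1 - a) s * ek s t).
    apply: measurable_funM; first exact: measurable_pw.
    by apply: measurableT_comp => //; apply: measurable_funN; exact: measurable_funM.
  rewrite ge0_integralZl//; try by
    [apply/measurable_EFinP; exact: mp|move=> s _; rewrite lee_fin mulr_ge0 ?pw_ge0 ?expR_ge0|
     rewrite lee_fin ltW].
  have hb : 0 < 1 - a <= 2 by lra.
  have -> : (\int[mu]_s (pw (1 - a) s * ek s t)%:E =
             \int[mu]_s (pw (1 - a) s * expR (- (t * s)))%:E)%E.
    by apply: eq_integral => s _; rewrite /ek (mulrC s).
  rewrite (laplace hb t0) -EFinM /rl /pw t0 /c opprB; congr EFin.
  by rewrite -mulrA; congr (_ * _); rewrite mulrA mulVf ?mul1r// gt_eqF.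
have mixD z : (\int[mu]_s (D z * (w s * ek s (z.1 - z.2)))%:E =
    (tr T (rl a) (z.1 - z.2))%:E)%E.
  rewrite /D indicE /tr patchE; case: ifPn => h.
    under eq_integral do rewrite mul1r; apply: mixe.
    by move: h; rewrite inE/= in_itv/= => /andP[].
  by under eq_integral do rewrite mul0r; rewrite integral0.
have mk : measurable_fun setT (fun z : measurableTypeR R * measurableTypeR R => tr T (rl a) (z.1 - z.2)).
  apply: (measurableT_comp (good_meas (good_tr ha))).
  by apply: measurable_funB.
have tr0 t : 0 <= tr T (rl a) t.
  rewrite /tr patchE; case: ifP => // _.
  by apply: mulr_ge0; [rewrite invr_ge0; exact: ltW ga|exact: pw_ge0].
pose F (z : measurableTypeR R * measurableTypeR R) := ff z * tr T (rl a) (z.1 - z.2).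
have iF : (mu \x mu)%E.-integrable setT (EFin \o F) :=
  integrable_pair (good_L1 (good_tr ha)) (good_L1 gf) hx.2 tr0.
have D0 z : 0 <= D z by rewrite /D indicE.
have mws (c' : R) t : measurable_fun setT (fun s : measurableTypeR R => c' * (w s * ek s t)).
  apply: measurable_funM => //; apply: measurable_funM => //.
  by apply: measurableT_comp => //; apply: measurable_funN; exact: measurable_funM.
have ws0 z s : 0 <= D z * (w s * ek s (z.1 - z.2)).
  by apply: mulr_ge0 => //; apply: mulr_ge0 => //; exact: expR_ge0.
have aF z : (\int[mu]_s `|G (z, s)|%:E = `|F z|%:E)%E.
  rewrite /F normrM (ger0_norm (tr0 _)) EFinM -mixD -ge0_integralZl//; try by
    [apply/measurable_EFinP; exact: mws|move=> s _; rewrite lee_fin ws0].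
  by apply: eq_integral => s _ /=; rewrite -EFinM normrM (ger0_norm (ws0 _ _)).
have eF z : \int[mu]_s G (z, s) = F z.
  transitivity (\int[mu]_s (ff z * (D z * (w s * ek s (z.1 - z.2))))); first by [].
  transitivity (ff z * \int[mu]_s (D z * (w s * ek s (z.1 - z.2)))).
    by apply: RintegralZ => //; exact: mws.
  by congr (_ * _); rewrite /Rintegral mixD.
have -> : ip (fr T a * x) x = \int[(mu \x mu)%E]_z F z.
  rewrite ip_conv//; apply: EFin_inj; rewrite [X in _ = X%:E]/Rintegral fineK; last exact: integrable_fin_num iF.
  rewrite -(Rintegral_fubini_F iF); congr EFin; apply: eq_Rintegral => t _.
  rewrite /conv -RintegralZ//; last first.
    apply: measurable_funM => //; apply: (measurableT_comp (good_meas (good_tr ha))) => //.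
    exact: measurable_funB.
  by apply: eq_Rintegral => y _; rewrite /F /ff/= -mulrA; congr (_ * _); rewrite mulrC.
apply: (@mixture_ge0 _ _ R _ (product_sigma_finite mu mu) G F mG iF aF eF) => s.
have [s0|s0] := ltP 0 s; last first.
  apply: Rintegral_ge0 => z _.
  by rewrite /G /w /pw ltNge s0/= mulr0 mul0r !mulr0.
have he := L1T_ek s0.
have e0 t : 0 <= tr T (ek s) t by rewrite /tr patchE; case: ifP => // _; exact: expR_ge0.
have iH := integrable_pair (good_L1 (good_tr he)) (good_L1 gf) hx.2 e0.
have -> : \int[(mu \x mu)%E]_z G (z, s) = w s * \int[(mu \x mu)%E]_z (ff z * tr T (ek s) (z.1 - z.2)).
  rewrite -RintegralZ//; last by apply/measurable_EFinP; exact: measurable_int iH.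
  apply: eq_Rintegral => z _; rewrite /G /= /D indicE /tr patchE; case: ifP => _.
    by rewrite mul1r mulrCA.
  by rewrite mul0r !mulr0.
apply: mulr_ge0 => //; suff -> : \int[(mu \x mu)%E]_z (ff z * tr T (ek s) (z.1 - z.2)) = ip (emb T (ek s) * x) x.
  exact: ip_ek.
rewrite ip_conv//; apply: EFin_inj; rewrite [X in X%:E = _]/Rintegral fineK; last exact: integrable_fin_num iH.
rewrite -(Rintegral_fubini_F iH); congr EFin; apply: eq_Rintegral => t _.
rewrite /conv -RintegralZ//; last first.
  apply: measurable_funM => //; apply: (measurableT_comp (good_meas (good_tr he))) => //.
  exact: measurable_funB.
by apply: eq_Rintegral => y _; rewrite /= -mulrA; congr (_ * _); rewrite mulrC.
Qed.

End fractional_positivity.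

(** * Operational calculus *)

(* The operational calculus of the causal convolutions on ]0, T[: elements act on
   the square integrable ones by multiplication; [tc_int] is integration,
   [tc_frac a] fractional integration of order [a], [tc_res s] is
   (1 + s d/dt)^-1 and [tc_flip] time reversal. *)
Record time_calculus (R : realType) := TimeCalculus {
  tc :> comNzRingType;
  tc_cst : {rmorphism R -> tc};
  tc_sq : tc -> Prop;
  tc_ip : tc -> tc -> R;
  tc_int : tc;
  tc_frac : R -> tc;
  tc_res : R -> tc;
  tc_flip : tc -> tc;
  tc_len : R;
  tc_sqD : forall x y, tc_sq x -> tc_sq y -> tc_sq (x + y);
  tc_sqM : forall x y, tc_sq y -> tc_sq (x * y);
  tc_ipC : forall x y, tc_ip x y = tc_ip y x;
  tc_ipDl : forall x y z, tc_sq x -> tc_sq y -> tc_sq z -> tc_ip (x + y) z = tc_ip x z + tc_ip y z;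
  tc_ipZl : forall c x y, tc_ip (tc_cst c * x) y = c * tc_ip x y;
  tc_ip_ge0 : forall x, 0 <= tc_ip x x;
  tc_ip_le : forall x y, tc_sq x -> tc_sq y ->
    `|tc_ip x y| <= Num.sqrt (tc_ip x x) * Num.sqrt (tc_ip y y);
  tc_ip_int : forall x, tc_sq x -> 0 <= tc_ip (tc_int * x) x;
  tc_int_le : forall x, tc_sq x ->
    Num.sqrt (tc_ip (tc_int * x) (tc_int * x)) <= tc_len * Num.sqrt (tc_ip x x);
  tc_resE : forall s, 0 < s -> tc_cst s * tc_res s = tc_int * (1 - tc_res s);
  tc_fracM : forall a b, 0 < a -> 0 < b -> a + b <= 2 -> tc_frac a * tc_frac b = tc_frac (a + b);
  tc_frac1 : tc_frac 1 = tc_int;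
  tc_res_frac : forall s r x, 0 < s -> 0 < r <= 1 -> tc_sq x ->
    Num.sqrt (tc_ip ((1 - tc_res s) * tc_frac r * x) ((1 - tc_res s) * tc_frac r * x)) <=
    2 * s `^ r * Num.sqrt (tc_ip x x);
  tc_ip_frac : forall a x, 0 < a < 1 -> tc_sq x -> 0 <= tc_ip (tc_frac a * x) x;
  tc_flip_sq : forall x, tc_sq x -> tc_sq (tc_flip x);
  tc_flip_ip : forall x y, tc_ip (tc_flip x) (tc_flip y) = tc_ip x y;
  tc_adjoint : forall x y z, tc_sq y -> tc_sq z ->
    tc_ip (x * y) z = tc_ip y (tc_flip (x * tc_flip z))
}.

Section operational_calculus.
Context {R : realType} (X : time_calculus R).
Implicit Types (s t r a b B C : R) (x y z g : X).
Local Notation cst := (tc_cst X).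
Local Notation sq := (tc_sq (t := X)).
Local Notation ip := (tc_ip (t := X)).
Local Notation I := (tc_int X).
Local Notation fr := (tc_frac X).
Local Notation J := (tc_res X).

Definition nrm x : R := Num.sqrt (ip x x).

Lemma nrm_ge0 x : 0 <= nrm x. Proof. exact: sqrtr_ge0. Qed.

Lemma sqr_nrm x : nrm x ^+ 2 = ip x x.
Proof. by rewrite sqr_sqrtr// tc_ip_ge0. Qed.

Lemma sqZ c x : sq x -> sq (cst c * x). Proof. exact: tc_sqM. Qed.

Lemma tc_ipDr x y z : sq x -> sq y -> sq z -> ip z (x + y) = ip z x + ip z y.
Proof. by move=> hx hy hz; rewrite tc_ipC tc_ipDl// !(tc_ipC _ z). Qed.

Lemma nrmZ c x : nrm (cst c * x) = `|c| * nrm x.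
Proof.
by rewrite /nrm tc_ipZl tc_ipC tc_ipZl mulrA -expr2 sqrtrM ?sqr_ge0// sqrtr_sqr.
Qed.

Lemma sqr_nrmD x y : sq x -> sq y -> nrm (x + y) ^+ 2 = nrm x ^+ 2 + 2 * ip x y + nrm y ^+ 2.
Proof.
move=> hx hy; have hxy := tc_sqD hx hy.
by rewrite !sqr_nrm (tc_ipDl hx hy hxy) (tc_ipDr hx hy hx) (tc_ipDr hx hy hy) (tc_ipC y x); ring.
Qed.

Lemma ip_le_nrm x y : sq x -> sq y -> ip x y <= nrm x * nrm y.
Proof. by move=> hx hy; apply: le_trans (ler_norm _) _; exact: tc_ip_le. Qed.

Lemma le_sqr_nrm x C : 0 <= C -> nrm x ^+ 2 <= C ^+ 2 -> nrm x <= C.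
Proof. by move=> C0; rewrite ler_sqr ?nnegrE ?nrm_ge0. Qed.

Lemma nrmD x y : sq x -> sq y -> nrm (x + y) <= nrm x + nrm y.
Proof.
move=> hx hy; apply: le_sqr_nrm; first by rewrite addr_ge0 ?nrm_ge0.
by rewrite sqr_nrmD//; have := ip_le_nrm hx hy; nra.
Qed.

(** A bound for the operator norm of multiplication by [x] on the square integrable elements. *)
Definition bd x C : Prop := 0 <= C /\ forall y, sq y -> nrm (x * y) <= C * nrm y.

Lemma bdM x y a b : bd x a -> bd y b -> bd (x * y) (a * b).
Proof.
move=> [a0 ha] [b0 hb]; split=> [|z hz]; first exact: mulr_ge0.
rewrite -!mulrA; apply: (le_trans (ha _ (tc_sqM _ hz))).
by rewrite ler_wpM2l// hb.
Qed.

Lemma bdD x y a b : bd x a -> bd y b -> bd (x + y) (a + b).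
Proof.
move=> [a0 ha] [b0 hb]; split=> [|z hz]; first exact: addr_ge0.
rewrite mulrDl [leRHS]mulrDl; apply: le_trans (nrmD (tc_sqM _ hz) (tc_sqM _ hz)) _.
by rewrite lerD// ?ha ?hb.
Qed.

Lemma bdZ c : bd (cst c) `|c|.
Proof. by split=> // y _; rewrite nrmZ. Qed.

Lemma bd1 : bd 1 1.
Proof. by split=> // y _; rewrite !mul1r. Qed.

Lemma bdW x a b : a <= b -> bd x a -> bd x b.
Proof.
move=> ab [a0 h]; split=> [|y hy]; first exact: le_trans ab.
by apply: le_trans (h y hy) _; rewrite ler_wpM2r ?nrm_ge0.
Qed.

Lemma cstV s : 0 < s -> cst s * cst s^-1 = 1.
Proof. by move=> s0; rewrite -rmorphM mulfV ?rmorph1// gt_eqF. Qed.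

Lemma res_int s : 0 < s -> J s = cst s^-1 * I * (1 - J s).
Proof. by move=> s0; rewrite -mulrA -tc_resE// mulrA [cst _ * cst s]mulrC cstV// mul1r. Qed.

(** With y = (1 - J s) x one has J s x = s^-1 I y, and [I] is of positive type. *)
Lemma ip_res s x : 0 < s -> sq x -> 0 <= ip (J s * x) ((1 - J s) * x).
Proof.
move=> s0 hx; rewrite {1}res_int// -!mulrA tc_ipZl mulr_ge0 ?invr_ge0 ?(ltW s0)//.
by apply: tc_ip_int; exact: tc_sqM.
Qed.

Lemma res_split s x : 0 < s -> sq x ->
  nrm (J s * x) ^+ 2 + nrm ((1 - J s) * x) ^+ 2 <= nrm x ^+ 2.
Proof.
move=> s0 hx; have h := ip_res s0 hx.
have {3}-> : x = J s * x + (1 - J s) * x by ring.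
by rewrite sqr_nrmD; [lra| exact: tc_sqM | exact: tc_sqM].
Qed.

Lemma bd_res s : 0 < s -> bd (J s) 1.
Proof.
move=> s0; split=> // y hy; rewrite mul1r; apply: le_sqr_nrm; first exact: nrm_ge0.
by have := res_split s0 hy; have := sqr_ge0 (nrm ((1 - J s) * y)); lra.
Qed.

Lemma bd_1res s : 0 < s -> bd (1 - J s) 1.
Proof.
move=> s0; split=> // y hy; rewrite mul1r; apply: le_sqr_nrm; first exact: nrm_ge0.
by have := res_split s0 hy; have := sqr_ge0 (nrm (J s * y)); lra.
Qed.

Lemma bd_res_frac s r : 0 < s -> 0 < r <= 1 -> bd ((1 - J s) * fr r) (2 * s `^ r).
Proof.
move=> s0 hr; split=> [|y hy]; first by rewrite mulr_ge0 ?powR_ge0.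
exact: tc_res_frac.
Qed.

(** With p for d/dt, J_s is 1/(1 + s p), and both sides are 2 s p / ((1 + s p)(1 + 2 s p)). The
    proof stays in the ring, using the resolvent equation at [s] and at [2 * s]. *)
Lemma res_double2 s : 0 < s -> J s * (1 - J (2 * s)) = 2 * (J (2 * s) * (1 - J s)).
Proof.
move=> s0; have s2 : 0 < 2 * s by lra.
have h1 := tc_resE X s0; have h2 := tc_resE X s2.
have h3 : cst s * (J s * (1 - J (2 * s))) = cst s * (2 * (J (2 * s) * (1 - J s))).
  rewrite mulrA h1; have -> : I * (1 - J s) * (1 - J (2 * s)) = (1 - J s) * (I * (1 - J (2 * s))) by ring.
  by rewrite -h2 rmorphM rmorph_nat; ring.
have := congr1 (fun x => cst s^-1 * x) h3; rewrite !mulrA [cst _ * cst s]mulrC cstV//.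
by rewrite !mul1r -!mulrA.
Qed.

Lemma res_double s : 0 < s -> J s - J (2 * s) = (1 - J s) * J (2 * s).
Proof.
move=> s0; have -> : J s - J (2 * s) =
  J s * (1 - J (2 * s)) - 2 * (J (2 * s) * (1 - J s)) + (1 - J s) * J (2 * s) by ring.
by rewrite res_double2// subrr add0r.
Qed.

(** Put y = J_(2s) g. By [res_double] the difference d g is (1 - J_s) y, so its pairing with y is at
    least |d g|^2 by [ip_res]. Expanding |y + d g|^2 then yields |y|^2 + 3 |d g|^2. *)
Lemma res_telescope s g : 0 < s -> sq g ->
  3 * nrm ((J s - J (2 * s)) * g) ^+ 2 <= nrm (J s * g) ^+ 2 - nrm (J (2 * s) * g) ^+ 2.
Proof.
move=> s0 hg; have s2 : 0 < 2 * s by lra.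
set b := J (2 * s); set d := J s - b.
have hbg : sq (b * g) by exact: tc_sqM.
have hdg : sq (d * g) by exact: tc_sqM.
have dE : d * g = (1 - J s) * (b * g) by rewrite /d res_double// mulrA.
have h : nrm (d * g) ^+ 2 <= ip (b * g) (d * g).
  rewrite dE; set y := b * g.
  have {2}-> : y = J s * y + (1 - J s) * y by ring.
  have hy : sq y := hbg.
  rewrite (tc_ipDl (tc_sqM _ hy) (tc_sqM _ hy) (tc_sqM _ hy)) sqr_nrm lerDr.
  exact: ip_res.
have -> : J s * g = b * g + d * g by rewrite /d; ring.
rewrite (sqr_nrmD hbg hdg); lra.
Qed.

(** * Dyadic frequency blocks and K-functionals *)

Definition dy s (j : nat) : R := s * 2 ^+ j.

Lemma dy_gt0 s j : 0 < s -> 0 < dy s j.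
Proof. by move=> s0; rewrite mulr_gt0// exprn_gt0. Qed.

Lemma dyS s j : dy s j.+1 = 2 * dy s j.
Proof. by rewrite /dy exprS mulrCA. Qed.

(** A band-pass filter for the frequencies around 1 / [dy s j]; the blocks telescope. *)
Definition Jd s j : X := J (dy s j) - J (dy s j.+1).

Lemma square_function s n g : 0 < s -> sq g ->
  \sum_(j < n) nrm (Jd s j * g) ^+ 2 <= nrm g ^+ 2.
Proof.
move=> s0 hg; have h j : 3 * nrm (Jd s j * g) ^+ 2 <=
    nrm (J (dy s j) * g) ^+ 2 - nrm (J (dy s j.+1) * g) ^+ 2.
  by rewrite /Jd dyS; apply: res_telescope => //; exact: dy_gt0.
have : 3 * (\sum_(j < n) nrm (Jd s j * g) ^+ 2) <=
    nrm (J (dy s 0) * g) ^+ 2 - nrm (J (dy s n) * g) ^+ 2.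
  elim: n => [|n IH]; first by rewrite big_ord0 mulr0 subrr.
  by rewrite big_ord_recr/= mulrDr; have := h n; lra.
have : nrm (J (dy s 0) * g) ^+ 2 <= nrm g ^+ 2.
  rewrite ler_sqr ?nnegrE ?nrm_ge0//; have [_] := bd_res (dy_gt0 0 s0).
  by move=> /(_ g hg); rewrite mul1r.
have := sqr_ge0 (nrm (J (dy s n) * g)).
have : 0 <= \sum_(j < n) nrm (Jd s j * g) ^+ 2 by apply: sumr_ge0 => j _; exact: sqr_ge0.
lra.
Qed.

Lemma square_function_adj s n z : 0 < s -> sq z ->
  \sum_(j < n) nrm (tc_flip (Jd s j * tc_flip z)) ^+ 2 <= nrm z ^+ 2.
Proof.
move=> s0 hz; under eq_bigr do rewrite sqr_nrm tc_flip_ip -sqr_nrm.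
rewrite -[X in _ <= X ^+ 2](_ : nrm (tc_flip z) = _); last by rewrite /nrm tc_flip_ip.
by apply: square_function => //; exact: tc_flip_sq.
Qed.

(** An explicit witness that the K-functional of the couple (L^2, 0H^m) at [t] is at most [B]; [q]
    is the m-th derivative of the smooth part. *)
Definition split m t x B : Prop :=
  exists p q, [/\ sq p, sq q, x = p + I ^+ m * q & nrm p + t * nrm q <= B].

Lemma resI s : 0 < s -> (1 - J s) * I = cst s * J s.
Proof. by move=> s0; rewrite mulrC -tc_resE. Qed.

Lemma bd_resI s : 0 < s -> bd ((1 - J s) * I) s.
Proof.
move=> s0; rewrite resI//; have := bdM (bdZ s) (bd_res s0).
by rewrite mulr1 gtr0_norm.
Qed.

(** Multiplication by [y] commutes with [I], so it maps a decomposition to a decomposition. *)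
Lemma split_bd m t x B y C : bd y C -> 0 <= t -> split m t x B -> split m t (y * x) (C * B).
Proof.
move=> [C0 hy] t0 [p [q [hp hq -> hB]]]; exists (y * p), (y * q); split.
- exact: tc_sqM.
- exact: tc_sqM.
- by ring.
apply: le_trans (ler_wpM2l C0 hB); rewrite mulrDr mulrCA lerD ?hy//.
by rewrite ler_wpM2l// hy.
Qed.

(** On the rough part the block has norm at most 2. On the smooth part it absorbs one integration at
    the price of a factor [dy s j], because Jd I = (1 - J_s) I J_(2s) at s = [dy s j]. *)
Lemma Jd_split s j x B : 0 < s -> split 1 (dy s j) x B -> nrm (Jd s j * x) <= 2 * B.
Proof.
move=> s0 [p [q [hp hq -> hB]]]; have d0 := dy_gt0 j s0; have d1 := dy_gt0 j.+1 s0.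
have h1 : bd (Jd s j) 2.
  have -> : Jd s j = (1 - J (dy s j.+1)) + cst (-1) * (1 - J (dy s j)).
    by rewrite rmorphN rmorph1 /Jd; ring.
  apply: bdW (bdD (bd_1res d1) (bdM (bdZ _) (bd_1res d0))).
  by rewrite normrN1; lra.
have h2 : bd (Jd s j * I) (dy s j).
  have -> : Jd s j * I = (1 - J (dy s j)) * I * J (dy s j.+1).
    by rewrite /Jd dyS res_double//; ring.
  by apply: bdW (bdM (bd_resI d0) (bd_res d1)); rewrite mulr1.
rewrite mulrDr expr1 mulrA; apply: le_trans (nrmD (tc_sqM _ hp) (tc_sqM _ hq)) _.
have := h1.2 _ hp; have := h2.2 _ hq; have := nrm_ge0 p; have := nrm_ge0 q; nra.
Qed.

Lemma res_split1 s x B : 0 < s -> split 1 s x B -> nrm ((1 - J s) * x) <= B.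
Proof.
move=> s0 [p [q [hp hq -> hB]]].
rewrite mulrDr expr1 mulrA; apply: le_trans (nrmD (tc_sqM _ hp) (tc_sqM _ hq)) _.
by have := (bd_1res s0).2 _ hp; have := (bd_resI s0).2 _ hq; lra.
Qed.

(* [FJ (J s)] cuts off the frequencies above 1/s; both [FJ] and [1 - FJ] vanish to
   second order at the respective ends, which is needed for gaining [s `^ r]. *)
Definition FJ x : X := x ^+ 2 * (2 - x ^+ 2).

Lemma bd_1Dres s : 0 < s -> bd (1 + J s) 2.
Proof. by move=> s0; apply: bdW (bdD bd1 (bd_res s0)); lra. Qed.

Lemma bd_2Bres2 s : 0 < s -> bd (2 - J s ^+ 2) 3.
Proof.
move=> s0; have -> : 2 - J s ^+ 2 = 1 + (1 + J s) * (1 - J s) by ring.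
by apply: bdW (bdD bd1 (bdM (bd_1Dres s0) (bd_1res s0))); lra.
Qed.

(** As 1 - FJ(x) = (1 - x^2)^2, two factors 1 - J are present: one tames [fr r], the other is left
    to act on the argument. *)
Lemma FJ_frac s r : (1 - FJ (J s)) * fr r =
  (1 + J s) * (1 + J s) * ((1 - J s) * fr r) * (1 - J s).
Proof. by rewrite /FJ; ring. Qed.

Lemma nrm_1FJ_frac s r x : 0 < s -> 0 < r <= 1 -> sq x ->
  nrm ((1 - FJ (J s)) * fr r * x) <= 8 * s `^ r * nrm ((1 - J s) * x).
Proof.
move=> s0 hr hx; have d := bd_1Dres s0.
have h := bdM (bdM d d) (bd_res_frac s0 hr).
rewrite FJ_frac -(mulrA _ (1 - J s) x); apply: (le_trans (h.2 _ (tc_sqM _ hx))).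
by rewrite ler_wpM2r ?nrm_ge0//; lra.
Qed.

(** The time derivative of the resolvent, in the sense of [J s = I * dJ s]. *)
Definition dJ s : X := cst s^-1 * (1 - J s).

Lemma dJE s : 0 < s -> J s = I * dJ s.
Proof. by move=> s0; rewrite {1}res_int// /dJ; ring. Qed.

Lemma dJ_double s : 0 < s -> dJ s * J (2 * s) = J s * dJ (2 * s).
Proof.
move=> s0; have s2 : 0 < 2 * s by lra.
have E : cst s^-1 = 2 * cst (2 * s)^-1.
  rewrite -[2](rmorph_nat cst) -rmorphM; congr (cst _); field; exact: lt0r_neq0.
rewrite /dJ; transitivity (cst (2 * s)^-1 * (2 * (J (2 * s) * (1 - J s)))).
  by rewrite E; ring.
by rewrite -res_double2//; ring.
Qed.

Lemma bd_dJ s : 0 < s -> bd (dJ s) s^-1.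
Proof.
move=> s0; have := bdM (bdZ s^-1) (bd_1res s0); rewrite mulr1 gtr0_norm// invr_gt0//.
Qed.

Lemma bd_dJ_frac s r : 0 < s -> 0 < r <= 1 -> bd (dJ s * fr r) (2 * s^-1 * s `^ r).
Proof.
move=> s0 hr; rewrite /dJ -mulrA.
have := bdM (bdZ s^-1) (bd_res_frac s0 hr); apply: bdW.
by rewrite gtr0_norm ?invr_gt0//; lra.
Qed.

Lemma powR2_le s r : 0 < s -> 0 < r <= 1 -> (2 * s) `^ r <= 2 * s `^ r.
Proof.
move=> s0 /andP[r0 r1]; rewrite powRM ?(ltW s0)// ler_wpM2r ?powR_ge0//.
by rewrite -[leRHS](@powRr1 _ 2)//; apply: ler_powR => //; lra.
Qed.

(** The cofactor in FJ(J_s) - FJ(J_(2s)) = (J_s - J_(2s)) (J_s + J_(2s)) cutoff2: the step between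
    consecutive cutoffs contains a dyadic block. *)
Definition cutoff2 s : X := (1 - J s ^+ 2) + (1 - J (2 * s) ^+ 2).

Lemma cutoff2E s : cutoff2 s = (1 + J s) * (1 - J s) + (1 + J (2 * s)) * (1 - J (2 * s)).
Proof. by rewrite /cutoff2; ring. Qed.

Lemma bd_cutoff2_frac s r : 0 < s -> 0 < r <= 1 -> bd (cutoff2 s * fr r) (12 * s `^ r).
Proof.
move=> s0 hr; have s2 : 0 < 2 * s by lra.
have -> : cutoff2 s * fr r = (1 + J s) * ((1 - J s) * fr r) +
    (1 + J (2 * s)) * ((1 - J (2 * s)) * fr r) by rewrite cutoff2E; ring.
apply: bdW (bdD (bdM (bd_1Dres s0) (bd_res_frac s0 hr)) (bdM (bd_1Dres s2) (bd_res_frac s2 hr))).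
by have := powR2_le s0 hr; lra.
Qed.

Lemma bd_cutoff2 s : 0 < s -> bd (cutoff2 s) 4.
Proof.
move=> s0; have s2 : 0 < 2 * s by lra.
rewrite cutoff2E.
by apply: bdW (bdD (bdM (bd_1Dres s0) (bd_1res s0)) (bdM (bd_1Dres s2) (bd_1res s2))); lra.
Qed.

Lemma bd_cutoff2_int s : 0 < s -> bd (cutoff2 s * I) (6 * s).
Proof.
move=> s0; have s2 : 0 < 2 * s by lra.
have -> : cutoff2 s * I = (1 + J s) * ((1 - J s) * I) +
    (1 + J (2 * s)) * ((1 - J (2 * s)) * I) by rewrite cutoff2E; ring.
apply: bdW (bdD (bdM (bd_1Dres s0) (bd_resI s0)) (bdM (bd_1Dres s2) (bd_resI s2))); lra.
Qed.

(** * Splitting a fractional integral at one scale *)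

Section frac_lt1.
Variables (r : R) (hr : 0 < r <= 1).

(** The cutoff [1 - FJ (J s)] keeps the frequencies above 1/s. What [FJ (J s)] keeps is a primitive,
    since [J s = I * dJ s], and [Qf] is its derivative. So [Pf] and [Qf] are the two parts of a
    K-functional decomposition of [fr r * g]. *)
Definition Pf s g : X := (1 - FJ (J s)) * fr r * g.
Definition Qf s g : X := dJ s * (J s * (2 - J s ^+ 2)) * fr r * g.

Lemma PQf s g : 0 < s -> fr r * g = Pf s g + I * Qf s g.
Proof.
move=> s0; have -> : I * Qf s g = (I * dJ s) * (J s * (2 - J s ^+ 2)) * fr r * g.
  by rewrite /Qf; ring.
by rewrite -dJE// /Pf /FJ; ring.
Qed.

(** Doubling the scale changes the rough part by a single block of [g], on which [cutoff2 s * fr r]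
    gains s^r; 24 is 2 times the 12 of [bd_cutoff2_frac]. *)
Lemma Pf_double s g : 0 < s -> sq g ->
  nrm (Pf (2 * s) g) <= nrm (Pf s g) + 24 * s `^ r * nrm ((J s - J (2 * s)) * g).
Proof.
move=> s0 hg; have s2 : 0 < 2 * s by lra.
have hb := bdM (bdD (bd_res s0) (bd_res s2)) (bd_cutoff2_frac s0 hr).
have -> : Pf (2 * s) g = Pf s g + (J s + J (2 * s)) * (cutoff2 s * fr r) * ((J s - J (2 * s)) * g).
  by rewrite /Pf /FJ /cutoff2; ring.
apply: le_trans (nrmD (tc_sqM _ hg) (tc_sqM _ (tc_sqM _ hg))) _.
by rewrite lerD2l; apply: le_trans (hb.2 _ (tc_sqM _ hg)) _; rewrite ler_wpM2r ?nrm_ge0//; lra.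
Qed.

(** The counterpart for the smooth part, passing from the coarse scale to the fine one; the identity
    [E] rests on [dJ_double]. *)
Lemma Qf_double s g : 0 < s -> sq g ->
  nrm (Qf s g) <= nrm (Qf (2 * s) g) + 24 * s^-1 * s `^ r * nrm ((J s - J (2 * s)) * g).
Proof.
move=> s0 hg; have s2 : 0 < 2 * s by lra.
have hb := bdM (bdD (bd_dJ s0) (bd_dJ s2)) (bd_cutoff2_frac s0 hr).
have E : Qf s g = Qf (2 * s) g +
    (dJ s + dJ (2 * s)) * (cutoff2 s * fr r) * ((J s - J (2 * s)) * g).
  have h := dJ_double s0; apply/eqP; rewrite -subr_eq0; apply/eqP.
  transitivity ((dJ s * J (2 * s) - J s * dJ (2 * s)) *
      ((2 - J s ^+ 2 - J (2 * s) ^+ 2) + J s * J (2 * s)) * fr r * g).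
    by rewrite /Qf /cutoff2; ring.
  by rewrite h subrr !mul0r.
rewrite E; apply: le_trans (nrmD (tc_sqM _ hg) (tc_sqM _ (tc_sqM _ hg))) _.
rewrite lerD2l; apply: le_trans (hb.2 _ (tc_sqM _ hg)) _; rewrite ler_wpM2r ?nrm_ge0//.
have -> : (2 * s)^-1 = 2^-1 * s^-1 by rewrite invfM.
have : 0 <= s^-1 * s `^ r by rewrite mulr_ge0 ?powR_ge0// invr_ge0 ltW.
lra.
Qed.

Lemma Qf_le s g : 0 < s -> sq g -> nrm (Qf s g) <= 6 * s^-1 * s `^ r * nrm g.
Proof.
move=> s0 hg.
have -> : Qf s g = dJ s * fr r * (J s * (2 - J s ^+ 2)) * g by rewrite /Qf; ring.
have hb := bdM (bd_dJ_frac s0 hr) (bdM (bd_res s0) (bd_2Bres2 s0)).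
by apply: le_trans (hb.2 _ hg) _; rewrite ler_wpM2r ?nrm_ge0//; lra.
Qed.

End frac_lt1.

(** The primitive of the rough part is split once more by the resolvent at scale [t]: I p = (1 - J)
    I p + I^2 (dJ p). Both pieces cost t |p|, the second with the new parameter t^2. *)
Lemma split_int t x B : 0 < t -> split 1 t x B -> split 2 (t ^+ 2) (I * x) (2 * t * B).
Proof.
move=> t0 [p [q [hp hq -> hB]]]; exists ((1 - J t) * I * p), (dJ t * p + q); split.
- exact: tc_sqM.
- by apply: tc_sqD => //; exact: tc_sqM.
- have -> : I ^+ 2 * (dJ t * p + q) = I * (I * dJ t) * p + I ^+ 2 * q by ring.
  by rewrite -dJE//; ring.
have h1 := (bd_resI t0).2 _ hp.
have h2 := nrmD (tc_sqM (dJ t) hp) hq; have h3 := (bd_dJ t0).2 _ hp.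
have h4 : t ^+ 2 * nrm (dJ t * p + q) <= t * nrm p + t ^+ 2 * nrm q.
  rewrite (_ : t * nrm p = t ^+ 2 * (t^-1 * nrm p)); last first.
    by field; exact: lt0r_neq0.
  by rewrite -mulrDr ler_wpM2l ?sqr_ge0//; lra.
apply: le_trans (lerD h1 h4) _.
have tq : 0 <= t * nrm q by rewrite mulr_ge0 ?nrm_ge0// ltW.
have -> : t * nrm p + (t * nrm p + t ^+ 2 * nrm q) = t * (2 * nrm p + t * nrm q) by ring.
rewrite (_ : 2 * t * B = t * (2 * B)); last by ring.
by rewrite ler_wpM2l ?(ltW t0)//; lra.
Qed.

(** Here the second order of the cutoff is used: FJ = J^2 (2 - J^2) with J = I dJ makes the low
    frequencies of [fr r * p] and [fr r * (I * q)] second primitives. The rough part contributes 8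
    and the smooth part 6 to the constant 14. *)
Lemma split_frac2 r t g B : 0 < r <= 1 -> 0 < t -> split 1 t g B ->
  split 2 (t ^+ 2) (fr r * g) (14 * t `^ r * B).
Proof.
move=> hr t0 [p [q [hp hq -> hB]]].
pose Op := (1 + J t) * (1 + J t) * ((1 - J t) * fr r).
have d := bd_1Dres t0; have hOp := bdM (bdM d d) (bd_res_frac t0 hr).
pose H1 := dJ t * (dJ t * fr r) * (2 - J t ^+ 2); pose H2 := dJ t * fr r * J t * (2 - J t ^+ 2).
have b1 := bdM (bdM (bd_dJ t0) (bd_dJ_frac t0 hr)) (bd_2Bres2 t0).
have b2 := bdM (bdM (bd_dJ_frac t0 hr) (bd_res t0)) (bd_2Bres2 t0).
exists (Op * (1 - J t) * p + Op * ((1 - J t) * I) * q), (H1 * p + H2 * q); split.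
- by apply: tc_sqD; exact: tc_sqM.
- by apply: tc_sqD; exact: tc_sqM.
- have -> : I ^+ 2 * (H1 * p + H2 * q) = ((I * dJ t) * (I * dJ t) * p + (I * dJ t) * J t * (I * q)) *
      (fr r * (2 - J t ^+ 2)) by rewrite /H1 /H2; ring.
  by rewrite -dJE// /Op expr1; ring.
have c1 := (bdM hOp (bd_1res t0)).2 _ hp; have c2 := (bdM hOp (bd_resI t0)).2 _ hq.
have c3 := b1.2 _ hp; have c4 := b2.2 _ hq.
have e1 := nrmD (tc_sqM (Op * (1 - J t)) hp) (tc_sqM (Op * ((1 - J t) * I)) hq).
have e2 := nrmD (tc_sqM H1 hp) (tc_sqM H2 hq).
have tr0 := powR_ge0 t r.
have k : t ^+ 2 * nrm (H1 * p + H2 * q) <= 6 * t `^ r * (nrm p + t * nrm q).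
  have -> : 6 * t `^ r * (nrm p + t * nrm q) =
    t ^+ 2 * (t^-1 * (2 * t^-1 * t `^ r) * 3 * nrm p + 2 * t^-1 * t `^ r * 1 * 3 * nrm q).
    by field; exact: lt0r_neq0.
  by rewrite ler_wpM2l ?sqr_ge0//; lra.
apply: (@le_trans _ _ (8 * t `^ r * (nrm p + t * nrm q) + 6 * t `^ r * (nrm p + t * nrm q))).
  apply: lerD => //; apply: le_trans e1 _; lra.
rewrite -mulrDl -mulrDl (_ : 8 + 6 = 14 :> R); last by ring.
by rewrite ler_wpM2l ?mulr_ge0.
Qed.

(** An energy estimate: pair w + l (fr a w) = x with w and drop the fractional term, which is
    nonnegative. *)
Lemma resolvent_le a l y : 0 < a < 1 -> 0 <= l -> (1 + cst l * fr a) * y = 1 -> bd y 1.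
Proof.
move=> ha l0 hy; split=> // x hx; rewrite mul1r.
set w := y * x; have hw : sq w by exact: tc_sqM.
have xE : x = w + cst l * (fr a * w) by rewrite -{1}[x]mul1r -hy /w; ring.
have h : nrm w ^+ 2 <= nrm x * nrm w.
  apply: le_trans (ip_le_nrm hx hw); rewrite sqr_nrm {1}xE.
  rewrite (tc_ipDl hw (sqZ _ (tc_sqM _ hw)) hw) tc_ipZl lerDl mulr_ge0//.
  exact: tc_ip_frac.
have := nrm_ge0 w; rewrite le_eqVlt => /predU1P[<-|w0]; first exact: nrm_ge0.
by rewrite -(ler_pM2r w0) -expr2.
Qed.

(** * The endpoint of order one, by duality *)

Section frac_eq1.
Variables (r a : R) (hr : 0 < r) (ha : 0 < a) (ar : a + r = 1).

(** Only a decomposition of [fr a * h] is at hand, so a factor [fr a] must be produced in front of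
    [h]: each resolvent is I times dJ, and I = fr r fr a. The remaining dJ fr r costs s^(r-1) =
    s^(-a). *)
Lemma cutoff_le s h B : 0 < s -> sq h -> split 1 s (fr a * h) B ->
  nrm ((J s + J (2 * s)) * cutoff2 s * h) <= 24 * s `^ (- a) * B.
Proof.
move=> s0 hh [p [q [hp hq gE hB]]]; have s2 : 0 < 2 * s by lra.
have hr1 : 0 < r <= 1 by rewrite hr -ar lerDr ltW.
have ra : r + a <= 2 by rewrite addrC ar ler1n.
have fI : I = fr r * fr a by rewrite (tc_fracM X hr ha ra) addrC ar tc_frac1.
pose M := dJ s * fr r + dJ (2 * s) * fr r.
have E : (J s + J (2 * s)) * cutoff2 s * h = M * cutoff2 s * p + M * (cutoff2 s * I) * q.
  rewrite (dJE s0) (dJE s2) fI.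
  transitivity (M * cutoff2 s * (fr a * h)); first by rewrite /M; ring.
  by rewrite gE -fI; ring.
have bM : bd M (4 * s^-1 * s `^ r).
  apply: bdW (bdD (bd_dJ_frac s0 hr1) (bd_dJ_frac s2 hr1)).
  have -> : (2 * s)^-1 = 2^-1 * s^-1 by rewrite invfM.
  have si : 0 <= s^-1 by rewrite invr_ge0 ltW.
  have := ler_wpM2l si (powR2_le s0 hr1); lra.
rewrite E; apply: le_trans (nrmD (tc_sqM _ hp) (tc_sqM _ hq)) _.
have c1 := (bdM bM (bd_cutoff2 s0)).2 _ hp; have c2 := (bdM bM (bd_cutoff2_int s0)).2 _ hq.
have pE : s `^ (- a) = s^-1 * s `^ r.
  have -> : - a = - 1 + r by rewrite -ar opprD subrK.
  by rewrite powRD ?powR_inv1 ?(ltW s0)//; apply/implyP => _; exact: lt0r_neq0.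
have p0 := powR_ge0 s (- a).
apply: (@le_trans _ _ (24 * s `^ (- a) * (nrm p + s * nrm q))); last first.
  by rewrite ler_wpM2l// mulr_ge0.
have np := nrm_ge0 p; have : 0 <= s `^ (- a) * nrm p by rewrite mulr_ge0.
by move: c1 c2; rewrite pE; lra.
Qed.

(** The difference of the cutoffs is a sum of blocks Jd_j e_j. In the pairing of this sum z with
    itself the blocks move to the other side as adjoints, and 2 |z|^2 <= sum |e_j|^2 + |z|^2 follows
    from the square function bound for the adjoints. No geometric decay in j is needed. *)
Lemma frac_eq1 s n h (B : nat -> R) : 0 < s -> sq h ->
  (forall j, (j < n)%N -> split 1 (dy s j) (fr a * h) (B j)) ->
  nrm ((FJ (J (dy s 0)) - FJ (J (dy s n))) * h) ^+ 2 <=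
  \sum_(j < n) (24 * dy s j `^ (- a) * B j) ^+ 2.
Proof.
move=> s0 hh hB; set z := (_ * h); have hz : sq z by exact: tc_sqM.
pose e j := (J (dy s j) + J (2 * dy s j)) * cutoff2 (dy s j) * h.
have he j : sq (e j) by exact: tc_sqM.
have zE : z = \sum_(j < n) Jd s j * e j.
  rewrite /z; elim: n {hB z hz} => [|n IH]; first by rewrite big_ord0 subrr mul0r.
  rewrite big_ord_recr/= -IH /e /Jd dyS /FJ /cutoff2; ring.
have ipE : ip z z = \sum_(j < n) ip (e j) (tc_flip (Jd s j * tc_flip z)).
  rewrite {1}zE; have sqs m : sq (\sum_(j < m) Jd s j * e j).
    elim: m => [|m IH]; last by rewrite big_ord_recr; apply: tc_sqD => //; exact: tc_sqM.
    by rewrite big_ord0 -(mul0r h); exact: tc_sqM.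
  elim: (n) => [|k IH].
    by rewrite !big_ord0 -(mul0r h) -(rmorph0 cst) tc_ipZl mul0r.
  rewrite !big_ord_recr/= (tc_ipDl (sqs k) (tc_sqM _ (he k)) hz) IH.
  by rewrite (tc_adjoint _ (he k) hz).
have := square_function_adj n s0 hz.
have : \sum_(j < n) nrm (e j) ^+ 2 <= \sum_(j < n) (24 * dy s j `^ (- a) * B j) ^+ 2.
  apply: ler_sum => j _; have hj := cutoff_le (dy_gt0 j s0) hh (hB j (ltn_ord j)).
  by rewrite ler_sqr ?nnegrE ?nrm_ge0// (le_trans _ hj)// nrm_ge0.
have : 2 * ip z z <= \sum_(j < n) nrm (e j) ^+ 2 +
    \sum_(j < n) nrm (tc_flip (Jd s j * tc_flip z)) ^+ 2.
  rewrite ipE mulr_sumr -big_split/=; apply: ler_sum => j _.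
  have hf : sq (tc_flip (Jd s j * tc_flip z)).
    by apply: tc_flip_sq; apply: tc_sqM; exact: tc_flip_sq.
  have := ip_le_nrm (he j) hf; have := sqr_ge0 (nrm (e j) - nrm (tc_flip (Jd s j * tc_flip z))).
  move: (nrm _) (nrm _) (ip _ _) => u v w; nra.
rewrite -sqr_nrm; lra.
Qed.

End frac_eq1.

End operational_calculus.

(** * Summation of the scales *)

Section frac_lt1_sum.
Context {R : realType}.
Implicit Types (u c : nat -> R) (th : R).

(** Convexity of the square, at th y + (1 - th) (z / (1 - th)). *)
Lemma sqr_convex th (x y z : R) : 0 <= th < 1 -> 0 <= x -> x <= th * y + z ->
  x ^+ 2 <= th * y ^+ 2 + z ^+ 2 / (1 - th).
Proof.
move=> /andP[th0 th1] x0 h; have d : 0 < 1 - th by lra.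
apply: (@le_trans _ _ ((th * y + z) ^+ 2)).
  by rewrite ler_sqr ?nnegrE// (le_trans x0 h).
rewrite -subr_ge0 (_ : _ - _ = th / (1 - th) * ((1 - th) * y - z) ^+ 2); last first.
  by field; exact: lt0r_neq0.
by rewrite mulr_ge0 ?sqr_ge0// divr_ge0// ltW.
Qed.

(** A discrete Hardy inequality: each step contracts the old value by [th], so that summing the
    squared recursion leaves the factor 1 - th on the left. *)
Lemma forward_sum th u c n : 0 <= th < 1 -> (forall j, 0 <= u j) ->
  (forall j, (j < n)%N -> u j.+1 <= th * u j + c j) ->
  (1 - th) * \sum_(j < n) u j ^+ 2 <= u 0%N ^+ 2 + (\sum_(j < n) c j ^+ 2) / (1 - th).
Proof.
move=> hth u0 hu; have d : 0 <= 1 - th by lra.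
suff : (1 - th) * \sum_(j < n) u j ^+ 2 + u n ^+ 2 <= u 0%N ^+ 2 + (\sum_(j < n) c j ^+ 2) / (1 - th).
  by apply: le_trans; rewrite lerDl sqr_ge0.
elim: n hu => [|n IH] hu; first by rewrite !big_ord0 mulr0 mul0r addr0 add0r.
rewrite !big_ord_recr/= mulrDr [in leRHS]mulrDl.
have := IH (fun j jn => hu j (ltnW jn)); have := sqr_convex hth (u0 n.+1) (hu n (ltnSn n)).
lra.
Qed.

Lemma backward_sum th u c n : 0 <= th < 1 -> (forall j, 0 <= u j) ->
  (forall j, (j < n)%N -> u j <= th * u j.+1 + c j) ->
  (1 - th) * \sum_(j < n) u j ^+ 2 <= u n ^+ 2 + (\sum_(j < n) c j ^+ 2) / (1 - th).
Proof.
move=> hth u0 hu; have d : 0 <= 1 - th by lra.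
have h : u 0%N ^+ 2 + (1 - th) * \sum_(j < n) u j.+1 ^+ 2 <=
    u n ^+ 2 + (\sum_(j < n) c j ^+ 2) / (1 - th).
  elim: n hu => [|n IH] hu; first by rewrite !big_ord0 mulr0 mul0r.
  rewrite !big_ord_recr/= mulrDr [in leRHS]mulrDl.
  have := IH (fun j jn => hu j (ltnW jn)); have := sqr_convex hth (u0 n) (hu n (ltnSn n)).
  lra.
apply: le_trans h; apply: (@le_trans _ _ ((1 - th) * \sum_(j < n.+1) u j ^+ 2)).
  by rewrite ler_wpM2l// big_ord_recr/= lerDl sqr_ge0.
rewrite big_ord_recl/= mulrDr lerD2r ler_piMl ?sqr_ge0//; lra.
Qed.

Lemma combine_bounds (k1 k2 k3 C1 C2 x y z u v : R) : 0 <= k1 -> 0 <= k2 -> 0 <= k3 ->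
  0 < C1 -> 0 < C2 -> 0 <= x -> 0 <= y -> 0 <= z ->
  u <= C1 * (k1 * x + C1 * (k3 * z)) -> v <= C2 * (k2 * y + C2 * (k3 * z)) ->
  2 * (u + v) <= 2 * (C1 * k1 + C1 * C1 * k3 + (C2 * k2 + C2 * C2 * k3)) * (x + y + z).
Proof.
move=> k10 k20 k30 C10 C20 x0 y0 z0 hu hv; set S := x + y + z.
have xS : x <= S by rewrite /S; lra.
have yS : y <= S by rewrite /S; lra.
have zS : z <= S by rewrite /S; lra.
have e k C t : 0 <= k -> 0 < C -> t <= S -> C * (k * t + C * (k3 * z)) <= C * (k * S + C * (k3 * S)).
  move=> k0 C0 tS; apply: ler_wpM2l; first exact: ltW.
  by apply: lerD; [|apply: ler_wpM2l; first exact: ltW]; exact: ler_wpM2l.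
have -> : 2 * (C1 * k1 + C1 * C1 * k3 + (C2 * k2 + C2 * C2 * k3)) * S =
  2 * (C1 * (k1 * S + C1 * (k3 * S)) + C2 * (k2 * S + C2 * (k3 * S))) by ring.
rewrite ler_pM2l//; apply: lerD; first exact: le_trans hu (e _ _ _ k10 C10 xS).
exact: le_trans hv (e _ _ _ k20 C20 yS).
Qed.

Lemma powR2_lt1 (x : R) : x < 0 -> 0 <= (2 : R) `^ x < 1.
Proof.
move=> x0; rewrite powR_ge0 /powR pnatr_eq0/= -[ltRHS]expR0 ltr_expR.
by rewrite nmulr_rlt0// ln_gt0// ltr1n.
Qed.

(** Weighted by the power -(gam + r) of the scale, the rough parts obey a recursion towards larger
    scales with ratio 2^-(gam+r), and the smooth parts one towards smaller scales with ratio
    2^(gam+r-1). Both ratios are below 1 because 0 < gam + r < 1. The recursions start from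
    [nrm_1FJ_frac] at the smallest and [Qf_le] at the largest scale. The constant is chosen before
    the calculus, hence independent of the length of the time interval. *)
Lemma frac_lt1 gam r : 0 <= gam -> 0 < r <= 1 -> gam + r < 1 ->
  exists2 C : R, 0 < C & forall (X : time_calculus R) (g : X) s n, 0 < s -> tc_sq g ->
  exists B : nat -> R, (forall j, split 1 (dy s j) (tc_frac X r * g) (B j)) /\
    \sum_(j < n) (dy s j `^ (- (gam + r)) * B j) ^+ 2 <=
    C * ((dy s 0 `^ (- gam) * nrm ((1 - tc_res X (dy s 0)) * g)) ^+ 2 +
         (dy s n `^ (- gam) * nrm g) ^+ 2 +
         \sum_(j < n) (dy s j `^ (- gam) * nrm (Jd X s j * g)) ^+ 2).
Proof.
move=> g0 hr gr1; have /andP[r0 r1] := hr; set m := gam + r.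
have m0 : 0 < m by rewrite /m; lra.
pose th1 : R := 2 `^ (- m).
pose th2' : R := 2 `^ (m - 1).
have hth1 : 0 <= th1 < 1 by apply: powR2_lt1; lra.
have hth2 : 0 <= th2' < 1 by apply: powR2_lt1; rewrite /m; lra.
have t1 : 0 < 1 - th1 by lra.
have t2 : 0 < 1 - th2' by lra.
pose C1 := (1 - th1)^-1; pose C2 := (1 - th2')^-1.
have C10 : 0 < C1 by rewrite invr_gt0.
have C20 : 0 < C2 by rewrite invr_gt0.
(* The numbers 64, 36 and 576 are the squares of the constants 8 of [nrm_1FJ_frac], 6 of [Qf_le] and
   24 of the two doubling lemmas. *)
pose C := 2 * (C1 * 64 + C1 * C1 * 576 + (C2 * 36 + C2 * C2 * 576)).
have C0 : 0 < C by have := mulr_gt0 C10 C10; have := mulr_gt0 C20 C20; rewrite /C; lra.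
exists C => // X g s n s0 hg.
pose nP j := nrm (Pf r (dy s j) g); pose nQ j := nrm (Qf r (dy s j) g).
exists (fun j => nP j + dy s j * nQ j); split.
  move=> j; exists (Pf r (dy s j) g), (Qf r (dy s j) g); split => //; try exact: tc_sqM.
  by rewrite expr1; apply: PQf; exact: dy_gt0.
pose w j := dy s j `^ (- m).
have w0 j : 0 <= w j := powR_ge0 _ _.
have dr j : w j * dy s j `^ r = dy s j `^ (- gam).
  rewrite /w -powRD; last by apply/implyP => _; exact/lt0r_neq0/dy_gt0.
  by congr (_ `^ _); rewrite /m; ring.
have wS j : w j.+1 = th1 * w j by rewrite /w dyS powRM// ltW ?dy_gt0.
have wS' j : w j * dy s j = th2' * (w j.+1 * dy s j.+1).
  rewrite wS dyS /th1 /th2'.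
  have -> : m - 1 = - (- m + 1) by ring.
  rewrite powRN powRD; last by apply/implyP => _; rewrite pnatr_eq0.
  rewrite powRr1//; have : 2 `^ (- m) != 0 :> R by rewrite gt_eqF// powR_gt0.
  by move: (2 `^ (- m)) => x x0; field.
pose q j := dy s j `^ (- gam) * nrm (Jd X s j * g).
pose u j := w j * nP j; pose v j := w j * dy s j * nQ j.
have u0 j : 0 <= u j by rewrite mulr_ge0 ?nrm_ge0.
have v0 j : 0 <= v j by rewrite mulr_ge0 ?nrm_ge0// mulr_ge0// ltW ?dy_gt0.
have hu j : (j < n)%N -> u j.+1 <= th1 * u j + 24 * q j.
  move=> _; have := Pf_double hr (dy_gt0 j s0) hg; rewrite -dyS -/(Jd X s j) => h.
  have wj : 0 <= th1 * w j by rewrite mulr_ge0//; lra.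
  rewrite /u wS; apply: le_trans (ler_wpM2l wj h) _.
  rewrite mulrDr mulrA lerD2l /q -dr.
  have : 0 <= w j * dy s j `^ r * nrm (Jd X s j * g) by rewrite mulr_ge0 ?nrm_ge0// mulr_ge0 ?powR_ge0.
  move=> z0.
  have -> : th1 * w j * (24 * dy s j `^ r * nrm (Jd X s j * g)) =
    th1 * (24 * (w j * dy s j `^ r * nrm (Jd X s j * g))) by ring.
  apply: ler_piMl; first by rewrite mulr_ge0.
  by case/andP: hth1 => _ /ltW.
have hv j : (j < n)%N -> v j <= th2' * v j.+1 + 24 * q j.
  move=> _; have := Qf_double hr (dy_gt0 j s0) hg; rewrite -dyS -/(Jd X s j) => h.
  have d0 := dy_gt0 j s0.
  have wj : 0 <= w j * dy s j by rewrite mulr_ge0// ltW.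
  have -> : th2' * v j.+1 = w j * dy s j * nQ j.+1 by rewrite wS' /v !mulrA.
  apply: le_trans (ler_wpM2l wj h) _; rewrite mulrDr; apply: lerD; first by [].
  rewrite /q -dr le_eqVlt; apply/orP; left; apply/eqP; field; exact: lt0r_neq0.
have b1 := forward_sum hth1 u0 hu; have b2 := backward_sum hth2 v0 hv.
set S0 := (_ * nrm ((1 - _) * g)); set Sn := (_ * nrm g); set Sq := \sum_(j < n) (_ * nrm _) ^+ 2.
have eq : \sum_(j < n) (24 * q j) ^+ 2 = 576 * Sq.
  by rewrite mulr_sumr; apply: eq_bigr => j _; rewrite exprMn; congr (_ * _); ring.
have bu : u 0%N ^+ 2 <= 64 * S0 ^+ 2.
  rewrite (_ : 64 * S0 ^+ 2 = (8 * S0) ^+ 2); last by ring.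
  have := nrm_1FJ_frac (dy_gt0 0 s0) hr hg => h.
  have S00 : 0 <= S0 by rewrite mulr_ge0 ?nrm_ge0 ?powR_ge0.
  rewrite ler_sqr ?nnegrE//; last by lra.
  apply: le_trans (ler_wpM2l (w0 0%N) h) _; rewrite /S0 -dr; lra.
have bv : v n ^+ 2 <= 36 * Sn ^+ 2.
  rewrite (_ : 36 * Sn ^+ 2 = (6 * Sn) ^+ 2); last by ring.
  have d0 := dy_gt0 n s0; have := Qf_le hr d0 hg => h.
  have Sn0 : 0 <= Sn by rewrite mulr_ge0 ?nrm_ge0 ?powR_ge0.
  rewrite ler_sqr ?nnegrE//; last by lra.
  have wj : 0 <= w n * dy s n by rewrite mulr_ge0// ltW.
  apply: le_trans (ler_wpM2l wj h) _.
  by rewrite /Sn -dr le_eqVlt; apply/orP; left; apply/eqP; field; exact: lt0r_neq0.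
have bb : \sum_(j < n) (w j * (nP j + dy s j * nQ j)) ^+ 2 <=
    2 * (\sum_(j < n) u j ^+ 2 + \sum_(j < n) v j ^+ 2).
  rewrite -big_split/= mulr_sumr; apply: ler_sum => j _.
  rewrite mulrDr mulrA -/(u j) -/(v j); have := sqr_ge0 (u j - v j); nra.
apply: le_trans bb _.
have Sq0 : 0 <= Sq by apply: sumr_ge0 => j _; exact: sqr_ge0.
have S00 : 0 <= S0 ^+ 2 by exact: sqr_ge0.
have Sn0 : 0 <= Sn ^+ 2 by exact: sqr_ge0.
have d1 : \sum_(j < n) u j ^+ 2 <= C1 * (64 * S0 ^+ 2 + C1 * (576 * Sq)).
  rewrite -(ler_pM2l t1) mulrA mulfV ?gt_eqF// mul1r.
  apply: le_trans b1 _; rewrite eq; apply: lerD => //.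
  by rewrite mulrC.
have d2 : \sum_(j < n) v j ^+ 2 <= C2 * (36 * Sn ^+ 2 + C2 * (576 * Sq)).
  rewrite -(ler_pM2l t2) mulrA mulfV ?gt_eqF// mul1r.
  apply: le_trans b2 _; rewrite eq; apply: lerD => //.
  by rewrite mulrC.
exact: (combine_bounds (ler0n _ _) (ler0n _ _) (ler0n _ _) C10 C20 S00 Sn0 Sq0 d1 d2).
Qed.

End frac_lt1_sum.

(** * Weak derivatives *)

Section bump_functions.
Context {R : realType}.
Implicit Types (a b e t x : R) (j k : nat) (f g : R -> R).

(** The negative powers of x in front of exp(-e/x) make the span of this family closed under
    differentiation. *)
Definition bmon e k x : R := if 0 < x then x^-1 ^+ k * expR (- (e * x^-1)) else 0.

Lemma expR_ge_pow x k : 0 <= x -> (x / k.+1%:R) ^+ k.+1 <= expR x.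
Proof.
move=> x0; have -> : expR x = expR (x / k.+1%:R) ^+ k.+1.
  by rewrite -expRM_natl mulrC divfK// pnatr_eq0.
apply: lerXn2r; rewrite ?nnegrE ?expR_ge0 ?divr_ge0//.
by apply: le_trans (expR_ge1Dx _); rewrite lerDr.
Qed.

(** The exponential exp(e/x) beats the power k + 2 of 1/x. The quadratic bound yields derivative 0
    at the gluing point 0, for all k at once. *)
Lemma bmon_le e k x : 0 < e -> `|bmon e k x| <= (k.+2%:R / e) ^+ k.+2 * x ^+ 2.
Proof.
move=> e0; have c0 : 0 <= (k.+2%:R / e) ^+ k.+2 by rewrite exprn_ge0// divr_ge0// ltW.
rewrite /bmon; case: ifPn => [x0|_]; last by rewrite normr0 mulr_ge0 ?sqr_ge0.
have xi : 0 < x^-1 by rewrite invr_gt0.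
rewrite ger0_norm ?mulr_ge0 ?expR_ge0 ?exprn_ge0 ?(ltW xi)//.
rewrite expRN ler_pdivrMr ?expR_gt0//.
have h := expR_ge_pow k.+1 (ltW (mulr_gt0 e0 xi)).
apply: (@le_trans _ _ ((k.+2%:R / e) ^+ k.+2 * x ^+ 2 * (e * x^-1 / k.+2%:R) ^+ k.+2)).
  have -> : (k.+2%:R / e) ^+ k.+2 * x ^+ 2 * (e * x^-1 / k.+2%:R) ^+ k.+2 =
      ((k.+2%:R / e) * (e / k.+2%:R)) ^+ k.+2 * (x ^+ 2 * x^-1 ^+ k.+2).
    by rewrite !exprMn; ring.
  have -> : k.+2%:R / e * (e / k.+2%:R) = 1.
    by rewrite mulrA divfK ?gt_eqF// mulfV// pnatr_eq0.
  have -> : x^-1 ^+ k.+2 = x^-1 ^+ 2 * x^-1 ^+ k by rewrite -exprD.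
  by rewrite expr1n mul1r mulrA -exprMn mulfV ?gt_eqF// expr1n mul1r.
by rewrite ler_wpM2l// mulr_ge0// sqr_ge0.
Qed.

Lemma is_derive_sqr_bound f (C : R) : f 0 = 0 -> (forall x, `|f x| <= C * x ^+ 2) ->
  is_derive (0 : R) 1 f 0.
Proof.
move=> f0 fC; have C0 : 0 <= C by have := fC 1; rewrite expr1n mulr1; exact: le_trans.
have cv : h^-1 *: ((f \o shift 0) (h *: (1 : R)) - f 0) @[h --> (0 : R)^'] --> (0 : R).
  apply/cvgrPdist_le => /= d d0; near=> h.
  rewrite sub0r normrN addr0 scaler1 f0 subr0 normrZ normfV.
  have h0 : h != 0 by near: h; exact: nbhs_dnbhs_neq.
  rewrite mulrC ler_pdivrMr ?normr_gt0//; apply: le_trans (fC h) _.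
  have -> : h ^+ 2 = `|h| * `|h| by rewrite -expr2 real_normK ?num_real.
  rewrite mulrA ler_wpM2r//.
  have hd : `|h| <= d / (C + 1).
    near: h; apply: dnbhs0_le; rewrite divr_gt0//; lra.
  apply: le_trans (ler_wpM2l C0 hd) _.
  by rewrite mulrCA ler_piMr ?(ltW d0)// ler_pdivrMr ?mul1r; lra.
by apply: DeriveDef; [apply/cvg_ex; exists 0; exact: cv|exact: cvg_lim cv].
Unshelve. all: by end_near. Qed.

Lemma is_derive_bmon e k x : 0 < e ->
  is_derive x 1 (bmon e k) (- k%:R * bmon e k.+1 x + e * bmon e k.+2 x).
Proof.
move=> e0; have [x0|x0|->] := ltgtP x 0.
- rewrite /bmon ltNge (ltW x0)/= !mulr0 addr0.
  apply: (near_eq_is_derive _ (is_derive_cst (0 : R) x (1 : R))).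
  have : \forall y \near x, y < 0 by exact: lt_nbhsl.
  by apply: filterS => y y0; rewrite /= ltNge (ltW y0).
- have D1 : is_derive x 1 (fun y : R => y^-1) (- x ^- 2).
    have := @is_deriveV _ (fun y : R => y) x 1 1.
    rewrite gt_eqF// => /(_ isT (is_derive_id _ _)) h; apply: is_derive_eq.
    by rewrite /GRing.scale/= mulr1.
  have D2 : is_derive x 1 (fun y : R => - (e * y^-1)) (e * x ^- 2).
    rewrite (_ : (fun y : R => _) = (- e) \*: (fun y : R => y^-1)); last first.
      by apply/funext => y /=; rewrite /GRing.scale/= mulNr.
    by apply: is_derive_eq; rewrite /GRing.scale/= mulrNN.
  have D3 := @is_derive1_comp R expR (fun y : R => - (e * y^-1)) x _ _ (is_derive_expR _) D2.
  have D4 : is_derive x 1 ((fun y : R => y^-1) ^+ k) ((k%:R * x^-1 ^+ k.-1) *: (- x ^- 2)).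
    exact: is_deriveX.
  have D5 := is_deriveM D4 D3.
  apply: (@near_eq_is_derive _ _ _ (((fun y : R => y^-1) ^+ k) * (expR \o (fun y : R => - (e * y^-1))))).
    have : \forall y \near x, 0 < y by exact: lt_nbhsr.
    apply: filterS => y y0; rewrite /bmon y0 /= /GRing.mul/=; congr (_ * _).
    by rewrite fctE.
  apply: (is_derive_eq D5); rewrite /bmon x0 /GRing.scale/= fctE.
  have -> : x ^- 2 = x^-1 * x^-1 by rewrite -exprVn expr2.
  case: k D4 D5 => [|k] D4 D5 /=; last by rewrite !exprS; ring.
  by rewrite !expr0 !exprS expr0; ring.
have -> : - k%:R * bmon e k.+1 0 + e * bmon e k.+2 0 = 0.
  by rewrite /bmon ltxx !mulr0 addr0.
apply: (@is_derive_sqr_bound _ ((k.+2%:R / e) ^+ k.+2)); first by rewrite /bmon ltxx.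
by move=> t; exact: bmon_le.
Qed.

(** A class of functions that contains the bumps and is stable under differentiation, so that
    smoothness needs a single induction. *)
Inductive bumpf : (R -> R) -> Prop :=
| bump_mon a b e j k : 0 < e -> bumpf (fun t => bmon e j (t - a) * bmon e k (b - t))
| bump_lin c f g : bumpf f -> bumpf g -> bumpf (fun t => c * f t + g t).

Lemma bumpf_derive f : bumpf f -> exists2 g, bumpf g & forall t, is_derive t 1 f (g t).
Proof.
elim => [a b e j k e0|c g h _ [g' bg Dg] _ [h' bh Dh]]; last first.
  exists (fun t => c * g' t + h' t); first exact: bump_lin.
  move=> t; rewrite (_ : (fun t => c * g t + h t) = (c \*: g) + h)//.
  by apply: is_derive_eq; rewrite /GRing.scale.
pose M j k := fun t : R => bmon e j (t - a) * bmon e k (b - t).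
have bM j' k' : bumpf (M j' k') by exact: bump_mon.
(* The coefficient -e of the fourth term is written as (-e - 1) + 1, because the constructor
   [bump_lin] requires a last summand without coefficient. *)
exists (fun t => - j%:R * M j.+1 k t + (e * M j.+2 k t + (k%:R * M j k.+1 t +
    ((- e - 1) * M j k.+2 t + M j k.+2 t)))).
  by do 3 apply: bump_lin => //; exact: bump_lin.
move=> t.
have d1 : is_derive t 1 (fun t => t - a) 1.
  by apply: is_derive_eq; rewrite subr0.
have d2 : is_derive t 1 (fun t => b - t) (- 1).
  rewrite (_ : (fun t => b - t) = - (fun t => t - b)); last by apply/funext => x /=; rewrite fctE opprB.
  by apply: is_deriveN; apply: is_derive_eq; rewrite subr0.
have D1 := @is_derive1_comp R (bmon e j) (fun t : R => t - a) t _ _ (is_derive_bmon j (t - a) e0) d1.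
have D2 := @is_derive1_comp R (bmon e k) (fun t : R => b - t) t _ _ (is_derive_bmon k (b - t) e0) d2.
apply: (is_derive_eq (is_deriveM D1 D2)).
by rewrite /M /GRing.scale/=; ring.
Qed.

Lemma derive1_is_derive f g : (forall t, is_derive t 1 f (g t)) -> f^`()%classic = g.
Proof. by move=> h; apply/funext => t; rewrite derive1E; exact: derive_val. Qed.

Lemma bumpf_smooth f : bumpf f -> smooth f.
Proof.
move=> bf n t; suff [h] : exists2 h, bumpf h & h = (f^`(n))%classic.
  by move=> /bumpf_derive[g _ Dg] <-; have [] := Dg t.
elim: n => [|n [h bh hE]]; first by exists f.
have [g bg Dg] := bumpf_derive bh; exists g => //.
by rewrite derive1nS -hE (derive1_is_derive Dg).
Qed.

Lemma bumpf_continuous f : bumpf f -> continuous f.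
Proof.
move=> /bumpf_derive[g _ Dg] t; apply: differentiable_continuous; apply/derivable1_diffP.
by have [] := Dg t.
Qed.

(** For [e] tending to 0 these functions converge pointwise to the indicator of (a,b), staying below
    1. *)
Definition bump a b e t : R := bmon e 0 (t - a) * bmon e 0 (b - t).

Lemma bump_bumpf a b e : 0 < e -> bumpf (bump a b e).
Proof. exact: bump_mon. Qed.

Lemma bump_out a b e t : ~ a < t < b -> bump a b e t = 0.
Proof.
rewrite /bump /bmon !subr_gt0 => /negP; rewrite negb_and => /orP[] /negbTE ->.
  by rewrite mul0r.
by rewrite mulr0.
Qed.

Lemma bump_in a b e t : a < t < b -> bump a b e t = expR (- (e * ((t - a)^-1 + (b - t)^-1))).
Proof.
move=> /andP[h1 h2]; rewrite /bump /bmon !subr_gt0 h1 h2 !expr0 !mul1r -expRD.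
by congr expR; ring.
Qed.

Lemma bump_le1 a b e t : 0 < e -> 0 <= bump a b e t <= 1.
Proof.
move=> e0; have [h|h] := pselect (a < t < b); last by rewrite bump_out// lexx ler01.
rewrite bump_in// expR_ge0/= -expR0 ler_expR oppr_le0 mulr_ge0 ?(ltW e0)//.
by have /andP[h1 h2] := h; rewrite addr_ge0// invr_ge0 subr_ge0 ltW.
Qed.

Lemma measurable_bump a b e : 0 < e -> measurable_fun setT (bump a b e).
Proof.
by move=> e0; apply: continuous_measurable_fun; apply: bumpf_continuous; exact: bump_bumpf.
Qed.

End bump_functions.

(** * The du Bois-Reymond lemma *)

Section du_bois_reymond.
Context {R : realType} (T : R).
Hypothesis T0 : 0 < T.
Local Notation mu := (@lebesgue_measure R).
Local Notation DT := `]0, T[%classic.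
Implicit Types (V f g psi : R -> R) (a b c t : R).

Lemma bump_cvg V a b : L1T T V -> 0 < a -> a < b -> b < T ->
  \int[mu]_(t in DT) (V t * bump a b n.+1%:R^-1 t) @[n --> \oo] --> \int[mu]_(t in `]a, b[) V t.
Proof.
move=> LV a0 ab bT.
have mV : measurable_fun DT V by apply/measurable_EFinP; exact: measurable_int LV.
have e0 n : 0 < n.+1%:R^-1 :> R by rewrite invr_gt0.
pose g t := V t * ((a < t < b)%R)%:R.
have mf n : measurable_fun DT (fun t => V t * bump a b n.+1%:R^-1 t).
  by apply: measurable_funM => //; apply: measurable_funTS; exact: measurable_bump.
have sub : `]a, b[%classic `<=` DT.
  move=> t /=; rewrite !in_itv/= => /andP[h1 h2].
  by rewrite (lt_trans a0 h1) (lt_trans h2 bT).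
have E : \int[mu]_(t in `]a, b[) V t = \int[mu]_(t in DT) g t.
  rewrite Rintegral_mkcond [RHS]Rintegral_mkcond; apply: eq_Rintegral => t _.
  rewrite !patchE !mem_setE !in_itv/= /g; case: (boolP (a < t < b)) => [/andP[h1 h2]|_].
    by rewrite (lt_trans a0 h1) (lt_trans h2 bT)/= mulr1.
  by rewrite mulr0; case: ifP.
have dom n t : DT t -> (`|(V t * bump a b n.+1%:R^-1 t)%:E| <= `|V t|%:E)%E.
  move=> _; rewrite /= lee_fin normrM ler_piMr//.
  have /andP[h1 h2] := bump_le1 a b t (e0 n); by rewrite ger0_norm.
have mg : measurable_fun DT g.
  apply: measurable_funM => //; apply: measurable_funTS.
  rewrite (_ : (fun t => _) = \1_`]a, b[) //; apply/funext => t.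
  by rewrite indicE mem_setE in_itv.
have cv t : DT t -> (fun n => (V t * bump a b n.+1%:R^-1 t)%:E) @ \oo --> (g t)%:E.
  move=> _; apply: cvg_EFin; first exact: nearW.
  apply: cvgM; first exact: cvg_cst.
  case: (boolP (a < t < b)) => h; last first.
    by apply: cvg_near_cst; apply: nearW => n; apply: bump_out; exact/negP.
  under eq_fun do rewrite bump_in//.
  have c0 : - (n.+1%:R^-1 * ((t - a)^-1 + (b - t)^-1)) @[n --> \oo] --> (- 0 : R).
    apply: cvgN; rewrite -[X in _ --> X](mul0r ((t - a)^-1 + (b - t)^-1)).
    by apply: cvgM; [exact: cvg_harmonic|exact: cvg_cst].
  have := cvg_comp _ _ c0 (@continuous_expR R (- 0)).
  by rewrite oppr0 expR0.
have iabs : mu.-integrable DT (fun t => `|V t|%:E) by exact: (integrable_abse LV).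
have [ig _ C] := @dominated_convergence _ _ _ mu DT (measurable_itv _)
  (fun n t => (V t * bump a b n.+1%:R^-1 t)%:E) (EFin \o g) (fun t => `|V t|%:E)
  (fun n => ltac:(apply/measurable_EFinP; exact: mf))
  (ltac:(apply/measurable_EFinP; exact: mg)) (ae_all cv) iabs
  (ltac:(by apply: ae_all => t; move=> Dt n; exact: dom)).
rewrite E /Rintegral; apply: fine_cvg; rewrite fineK; first exact: C.
exact: (integrable_fin_num _ ig).
Qed.

(** The mean value 0 is what makes the primitive of [f] vanish beyond [b], and hence a test
    function. *)
Lemma test_primitive f a b : 0 < a -> a < b -> b < T -> bumpf f ->
  (forall t, ~ a < t < b -> f t = 0) -> \int[mu]_(t in DT) f t = 0 ->
  exists2 psi, test_time T psi & (psi^`())%classic = f.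
Proof.
move=> a0 ab bT bf f0 If; have cf := bumpf_continuous bf.
have itf c d : mu.-integrable `[c, d] (EFin \o f).
  by apply: continuous_compact_integrable; [exact: segment_compact|exact: continuous_subspaceT].
(* The lower limit lies strictly to the left of the support, so that every point of [a,b] is
   interior for the fundamental theorem. *)
pose psi t := \int[mu]_(s in `[-1, t]) f s.
have psi_l t : t < a -> psi t = 0.
  move=> ta; rewrite /psi /Rintegral integral0_eq// => s; rewrite /= in_itv/= => /andP[_ st].
  by rewrite f0// => /andP[/lt_le_trans/(_ st)/(lt_trans ta)]; rewrite ltxx.
have D t : is_derive t 1 psi (f t).
  have [ta|at_] := ltP t a.
    rewrite f0; last by lra.
    apply: (near_eq_is_derive _ (is_derive_cst (0 : R) t (1 : R))).
    have : \forall y \near t, y < a by exact: lt_nbhsl.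
    by apply: filterS => y ya; rewrite psi_l.
  have t1 : -1 < t by lra.
  have [d1 d2] := continuous_FTC1_closed (ltr_pwDr ltr01 (lexx t)) (itf (-1) (t + 1)) t1 (cf t).
  by apply: (DeriveDef d1); rewrite -derive1E; exact: d2.
have psi' := derive1_is_derive D.
exists psi => //; split.
  move=> [|n] t; first by have [] := D t.
  by rewrite derive1Sn psi'; exact: bumpf_smooth.
exists `[a, b]%classic; split; first exact: segment_compact.
  by move=> t /=; rewrite !in_itv/= => /andP[/(lt_le_trans a0)-> /le_lt_trans->].
move=> t /negP; rewrite in_itv/= negb_and -!ltNge => /orP[|tb]; first exact: psi_l.
rewrite -If /psi Rintegral_mkcond [RHS]Rintegral_mkcond; apply: eq_Rintegral => s _.
rewrite !patchE !mem_setE !in_itv/=; case: (pselect (a < s < b)) => [/andP[h1 h2]|h].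
  by rewrite (lt_trans a0 h1) (lt_trans h2 bT)/= (ltW (lt_trans h2 tb)) andbT (le_trans _ (ltW h1))//; lra.
by rewrite f0//; case: ifP; case: ifP.
Qed.

Lemma primitiveB V a b : L1 V -> 0 <= a -> a < b ->
  \int[mu]_(t in `]0, b[) V t = \int[mu]_(t in `]0, a[) V t + \int[mu]_(t in `]a, b[) V t.
Proof.
move=> LV a0 ab; have iV (D : set (measurableTypeR R)) : measurable D -> mu.-integrable D (EFin \o V).
  by move=> mD; apply: integrableS LV.
rewrite (primitiveE a LV).1 -Rintegral_setU//.
- congr Rintegral; apply/seteqP; split => t /=; rewrite !in_itv/=.
    by move=> /andP[-> tb]/=; case: (leP t a) => h; [left|right; rewrite tb].
  by move=> [/andP[-> /le_lt_trans->]|/andP[h ->]]//; rewrite (le_lt_trans a0 h).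
- apply: iV; exact: measurableU.
- apply/disj_set2P; apply/seteqP; split => // t [] /=; rewrite !in_itv/=.
  by move=> /andP[_ h1] /andP[h2 _]; have := lt_le_trans h2 h1; rewrite ltxx.
Qed.

(** A bump minus the multiple of a fixed bump with the same integral is the derivative of a test
    function. So V has the same integrals as a constant c against all bumps, then over all intervals
    by letting the bumps sharpen, and the primitive of V - c is constant. *)
Lemma du_bois_reymond V : L1T T V ->
  (forall psi, test_time T psi -> \int[mu]_(t in DT) (V t * (psi^`())%classic t) = 0) ->
  exists c, {ae mu, forall t, DT t -> V t = c}.
Proof.
move=> LV h; pose a0 := T / 4; pose b0 := 3 * a0.
have a00 : 0 < a0 by rewrite divr_gt0.
have TE : T = 4 * a0 by rewrite /a0; field.
have ab0 : a0 < b0 by rewrite /b0; clear -a00; lra.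
have bT0 : b0 < T by rewrite TE /b0; clear -a00; lra.
have mV : measurable_fun DT V by apply/measurable_EFinP; exact: measurable_int LV.
have Lb a b e : 0 < e -> L1T T (bump a b e).
  move=> e0; have [] := Lsq_emb (@sqi_bounded _ T (bump a b e) 1 _ _) => //.
    by apply: measurable_funTS; exact: measurable_bump.
  by move=> t _; have /andP[h1 h2] := bump_le1 a b t e0; rewrite ger0_norm.
have LVb a b e : 0 < e -> L1T T (fun t => V t * bump a b e t).
  move=> e0; apply: (le_integrable _ _ _ LV) => //.
    by apply/measurable_EFinP; apply: measurable_funM => //; apply: measurable_funTS; exact: measurable_bump.
  move=> t _; rewrite lee_fin normrM ler_piMr//.
  by have /andP[h1 h2] := bump_le1 a b t e0; rewrite ger0_norm.
pose m2 := \int[mu]_(t in DT) bump a0 b0 1 t.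
have m20 : m2 != 0.
  apply/eqP => m2E; have L := Lb a0 b0 1 ltr01.
  have : norm1 (tr T (bump a0 b0 1)) = 0.
    apply: EFin_inj; rewrite norm1_tr//; transitivity m2%:E; last by rewrite m2E.
    rewrite /m2 /Rintegral fineK; last exact: integrable_fin_num L.
      by apply: eq_integral => t _; have /andP[h1 _] := bump_le1 a0 b0 t ltr01; rewrite ger0_norm.
  move=> /(norm1_eq0 (L1_tr L)) /(ae_nonempty_itv ab0)[t tab].
  rewrite trE; last first.
    have /andP[h1 h2] := tab; rewrite /= in_itv/= (lt_trans a00 h1) (lt_trans h2 bT0)//.
  by rewrite bump_in// => /eqP; rewrite gt_eqF// expR_gt0.
pose c := (\int[mu]_(t in DT) (V t * bump a0 b0 1 t)) / m2.
have hb a b e : 0 < a -> a < b -> b < T -> 0 < e ->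
    \int[mu]_(t in DT) (V t * bump a b e t) = c * \int[mu]_(t in DT) bump a b e t.
  move=> ha hab hbT e0; pose k := (\int[mu]_(t in DT) bump a b e t) / m2.
  pose f t := - k * bump a0 b0 1 t + bump a b e t.
  have L1' := Lb a0 b0 1 ltr01; have L2 := Lb a b e e0.
  have bf : bumpf f by apply: bump_lin; exact: bump_bumpf.
  pose a1 := Num.min a a0; pose b1 := Num.max b b0.
  have a10 : 0 < a1 by rewrite lt_min ha.
  have b1T : b1 < T by rewrite gt_max hbT.
  have ab1 : a1 < b1 by rewrite lt_max gt_min hab.
  have f0 t : ~ a1 < t < b1 -> f t = 0.
    move=> nt; rewrite /f !bump_out ?mulr0 ?addr0// => /andP[h1 h2]; apply: nt;
      by rewrite gt_min lt_max h1 h2 ?orbT.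
  have If : \int[mu]_(t in DT) f t = 0.
    rewrite /f RintegralD//; last exact: L1TZ.
    by rewrite RintegralZl// /k mulNr divfK// addNr.
  have [psi tp psiE] := test_primitive a10 ab1 b1T bf f0 If.
  have := h psi tp; rewrite psiE.
  have -> : \int[mu]_(t in DT) (V t * f t) =
      \int[mu]_(t in DT) (- k * (V t * bump a0 b0 1 t) + V t * bump a b e t).
    by apply: eq_Rintegral => t _; rewrite /f; ring.
  rewrite RintegralD//; [|exact: L1TZ (LVb _ _ _ ltr01)|exact: LVb].
  rewrite RintegralZl//; last exact: LVb.
  rewrite /c /k; move: (\int[mu]_(t in DT) (V t * bump a0 b0 1 t)) => p /eqP.
  rewrite mulNr addrC subr_eq0 => /eqP ->; field; exact: m20.
have hitv a b : 0 < a -> a < b -> b < T -> \int[mu]_(t in `]a, b[) V t = c * \int[mu]_(t in `]a, b[) 1.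
  move=> ha hab hbT; have e0 n : 0 < n.+1%:R^-1 :> R by rewrite invr_gt0.
  apply: (cvg_unique _ (bump_cvg LV ha hab hbT)) => //.
  have -> : (fun n => \int[mu]_(t in DT) (V t * bump a b n.+1%:R^-1 t)) =
    (fun n => c * \int[mu]_(t in DT) (1 * bump a b n.+1%:R^-1 t)).
    apply/funext => n; rewrite hb//; congr (_ * _); apply: eq_Rintegral => t _.
    by rewrite mul1r.
  by apply: cvgM; [exact: cvg_cst|exact: (bump_cvg (L1T_cst T 1))].
exists c; pose z t := V t + - c * 1.
have Lz : L1T T z by apply: L1TD => //; exact: L1TZ (L1T_cst T 1).
have gz := good_tr Lz.
have zitv a b : 0 < a -> a < b -> b < T -> \int[mu]_(t in `]a, b[) tr T z t = 0.
  move=> ha hab hbT.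
  have sub : `]a, b[%classic `<=` DT.
    by move=> t /=; rewrite !in_itv/= => /andP[h1 h2]; rewrite (lt_trans ha h1) (lt_trans h2 hbT).
  have Ls g : L1T T g -> mu.-integrable `]a, b[ (EFin \o g) by apply: integrableS.
  have -> : \int[mu]_(t in `]a, b[) tr T z t = \int[mu]_(t in `]a, b[) z t.
    by apply: eq_Rintegral => t; rewrite inE => /sub; exact: trE.
  rewrite /z RintegralD//; [|exact: Ls|exact: Ls (L1TZ _ (L1T_cst T 1))].
  by rewrite RintegralZl ?hitv// ?mulNr ?subrr//; exact: Ls (L1T_cst T 1).
have : {ae mu, forall t, tr T z t = 0}.
  apply: (@ae_cst_primitive _ _ T (\int[mu]_(s in `]0, (T / 2)[) tr T z s)) => //.
  apply: ae_all => t /andP[t0 tT].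
  have T2 : 0 < T / 2 by rewrite divr_gt0.
  have T2T : T / 2 < T by rewrite ltr_pdivrMr// ltr_pMr// ltr1n.
  have [h1|h1|->//] := ltgtP t (T / 2).
    by rewrite (primitiveB (good_L1 gz) (ltW t0) h1) zitv ?addr0.
  by rewrite (primitiveB (good_L1 gz) (ltW T2) h1) zitv ?addr0.
by apply: aeW => t /[swap] Dt; rewrite trE// /z mulr1 => /eqP; rewrite subr_eq0 => /eqP.
Qed.

End du_bois_reymond.

(** * Weak derivatives as equations in the algebra *)

Section weak_derivatives.
Context {R : realType} (T : R).
Hypothesis T0 : 0 < T.
Local Notation mu := (@lebesgue_measure R).
Local Notation DT := `]0, T[%classic.
Local Notation sqT := (square_integrable mu DT).
Local Notation Ic := (Ic T).
Implicit Types (v g psi : R -> R).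

Lemma sqT_L1T v : sqT v -> L1T T v. Proof. by move=> /Lsq_emb[]. Qed.

Lemma sqT_Lsq v : sqT v -> Lsq (emb T v). Proof. by move=> /Lsq_emb[]. Qed.

Lemma test_continuous psi : smooth psi -> continuous psi /\ continuous (psi^`())%classic.
Proof.
move=> sp; split=> t; apply: differentiable_continuous; apply/derivable1_diffP.
  exact: (sp 0%N t).
exact: (sp 1%N t).
Qed.

Lemma continuous_sqT v : continuous v -> sqT v.
Proof.
move=> cv; split; first by apply: measurable_funTS; exact: continuous_measurable_fun.
have cv2 : continuous (fun t => v t ^+ 2).
  rewrite (_ : (fun t => _) = (fun t => v t * v t)); last by apply/funext => t; rewrite expr2.
  by move=> t; apply: cvgM; exact: cv.
have : mu.-integrable `[0, T] (EFin \o (fun t => v t ^+ 2)).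
  by apply: continuous_compact_integrable; [exact: segment_compact|exact: continuous_subspaceT].
move=> /integrableP[_]; apply: le_lt_trans.
apply: (@le_trans _ _ (\int[mu]_(t in `[0%R, T]) (v t ^+ 2)%:E)%E).
  apply: ge0_subset_integral => //.
  - by apply/measurable_EFinP; apply: measurable_funTS; exact: continuous_measurable_fun.
  - by move=> t _; rewrite lee_fin sqr_ge0.
  - exact: subset_itv_oo_cc.
rewrite le_eqVlt; apply/orP; left; apply/eqP; apply: eq_integral => t _ /=.
by rewrite ger0_norm ?sqr_ge0.
Qed.

Lemma test_FTC psi : test_time T psi ->
  Ic * emb T (psi^`())%classic = emb T psi /\ \int[mu]_(t in DT) (psi^`())%classic t = 0.
Proof.
move=> [sp [K [_ KT psi0]]]; have [cp cp'] := test_continuous sp.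
have L := sqT_L1T (continuous_sqT cp').
have h t : 0 < t -> \int[mu]_(s in `]0, t[) (psi^`())%classic s = psi t.
  move=> t0; have ip : mu.-integrable `[0, t] (EFin \o (psi^`())%classic).
    by apply: continuous_compact_integrable; [exact: segment_compact|exact: continuous_subspaceT].
  have p0 : psi 0 = 0 by apply: psi0 => /KT; rewrite /= in_itv/= ltxx.
  rewrite /Rintegral integral_itv_bndo_bndc; last first.
    by apply/measurable_EFinP; apply: measurable_funTS; exact: continuous_measurable_fun.
  rewrite integral_itv_obnd_cbnd; last first.
    by apply/measurable_EFinP; apply: measurable_funTS; exact: continuous_measurable_fun.
  rewrite (@continuous_FTC2 _ _ psi)// ?p0 ?sube0//.
    exact: continuous_subspaceT.
  split.
  - by move=> s _; exact: (sp 0%N s).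
  - by apply: cvg_at_right_filter; exact: cp.
  - by apply: cvg_at_left_filter; exact: cp.
split; last first.
  by rewrite h//; apply: psi0 => /KT; rewrite /= in_itv/= ltxx andbF.
rewrite Ic_emb//; apply/emb_eq; [exact: L1T_primitive|exact: sqT_L1T (continuous_sqT cp)|].
by apply: ae_all => t; rewrite /= in_itv/= => /andP[t0 _]; exact: h.
Qed.

Lemma ip_embE v g : sqT v -> sqT g -> \int[mu]_(t in DT) (v t * g t) = ip (emb T v) (emb T g).
Proof.
move=> sv sg; rewrite ipE//; [exact: sqT_L1T|exact: sqT_L1T|].
by apply: measurable_funM; [case: sv|case: sg].
Qed.

Lemma Rintegral_emb v : L1T T v -> \int[mu]_t fun_part (emb T v) t = \int[mu]_(t in DT) v t.
Proof.
move=> Lv; rewrite [RHS]Rintegral_mkcond /Rintegral; congr fine; apply: ae_eq_integral => //.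
- by apply/measurable_EFinP; exact: good_meas (good_fun _).
- by apply/measurable_EFinP; exact: good_meas (good_tr Lv).
- by have := fun_part_mk 0 (good_tr Lv); apply: aeW => t /= ->.
Qed.

(** Integration by parts: the adjoint of Ic integrates over (t,T), and applied to psi' it yields
    -psi since psi' has mean 0. *)
Lemma ip_Ic_test (x : calg T) psi : Lsq x -> test_time T psi ->
  ip (Ic * x) (emb T (psi^`())%classic) = - ip x (emb T psi).
Proof.
move=> hx tp; have [cp cp'] := test_continuous tp.1; have [E E0] := test_FTC tp.
have s' := continuous_sqT cp'.
set y := emb T (psi^`())%classic; have hy : Lsq y := sqT_Lsq s'.
rewrite (adjoint _ hx hy); have := Ic_refl (hy.1 : cst_part y = 0); rewrite E.
rewrite Rintegral_emb ?E0; last exact: sqT_L1T.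
rewrite rmorph0 mul0r => /eqP; rewrite addrC addr_eq0 => /eqP ->.
by rewrite ipNr.
Qed.

Lemma weak_deriv_of_alg v g c : sqT v -> sqT g ->
  emb T v = Ic * emb T g + cst_alg T c * Ic -> weak_deriv T v g.
Proof.
move=> sv sg E; split; [exact: sqT_L1T|exact: sqT_L1T|move=> psi tp].
have [cp cp'] := test_continuous tp.1.
have s1 := continuous_sqT cp; have s2 := continuous_sqT cp'.
have hg := sqT_Lsq sg; have h2 := sqT_Lsq s2.
rewrite !ip_embE// E (ipDl (LsqM _ hg) (LsqZ c (Lsq_Ic T)) h2) ip_Ic_test// ipZl.
have -> : ip Ic (emb T (psi^`())%classic) = 0.
  rewrite -ip_embE//; last exact: sqi_cst.
  by rewrite -[RHS](test_FTC tp).2; apply: eq_Rintegral => t _; rewrite mul1r.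
by rewrite mulr0 addr0.
Qed.

(** The difference of [v] and the primitive of [g] is orthogonal to all psi', hence constant by
    [du_bois_reymond]. *)
Lemma alg_of_weak_deriv v g : sqT v -> sqT g -> weak_deriv T v g ->
  exists c, emb T v = Ic * emb T g + cst_alg T c * Ic.
Proof.
move=> sv sg [_ _ h]; have hv := sqT_Lsq sv; have hg := sqT_Lsq sg.
pose x := emb T v - Ic * emb T g; have hx : Lsq x := LsqB hv (LsqM _ hg).
have sx := Lsq_sqi hx; have xE : emb T (fun_part x) = x := emb_fun_part hx.1.
have [|c hc] := @du_bois_reymond _ T T0 (fun_part x) (sqT_L1T sx).
  move=> psi tp; have [cp cp'] := test_continuous tp.1.
  have s1 := continuous_sqT cp; have s2 := continuous_sqT cp'; have h2 := sqT_Lsq s2.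
  rewrite (ip_embE sx s2) xE /x (ipDl hv (LsqN (LsqM _ hg)) h2) ipNl ip_Ic_test//.
  by rewrite -!ip_embE// (h _ tp) opprK addNr.
exists c; have -> : emb T v = Ic * emb T g + x by rewrite /x addrC subrK.
congr (_ + _); rewrite -xE /Ic embZ; last exact: L1T_cst.
apply/emb_eq; [exact: sqT_L1T|apply: L1TZ; exact: L1T_cst|].
by move: hc; apply: aeW => t ht /ht ->; rewrite mulr1.
Qed.

(** The continuous representative minus the primitive is continuous and almost everywhere [c], hence
    [c] at 0 too, where both terms vanish. *)
Lemma zero_at_0_alg v (x : calg T) c : cst_part x = 0 -> zero_at_0 T v ->
  {ae mu, forall t, DT t -> v t = \int[mu]_(s in `]0, t[) fun_part x s + c} -> c = 0.
Proof.
move=> x0 [w [cw wv w0]] vE.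
have cp := continuous_primitive (good_L1 (good_fun x)) (ltW T0).
have cd : {within `[0, T], continuous (fun t => w t - \int[mu]_(s in `]0, t[) fun_part x s)}.
  by move=> t; apply: cvgB; [exact: cw|exact: cp].
have := @within_ae_cst _ _ 0 T c T0 cd.
move=> /(_ _ 0); rewrite lexx (ltW T0) w0 => <- //.
  rewrite (_ : \int[mu]_(s in _) _ = 0) ?subr0//.
  by rewrite set_itv_ge ?bnd_simp ?ltxx// Rintegral_set0.
move: (aeI vE wv); apply: aeW => t [h1 h2] tT.
by rewrite h2 ?in_itv/= ?tT// h1 /= ?in_itv/= ?tT// addrC addKr.
Qed.

Lemma fun_part_Ic (x : calg T) : cst_part x = 0 ->
  {ae mu, forall t, DT t -> fun_part (Ic * x) t = \int[mu]_(s in `]0, t[) fun_part x s}.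
Proof.
move=> x0; have Lx := L1T_fun_part x.
have E : Ic * x = emb T (fun t => \int[mu]_(s in `]0, t[) fun_part x s).
  by rewrite -{1}(emb_fun_part x0) Ic_emb.
by have := embE (L1T_primitive Lx); apply: aeW => t h Dt; rewrite E h.
Qed.

Lemma alg_of_deriv0 v g : sqT v -> sqT g -> weak_deriv T v g -> zero_at_0 T v ->
  emb T v = Ic * emb T g.
Proof.
move=> sv sg wd z0; have [c E] := alg_of_weak_deriv sv sg wd.
suff c0 : c = 0 by rewrite E c0 rmorph0 mul0r addr0.
apply: (@zero_at_0_alg v (emb T g)) => //.
have Lv := sqT_L1T sv.
have h1 := embE Lv; have h2 := @fun_part_Ic (emb T g) erefl.
have h3 := fun_partD (Ic * emb T g) (cst_alg T c * Ic); have h4 := fun_part_cst c Ic.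
have h5 := embE (L1T_cst T 1).
move: (aeI h1 (aeI h2 (aeI h3 (aeI h4 h5)))); apply: aeW => t [g1 [g2 [g3 [g4 g5]]]] Dt.
by rewrite -g1// E g3 g4 g2// /Ic g5// mulr1.
Qed.

Lemma deriv0_of_alg v g : sqT v -> sqT g -> emb T v = Ic * emb T g ->
  weak_deriv T v g /\ zero_at_0 T v.
Proof.
move=> sv sg E; split.
  by apply: (@weak_deriv_of_alg _ _ 0) => //; rewrite rmorph0 mul0r addr0.
have [Lg _] := good_fun (emb T g).
exists (fun t => \int[mu]_(s in `]0, t[) fun_part (emb T g) s); split.
- exact: continuous_primitive (ltW T0).
- have h1 := embE (sqT_L1T sv); have h2 := @fun_part_Ic (emb T g) erefl.
  move: (aeI h1 h2); apply: aeW => t [g1 g2] Dt; rewrite -g1//; first by rewrite E g2.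
- by rewrite set_itv_ge ?bnd_simp ?ltxx// Rintegral_set0.
Qed.

Lemma H0_derivs_alg m (g : nat -> R -> R) : H0_derivs T m g ->
  sqT (g 0%N) /\ sqT (g m) /\ emb T (g 0%N) = Ic ^+ m * emb T (g m).
Proof.
move=> [sg wg]; split; first exact: sg; split; first exact: sg.
elim: m sg wg => [|m IH] sg wg; first by rewrite expr0 mul1r.
rewrite IH; [|by move=> k km; apply: sg; exact: leqW|by move=> k km; apply: wg; exact: leqW].
have [w1 w2] := wg m (ltnSn m).
by rewrite (alg_of_deriv0 (sg _ (leqnSn m)) (sg _ (leqnn _)) w1 w2) exprSr mulrA.
Qed.

Lemma sqrte_EFinX2 (a : R) : 0 <= a -> sqrte (a ^+ 2)%:E = a%:E.
Proof. by move=> a0 /=; rewrite sqrtr_sqr ger0_norm. Qed.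

Lemma H0int_norm_le m v (x : calg T) : sqT v -> Lsq x -> emb T v = Ic ^+ m * x ->
  (H0int_norm T m v <= (N x)%:E)%E.
Proof.
move=> sv hx E; apply: ereal_inf_lbound.
(* The k-th derivative of I^m x is I^(m-k) x; only for k = 0 must the function itself be kept, not
   just its class. *)
pose g k := if k is 0 then v else fun_part (Ic ^+ (m - k) * x).
have hk k : Lsq (Ic ^+ k * x) by exact: LsqM.
have sg k : sqT (g k) by case: k => [|k] //; exact: Lsq_sqi.
have ge k : (k <= m)%N -> emb T (g k) = Ic ^+ (m - k) * x.
  by case: k => [|k] km; [rewrite subn0|rewrite /g emb_fun_part//; exact: (hk _).1].
exists g; last first.
  by rewrite (N_emb (sg m)) sqrte_EFinX2 ?N_ge0// ge// subnn expr0 mul1r.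
split => //; split => [k _|k km]; first exact: sg.
apply: deriv0_of_alg => //; rewrite !ge ?(ltnW km)// mulrA -exprS.
by rewrite subnSK.
Qed.

(** Admissible derivative chains correspond to square integrable solutions of v = I^m x. As Ic is
    injective there is only one, so the infimum is taken over a single value. *)
Lemma H0int_normP m v : (H0int_norm T m v < +oo)%E ->
  sqT v /\ exists2 x : calg T, Lsq x & emb T v = Ic ^+ m * x /\ H0int_norm T m v = (N x)%:E.
Proof.
move=> /ereal_inf_lt[_ [g [hg gv] <-] _].
have [s0 [sm E]] := H0_derivs_alg hg; rewrite gv in s0 E.
split=> //; exists (emb T (g m)); first exact: sqT_Lsq.
split=> //; apply/eqP; rewrite eq_le H0int_norm_le//=; last exact: sqT_Lsq.
apply: le_ereal_inf_tmp => _ [g' [hg' gv'] <-].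
have [s0' [sm' E']] := H0_derivs_alg hg'.
rewrite (N_emb sm') sqrte_EFinX2 ?N_ge0// lee_fin le_eqVlt; apply/orP; left; apply/eqP; congr N.
rewrite gv' E in E'; move: E'; move: (emb T (g m)) (emb T (g' m)) (sqT_Lsq sm).1 (sqT_Lsq sm').1.
move=> x y x0 y0; elim: (m) => [|k IH]; first by rewrite !expr0 !mul1r.
rewrite !exprS -!mulrA => /(Ic_inj T0) h; apply: IH; apply: h.
by rewrite !mulE/= x0 y0 !mulr0.
Qed.

End weak_derivatives.

(** * Interpolation norms and K-functionals *)

Section time_instance.
Context {R : realType} (T : R).
Hypothesis T0 : 0 < T.
Local Notation mu := (@lebesgue_measure R).
Local Notation DT := `]0, T[%classic.
Local Notation sqT := (square_integrable mu DT).
Implicit Types (v w f : R -> R) (t : R).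

Lemma N_Ic_le (x : calg T) : Lsq x -> N (Ic T * x) <= T * N x.
Proof.
move=> hx; have L := L1T_cst T (1 : R); have [_ h] := young_alg L hx.
apply: le_trans h _; rewrite ler_wpM2r ?N_ge0// -lee_fin norm1_tr//.
rewrite (_ : (\int[mu]_(t in DT) `|cst 1 t|%:E)%E = (\int[mu]_(t in DT) (cst 1%E t))%E).
  by rewrite integral_cst// mul1e /= lebesgue_measure_itv/= lte_fin T0 oppr0 adde0.
by apply: eq_integral => t _; rewrite /= normr1.
Qed.

Definition time_calc : time_calculus R := @TimeCalculus R (calg T) (cst_alg T) (@Lsq R T)
  (@ip R T) (Ic T) (fr T) (J T) (@refl R T) T (@LsqD R T) (@LsqM R T) (@ipC R T) (@ipDl R T)
  (@ipZl R T) (@ip_ge0 R T) (@ip_le R T) (@ip_Ic R T) N_Ic_le (@J_Ic R T) (@frM R T T0)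
  (@fr1 R T T0) (@N_1J_fr R T T0) (@ip_fr R T T0) (@Lsq_refl R T) (@ip_refl R T) (@adjoint R T).

Lemma sqTB v w : sqT v -> sqT w -> sqT (v \- w).
Proof.
move=> hv hw; have mD : measurable (DT : set (measurableTypeR R)) := measurable_itv _.
have := sqiD mD hv (sqiZ mD (-1) hw).
by congr square_integrable; apply/funext => t /=; rewrite mulN1r.
Qed.

Lemma H0int_norm_ge0 m v : (0 <= H0int_norm T m v)%E.
Proof. by apply: le_ereal_inf_tmp => _ [g _ <-]; exact: sqrte_ge0. Qed.

Lemma Kfun_le m t v B : sqT v -> 0 <= t ->
  split (X := time_calc) m t (emb T v) B -> (Kfun T m t v <= B%:E)%E.
Proof.
move=> hv t0 [p [q [hp hq E hB]]]; rewrite /= in hp hq E.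
have hw : Lsq (Ic T ^+ m * q) := LsqM _ hq.
pose w := fun_part (Ic T ^+ m * q).
have sw : sqT w := Lsq_sqi hw.
have ew : emb T w = Ic T ^+ m * q := emb_fun_part hw.1.
apply: (@le_trans _ _ (H0int_norm T 0 (v \- w)%R + t%:E * H0int_norm T m w)%E).
  by apply: ereal_inf_lbound; exists w.
apply: (@le_trans _ _ ((N p)%:E + t%:E * (N q)%:E)%E); last by rewrite -EFinM -EFinD lee_fin.
apply: leeD.
  apply: (H0int_norm_le T0 (sqTB hv sw) hp); rewrite expr0 mul1r.
  have -> : emb T (v \- w) = emb T v - emb T w.
    by rewrite embN ?embD//; [exact: sqT_L1T|have := L1TZ (-1) (sqT_L1T sw); apply: eq_integrable => // x _; rewrite /= mulN1r|exact: sqT_L1T].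
  by rewrite E ew addrK.
by apply: lee_wpmul2l; [rewrite lee_fin|exact: H0int_norm_le].
Qed.

(** The infimum need not be attained; strictness supplies a competitor below [B], whose two norms
    are then finite. *)
Lemma Kfun_split m t v B : 0 < t -> (Kfun T m t v < B%:E)%E ->
  split (X := time_calc) m t (emb T v) B.
Proof.
move=> t0 /ereal_inf_lt[_ [w _ <-] h].
have h0 := H0int_norm_ge0 0 (v \- w); have hm := H0int_norm_ge0 m w.
have f1 : (H0int_norm T 0 (v \- w)%R < +oo)%E.
  rewrite ltey; apply/eqP => E; move: h; rewrite E addye ?ltNge ?leey//.
  by rewrite gt_eqF// (lt_le_trans (@ltNy0 R))// mule_ge0// lee_fin ltW.
have f2 : (H0int_norm T m w < +oo)%E.
  rewrite ltey; apply/eqP => E; move: h; rewrite E gt0_muley ?lte_fin// addey ?ltNge ?leey//.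
  by rewrite gt_eqF// (lt_le_trans (@ltNy0 R)).
have [s1 [p hp [E1 N1]]] := H0int_normP T0 f1; have [s2 [q hq [E2 N2]]] := H0int_normP T0 f2.
exists p, q; split => //; last by move: h; rewrite N1 N2 -EFinM -EFinD lte_fin => /ltW.
rewrite /= -E2; rewrite expr0 mul1r in E1; rewrite -E1.
rewrite embD; [|exact: sqT_L1T|exact: sqT_L1T].
by congr emb; apply/funext => x /=; rewrite subrK.
Qed.

Lemma Kfun_mono m t t' v : 0 <= t -> t <= t' -> (Kfun T m t v <= Kfun T m t' v)%E.
Proof.
move=> t0 tt'; apply: le_ereal_inf_tmp => _ [w _ <-].
apply: ge_ereal_inf; exists (H0int_norm T 0 (v \- w)%R + t%:E * H0int_norm T m w)%E; first by exists w.
by apply: leeD => //; apply: lee_wpmul2r; [exact: H0int_norm_ge0|rewrite lee_fin].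
Qed.

Lemma Kfun_ge0 m t v : 0 <= t -> (0 <= Kfun T m t v)%E.
Proof.
move=> t0; apply: le_ereal_inf_tmp => _ [w _ <-].
by rewrite adde_ge0 ?H0int_norm_ge0// mule_ge0 ?H0int_norm_ge0// lee_fin.
Qed.

Lemma Kfun_fin m t v : sqT v -> 0 <= t -> Kfun T m t v \is a fin_num.
Proof.
move=> hv t0; rewrite ge0_fin_numE ?Kfun_ge0//.
apply: (@le_lt_trans _ _ (N (emb T v))%:E); last exact: ltry.
apply: Kfun_le => //; exists (emb T v), (0 : calg T); split => /=.
- exact: sqT_Lsq.
- exact: Lsq0.
- by rewrite mulr0 addr0.
by rewrite /nrm/= /ip; under eq_Rintegral => x _ do idtac; rewrite -/(ip (0 : calg T) 0) -/(N (0 : calg T)) -/(N (emb T v)) -(mul0r (0 : calg T)) -(rmorph0 (cst_alg T)) NZ normr0 mul0r mulr0 addr0.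
Qed.

Definition kf m v t : R := fine (Kfun T m t v).

Lemma kfE m v t : sqT v -> 0 <= t -> Kfun T m t v = (kf m v t)%:E.
Proof. by move=> hv t0; rewrite /kf fineK// Kfun_fin. Qed.

Lemma kf_ge0 m v t : 0 <= t -> 0 <= kf m v t.
Proof. by move=> t0; rewrite fine_ge0// Kfun_ge0. Qed.

Lemma kf_mono m v t t' : sqT v -> 0 <= t -> t <= t' -> kf m v t <= kf m v t'.
Proof.
move=> hv t0 tt'; have t'0 := le_trans t0 tt'.
by rewrite -lee_fin -!kfE// Kfun_mono.
Qed.

Definition kint m (th : R) v t : R := (t `^ (- th) * kf m v t) ^+ 2 * t^-1.

Lemma kint_ge0 m th v t : 0 < t -> 0 <= kint m th v t.
Proof. by move=> t0; rewrite mulr_ge0 ?sqr_ge0// invr_ge0 ltW. Qed.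

Lemma measurable_kint m th v : sqT v -> measurable_fun (`]0, +oo[%classic : set R) (kint m th v).
Proof.
move=> hv; apply: measurable_funM.
  apply: measurable_funX; apply: measurable_funM.
    by apply: measurable_funTS; exact: measurable_powR.
  (* Measurability comes from monotonicity, so the K-functional is continued by its value at 0 to a
     function that is monotone on the whole line. *)
  apply: (eq_measurable_fun (fun t => kf m v (Num.max t 0))).
    by move=> x; rewrite inE/= in_itv/= andbT => x0; rewrite max_l// ltW.
  apply: nondecreasing_measurable => // x y xy; apply: kf_mono => //.
    by rewrite le_max lexx orbT.
  by rewrite ge_max !le_max xy lexx orbT.
apply: (eq_measurable_fun (fun t => t `^ (-1))); last by apply: measurable_funTS; exact: measurable_powR.
by move=> x; rewrite inE/= in_itv/= andbT => x0; rewrite powR_inv1// ltW.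
Qed.

Lemma interp_normE m th v : sqT v ->
  interp_norm T m th v = sqrte (\int[mu]_(t in `]0%R, +oo[) (kint m th v t)%:E)%E.
Proof.
move=> hv; congr sqrte; apply: eq_integral => t; rewrite inE/= in_itv/= andbT => t0.
by rewrite kfE ?(ltW t0)// -EFinM -EFin_expe -EFinM.
Qed.

End time_instance.

(** * Integrals over dyadic intervals *)

Section dyadic_integrals.
Context {R : realType}.
Local Notation mu := (@lebesgue_measure R).
Implicit Types (h : R -> R) (x e : nat -> R).

Lemma integral_steps h x n : measurable_fun (`]0, +oo[%classic : set R) h ->
  (forall t, 0 < t -> 0 <= h t) -> 0 <= x 0%N -> (forall j, x j <= x j.+1) ->
  (\int[mu]_(t in `]x 0%N, x n]) (h t)%:E = \sum_(j < n) \int[mu]_(t in `]x j, x j.+1]) (h t)%:E)%E.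
Proof.
move=> mh h0 x00 xS; have x0 j : 0 <= x j by elim: j => // j IH; exact: le_trans (xS j).
have x0n j : x 0%N <= x j by elim: j => // j IH; exact: le_trans IH (xS j).
elim: n => [|n IH]; first by rewrite big_ord0 set_itv_ge ?bnd_simp ?ltxx// integral_set0.
rewrite big_ord_recr/= -IH -ge0_integral_setU//.
- congr integral; apply/seteqP; split => t /=; rewrite !in_itv/=.
    by move=> /andP[h1 h2]; case: (leP t (x n)) => h3; [left; rewrite h1|right].
  by move=> [/andP[-> /le_trans->//]|/andP[h1 ->]]; rewrite (le_lt_trans (x0n n)).
- apply/measurable_EFinP; apply: measurable_funS mh => // t.
  by rewrite /= !in_itv/= andbT => -[] /andP[h1 _]; exact: le_lt_trans h1.
- by move=> t /=; rewrite !in_itv/= => -[] /andP[h1 _]; rewrite lee_fin h0//; exact: le_lt_trans h1.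
- apply/disj_set2P; apply/seteqP; split => // t [] /=; rewrite !in_itv/=.
  by move=> /andP[_ h1] /andP[h2 _]; have := lt_le_trans h2 h1; rewrite ltxx.
Qed.

Lemma integral_step_le h (a b c : R) : measurable_fun (`]0, +oo[%classic : set R) h ->
  (forall t, 0 < t -> 0 <= h t) -> 0 <= a -> a < b -> 0 <= c ->
  (forall t, a < t <= b -> h t <= c) ->
  (\int[mu]_(t in `]a, b]) (h t)%:E <= (c * (b - a))%:E)%E.
Proof.
move=> mh h0 a0 ab c0 hc.
have -> : (c * (b - a))%:E = (\int[mu]_(t in `]a, b]) (cst c%:E t))%E.
  by rewrite integral_cst//= lebesgue_measure_itv/= lte_fin ab EFinM EFinB.
apply: ge0_le_integral => //.
- by move=> t /=; rewrite in_itv/= => /andP[h1 _]; rewrite lee_fin h0//; exact: le_lt_trans h1.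
- apply/measurable_EFinP; apply: measurable_funS mh => // t.
  by rewrite /= !in_itv/= andbT => /andP[h1 _]; exact: le_lt_trans h1.
Qed.

Lemma integral_step_ge h (a b c : R) : measurable_fun (`]0, +oo[%classic : set R) h ->
  (forall t, 0 < t -> 0 <= h t) -> 0 <= a -> a < b -> 0 <= c ->
  (forall t, a < t <= b -> c <= h t) ->
  ((c * (b - a))%:E <= \int[mu]_(t in `]a, b]) (h t)%:E)%E.
Proof.
move=> mh h0 a0 ab c0 hc.
have -> : (c * (b - a))%:E = (\int[mu]_(t in `]a, b]) (cst c%:E t))%E.
  by rewrite integral_cst//= lebesgue_measure_itv/= lte_fin ab EFinM EFinB.
apply: ge0_le_integral => //.
- apply/measurable_EFinP; apply: measurable_funS mh => // t.
  by rewrite /= !in_itv/= andbT => /andP[h1 _]; exact: le_lt_trans h1.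
Qed.

(** The intervals run from 2^(-N m) to 2^(N m) and exhaust the half-line. The threshold [N0] leaves
    room for bounds that hold only once the largest scale exceeds [T]. *)
Lemma integral_exhaust h (M : R) (m N0 : nat) : (0 < m)%N ->
  measurable_fun (`]0, +oo[%classic : set R) h -> (forall t, 0 < t -> 0 <= h t) ->
  (forall N, (N0 <= N)%N ->
    (\int[mu]_(t in `](dy (2^-1 ^+ N) 0 ^+ m : R)%R, (dy (2^-1 ^+ N) (2 * N)%N ^+ m)%R]) (h t)%:E <= M%:E)%E) ->
  (\int[mu]_(t in `]0%R, +oo[) (h t)%:E <= M%:E)%E.
Proof.
move=> m0 mh h0 hM.
pose E (N : nat) : set (measurableTypeR R) :=
  `](dy (2^-1 ^+ N) 0 ^+ m : R), dy (2^-1 ^+ N) (2 * N) ^+ m]%classic.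
have lo N : (dy (2^-1 ^+ N) 0 : R) = 2^-1 ^+ N by rewrite /dy expr0 mulr1.
have hi N : (dy (2^-1 ^+ N) (2 * N) : R) = 2 ^+ N.
  by rewrite /dy mul2n -addnn exprD mulrA -exprMn mulVf ?expr1n ?mul1r// pnatr_eq0.
have p2 N : (N%:R : R) <= 2 ^+ N by rewrite -natrX ler_nat ltnW// ltn_expl.
have q2 N : 0 < (2 : R) ^+ N by rewrite exprn_gt0.
have EE : `]0, +oo[%classic = \bigcup_N E N.
  apply/seteqP; split => x /=; rewrite in_itv/= ?andbT.
    move=> x0; pose N := (Num.truncn (x + x^-1)).+1.
    have xN : x + x^-1 < 2 ^+ N by apply: lt_le_trans (p2 N); exact: truncnS_gt.
    have xi : 0 < x^-1 by rewrite invr_gt0.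
    have g1 : 1 <= (2 : R) ^+ N by rewrite exprn_ege1// ler1n.
    exists N => //; rewrite /E /= in_itv/= lo hi; apply/andP; split.
      apply: (@le_lt_trans _ _ (2^-1 ^+ N)).
        rewrite -[leRHS]expr1; apply: ler_wiXn2l => //.
        by rewrite exprn_ile1// invf_le1// ler1n.
      by rewrite exprVn invf_plt ?posrE//; lra.
    apply: (@le_trans _ _ (2 ^+ N)); first lra.
    by rewrite -[leLHS]expr1; apply: ler_weXn2l.
  by move=> [N _]; rewrite /E /= in_itv/= lo => /andP[h1 _]; apply: le_lt_trans h1; rewrite !exprn_ge0.
have E0 N (x : R) : E N x -> 0 < x.
  by rewrite /E /= in_itv/= lo => /andP[h1 _]; apply: le_lt_trans h1; rewrite !exprn_ge0.
rewrite EE.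
have C := @ge0_nondecreasing_set_cvg_integral _ _ _ E (EFin \o h) mu _
  (fun n => measurable_itv _).
have ndE : {homo E : n k / (n <= k)%N >-> (n <= k)%O}.
  move=> n k nk; apply/subsetPset => x; rewrite /E/= !in_itv/= !lo !hi => /andP[h1 h2].
  apply/andP; split.
    apply: le_lt_trans h1; apply: lerXn2r; rewrite ?nnegrE ?exprn_ge0//.
    by apply: ler_wiXn2l => //; rewrite invf_le1// ler1n.
  apply: le_trans h2 _; apply: lerXn2r; rewrite ?nnegrE ?exprn_ge0//.
  by apply: ler_weXn2l => //; rewrite ler1n.
have {}C := C ndE.
have /C{}C : forall i, measurable_fun (E i) (EFin \o h).
  move=> i; apply/measurable_EFinP; apply: measurable_funS mh => //.
  by move=> x /E0 x0; rewrite /= in_itv/= x0.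
have /C{}C : forall i (x : R), E i x -> (0 <= (EFin \o h) x)%E.
  by move=> i x /E0 x0; rewrite lee_fin h0.
rewrite -(cvg_lim _ C)//; apply: lime_le; first by apply/cvg_ex; eexists; exact: C.
by exists N0 => // N /hM.
Qed.

End dyadic_integrals.

Section interpolation_norms.
Context {R : realType} (T : R).
Hypothesis T0 : 0 < T.
Local Notation mu := (@lebesgue_measure R).
Local Notation DT := `]0, T[%classic.
Local Notation sqT := (square_integrable mu DT).
Local Notation X := (time_calc T0).
Implicit Types (v f : R -> R) (t s r : R).

Lemma powR_dyS r s j : 0 < s -> dy s j `^ (- r) = 2 `^ r * dy s j.+1 `^ (- r).
Proof.
move=> s0; rewrite dyS powRM ?ltW ?dy_gt0// mulrA -powRD ?pnatr_eq0 ?implybT//.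
by rewrite subrr powRr0 mul1r.
Qed.

(** With t = dy^m the weight t^(-th) becomes dy^(-r). On one dyadic interval the K-functional is
    bounded by its value at the right end and the weights by theirs at the left end; hence 2 N
    intervals need 2 N + 1 values [B j]. *)
Lemma interp_le m (th r : R) v M (N0 : nat) : (0 < m <= 2)%N -> r = m%:R * th -> 0 <= r <= 2 ->
  sqT v -> 0 <= M ->
  (forall N, (N0 <= N)%N -> exists B : nat -> R,
    (forall j, split (X := X) m (dy (2^-1 ^+ N) j ^+ m) (emb T v) (B j)) /\
    \sum_(j < (2 * N).+1) (dy (2^-1 ^+ N) j `^ (- r) * B j) ^+ 2 <= M ^+ 2) ->
  (interp_norm T m th v <= (8 * M)%:E)%E.
Proof.
move=> /andP[m0 m2] rE /andP[r0 r2] hv M0 H.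
have th0 : 0 <= th by move: r0; rewrite rE pmulr_rge0// ltr0n.
rewrite (interp_normE T0)// -(@sqrte_EFinX2 R (8 * M)); last by rewrite mulr_ge0.
rewrite lee_sqrt; last first.
  by rewrite lee_fin sqr_ge0.
apply: (@integral_exhaust _ _ _ m N0) => //.
- exact: measurable_kint.
- by move=> t t0; exact: kint_ge0.
move=> N /H[B [hB sB]]; set s : R := 2^-1 ^+ N in hB sB *.
have s0 : 0 < s by rewrite exprn_gt0.
have d0 j : 0 < dy s j := dy_gt0 j s0.
have B0 j : 0 <= B j.
  have [p [q [_ _ _]]] := hB j; apply: le_trans.
  by rewrite addr_ge0 ?nrm_ge0// mulr_ge0 ?nrm_ge0// exprn_ge0// ltW.
have dm j : 0 < dy s j ^+ m by rewrite exprn_gt0.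
have dlt j : dy s j ^+ m < dy s j.+1 ^+ m.
  by rewrite dyS [ltRHS]exprMn ltr_pMl// exprn_egt1 ?ltr1n// -lt0n.
rewrite (@integral_steps _ _ (fun j => dy s j ^+ m))//; last first.
- by move=> j; exact: ltW.
- exact: ltW.
- by move=> t t0; exact: kint_ge0.
- exact: measurable_kint.
pose c j := dy s j `^ (- r) * B j.
have step j : (\int[mu]_(t in `](dy s j ^+ m)%R, (dy s j.+1 ^+ m)%R]) (kint T m th v t)%:E <=
    (64 * c j.+1 ^+ 2)%:E)%E.
  set K := (dy s j `^ (- r) * B j.+1) ^+ 2 * (dy s j ^+ m)^-1.
  have K0 : 0 <= K by rewrite mulr_ge0 ?sqr_ge0// invr_ge0 ltW.
  apply: le_trans (integral_step_le (c := K) _ _ (ltW (dm j)) (dlt j) K0 _) _.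
  - exact: measurable_kint.
  - by move=> t t0; exact: kint_ge0.
  - move=> t /andP[t1 t2]; have t0 : 0 < t := lt_trans (dm j) t1.
    rewrite /kint /K; apply: ler_pM; rewrite ?sqr_ge0 ?invr_ge0 ?(ltW t0)//; last first.
      by rewrite lef_pV2 ?posrE// ltW.
    apply: lerXn2r; rewrite ?nnegrE ?mulr_ge0 ?powR_ge0 ?kf_ge0 ?(ltW t0)//.
    apply: ler_pM; rewrite ?powR_ge0 ?kf_ge0 ?(ltW t0)//.
      rewrite rE -mulrN powRrM powR_mulrn ?(ltW (d0 _))// !powRN lef_pV2 ?posrE ?powR_gt0//.
      by apply: ge0_ler_powR; rewrite ?nnegrE ?(ltW t0) ?(ltW (dm j)) ?(ltW t1).
    apply: le_trans (kf_mono T0 _ hv (ltW t0) t2) _.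
    by rewrite -lee_fin -kfE ?(ltW (dm _))//; apply: Kfun_le => //; exact: ltW.
  rewrite lee_fin /K; have -> : dy s j.+1 ^+ m = 2 ^+ m * dy s j ^+ m by rewrite dyS exprMn.
  have -> : (dy s j `^ (- r) * B j.+1) ^+ 2 / dy s j ^+ m * (2 ^+ m * dy s j ^+ m - dy s j ^+ m) =
      (dy s j `^ (- r) * B j.+1) ^+ 2 * (2 ^+ m - 1) by field; exact: lt0r_neq0.
  rewrite (powR_dyS _ _ s0) -[2 `^ r * _ * _]mulrA -/(c j.+1) exprMn mulrAC.
  rewrite ler_wpM2r ?sqr_ge0//.
  have p1 : (2 `^ r : R) <= 4.
    have -> : (4 : R) = 2 `^ 2 by rewrite powR_mulrn//; ring.
    by apply: ler_powR; rewrite ?ler1n.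
  have p2 : (2 : R) ^+ m - 1 <= 4.
    apply: (@le_trans _ _ (2 ^+ m)); first by rewrite gerBl.
    rewrite (_ : (4 : R) = 2 ^+ 2); last by ring.
    by apply: ler_weXn2l => //; rewrite ler1n.
  have p3 : 0 <= (2 : R) ^+ m - 1 by rewrite subr_ge0 exprn_ege1// ler1n.
  have p0 : 0 <= (2 `^ r : R) := powR_ge0 _ _.
  (* Since r and m are at most 2, both 2^r and 2^m - 1 are at most 4; 64 is the square of the
     constant 8. *)
  rewrite (_ : (64 : R) = 4 ^+ 2 * 4); last by ring.
  by apply: ler_pM => //; rewrite ?sqr_ge0//; apply: lerXn2r; rewrite ?nnegrE.
apply: (@le_trans _ _ (\sum_(j < 2 * N) (64 * c j.+1 ^+ 2)%:E)%E).
  by apply: lee_sum => j _; exact: step.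
rewrite sumEFin lee_fin -mulr_sumr exprMn (_ : (8 : R) ^+ 2 = 64); last by ring.
rewrite ler_pM2l//; apply: le_trans sB; rewrite big_ord_recl/= lerDr.
exact: sqr_ge0.
Qed.

(** Monotonicity of the K-functional, now used at the left ends, gives a square sum of at most 4
    F^2. The increment [del] provides the strict inequality that yields a decomposition, and 2 * 4
    F^2 <= (3 F)^2. *)
Lemma interp_blocks gam f F s n eta : 0 < gam -> gam <= 1 / 2 -> sqT f ->
  interp_norm T 1 gam f = F%:E -> 0 < s -> 0 < eta -> exists B : nat -> R,
    (forall j, split (X := X) 1 (dy s j) (emb T f) (B j)) /\
    \sum_(j < n) (dy s j `^ (- gam) * B j) ^+ 2 <= (3 * F + eta) ^+ 2.
Proof.
move=> g0 g2 hf hF s0 eta0; have d0 j : 0 < dy s j := dy_gt0 j s0.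
have F0 : 0 <= F by rewrite -lee_fin -hF; exact: sqrte_ge0.
have kp t : 0 < t -> 0 <= kint T 1 gam f t by move=> t0; exact: kint_ge0.
have mk := measurable_kint T0 1 gam hf.
have iF : (\int[mu]_(t in `]0%R, +oo[) (kint T 1 gam f t)%:E <= (F ^+ 2)%:E)%E.
  rewrite -lee_sqrt; last by rewrite lee_fin sqr_ge0.
  by rewrite -(interp_normE T0)// hF sqrte_EFinX2.
pose k j := dy s j `^ (- gam) * kf T 1 f (dy s j).
have k0 j : 0 <= k j by rewrite mulr_ge0 ?powR_ge0// kf_ge0// ltW.
have sk : \sum_(j < n) (k j) ^+ 2 <= 4 * F ^+ 2.
  have dlt j : dy s j < dy s j.+1 by rewrite dyS ltr_pMl// ltr1n.
  have step j : ((k j ^+ 2 / 4)%:E <= \int[mu]_(t in `](dy s j)%R, (dy s j.+1)%R]) (kint T 1 gam f t)%:E)%E.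
    set K := (dy s j.+1 `^ (- gam) * kf T 1 f (dy s j)) ^+ 2 * (dy s j.+1)^-1.
    have K0 : 0 <= K by rewrite mulr_ge0 ?sqr_ge0// invr_ge0 ltW.
    apply: le_trans (integral_step_ge (c := K) mk kp (ltW (d0 j)) (dlt j) K0 _); last first.
      move=> t /andP[t1 t2]; have t0 : 0 < t := lt_trans (d0 j) t1.
      rewrite /kint /K; apply: ler_pM; rewrite ?sqr_ge0 ?invr_ge0 ?(ltW (d0 _))//; last first.
        by rewrite lef_pV2 ?posrE.
      have z := kf_ge0 T 1 f (ltW (d0 j)).
      apply: lerXn2r; rewrite ?nnegrE ?mulr_ge0 ?powR_ge0 ?kf_ge0 ?(ltW t0) ?(ltW (d0 _))//.
      apply: ler_pM; rewrite ?powR_ge0//; last exact: (kf_mono T0 _ hf (ltW (d0 j)) (ltW t1)).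
      rewrite !powRN lef_pV2 ?posrE ?powR_gt0//.
      by apply: ge0_ler_powR; rewrite ?nnegrE ?(ltW g0) ?(ltW t0) ?(ltW (d0 _)).
    rewrite lee_fin /K /k (powR_dyS _ _ s0) -[2 `^ gam * _ * _]mulrA.
    move: (dy s j.+1 `^ _ * _) => z; rewrite dyS.
    have -> : z ^+ 2 / (2 * dy s j) * (2 * dy s j - dy s j) = z ^+ 2 / 2.
      by field; exact: lt0r_neq0.
    have : (2 `^ gam : R) ^+ 2 <= 2.
      rewrite -powR_mulrn ?powR_ge0// -powRrM -[leRHS](@powRr1 _ 2)//.
      by apply: ler_powR; [rewrite ler1n|lra].
    by have := sqr_ge0 z; rewrite exprMn; nra.
  rewrite -ler_pdivrMl// mulrC -lee_fin; apply: le_trans iF.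
  apply: (@le_trans _ _ (\int[mu]_(t in `](dy s 0)%R, (dy s n)%R]) (kint T 1 gam f t)%:E)%E); last first.
    apply: ge0_subset_integral => //; first by apply/measurable_EFinP.
      by move=> t; rewrite /= in_itv/= andbT => t0; rewrite lee_fin kp.
    by move=> t; rewrite /= !in_itv/= andbT => /andP[h _]; exact: lt_trans h.
  rewrite (integral_steps _ mk kp (ltW (d0 0%N)) (fun j => ltW (dlt j))).
  rewrite mulr_suml -sumEFin; apply: lee_sum => j _; exact: step.
pose S := \sum_(j < n) (dy s j `^ (- gam)) ^+ 2.
have S0 : 0 <= S by apply: sumr_ge0 => j _; exact: sqr_ge0.
(* So small that the increments contribute at most eta^2 to the weighted square sum. *)
pose del := eta / (2 * (S + 1)).
have del0 : 0 < del by rewrite divr_gt0// mulr_gt0//; lra.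
exists (fun j => kf T 1 f (dy s j) + del); split.
  move=> j; apply: Kfun_split => //; rewrite (kfE T0) ?(ltW (d0 _))// lte_fin; lra.
have h : \sum_(j < n) (dy s j `^ (- gam) * (kf T 1 f (dy s j) + del)) ^+ 2 <=
    2 * \sum_(j < n) (k j) ^+ 2 + 2 * del ^+ 2 * S.
  rewrite !mulr_sumr -big_split/=; apply: ler_sum => j _; rewrite mulrDr -/(k j).
  have := sqr_ge0 (k j - dy s j `^ (- gam) * del); move: (dy s j `^ _) => z; nra.
apply: le_trans h _.
have : 2 * del ^+ 2 * S <= eta ^+ 2.
  have -> : eta = del * (2 * (S + 1)) by rewrite /del divfK// gt_eqF// mulr_gt0//; lra.
  have e1 : 2 * S <= (2 * (S + 1)) ^+ 2 by nra.
  have -> : 2 * del ^+ 2 * S = del ^+ 2 * (2 * S) by ring.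
  by rewrite (exprMn _ del) ler_wpM2l ?sqr_ge0.
have : 0 <= F * eta by rewrite mulr_ge0// ltW.
by move=> *; nra.
Qed.

End interpolation_norms.

(** * Estimates for one mode *)

Section one_mode.
Context {R : realType} (X : time_calculus R).
Variables (a lam : R) (ha : 0 < a < 1) (lam0 : 0 < lam) (f w y : X).
Local Notation I := (tc_int X).
Local Notation fr := (tc_frac X).
Local Notation J := (tc_res X).
Local Notation c := (tc_cst X lam).
Hypotheses (hf : tc_sq f) (hw : tc_sq w)
  (hwf : w + c * (fr a * w) = f) (hy : (1 + c * fr a) * y = 1).

Let wE : w = y * f.
Proof. by rewrite -hwf -[LHS]mul1r -hy; ring. Qed.

Let bdy : bd y 1.
Proof. exact: resolvent_le ha (ltW lam0) hy. Qed.

Lemma nrm_w : nrm w <= nrm f.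
Proof. by rewrite wE; have := bdy.2 _ hf; rewrite mul1r. Qed.

Let g : X := c * (fr a * w).

Let hg : tc_sq g. Proof. by apply: tc_sqM; exact: tc_sqM. Qed.

Let gE : g = (1 - y) * f.
Proof. by rewrite mulrBl mul1r -wE -hwf /g; ring. Qed.

Let bd1y : bd (1 - y) 2.
Proof.
have -> : 1 - y = 1 + tc_cst X (-1) * y by rewrite rmorphN rmorph1 mulN1r.
by apply: bdW (bdD (bd1 X) (bdM (bdZ X (-1)) bdy)); rewrite normrN1; lra.
Qed.

Let nrm_g : nrm g <= 2 * nrm f.
Proof. by rewrite gE; exact: bd1y.2. Qed.

(** The eigenvalue is absorbed here: lam I w = fr(1-a) (lam fr a w), and g = lam fr a w = f - w is
    bounded by 2 |f| whatever the eigenvalue. *)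
Let luE : c * (I * w) = fr (1 - a) * g.
Proof.
have /andP[a0 a1] := ha; have b0 : 0 < 1 - a by rewrite subr_gt0.
have h : 1 - a + a <= 2 by lra.
have e : fr (1 - a) * fr a = I by rewrite (tc_fracM X b0 a0 h) subrK tc_frac1.
by rewrite -e /g; ring.
Qed.

Section positive_gamma.
Variables (gam F : R) (g0 : 0 < gam) (g2 : gam <= 1 / 2) (F0 : 0 <= F).
Hypothesis fB : forall s n eta, 0 < s -> 0 < eta -> exists B : nat -> R,
  (forall j, split 1 (dy s j) f (B j)) /\
  \sum_(j < n) (dy s j `^ (- gam) * B j) ^+ 2 <= (3 * F + eta) ^+ 2.

Lemma mode_int s n eta : 0 < s -> 0 < eta -> exists B : nat -> R,
  (forall j, split 2 (dy s j ^+ 2) (I * w) (B j)) /\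
  \sum_(j < n) (dy s j `^ (- (1 + gam)) * B j) ^+ 2 <= (2 * (3 * F + eta)) ^+ 2.
Proof.
move=> s0 eta0; have [B [hB sB]] := fB n s0 eta0.
exists (fun j => 2 * dy s j * B j); split.
  move=> j; rewrite wE; have d0 := dy_gt0 j s0.
  have := split_bd bdy (ltW d0) (hB j); rewrite mul1r => h.
  exact: (split_int d0 h).
rewrite exprMn; apply: le_trans (ler_wpM2l (sqr_ge0 2) sB).
rewrite mulr_sumr le_eqVlt; apply/orP; left; apply/eqP; apply: eq_bigr => j _.
have d0 := dy_gt0 j s0; rewrite -exprMn; congr (_ ^+ 2).
rewrite opprD powRD ?powR_inv1 ?(ltW d0)//; last by apply/implyP => _; exact: lt0r_neq0.
by field; exact: lt0r_neq0.
Qed.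

Let blocks s n eta : 0 < s -> 0 < eta -> exists B : nat -> R,
  [/\ forall j, split 1 (dy s j) g (2 * B j),
      forall j, split 1 (dy s j) w (B j),
      forall j, 0 <= B j &
      \sum_(j < n) (dy s j `^ (- gam) * B j) ^+ 2 <= (3 * F + eta) ^+ 2].
Proof.
move=> s0 eta0.
have [B [hB sB]] := fB n s0 eta0.
exists B; split => // j.
- by rewrite gE; apply: split_bd => //; exact: ltW (dy_gt0 j s0).
- by rewrite wE -[B j]mul1r; apply: split_bd => //; exact: ltW (dy_gt0 j s0).
have [p [q [_ _ _]]] := hB j; apply: le_trans.
by rewrite addr_ge0 ?nrm_ge0// mulr_ge0 ?nrm_ge0// ltW// dy_gt0.
Qed.

(** The order 1 + gam - a exceeds 1, so the couple with [m = 2] is used, and [split_frac2] transfers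
    each decomposition of g scale by scale. *)
Lemma mode_gt1 s n eta : a < gam -> 0 < s -> 0 < eta -> exists B : nat -> R,
  (forall j, split 2 (dy s j ^+ 2) (c * (I * w)) (B j)) /\
  \sum_(j < n) (dy s j `^ (- (1 + gam - a)) * B j) ^+ 2 <= (28 * (3 * F + eta)) ^+ 2.
Proof.
move=> ag s0 eta0; have /andP[a0 a1] := ha.
have [B [hB _ _ sB]] := blocks n s0 eta0.
have hr : 0 < 1 - a <= 1 by apply/andP; split; lra.
exists (fun j => 14 * dy s j `^ (1 - a) * (2 * B j)); split.
  by move=> j; rewrite luE; exact: (split_frac2 hr (dy_gt0 j s0) (hB j)).
rewrite exprMn; apply: le_trans (ler_wpM2l (sqr_ge0 28) sB).
rewrite mulr_sumr le_eqVlt; apply/orP; left; apply/eqP; apply: eq_bigr => j _.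
have d0 := dy_gt0 j s0; rewrite -exprMn; congr (_ ^+ 2).
have -> : - gam = - (1 + gam - a) + (1 - a) by ring.
rewrite (@powRD _ _ (- (1 + gam - a)) (1 - a)); last by apply/implyP => _; exact: lt0r_neq0.
by ring.
Qed.

(** The norm of order 1 of lam u is |h| with h = lam w. [frac_eq1] bounds the part of h between two
    cutoffs, uniformly in M. The part above the frequency 2^M is at most 4 lam 2^(-gam M) (3 F +
    eta), the part below 2^(-M) at most 3 T 2^(-M) |h|. Both tend to 0, so lam and [T] do not enter
    the bound. *)
Lemma mode_eq1 eta e : gam = a -> 0 < eta -> 0 < e ->
  nrm (c * w) <= 48 * (3 * F + eta) + e.
Proof.
move=> ga eta0 e0; have /andP[a0 a1] := ha; pose h := c * w.
have hh : tc_sq h by exact: tc_sqM.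
rewrite -/h; pose T := tc_len X.
pose Q := 3 * F + eta.
have Q0 : 0 <= Q by rewrite addr_ge0 ?mulr_ge0// ltW.
have e4 : 0 < e / 2 by rewrite divr_gt0.
have c1 : (4 * lam * Q) * (2^-1 `^ gam) ^+ n @[n --> \oo] --> (0 : R).
  rewrite -[X in _ --> X](mulr0 (4 * lam * Q)); apply: cvgM; first exact: cvg_cst.
  apply: cvg_expr; rewrite ger0_norm ?powR_ge0//.
  have -> : (2^-1 : R) `^ gam = 2 `^ (- gam) by rewrite -powR_inv1// -powRrM mulN1r.
  have ng : - gam < 0 by rewrite oppr_lt0.
  by have /andP[_ ?] := powR2_lt1 ng.
have c2 : (3 * T * nrm h) * 2^-1 ^+ n @[n --> \oo] --> (0 : R).
  rewrite -[X in _ --> X](mulr0 (3 * T * nrm h)); apply: cvgM; first exact: cvg_cst.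
  by apply: cvg_expr; rewrite ger0_norm// invf_lt1// ltr1n.
have [M [M1 M2]] : exists M : nat, (4 * lam * Q) * (2^-1 `^ gam) ^+ M <= e / 2 /\
    (3 * T * nrm h) * 2^-1 ^+ M <= e / 2.
  move/cvgrPdist_le : c1 => /(_ _ e4) [M1 _ h1]; move/cvgrPdist_le : c2 => /(_ _ e4) [M2 _ h2].
  exists (maxn M1 M2); split.
    have := h1 (maxn M1 M2) (leq_maxl _ _); rewrite sub0r normrN; exact: le_trans (ler_norm _).
  have := h2 (maxn M1 M2) (leq_maxr _ _); rewrite sub0r normrN; exact: le_trans (ler_norm _).
have s0 : 0 < (2^-1 : R) ^+ M by rewrite exprn_gt0// invr_gt0.
set s : R := 2^-1 ^+ M in s0 M2 *.
have [B [hB hBw B0 sB]] := blocks (2 * M).+1 s0 eta0; rewrite -/s in hB hBw sB.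
have d0 j := dy_gt0 j s0.
have b0 : 0 < 1 - a by lra.
have ab1 : a + (1 - a) = 1 by rewrite addrC subrK.
have hB' j : (j < 2 * M)%N -> split 1 (dy s j) (fr a * h) (2 * B j).
  by move=> _; rewrite (_ : fr a * h = g); [exact: hB|rewrite /g /h; ring].
have := frac_eq1 b0 a0 ab1 s0 hh hB'.
set z := (_ * h) => hz.
have zQ : nrm z <= 48 * Q.
  apply: le_sqr_nrm; first by rewrite mulr_ge0.
  apply: le_trans hz _; rewrite exprMn; apply: le_trans (ler_wpM2l (sqr_ge0 48) sB).
  rewrite mulr_sumr [leRHS]big_ord_recr/= -[leLHS]addr0; apply: lerD; last by rewrite mulr_ge0 ?sqr_ge0.
  rewrite le_eqVlt; apply/orP; left; apply/eqP; apply: eq_bigr => j _.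
  by rewrite -exprMn ga; congr (_ ^+ 2); ring.
have B00 : B 0%N <= dy s 0 `^ gam * Q.
  have h1 : (dy s 0 `^ (- gam) * B 0%N) ^+ 2 <= Q ^+ 2.
    apply: le_trans sB; rewrite big_ord_recl lerDl; apply: sumr_ge0 => j _; exact: sqr_ge0.
  have : dy s 0 `^ (- gam) * B 0%N <= Q.
    by move: h1; rewrite ler_sqr ?nnegrE// mulr_ge0 ?powR_ge0.
  by rewrite powRN mulrC ler_pdivrMr ?powR_gt0// mulrC.
have t1 : nrm ((1 - FJ (tc_res X (dy s 0))) * h) <= e / 2.
  have E1 : (1 - FJ (tc_res X (dy s 0))) * h = (tc_cst X lam) * ((1 + tc_res X (dy s 0)) * (1 + tc_res X (dy s 0)) *
      (1 - tc_res X (dy s 0)) * ((1 - tc_res X (dy s 0)) * w)).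
    by rewrite /FJ /h /=; ring.
  rewrite E1 nrmZ gtr0_norm//.
  have k1 := bdM (bdM (bd_1Dres X (d0 0%N)) (bd_1Dres X (d0 0%N))) (bd_1res X (d0 0%N)).
  have k2 := k1.2 _ (tc_sqM (1 - tc_res X (dy s 0)) hw).
  have k3 := res_split1 (d0 0%N) (hBw 0%N).
  apply: le_trans M1.
  have <- : dy s 0 `^ gam = (2^-1 `^ gam) ^+ M.
    by rewrite /dy expr0 mulr1 /s -powR_mulrn ?invr_ge0// -!powRrM mulrC powRrM powR_mulrn ?powR_ge0// -powR_mulrn ?powR_ge0// -powRrM mulrC powRrM powR_mulrn ?invr_ge0.
  have k4 := le_trans k3 B00.
  apply: (@le_trans _ _ (lam * (2 * 2 * 1 * (dy s 0 `^ gam * Q)))).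
    by rewrite ler_pM2l//; apply: le_trans k2 _; rewrite ler_wpM2l ?mulr1 ?mulr_ge0.
  by rewrite le_eqVlt; apply/orP; left; apply/eqP; ring.
have t2 : nrm (FJ (tc_res X (dy s (2 * M))) * h) <= e / 2.
  set J' := tc_res X _; have dn := d0 (2 * M)%N.
  have E2 : FJ J' * h = J' * (2 - J' ^+ 2) * (dJ X (dy s (2 * M))) * (I * h).
    rewrite /FJ {1}/J'; have := dJE X dn; rewrite -/J' /= => e1.
    transitivity (J' * (2 - J' ^+ 2) * (I * dJ X (dy s (2 * M))) * h); last by ring.
    by rewrite -e1; ring.
  rewrite E2; have k1 := bdM (bdM (bd_res X dn) (bd_2Bres2 X dn)) (bd_dJ X dn).
  have k2 := k1.2 _ (tc_sqM (I) hh); have k3 := tc_int_le hh.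
  apply: le_trans k2 _.
  have dE : dy s (2 * M) = 2 ^+ M.
    by rewrite /dy /s mul2n -addnn exprD mulrA -exprMn mulVf ?expr1n ?mul1r// pnatr_eq0.
  rewrite dE -exprVn; apply: le_trans M2.
  have sp : 0 <= 1 * 3 * s by rewrite mulr_ge0// ltW.
  apply: le_trans (ler_wpM2l sp k3) _; rewrite le_eqVlt; apply/orP; left; apply/eqP.
  by rewrite -/(nrm h) -/(nrm (I * h)) -/T; ring.
have hE : h = z + (1 - FJ (tc_res X (dy s 0))) * h + FJ (tc_res X (dy s (2 * M))) * h.
  by rewrite /z; ring.
have n1 := nrmD (tc_sqD (tc_sqM (FJ (tc_res X (dy s 0)) - FJ (tc_res X (dy s (2 * M)))) hh)
  (tc_sqM (1 - FJ (tc_res X (dy s 0))) hh)) (tc_sqM (FJ (tc_res X (dy s (2 * M)))) hh).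
have n2 := nrmD (tc_sqM (FJ (tc_res X (dy s 0)) - FJ (tc_res X (dy s (2 * M)))) hh)
  (tc_sqM (1 - FJ (tc_res X (dy s 0))) hh).
have n3 : nrm h <= nrm z + nrm ((1 - FJ (tc_res X (dy s 0))) * h) +
    nrm (FJ (tc_res X (dy s (2 * M))) * h).
  rewrite {1}hE; apply: le_trans n1 _; exact: lerD.
apply: le_trans n3 _; apply: le_trans (lerD (lerD zQ t1) t2) _.
by rewrite -addrA -splitr.
Qed.

(** The three terms supplied by [frac_lt1] are bounded by the K-functional of g. For the middle one
    the largest scale must exceed the length of the interval: then |p + I q| <= |p| + dy |q|.
    Together they give 4 + 4 + 16 = 24. *)
Lemma mode_lt1 C s n eta : 0 < C -> gam < a -> 0 < s -> 0 < eta -> tc_len X <= dy s n ->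
  (forall (Y : time_calculus R) (x : Y) s n, 0 < s -> tc_sq x ->
    exists B : nat -> R, (forall j, split 1 (dy s j) (tc_frac Y (1 - a) * x) (B j)) /\
    \sum_(j < n) (dy s j `^ (- (gam + (1 - a))) * B j) ^+ 2 <=
    C * ((dy s 0 `^ (- gam) * nrm ((1 - tc_res Y (dy s 0)) * x)) ^+ 2 +
         (dy s n `^ (- gam) * nrm x) ^+ 2 +
         \sum_(j < n) (dy s j `^ (- gam) * nrm (Jd Y s j * x)) ^+ 2)) ->
  exists B : nat -> R, (forall j, split 1 (dy s j) (c * (I * w)) (B j)) /\
  \sum_(j < n) (dy s j `^ (- (1 + gam - a)) * B j) ^+ 2 <= ((24 * C + 1) * (3 * F + eta)) ^+ 2.
Proof.
move=> C0 ga s0 eta0 TM HC; have /andP[a0 a1] := ha.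
have [B [hB _ B0 sB]] := blocks n.+1 s0 eta0.
have d0 j := dy_gt0 j s0.
have [B' [hB' sB']] := HC X g s n s0 hg.
exists B'; split; first by move=> j; rewrite luE.
have -> : - (1 + gam - a) = - (gam + (1 - a)) by ring.
apply: le_trans sB' _; set Q := 3 * F + eta in sB *.
have B2 j : 0 <= dy s j `^ (- gam) * B j by rewrite mulr_ge0 ?powR_ge0.
have q j : (j <= n)%N -> (dy s j `^ (- gam) * B j) ^+ 2 <= Q ^+ 2.
  move=> jM; apply: le_trans sB; rewrite (bigD1 (Ordinal (jM : (j < n.+1)%N)))//= lerDl.
  by apply: sumr_ge0 => i _; exact: sqr_ge0.
have e1 : (dy s 0 `^ (- gam) * nrm ((1 - J (dy s 0)) * g)) ^+ 2 <= 4 * Q ^+ 2.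
  apply: le_trans (ler_wpM2l (ler0n _ 4) (q 0%N (leq0n _))).
  rewrite (_ : (4 : R) = 2 ^+ 2); last by ring.
  rewrite -exprMn; apply: lerXn2r; rewrite ?nnegrE ?mulr_ge0 ?powR_ge0 ?nrm_ge0//.
  by rewrite [leRHS]mulrCA ler_wpM2l ?powR_ge0//; exact: (res_split1 (d0 0%N) (hB 0%N)).
have e2 : (dy s n `^ (- gam) * nrm g) ^+ 2 <= 4 * Q ^+ 2.
  apply: le_trans (ler_wpM2l (ler0n _ 4) (q n (leqnn _))).
  rewrite (_ : (4 : R) = 2 ^+ 2); last by ring.
  rewrite -exprMn; apply: lerXn2r; rewrite ?nnegrE ?mulr_ge0 ?powR_ge0 ?nrm_ge0//.
  rewrite [leRHS]mulrCA ler_wpM2l ?powR_ge0//.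
  have [p [q' [hp hq' E' h']]] := hB n.
  rewrite E' expr1; apply: le_trans (nrmD hp (tc_sqM _ hq')) _; apply: le_trans h'.
  rewrite lerD2l; apply: le_trans (tc_int_le hq') _.
  by rewrite ler_wpM2r ?nrm_ge0.
have e3 : \sum_(j < n) (dy s j `^ (- gam) * nrm (Jd X s j * g)) ^+ 2 <= 16 * Q ^+ 2.
  apply: le_trans (ler_wpM2l (ler0n _ 16) sB); rewrite mulr_sumr [leRHS]big_ord_recr/= -[leLHS]addr0.
  apply: lerD; last by rewrite mulr_ge0 ?sqr_ge0.
  apply: ler_sum => j _; rewrite (_ : (16 : R) = 4 ^+ 2); last by ring.
  rewrite -exprMn; apply: lerXn2r; rewrite ?nnegrE ?mulr_ge0 ?powR_ge0 ?nrm_ge0//.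
  rewrite [leRHS]mulrCA ler_wpM2l ?powR_ge0//; apply: le_trans (Jd_split s0 (hB j)) _.
  by rewrite mulrA -natrM.
apply: le_trans (ler_wpM2l (ltW C0) (lerD (lerD e1 e2) e3)) _.
have Q2 : 0 <= Q ^+ 2 by exact: sqr_ge0.
rewrite exprMn -/Q -!mulrDl mulrA ler_wpM2r//.
have := sqr_ge0 C; have := C0; nra.
Qed.

End positive_gamma.

(** For gam = 0 each of the three terms is at most |g|^2, the last one by [square_function]; with
    |g| <= 2 |f| this gives 3 * 4 = 12. *)
Lemma mode_lt1_0 C s n : 0 < C -> 0 < s ->
  (forall (Y : time_calculus R) (x : Y) s n, 0 < s -> tc_sq x ->
    exists B : nat -> R, (forall j, split 1 (dy s j) (tc_frac Y (1 - a) * x) (B j)) /\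
    \sum_(j < n) (dy s j `^ (- (0 + (1 - a))) * B j) ^+ 2 <=
    C * ((dy s 0 `^ (- 0) * nrm ((1 - tc_res Y (dy s 0)) * x)) ^+ 2 +
         (dy s n `^ (- 0) * nrm x) ^+ 2 +
         \sum_(j < n) (dy s j `^ (- 0) * nrm (Jd Y s j * x)) ^+ 2)) ->
  exists B : nat -> R, (forall j, split 1 (dy s j) (c * (I * w)) (B j)) /\
  \sum_(j < n) (dy s j `^ (- (1 - a)) * B j) ^+ 2 <= ((12 * C + 1) * nrm f) ^+ 2.
Proof.
move=> C0 s0 HC.
have [B' [hB' sB']] := HC X g s n s0 hg.
exists B'; split; first by move=> j; rewrite luE.
rewrite add0r in sB'; apply: le_trans sB' _; rewrite oppr0 !powRr0 !mul1r.
have Ng0 : 0 <= nrm g by exact: nrm_ge0.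
have e1 : nrm ((1 - J (dy s 0)) * g) ^+ 2 <= nrm g ^+ 2.
  apply: lerXn2r; rewrite ?nnegrE ?nrm_ge0//.
  by have := (bd_1res X (dy_gt0 0 s0)).2 _ hg; rewrite mul1r.
have e3 := square_function n s0 hg.
have -> : \sum_(j < n) (dy s j `^ 0 * nrm (Jd X s j * g)) ^+ 2 =
    \sum_(j < n) nrm (Jd X s j * g) ^+ 2.
  by apply: eq_bigr => j _; rewrite powRr0 mul1r.
apply: le_trans (ler_wpM2l (ltW C0) (lerD (lerD e1 (lexx (nrm g ^+ 2))) e3)) _.
have -> : nrm g ^+ 2 + nrm g ^+ 2 + nrm g ^+ 2 = 3 * nrm g ^+ 2.
  by ring.
have h : nrm g ^+ 2 <= 4 * nrm f ^+ 2.
  rewrite (_ : (4 : R) = 2 ^+ 2); last by ring.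
  by rewrite -exprMn; apply: lerXn2r; rewrite ?nnegrE ?mulr_ge0 ?nrm_ge0.
apply: (@le_trans _ _ (C * (3 * (4 * nrm f ^+ 2)))); first by rewrite ler_pM2l// ler_pM2l.
rewrite exprMn (_ : C * _ = 12 * C * nrm f ^+ 2); last by ring.
rewrite ler_wpM2r ?sqr_ge0//; have := sqr_ge0 C; have := C0; nra.
Qed.

End one_mode.

Section scalar_estimates.
Context {R : realType}.
Local Notation mu := (@lebesgue_measure R).
Implicit Types (T a r lam gam : R) (u v f : R -> R).

Lemma H0_norm_nat T m v : H0_norm T m%:R v = H0int_norm T m v.
Proof. by rewrite /H0_norm natrK eqxx. Qed.

Lemma H0_norm_frac T m r v : m%:R < r < m.+1%:R ->
  H0_norm T r v = interp_norm T m.+1 (r / m.+1%:R) v.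
Proof.
move=> /andP[h1 h2]; have r0 : 0 <= r by rewrite (le_trans _ (ltW h1)).
have tr : Num.truncn r = m by apply/eqP; rewrite truncn_eq// (ltW h1).
by rewrite /H0_norm tr lt_eqF.
Qed.

Lemma lee_eta (x : \bar R) (c F : R) : 0 < c ->
  (forall eta, 0 < eta -> (x <= (c * (3 * F + eta))%:E)%E) -> (x <= (3 * c * F)%:E)%E.
Proof.
move=> c0 h; apply/lee_addgt0Pr => e e0.
have := h (e / c) (divr_gt0 e0 c0); congr (_ <= _)%E; rewrite -EFinD; congr EFin.
by field; exact: lt0r_neq0.
Qed.

Lemma sqT_scale T c v : square_integrable mu `]0, T[ v ->
  square_integrable mu `]0, T[ (fun t => c * v t).
Proof.
have mD : measurable (`]0, T[%classic : set (measurableTypeR R)) := measurable_itv _.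
exact: (sqiZ mD c).
Qed.

Lemma resolvent_ex T a lam : 0 < T -> 0 < a -> exists y : calg T,
  (1 + cst_alg T lam * fr T a) * y = 1.
Proof.
move=> T0 a0; have ha := L1T_rl T0 a0.
have [y _ hy] := one_plus_inv (L1TZ lam ha).
by exists (1 + y); rewrite /fr embZ.
Qed.

Section concrete_mode.
Variables (T : R) (T0 : 0 < T) (a lam : R) (ha : 0 < a < 1) (lam0 : 0 < lam).
Variables (f u : R -> R) (w y : calg T).
Local Notation sqT := (square_integrable mu `]0, T[).
Local Notation X := (time_calc T0).
Local Notation c := (cst_alg T lam).
Hypotheses (hf : sqT f) (su : sqT u) (hw : Lsq w) (hu : emb T u = Ic T * w)
  (hwf : w + c * (fr T a * w) = emb T f) (hy : (1 + c * fr T a) * y = 1).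

Let Lf : Lsq (emb T f) := sqT_Lsq hf.
Let slu : sqT (fun t => lam * u t)%R := sqT_scale lam su.
Let luE : emb T (fun t => lam * u t)%R = c * (Ic T * w).
Proof. by rewrite -hu embZ//; exact: sqT_L1T. Qed.
Let hv N : 0 < (2^-1 : R) ^+ N. Proof. by rewrite exprn_gt0// invr_gt0. Qed.

Lemma est_int_1 : (H0int_norm T 1 u <= (N (emb T f))%:E)%E.
Proof.
apply: (@le_trans _ _ (N w)%:E); last first.
  by rewrite lee_fin; exact: (@nrm_w R X a lam ha lam0 (emb T f) w y Lf hwf hy).
by apply: H0int_norm_le => //; rewrite expr1.
Qed.

Lemma est_interp_lt1_0 C : 0 < C -> 
  (forall (Y : time_calculus R) (x : Y) s n, 0 < s -> tc_sq x ->
    exists B : nat -> R, (forall j, split 1 (dy s j) (tc_frac Y (1 - a) * x) (B j)) /\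
    \sum_(j < n) (dy s j `^ (- (0 + (1 - a))) * B j) ^+ 2 <=
    C * ((dy s 0 `^ (- 0) * nrm ((1 - tc_res Y (dy s 0)) * x)) ^+ 2 +
         (dy s n `^ (- 0) * nrm x) ^+ 2 +
         \sum_(j < n) (dy s j `^ (- 0) * nrm (Jd Y s j * x)) ^+ 2)) ->
  (interp_norm T 1 (1 - a) (fun t => lam * u t)%R <= (8 * (12 * C + 1) * N (emb T f))%:E)%E.
Proof.
move=> C0 HC; have /andP[a0 a1] := ha.
rewrite -mulrA.
apply: (interp_le (T0 := T0) (m := 1) (r := 1 - a) (N0 := 0%N)) => //.
- by rewrite mul1r.
- by apply/andP; split; lra.
- by apply: mulr_ge0; [lra|exact: N_ge0].
move=> M _; rewrite luE.
have [B hB] := @mode_lt1_0 R X a lam ha lam0 (emb T f) w y Lf hw hwf hy C _ (2 * M).+1 C0 (hv M) HC.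
by exists B.
Qed.

Section positive_gamma.
Variables (gam F : R) (g0 : 0 < gam) (g2 : gam <= 1 / 2) (hF : interp_norm T 1 gam f = F%:E).

Let F0 : 0 <= F. Proof. by rewrite -lee_fin -hF; exact: sqrte_ge0. Qed.

Let fB s n eta (s0 : 0 < s) (e0 : 0 < eta) := interp_blocks T0 n g0 g2 hf hF s0 e0.

Lemma est_interp_1 : (interp_norm T 2 ((1 + gam) / 2) u <= (3 * (8 * 2) * F)%:E)%E.
Proof.
apply: lee_eta => // eta eta0; rewrite -mulrA.
apply: (interp_le (T0 := T0) (m := 2) (r := 1 + gam) (N0 := 0%N)) => //.
- by field.
- by have := g0; have := g2; move=> ? ?; apply/andP; split; lra.
- by rewrite mulr_ge0// addr_ge0 ?mulr_ge0// ltW.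
move=> M _; rewrite hu.
have [B hB] := @mode_int R X a lam ha lam0 (emb T f) w y hwf hy gam F fB _ (2 * M).+1 eta (hv M) eta0.
by exists B.
Qed.

Lemma est_interp_gt1 : a < gam ->
  (interp_norm T 2 ((1 + gam - a) / 2) (fun t => lam * u t)%R <= (3 * (8 * 28) * F)%:E)%E.
Proof.
move=> ag; have /andP[a0 a1] := ha.
apply: lee_eta => // eta eta0; rewrite -mulrA.
apply: (interp_le (T0 := T0) (m := 2) (r := 1 + gam - a) (N0 := 0%N)) => //.
- by field.
- by have := g0; have := g2; move=> ? ?; apply/andP; split; lra.
- by rewrite mulr_ge0// addr_ge0 ?mulr_ge0// ltW.
move=> M _; rewrite luE.
have [B hB] := @mode_gt1 R X a lam ha lam0 (emb T f) w y hwf hy gam F fB _ (2 * M).+1 eta ag (hv M) eta0.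
by exists B.
Qed.

Lemma est_int_eq1 : gam = a -> (H0int_norm T 1 (fun t => lam * u t)%R <= (3 * 48 * F)%:E)%E.
Proof.
move=> ga; have hh : Lsq (c * w) by exact: LsqM.
apply: (@le_trans _ _ (N (c * w))%:E).
  apply: (H0int_norm_le T0 slu hh).
  exact: (etrans luE (etrans (mulrCA c (Ic T) w) (congr1 (fun z => z * (c * w)) (esym (expr1 (Ic T)))))).
apply: lee_eta => // eta eta0; rewrite lee_fin; apply/ler_addgt0Pr => e e0.
exact: (@mode_eq1 R X a lam ha lam0 (emb T f) w y hw hwf hy gam F g0 F0 fB eta e ga eta0 e0).
Qed.

Lemma est_interp_lt1 C : 0 < C -> gam < a ->
  (forall (Y : time_calculus R) (x : Y) s n, 0 < s -> tc_sq x ->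
    exists B : nat -> R, (forall j, split 1 (dy s j) (tc_frac Y (1 - a) * x) (B j)) /\
    \sum_(j < n) (dy s j `^ (- (gam + (1 - a))) * B j) ^+ 2 <=
    C * ((dy s 0 `^ (- gam) * nrm ((1 - tc_res Y (dy s 0)) * x)) ^+ 2 +
         (dy s n `^ (- gam) * nrm x) ^+ 2 +
         \sum_(j < n) (dy s j `^ (- gam) * nrm (Jd Y s j * x)) ^+ 2)) ->
  (interp_norm T 1 (1 + gam - a) (fun t => lam * u t)%R <= (3 * (8 * (24 * C + 1)) * F)%:E)%E.
Proof.
move=> C0 ga HC; have /andP[a0 a1] := ha.
have D0 : 0 < 24 * C + 1 by lra.
apply: lee_eta => [|eta eta0]; first by rewrite mulr_gt0.
rewrite -mulrA.
apply: (interp_le (T0 := T0) (m := 1) (r := 1 + gam - a) (N0 := Num.truncn T)) => //.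
- by rewrite mul1r.
- by have := g0; have := g2; move=> ? ?; apply/andP; split; lra.
- by rewrite mulr_ge0 ?(ltW D0)// addr_ge0 ?mulr_ge0// ltW.
move=> M NM; rewrite luE.
have TM : T <= dy (2^-1 ^+ M) (2 * M).+1.
  have -> : dy (2^-1 ^+ M) (2 * M).+1 = 2 * 2 ^+ M :> R.
    by rewrite dyS /dy mul2n -addnn exprD (mulrA (2^-1 ^+ M)) -exprMn mulVf ?expr1n ?mul1r// pnatr_eq0.
  rewrite -exprS -natrX; apply: le_trans (ltW (truncnS_gt T)) _; rewrite ler_nat.
  by apply: leq_ltn_trans NM _; apply: ltn_trans (ltn_expl _ _); rewrite // ltnS.
have [B hB] := @mode_lt1 R X a lam ha lam0 (emb T f) w y hw hwf hy gam F fB C _ (2 * M).+1 eta C0 ga (hv M) eta0 TM HC.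
by exists B.
Qed.

End positive_gamma.

End concrete_mode.

(** Four cases: gam = 0, where the norm of [f] is the plain L^2 norm, and gam below, above or equal
    to [a], according to whether the order 1 + gam - a lies below, above or at the integer 1, which
    decides the definition of the second norm. *)
Lemma scalar_estimate (a gam : R) : 0 < a < 1 -> 0 <= gam <= 1 / 2 ->
  exists2 C : R, 0 < C & forall (T lam : R) (f u : R -> R) (w : calg T) (F : R),
    0 < T -> 0 < lam -> square_integrable mu `]0, T[ f -> square_integrable mu `]0, T[ u ->
    Lsq w -> emb T u = Ic T * w -> w + cst_alg T lam * (fr T a * w) = emb T f ->
    H0_norm T gam f = F%:E ->
    (H0_norm T (1 + gam) u <= (C * F)%:E)%E /\
    (H0_norm T (1 + gam - a) (fun t => lam * u t)%R <= (C * F)%:E)%E.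
Proof.
move=> ha /andP[g0 g2]; have /andP[a0 a1] := ha.
have hr : 0 < 1 - a <= 1 by apply/andP; split; lra.
move: g0; rewrite le_eqVlt => /predU1P[<-|g0].
  have hr1 : 0 + (1 - a) < 1 by lra.
  have [C C0 HC] := frac_lt1 (lexx 0) hr hr1.
  exists (8 * (12 * C + 1)); first by lra.
  move=> T lam f u w F T0 lam0 hf su hw hu hwf.
  have [y hy] := resolvent_ex lam T0 a0.
  rewrite (H0_norm_nat T 0) => hF.
  have FE : F = N (emb T f).
    have hF' : (H0int_norm T 0 f < +oo)%E by rewrite hF ltry.
    have [_ [x hx [E N1]]] := H0int_normP T0 hF'.
    by move: N1; rewrite hF => -[->]; rewrite E expr0 mul1r.
  have F0 : 0 <= F by rewrite FE N_ge0.
  rewrite addr0; split.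
    rewrite (H0_norm_nat T 1); apply: le_trans (est_int_1 T0 ha lam0 hf su hw hu hwf hy) _.
    by rewrite lee_fin -FE; have := mulr_ge0 (ltW C0) F0; lra.
  rewrite (@H0_norm_frac _ 0); last by apply/andP; split; lra.
  rewrite divr1 FE; exact: (est_interp_lt1_0 T0 ha lam0 hf su hw hu hwf hy C0 HC).
have hgam : 0%:R < gam < 1%:R by apply/andP; split; lra.
have hgam1 : 1%:R < 1 + gam < 2%:R by apply/andP; split; lra.
have [ga|ga|ga] := ltgtP gam a.
- have hr1 : gam + (1 - a) < 1 by lra.
  have [C C0 HC] := frac_lt1 (ltW g0) hr hr1.
  exists (3 * (8 * 2) + 3 * (8 * (24 * C + 1))); first by lra.
  move=> T lam f u w F T0 lam0 hf su hw hu hwf.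
  have [y hy] := resolvent_ex lam T0 a0.
  rewrite (H0_norm_frac _ _ hgam) divr1 => hF.
  have F0 : 0 <= F by rewrite -lee_fin -hF; exact: sqrte_ge0.
  have CF := mulr_ge0 (ltW C0) F0.
  rewrite (H0_norm_frac _ _ hgam1) (@H0_norm_frac _ 0); last by apply/andP; split; lra.
  rewrite divr1; split.
    apply: le_trans (est_interp_1 T0 ha lam0 hf su hu hwf hy g0 g2 hF) _; rewrite lee_fin; lra.
  apply: le_trans (est_interp_lt1 T0 ha lam0 hf su hw hu hwf hy g0 g2 hF C0 ga HC) _.
  by rewrite lee_fin; lra.
- exists (3 * (8 * 2) + 3 * (8 * 28)); first by lra.
  move=> T lam f u w F T0 lam0 hf su hw hu hwf.
  have [y hy] := resolvent_ex lam T0 a0.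
  rewrite (H0_norm_frac _ _ hgam) divr1 => hF.
  have F0 : 0 <= F by rewrite -lee_fin -hF; exact: sqrte_ge0.
  rewrite (H0_norm_frac _ _ hgam1) (@H0_norm_frac _ 1); last by apply/andP; split; lra.
  split.
    apply: le_trans (est_interp_1 T0 ha lam0 hf su hu hwf hy g0 g2 hF) _; rewrite lee_fin; lra.
  apply: le_trans (est_interp_gt1 T0 ha lam0 hf su hu hwf hy g0 g2 hF ga) _.
  by rewrite lee_fin; lra.
exists (3 * (8 * 2) + 3 * 48); first by lra.
move=> T lam f u w F T0 lam0 hf su hw hu hwf.
have [y hy] := resolvent_ex lam T0 a0.
rewrite (H0_norm_frac _ _ hgam) divr1 => hF.
have F0 : 0 <= F by rewrite -lee_fin -hF; exact: sqrte_ge0.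
rewrite (H0_norm_frac _ _ hgam1) {2}ga addrK (H0_norm_nat T 1).
split.
  apply: le_trans (est_interp_1 T0 ha lam0 hf su hu hwf hy g0 g2 hF) _; rewrite lee_fin; lra.
apply: le_trans (est_int_eq1 T0 ha lam0 hf su hw hu hwf hy g0 g2 hF ga) _.
by rewrite lee_fin; lra.
Qed.

End scalar_estimates.

(** * Weak gradients *)

Lemma Rintegral_sum d' (X : measurableType d') (R : realType) (m : {measure set X -> \bar R})
    (D : set X) (I : Type) (s : seq I) (F : I -> X -> R) : measurable D ->
  (forall i, m.-integrable D (EFin \o F i)) ->
  m.-integrable D (EFin \o (fun x => \sum_(i <- s) F i x)) /\
  \int[m]_(x in D) (\sum_(i <- s) F i x) = \sum_(i <- s) \int[m]_(x in D) F i x.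
Proof.
move=> mD iF; elim: s => [|i s [ih1 ih2]].
  have E : (fun x : X => \sum_(i <- [::]) F i x) = cst 0 by apply/funext => x; rewrite big_nil.
  by rewrite E big_nil Rintegral_cst// mul0r; split => //; exact: integrable0.
have E : (fun x : X => \sum_(j <- i :: s) F j x) = (fun x => F i x + \sum_(j <- s) F j x).
  by apply/funext => x; rewrite big_cons.
rewrite E big_cons -ih2 RintegralD//; split => //.
by apply: eq_integrable (integrableD mD (iF i) ih1).
Qed.

(** * Borel sets and Lebesgue measure on row vectors *)

Section borel_rv.
Context {R : realType} {d : nat}.
Implicit Types (U Omega : set 'rV[R]_d) (f : 'rV[R]_d -> R).

Lemma countable_bigcapT_measurable d' (X : measurableType d') (I : countType) (F : I -> set X) :
  (forall i, measurable (F i)) -> measurable (\bigcap_i F i).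
Proof.
move=> mF; rewrite -[X in measurable X]setCK setC_bigcap; apply: measurableC.
by apply: countable_bigcupT_measurable => // i; exact: measurableC.
Qed.

Lemma measurable_polyhedron Omega : convex_polyhedral_domain Omega -> measurable Omega.
Proof.
move=> [_ _ [k [a [b OE]]]].
have -> : Omega = \bigcap_i [set x : 'rV[R]_d | \sum_(j < d) a i 0 j * x 0 j < b i].
  by rewrite OE; apply/seteqP; split => x h i; [move=> _; exact: h|exact: h].
apply: countable_bigcapT_measurable => i.
have mf : measurable_fun setT (fun x : 'rV[R]_d => \sum_(j < d) a i 0 j * x 0 j).
  apply: measurable_sum => j; apply: measurable_funM; first exact: measurable_cst.
  exact: measurable_rv_coor.
have := mf measurableT `]-oo, b i[%classic (measurable_itv _); rewrite setTI.
by congr measurable; apply/seteqP; split => x /=; rewrite in_itv.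
Qed.

Definition rational_box (p : {ffun 'I_d -> rat} * nat) : set 'rV[R]_d :=
  \bigcap_i [set x | `|ratr (p.1 i) - x 0 i| < p.2.+1%:R^-1].

Lemma measurable_rational_box p : measurable (rational_box p).
Proof.
apply: countable_bigcapT_measurable => i.
have mf : measurable_fun setT (fun x : 'rV[R]_d => `|ratr (p.1 i) - x 0 i|).
  apply: measurableT_comp => //; apply: measurable_funB; first exact: measurable_cst.
  exact: measurable_rv_coor.
have := mf measurableT `]-oo, p.2.+1%:R^-1[%classic (measurable_itv _); rewrite setTI.
by congr measurable; apply/seteqP; split => x /=; rewrite in_itv.
Qed.

(** The sigma-algebra is generated by coordinates, and the topology by boxes: an open set is the
    countable union of the boxes with rational centres and radii 1/(n+1) that it contains. *)
Lemma measurable_open_rv U : open U -> measurable U.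
Proof.
move=> oU.
have -> : U = \bigcup_p [set x | rational_box p x /\ rational_box p `<=` U].
  apply/seteqP; split => [x Ux|x [p _ [px]]]; last exact.
  have /nbhs_ballP[e /= e0 xe] : nbhs x U by exact: open_nbhs_nbhs.
  (* Two points of a box of this radius are at distance less than e. *)
  have [n hn] : exists n : nat, n.+1%:R^-1 < e / 2.
    have e2 : 0 < e / 2 by rewrite divr_gt0.
    have /cvgrPdist_lt/(_ _ e2)[n _ h] := @cvg_harmonic R.
    by exists n; have := h n (leqnn n); rewrite /harmonic/= sub0r normrN ger0_norm.
  have n0 : (0 : R) < n.+1%:R^-1 by rewrite invr_gt0.
  have hq i : exists q : rat, `|ratr q - x 0 i| < n.+1%:R^-1.
    have lt : x 0 i - n.+1%:R^-1 < x 0 i + n.+1%:R^-1 by rewrite ltrD2l gtrN.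
    have [q] := rat_in_itvoo lt; rewrite in_itv/= => hq; exists q.
    by rewrite ltr_distl.
  pose q := [ffun i => sval (cid (hq i))].
  exists (q, n) => //; split.
    by move=> i _ /=; rewrite ffunE; exact: svalP (cid (hq i)).
  move=> y hy; apply: xe; split => // i j; rewrite ord1 /ball/=.
  have := hy j I; rewrite /= ffunE; case: cid => q' /= h1 h2.
  have -> : x 0 j - y 0 j = - (ratr q' - x 0 j) + (ratr q' - y 0 j) by ring.
  rewrite (le_lt_trans (ler_normD _ _))// normrN [e]splitr.
  by apply: ltrD; [exact: lt_trans hn|exact: lt_trans hn].
apply: countable_bigcupT_measurable => // p.
have [pU|npU] := pselect (rational_box p `<=` U).
  rewrite (_ : [set x | _] = rational_box p); first exact: measurable_rational_box.
  by apply/seteqP; split => x //= -[].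
by rewrite (_ : [set x | _] = set0)//; apply/seteqP; split => x //= -[].
Qed.

Lemma measurable_continuous_rv f : continuous f -> measurable_fun setT f.
Proof.
move=> cf mD; apply: (measurability _ (RGenOInfty.measurableE R)) => //.
move=> /= _ [_ [a ->] <-]; rewrite setTI; apply: measurable_open_rv.
by apply: open_comp => [x _|]; [exact: cf|exact: interval_open].
Qed.

End borel_rv.

Section sigma_finite_rv.
Context {R : realType}.

(** Induction on the dimension: an exhaustion of the product is pulled back along [un], the inverse
    of the map that appends a coordinate. *)
Lemma sigma_finite_rv d : sigma_finite setT (lebesgue_rv R d).
Proof.
elim: d => [|d IH].
  exists (fun=> setT); first by rewrite bigcup_const//; exists 0%N.
  by move=> i; split => //=; rewrite diracT ltry.
have [F FT Ff] := product_sigma_finite (sf_measure IH) (@lebesgue_measure R).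
pose un (x : 'rV[R]_d.+1) : 'rV[R]_d * measurableTypeR R :=
  (\row_(j < d) x 0 (lift ord_max j), x 0 ord_max).
have mun : measurable_fun setT un.
  apply/measurable_fun_pairP; split; last exact: measurable_rv_coor.
  apply: measurable_rvP => i; rewrite /un/=.
  rewrite (_ : (fun x => _) = (fun x : 'rV[R]_d.+1 => x 0 (lift ord_max i))); first exact: measurable_rv_coor.
  by apply/funext => x; rewrite mxE.
have unK : cancel (@snoc_rv R d) un.
  move=> [x y]; rewrite /un /snoc_rv; congr (_, _); last by rewrite mxE unlift_none.
  by apply/rowP => j; rewrite !mxE liftK.
exists (fun n => un @^-1` F n).
  apply/seteqP; split => // x _.
  have : (\bigcup_n F n) (un x) by rewrite -FT.
  by move=> [n _ h]; exists n.
move=> n; have [mF Fn] := Ff n; split.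
  by rewrite -[X in measurable X]setTI; exact: mun.
rewrite /=/pushforward (_ : _ @^-1` _ = F n)//.
by apply/seteqP; split => x /=; rewrite unK.
Qed.

End sigma_finite_rv.

(** * Green's formula for eigenfunctions *)

Section weak_gradients.
Context {R : realType} {d : nat}.
Variables (Omega : set 'rV[R]_d) (mO : measurable Omega).
Local Notation leb := (lebesgue_rv R d).
Local Notation sqO := (square_integrable leb Omega).
Implicit Types (g h psi S : 'rV[R]_d -> R) (G : 'I_d -> 'rV[R]_d -> R) (c l : R).

Lemma cvg_L2_int (gk : nat -> 'rV[R]_d -> R) g h : (forall k, measurable_fun Omega (gk k)) ->
  sqO g -> sqO h -> cvg_L2 Omega gk g ->
  \int[leb]_(x in Omega) (h x * gk k x) @[k --> \oo] --> \int[leb]_(x in Omega) (h x * g x).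
Proof.
move=> mg sg sh cg.
pose E k := (\int[leb]_(x in Omega) ((gk k x - g x) ^+ 2)%:E)%E.
have E0 k : (0 <= E k)%E by apply: integral_ge0 => x _; rewrite lee_fin sqr_ge0.
have cg' : E k @[k --> \oo] --> 0%E := cg.
have /fine_cvgP[Efin fE] := cg'.
(* Convergence to 0 allows [E k] to be infinite for finitely many k, so square integrability is
   claimed only where it is finite. *)
have sdk k : E k \is a fin_num -> sqO (fun x => gk k x - g x).
  move=> Ek; split; last by rewrite -/(E k) ltey_eq Ek.
  by apply: measurable_funB => //; exact: sg.1.
set A := \int[leb]_(x in Omega) (h x ^+ 2).
have A0 : 0 <= A by apply: Rintegral_ge0 => x _; exact: sqr_ge0.
have cs : \forall k \near \oo, `|\int[leb]_(x in Omega) (h x * g x) -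
    \int[leb]_(x in Omega) (h x * gk k x)| <= Num.sqrt A * Num.sqrt (fine (E k)).
  near=> k; have sk : sqO (fun x => gk k x - g x) by apply: sdk; near: k.
  have sgk : sqO (gk k).
    have := sqiD mO sk sg; congr square_integrable; apply/funext => x; exact: subrK.
  rewrite -RintegralB//; [|exact: sqi_mul..].
  have -> : \int[leb]_(x in Omega) (h x * g x - h x * gk k x) =
      - \int[leb]_(x in Omega) (h x * (gk k x - g x)).
    rewrite -[RHS]mulN1r -RintegralZ//; last by apply: measurable_funM; [exact: sh.1|exact: sk.1].
    by apply: eq_Rintegral => x _; ring.
  rewrite normrN -sqrtrM// -[leLHS]ger0_norm ?normr_ge0// -sqrtr_sqr ler_wsqrtr//.
  by rewrite real_normK ?num_real//; exact: (cauchy_schwarz mO sh sk).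
apply/cvgrPdist_le => e e0.
have c0 : Num.sqrt A * Num.sqrt (fine (E k)) @[k --> \oo] --> (0 : R).
  rewrite -(mulr0 (Num.sqrt A)) -[X in _ * X](sqrtr0 R); apply: cvgM; first exact: cvg_cst.
  by apply: continuous_cvg fE; exact: sqrt_continuous.
move/cvgrPdist_le : c0 => /(_ _ e0) c0.
near=> k; apply: le_trans (_ : Num.sqrt A * Num.sqrt (fine (E k)) <= _); first by near: k.
have : `|0 - Num.sqrt A * Num.sqrt (fine (E k))| <= e by near: k.
by rewrite sub0r normrN; apply: le_trans; exact: ler_norm.
Unshelve. all: by end_near. Qed.

Lemma test_rv_measurable psi : test_rv Omega psi ->
  measurable_fun Omega psi /\ forall j, measurable_fun Omega (partial j psi).
Proof.
move=> [sp _]; split=> [|j]; apply: measurable_funTS; apply: measurable_continuous_rv.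
  by have [] := sp [::].
by have [] := sp [:: j].
Qed.

(** The second weak derivatives of [phi] may be tested only with test functions. The identity is
    written for test functions that approximate [S] in H^1, and both sides pass to the limit;
    membership of [S] in H^1_0 removes the boundary term. *)
Lemma green_eigenfunction l phi (d0 : (0 < d)%N) G
    (H : 'I_d -> 'I_d -> 'rV[R]_d -> R) S GS :
  H10 Omega phi G -> (forall i j, weak_partial Omega j (G i) (H i j)) ->
  {ae leb, forall x, Omega x -> - (\sum_(j < d) H j j x) = l * phi x} ->
  H10 Omega S GS ->
  \sum_(j < d) \int[leb]_(x in Omega) (GS j x * G j x) = l * \int[leb]_(x in Omega) (S x * phi x).
Proof.
move=> [wphi _] wG eig [wS [psi [tpsi cpsi cdpsi]]].
have sH j : sqO (H j j) by have [] := wG j j.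
have sG j : sqO (G j) by have [] := wG j j.
pose j0 : 'I_d := Ordinal d0.
have sphi : sqO phi by have [] := wphi j0.
have sS : sqO S by have [] := wS j0.
have sGS j : sqO (GS j) by have [] := wS j.
have step j : \int[leb]_(x in Omega) (GS j x * G j x) = - \int[leb]_(x in Omega) (H j j x * S x).
  have c1 := cvg_L2_int (fun k => (test_rv_measurable (tpsi k)).2 j) (sGS j) (sG j) (cdpsi j).
  have c2 := cvg_L2_int (fun k => (test_rv_measurable (tpsi k)).1) sS (sH j) cpsi.
  have E : (fun k => \int[leb]_(x in Omega) (G j x * partial j (psi k) x)) =
      (fun k => - \int[leb]_(x in Omega) (H j j x * psi k x)).
    by apply/funext => k; have [_ _ ->] := wG j j.
  rewrite E in c1; have <- := cvg_unique (@norm_hausdorff _ _) c1 (cvgN c2).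
  by apply: eq_Rintegral => x _; rewrite mulrC.
rewrite (eq_bigr _ (fun j _ => step j)) sumrN.
have -> : \sum_(j < d) \int[leb]_(x in Omega) (H j j x * S x) =
    \int[leb]_(x in Omega) (\sum_(j < d) H j j x * S x).
  have ij j : leb.-integrable Omega (EFin \o (fun x => H j j x * S x)) := sqi_mul mO (sH j) sS.
  by rewrite (Rintegral_sum _ mO ij).2.
have mHS : measurable_fun Omega (fun x => \sum_(j < d) H j j x * S x).
  by apply: measurable_sum => j; apply: measurable_funM; [have [] := sH j|exact: sS.1].
have mPS : measurable_fun Omega (fun x => S x * phi x) by apply: measurable_funM; [exact: sS.1|exact: sphi.1].
rewrite -mulN1r -!RintegralZ//; congr fine; apply: ae_eq_integral => //.
- by apply/measurable_EFinP; apply: measurable_funM => //; exact: measurable_cst.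
- by apply/measurable_EFinP; apply: measurable_funM => //; exact: measurable_cst.
move: eig; apply: filterS => x h Ox; congr EFin.
by rewrite -mulr_suml mulN1r -mulNr h// -mulrA [phi x * _]mulrC.
Qed.

End weak_gradients.

Section product_rv.
Context d' (X : measurableType d') {R : realType}.
Local Notation mu := (@lebesgue_measure R).

Let sf_product_fubini (m : {sigma_finite_measure set X -> \bar R}) (k : X * measurableTypeR R -> R) :
  (m \x mu)%E.-integrable setT (EFin \o k) ->
  mu.-integrable setT (EFin \o (fun t => \int[m]_x k (x, t))) /\
  \int[(m \x mu)%E]_z k z = \int[mu]_t \int[m]_x k (x, t).
Proof.
move=> ik; split; first exact: integrable_Rfubini_G.
rewrite -Rfubini//; apply: EFin_inj; rewrite (Rintegral_fubini_F ik) /Rintegral fineK//.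
exact: (integrable_fin_num measurableT ik).
Qed.

Lemma product_fubini (m : {measure set X -> \bar R}) (h : sigma_finite setT m)
    (k : X * measurableTypeR R -> R) :
  (m \x mu)%E.-integrable setT (EFin \o k) ->
  mu.-integrable setT (EFin \o (fun t => \int[m]_x k (x, t))) /\
  \int[(m \x mu)%E]_z k z = \int[mu]_t \int[m]_x k (x, t).
Proof. exact: (@sf_product_fubini (sf_measure h)). Qed.

Let sf_product_tonelli (m : {sigma_finite_measure set X -> \bar R}) (F : X -> R) (H : R -> R) :
  measurable_fun setT F -> measurable_fun setT H -> (forall x, 0 <= F x) -> (forall t, 0 <= H t) ->
  (\int[(m \x mu)%E]_z (F z.1 * H z.2)%:E = (\int[m]_x (F x)%:E) * (\int[mu]_t (H t)%:E))%E.
Proof.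
move=> mF mH F0 H0.
have mFH : measurable_fun setT (fun z : X * measurableTypeR R => F z.1 * H z.2).
  by apply: measurable_funM; [exact: (measurableT_comp mF)|exact: (measurableT_comp mH)].
rewrite (@fubini_tonelli1 _ _ _ _ _ m mu (fun z : X * measurableTypeR R => (F z.1 * H z.2)%:E)); last 2 first.
  by apply/measurable_EFinP.
  by move=> z; rewrite lee_fin mulr_ge0.
have Hge : (0 <= \int[mu]_t (H t)%:E)%E by apply: integral_ge0 => t _; rewrite lee_fin.
rewrite -ge0_integralZr//; last 2 first.
  by apply/measurable_EFinP.
  by move=> x _; rewrite lee_fin.
apply: eq_integral => x _; rewrite /fubini_F /=.
rewrite -ge0_integralZl_EFin//; last 2 first.
  by move=> t _; rewrite lee_fin.
  by apply/measurable_EFinP.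
Qed.

Lemma product_tonelli (m : {measure set X -> \bar R}) (h : sigma_finite setT m)
    (F : X -> R) (H : R -> R) :
  measurable_fun setT F -> measurable_fun setT H -> (forall x, 0 <= F x) -> (forall t, 0 <= H t) ->
  (\int[(m \x mu)%E]_z (F z.1 * H z.2)%:E = (\int[m]_x (F x)%:E) * (\int[mu]_t (H t)%:E))%E.
Proof. exact: (@sf_product_tonelli (sf_measure h)). Qed.

End product_rv.

Lemma sqi_eq d' (X : measurableType d') (R : realType) (m : {measure set X -> \bar R}) (D : set X)
    (f g : X -> R) : (forall x, D x -> f x = g x) ->
  square_integrable m D f -> square_integrable m D g.
Proof.
move=> fg [mf lf]; have fg' : {in D, f =1 g} by move=> x /set_mem; exact: fg.
split; first exact: eq_measurable_fun mf.
by apply: le_lt_trans lf; rewrite le_eqVlt; apply/orP; left; apply/eqP; apply: eq_integral => x /fg' ->.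
Qed.

Section scaled_gradients.
Context {R : realType} {d : nat}.
Variables (Omega : set 'rV[R]_d) (mO : measurable Omega).
Local Notation leb := (lebesgue_rv R d).
Local Notation mu := (@lebesgue_measure R).
Local Notation sqO := (square_integrable leb Omega).
Implicit Types (g h psi S : 'rV[R]_d -> R) (G : 'I_d -> 'rV[R]_d -> R) (c l : R).

Lemma partial_scale c psi : smooth_rv psi -> forall s : seq 'I_d,
  foldr partial (fun x => c * psi x) s = (fun x => c * foldr partial psi s x).
Proof.
move=> sp; elim => [//|j s ih] /=; apply/funext => x.
have [_ /(_ j x) dx] := sp s.
by rewrite /partial ih; exact: (deriveZ c dx).
Qed.

Lemma test_rv_scale c psi : test_rv Omega psi -> test_rv Omega (fun x => c * psi x).
Proof.
move=> [sp [K [cK KO K0]]]; split; last by exists K; split => // x /K0 ->; rewrite mulr0.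
move=> s; rewrite /= (partial_scale c sp); have [cs ds] := sp s; split.
  by move=> x; apply: (@continuousM _ _ (cst c) (foldr partial psi s)); [exact: cst_continuous|exact: cs].
by move=> j x; exact: (@derivableZ _ _ _ (foldr partial psi s) c x 'e_j (ds j x)).
Qed.

Lemma weak_partial_scale c j g h h' : (forall x, Omega x -> h' x = c * h x) ->
  weak_partial Omega j g h -> weak_partial Omega j (fun x => c * g x) h'.
Proof.
move=> hh [sg sh wp]; split.
- exact: sqiZ.
- by apply: sqi_eq (sqiZ mO c sh) => x Ox; rewrite hh.
move=> psi tp; have [mp mdp] := test_rv_measurable tp.
have -> : \int[leb]_(x in Omega) (c * g x * partial j psi x) =
    \int[leb]_(x in Omega) (c * (g x * partial j psi x)).
  by apply: eq_Rintegral => x _; rewrite mulrA.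
have -> : \int[leb]_(x in Omega) (h' x * psi x) = \int[leb]_(x in Omega) (c * (h x * psi x)).
  by apply: eq_Rintegral => x /set_mem Ox; rewrite hh// mulrA.
rewrite !RintegralZ//; last 2 first.
- by apply: measurable_funM => //; exact: sh.1.
- by apply: measurable_funM => //; exact: sg.1.
by rewrite wp// mulrN.
Qed.

Lemma cvg_L2_scale c (gk : nat -> 'rV[R]_d -> R) g g' : (forall k, measurable_fun Omega (gk k)) ->
  measurable_fun Omega g -> (forall x, Omega x -> g' x = c * g x) ->
  cvg_L2 Omega gk g -> cvg_L2 Omega (fun k x => c * gk k x) g'.
Proof.
move=> mg mg0 gg cg; rewrite /cvg_L2.
have -> : (fun k => \int[leb]_(x in Omega) ((c * gk k x - g' x) ^+ 2)%:E)%E =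
    (fun k => (c ^+ 2)%:E * \int[leb]_(x in Omega) ((gk k x - g x) ^+ 2)%:E)%E.
  apply/funext => k; rewrite -ge0_integralZl_EFin ?sqr_ge0//; last 2 first.
  - by move=> x _; rewrite lee_fin sqr_ge0.
  - by apply/measurable_EFinP; apply: measurable_funX; exact: measurable_funB.
  apply: eq_integral => x /set_mem Ox; rewrite gg// -EFinM; congr EFin; ring.
rewrite -(mule0 (c ^+ 2)%:E); apply: cvgeZl => //; exact: cg.
Qed.

Lemma H10_scale c g G G' : (0 < d)%N -> (forall j x, Omega x -> G' j x = c * G j x) ->
  H10 Omega g G -> H10 Omega (fun x => c * g x) G'.
Proof.
move=> d0 GG [wg [psi [tp cp cdp]]]; split; first by move=> j; exact: (weak_partial_scale (GG j) (wg j)).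
have [sg _ _] := wg (Ordinal d0).
exists (fun k x => c * psi k x); split.
- by move=> k; exact: test_rv_scale.
- apply: (@cvg_L2_scale c psi g) => //; last exact: sg.1.
  by move=> k; have [] := test_rv_measurable (tp k).
move=> j; have [_ sG _] := wg j.
have -> : (fun k => partial j (fun x => c * psi k x)) = (fun k x => c * partial j (psi k) x).
  by apply/funext => k; exact: (partial_scale c (tp k).1 [:: j]).
apply: (@cvg_L2_scale c _ (G j)) => //; last exact: GG; last exact: sG.1.
by move=> k; have [_] := test_rv_measurable (tp k).
Qed.

End scaled_gradients.

Section separated_gradients.
Context {R : realType} {d : nat}.
Variables (d0 : (0 < d)%N) (Omega : set 'rV[R]_d) (mO : measurable Omega).
Variables (phi : nat -> 'rV[R]_d -> R) (lam : nat -> R) (T : R).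
Hypothesis basis : dirichlet_eigenbasis Omega phi lam.
Local Notation leb := (lebesgue_rv R d).
Local Notation mu := (@lebesgue_measure R).
Local Notation sqT := (square_integrable mu `]0, T[).
Local Notation Q := (Omega `*` `]0, T[%classic : set ('rV[R]_d * measurableTypeR R)).

Let mDT : measurable (`]0, T[%classic : set (measurableTypeR R)) := measurable_itv _.
Let mQ : measurable Q. Proof. exact: measurableX. Qed.

(** The gradient of psi(t) phi_n(x) is psi(t) times that of phi_n. Fubini reduces the pairing to
    almost every time slice, where [green_eigenfunction] produces the eigenvalue times the n-th
    coefficient of u. *)
Lemma separated_gradient n (psi : R -> R) : measurable_fun setT psi -> sqT psi ->
  exists Gv, is_gradient_T Omega phi T (fun m => if m == n then psi else cst 0) Gv /\
    forall u Gu, is_gradient_T Omega phi T u Gu -> sqT (u n) ->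
      gradient_pairing Omega T Gu Gv = lam n * \int[mu]_(t in `]0, T[) (u n t * psi t).
Proof.
move=> mpsi spsi; have [onb eig _ _ _] := basis; have [sphi orth _] := onb.
have [G [H [hphi wH eigH]]] := eig n.
have sG j : square_integrable leb Omega (G j) by have [_ ? _] := hphi.1 j.
(* Extension by 0 makes the spatial factor measurable on the whole space, as required for the
   product function. *)
pose Ge j : 'rV[R]_d -> R := G j \_ Omega.
have mGe j : measurable_fun setT (Ge j) by apply/(measurable_restrictT _ mO); exact: (sG j).1.
have GeE j x : Omega x -> Ge j x = G j x by move=> Ox; rewrite /Ge patchE mem_set.
pose Gv j (z : 'rV[R]_d * measurableTypeR R) : R := Ge j z.1 * psi z.2.
have mGv j : measurable_fun setT (Gv j).
  by apply: measurable_funM; [exact: (measurableT_comp (mGe j))|exact: (measurableT_comp mpsi)].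
have sGv j : square_integrable (leb \x mu)%E Q (Gv j).
  split; first exact: measurable_funTS.
  pose P := psi \_ `]0, T[%classic.
  have mP : measurable_fun setT P by apply/(measurable_restrictT _ mDT); exact: spsi.1.
  have -> : (\int[(leb \x mu)%E]_(z in Q) (Gv j z ^+ 2)%:E =
      \int[(leb \x mu)%E]_z (Ge j z.1 ^+ 2 * P z.2 ^+ 2)%:E)%E.
    rewrite integral_mkcond; apply: eq_integral => -[x t] _; rewrite patchE in_setX/= /Gv /P /Ge !patchE/=.
    by case: (x \in Omega); case: (t \in _); rewrite /= ?exprMn ?expr0n ?mul0r ?mulr0.
  rewrite (product_tonelli (sigma_finite_rv (R := R) d) (F := fun x => Ge j x ^+ 2) (H := fun t => P t ^+ 2)).
  - apply: lte_mul_pinfty.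
    + by apply: integral_ge0 => x _; rewrite lee_fin sqr_ge0.
    + rewrite ge0_fin_numE; last by apply: integral_ge0 => x _; rewrite lee_fin sqr_ge0.
      have := (sG j).2; rewrite integral_mkcond; congr (_ < _)%E; apply: eq_integral => x _.
      by rewrite /Ge !patchE; case: ifP; rewrite // expr0n.
    have := spsi.2; rewrite integral_mkcond; congr (_ < _)%E; apply: eq_integral => x _.
    by rewrite /P !patchE; case: ifP; rewrite // expr0n.
  - exact: measurable_funX.
  - exact: measurable_funX.
  - by move=> x; exact: sqr_ge0.
  - by move=> x; exact: sqr_ge0.
exists Gv; split.
  split; first exact: sGv.
  apply: ae_all => t _; exists (fun x => psi t * phi n x).
    by apply: H10_scale hphi => // j x Ox; rewrite /Gv/= GeE// mulrC.
  move=> m; have -> : \int[leb]_(x in Omega) (psi t * phi n x * phi m x) =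
      \int[leb]_(x in Omega) (psi t * (phi n x * phi m x)).
    by apply: eq_Rintegral => x _; rewrite mulrA.
  rewrite RintegralZ//; last by apply: measurable_funM; [exact: (sphi n).1|exact: (sphi m).1].
  by rewrite orth eq_sym; case: ifP; rewrite ?mulr1 ?mulr0.
move=> u Gu [sGu gu] su; rewrite /gradient_pairing.
pose k j z := ((fun z => Gu j z * Gv j z) \_ Q) z.
have ik j : (leb \x mu)%E.-integrable setT (EFin \o k j).
  have := sqi_mul mQ (sGu j) (sGv j); rewrite (integrable_mkcond _ mQ).
  apply: eq_integrable => // z _; rewrite /k /= !patchE; by case: ifP.
have kE j : \int[(leb \x mu)%E]_(z in Q) (Gu j z * Gv j z) = \int[mu]_t \int[leb]_x k j (x, t).
  by rewrite Rintegral_mkcond (product_fubini (sigma_finite_rv (R := R) d) (ik j)).2.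
rewrite (eq_bigr _ (fun j _ => kE j)).
have iK j := (product_fubini (sigma_finite_rv (R := R) d) (ik j)).1.
have [iS <-] := Rintegral_sum (index_enum 'I_d) measurableT iK.
have sup := sqi_mul mDT su spsi.
rewrite -RintegralZ//; last by apply/measurable_EFinP; exact: measurable_int sup.
rewrite [RHS]Rintegral_mkcond; congr fine; apply: ae_eq_integral => //.
- exact: measurable_int iS.
- apply/measurable_EFinP/(measurable_restrictT _ mDT); apply: measurable_funM; first exact: measurable_cst.
  by apply/measurable_EFinP; exact: measurable_int sup.
move: gu; apply: aeW => t ht _; congr EFin; rewrite patchE; case: ifPn => [tT|tT]; last first.
  rewrite big1// => j _; have -> : (fun x => k j (x, t)) = cst 0.
    by apply/funext => x; rewrite /k patchE in_setX/= (negbTE tT) andbF.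
  by rewrite Rintegral_cst// mul0r.
have tT' : t \in `]0, T[ by move/set_mem : tT.
have [S hS cS] := ht tT'.
have -> : \sum_(j < d) \int[leb]_x k j (x, t) = \sum_(j < d) psi t * \int[leb]_(x in Omega) (Gu j (x, t) * G j x).
  apply: eq_bigr => j _; have [_ sj _] := hS.1 j.
  rewrite -RintegralZ//; last by apply: measurable_funM; [exact: sj.1|exact: (sG j).1].
  rewrite [RHS]Rintegral_mkcond; apply: eq_Rintegral => x _; rewrite /k !patchE in_setX/= tT andbT.
  by case: ifP => // /set_mem Ox; rewrite /Gv/= GeE//; ring.
rewrite -mulr_sumr (green_eigenfunction mO d0 hphi wH eigH hS) cS; ring.
Qed.

End separated_gradients.

(** * Reduction to modes *)

Section fractional_operators.
Context {R : realType} (T : R).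
Hypothesis T0 : 0 < T.
Local Notation mu := (@lebesgue_measure R).
Local Notation DT := (`]0, T[%classic : set R).
Local Notation sqT := (square_integrable mu `]0, T[).
Local Notation Ic := (Ic T).
Implicit Types (v u : R -> R) (a b g lam : R).
Local Opaque Gamma.

Let mDT : measurable (DT : set (measurableTypeR R)) := measurable_itv _.

Lemma cst_partM (x y : calg T) : cst_part (x * y) = cst_part x * cst_part y.
Proof. by []. Qed.

Lemma cst_partD (x y : calg T) : cst_part (x + y) = cst_part x + cst_part y.
Proof. by []. Qed.

Lemma refl_emb v : L1T T v -> L1T T (fun t => v (T - t)) /\
  refl (emb T v) = emb T (fun t => v (T - t)).
Proof.
move=> Lv; have E : tr T (fun t => v (T - t)) = (fun t => tr T v (T - t)).
  apply/funext => t; rewrite /tr !patchE; congr (if _ then _ else _).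
  by apply/idP/idP => /set_mem; rewrite /= in_itv/= => /andP[t0 tT]; apply/mem_set;
    rewrite /= in_itv/=; apply/andP; split; lra.
have gr := good_reflect (good_tr Lv).
split; first by apply: L1T_tr; rewrite E; exact: gr.1.
rewrite /refl /emb E; apply: mk_eq => //; first exact: good_reflect (good_fun _).
by move: (ae_sub T (fun_part_mk 0 (good_tr Lv))); apply: aeW.
Qed.

Lemma I0E g v t : 0 < g -> L1T T v -> DT t -> I0 g v t = conv (tr T (rl g)) (tr T v) t.
Proof.
move=> g0 Lv Dt; rewrite (conv_trE _ _ Dt) /I0.
have /andP[t0 tT] : 0 < t < T by move: Dt; rewrite /= in_itv.
have sub : `]0, t[%classic `<=` DT.
  by move=> s /=; rewrite !in_itv/= => /andP[-> st]; exact: lt_trans tT.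
rewrite -RintegralZ//; last first.
  apply: measurable_funM.
    apply: (measurableT_comp (measurable_powR _)); exact: measurable_funB.
  by apply: measurable_funS sub _ => //; apply/measurable_EFinP; exact: measurable_int Lv.
apply: eq_Rintegral => s /set_mem; rewrite /= in_itv/= => /andP[s0 st].
by rewrite mulrA /rl /pw subr_gt0 st.
Qed.

Lemma I0_alg g v : 0 < g -> L1T T v -> L1T T (I0 g v) /\ emb T (I0 g v) = fr T g * emb T v.
Proof.
move=> g0 Lv; have Lg := L1T_rl T0 g0; have Lc := L1T_conv Lg Lv.
have L : L1T T (I0 g v).
  by apply: eq_integrable Lc => // t /set_mem Dt; rewrite /= I0E.
split=> //; rewrite embM//; apply/emb_eq => //.
by apply: ae_all => t Dt; rewrite I0E.
Qed.

(** The substitution s -> T - s turns the right-sided integral into the left-sided one. *)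
Lemma IT_alg g v : 0 < g -> L1T T v ->
  L1T T (IT g T v) /\ emb T (IT g T v) = refl (fr T g * refl (emb T v)).
Proof.
move=> g0 Lv; have [Lv' Ev'] := refl_emb Lv; have [LI EI] := I0_alg g0 Lv'.
have [Lr Er] := refl_emb LI.
have E t : DT t -> IT g T v t = I0 g (fun s => v (T - s)) (T - t).
  rewrite /= in_itv/= => /andP[t0 tT]; rewrite /IT /I0; congr (_ * _).
  rewrite Rintegral_mkcond [RHS]Rintegral_mkcond.
  have mI : measurable (`]t, T[%classic : set (measurableTypeR R)) by exact: measurable_itv.
  rewrite -(@Rintegral_reflect _ T); last first.
    apply/(measurable_restrictT _ mI); apply: measurable_funM.
      apply: (measurableT_comp (measurable_powR _)); exact: measurable_funB.
    have sub : `]t, T[%classic `<=` DT.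
      by move=> s /=; rewrite !in_itv/= => /andP[st ->]; rewrite (lt_trans t0 st).
    by apply: measurable_funS sub _ => //; apply/measurable_EFinP; exact: measurable_int Lv.
  apply: eq_Rintegral => s _; rewrite !patchE.
  have -> : (T - s \in `]t, T[%classic) = (s \in `]0, T - t[%classic).
    by apply/idP/idP => /set_mem; rewrite /= in_itv/= => /andP[h1 h2]; apply/mem_set;
      rewrite /= in_itv/=; apply/andP; split; lra.
  by case: ifP => // _; congr (_ `^ _ * _); ring.
have L : L1T T (IT g T v).
  by apply: eq_integrable Lr => // t /set_mem Dt; rewrite /= E.
split=> //; rewrite Ev' -EI Er; apply/emb_eq => //.
by apply: ae_all => t Dt; rewrite E.
Qed.

(** The definition says fr(1-b) u = Ic Du + c Ic. Multiplying by fr b and cancelling Ic leaves u =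
    fr b Du + c fr b, and c = 0 since fr b is not square integrable for [b <= 2^-1]. *)
Lemma D0_alg b u Du : 0 < b -> b <= 2^-1 -> sqT u -> sqT Du -> is_D0 b T u Du ->
  emb T u = fr T b * emb T Du.
Proof.
move=> b0 b2 su sDu wd; have Lu := sqT_L1T su; have hu := sqT_Lsq su; have hDu := sqT_Lsq sDu.
have b1 : 0 < 1 - b by rewrite subr_gt0 (le_lt_trans b2)// invf_lt1// ltr1n.
have bb : b + (1 - b) <= 2 by rewrite addrC subrK ler1n.
have [LI EI] := I0_alg b1 Lu.
have sI : sqT (I0 (1 - b) u) by apply: (sqi_of_Lsq LI); rewrite EI; exact: LsqM.
have [c E] := alg_of_weak_deriv T0 sI sDu wd.
have F : fr T b * fr T (1 - b) = Ic by rewrite frM// addrC subrK fr1.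
have key : emb T u = fr T b * emb T Du + cst_alg T c * fr T b.
  apply: (Ic_inj T0).
    have z1 : cst_part (fr T b) = 0 by [].
    by rewrite cst_partD !cst_partM hu.1 z1 mul0r mulr0 addr0.
  rewrite -{1}F -mulrA -EI E.
  move: (fr T b) (emb T Du) (cst_alg T c) Ic => p q r s; ring.
suff c0 : c = 0 by rewrite key c0 rmorph0 mul0r addr0.
apply: (fr_nLsq T0 b0 b2 (LsqB hu (LsqM (fr T b) hDu))).
by rewrite key addrC addKr.
Qed.

(** With c the mean of [V], the element V - c Ic has mean 0. It is orthogonal to Ic and, by
    assumption, to [V]; hence to itself. *)
Lemma Lsq_orthogonal (V : calg T) : Lsq V ->
  (forall x, Lsq x -> \int[mu]_t fun_part x t = 0 -> ip V x = 0) ->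
  exists c, V = cst_alg T c * Ic.
Proof.
move=> hV h; have sV := Lsq_sqi hV; have VE := emb_fun_part hV.1.
pose c := (\int[mu]_(t in DT) fun_part V t) / T; exists c.
have hI : Lsq Ic by exact: Lsq_Ic.
have hx : Lsq (V - cst_alg T c * Ic) by apply: LsqB => //; exact: LsqZ.
have Lc : L1T T (cst c) := L1T_cst T c.
have xE : V - cst_alg T c * Ic = emb T (fun t => fun_part V t - c).
  rewrite -{1}VE /Ic embZ; last exact: L1T_cst.
  have L1c : L1T T (fun t => c * cst 1 t) by apply: L1TZ; exact: L1T_cst.
  rewrite embN// embD//; last by have := L1TZ (-1) L1c; apply: eq_integrable => // t _ /=; rewrite mulN1r.
    by congr emb; apply/funext => t; rewrite /= mulr1.
  exact: sqT_L1T.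
have Lx : L1T T (fun t => fun_part V t - c) :=  L1TD (sqT_L1T sV) (L1T_cst T (- c)).
have int0 : \int[mu]_t fun_part (V - cst_alg T c * Ic) t = 0.
  rewrite xE Rintegral_emb// RintegralB//; last exact: sqT_L1T.
  rewrite Rintegral_cst// /= lebesgue_measure_itv/= lte_fin T0 oppr0 adde0/= /c divfK ?subrr//.
  exact: lt0r_neq0.
have ip1 : ip Ic (V - cst_alg T c * Ic) = 0.
  have sx : sqT (fun t => fun_part V t - c) by apply: (sqi_of_Lsq Lx); rewrite -xE.
  rewrite xE -ip_embE//; last exact: sqi_cst.
  rewrite -[RHS]int0 xE Rintegral_emb//; by apply: eq_Rintegral => t _; rewrite mul1r.
apply/eqP; rewrite -subr_eq0; apply/eqP; apply: N_eq0 => //.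
by rewrite /N (ipDl hV (LsqN (LsqZ c hI)) hx) ipNl ipZl ip1 mulr0 oppr0 addr0 (h _ hx int0) sqrtr0.
Qed.

End fractional_operators.

Lemma combine_modes (A : comNzRingType) (D c h u q f k r : A) :
  D + c * (h * u) - q * f = 0 -> u = h * D -> h * q = k -> h * h = r ->
  u + c * (r * u) = k * f.
Proof.
move=> E uE <- <-; apply/eqP; rewrite -subr_eq0; apply/eqP.
have -> : u + c * (h * h * u) - h * q * f = h * (D + c * (h * u) - q * f) by rewrite {1}uE; ring.
by rewrite E mulr0.
Qed.

(** * The integrated equation of one mode *)

Section mode_equation.
Context {R : realType} (T : R).
Hypothesis T0 : 0 < T.
Local Notation mu := (@lebesgue_measure R).
Local Notation sqT := (square_integrable mu `]0, T[).
Local Notation Ic := (Ic T).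
Local Notation fr := (fr T).
Implicit Types (v u : R -> R) (a lam : R).
Local Opaque Gamma.

Lemma reflN (x : calg T) : refl (- x) = - refl x.
Proof.
have E (y : calg T) : - y = cst_alg T (-1) * y by rewrite rmorphN rmorph1 mulN1r.
by rewrite (E x) (E (refl x)) refl_cst.
Qed.

Lemma refl_Ic (x : calg T) : Lsq x -> \int[mu]_t fun_part x t = 0 ->
  Ic * x = - refl (Ic * refl x) /\ refl (Ic * x) = - (Ic * refl x).
Proof.
move=> hx x0; have := Ic_refl hx.1; rewrite x0 rmorph0 mul0r => /eqP; rewrite addr_eq0 => /eqP E.
by split; rewrite // E reflN reflK.
Qed.

Lemma ip_combination (p q r x : calg T) lam : Lsq p -> Lsq q -> Lsq r -> Lsq x ->
  ip p x + lam * ip q x = ip r x -> ip (p + cst_alg T lam * q - r) x = 0.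
Proof.
move=> hp hq hr hx E; have hc := LsqZ lam hq.
by rewrite (ipDl (LsqD hp hc) (LsqN hr) hx) (ipDl hp hc hx) ipZl ipNl E subrr.
Qed.

Section identity.
Variables (a lam : R) (ha : 0 < a < 1) (u Du f : R -> R).
Hypotheses (su : sqT u) (sDu : sqT Du) (sf : sqT f) (uE : emb T u = fr (a / 2) * emb T Du).
Hypothesis test : forall x : calg T, Lsq x -> \int[mu]_t fun_part x t = 0 ->
  ip (fr (1 - a / 2) * emb T Du) x + lam * ip (Ic * emb T u) x =
  ip (fr (1 - a) * Ic * emb T f) x.

(** Orthogonality to mean 0 functions makes the residual [V] a constant c. It factors as fr(1-a/2)
    W, so multiplication by fr(a/2) and cancellation of Ic give W = c fr(a/2). As [W] is square
    integrable and the kernel of order a/2 is not, c = 0. One more factor fr(a/2) turns W = 0 into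
    the claim. *)
Lemma mode_equation_alg : emb T u + cst_alg T lam * (fr a * emb T u) = Ic * emb T f.
Proof.
have /andP[a0 a1] := ha; have hu := sqT_Lsq su; have hD := sqT_Lsq sDu; have hf := sqT_Lsq sf.
have b0 : 0 < a / 2 by rewrite divr_gt0.
have b2 : a / 2 <= 2^-1 by rewrite -[leRHS]mul1r ler_wpM2r// ltW.
have b1 : 0 < 1 - a / 2 by rewrite subr_gt0 (le_lt_trans b2)// invf_lt1// ltr1n.
have c0 : 0 < 1 - a by rewrite subr_gt0.
have s1 : a / 2 + (1 - a / 2) = 1 by rewrite addrC subrK.
have k1 : a / 2 + (1 - a / 2) <= 2 by rewrite s1 ler1n.
have F1 : fr (a / 2) * fr (1 - a / 2) = Ic by rewrite (frM T0 b0 b1 k1) s1 fr1.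
have s2 : a / 2 + (1 - a) = 1 - a / 2 by field.
have k2 : a / 2 + (1 - a) <= 2 by rewrite s2; lra.
have F2 : fr (a / 2) * fr (1 - a) = fr (1 - a / 2) by rewrite (frM T0 b0 c0 k2) s2.
have k3 : a / 2 + a / 2 <= 2 by lra.
have F3 : fr (a / 2) * fr (a / 2) = fr a by rewrite (frM T0 b0 b0 k3) -splitr.
pose V := fr (1 - a / 2) * emb T Du + cst_alg T lam * (Ic * emb T u) - fr (1 - a) * Ic * emb T f.
have h1 : Lsq (fr (1 - a / 2) * emb T Du) by exact: LsqM.
have h2 : Lsq (cst_alg T lam * (Ic * emb T u)) := LsqZ lam (LsqM Ic hu).
have h3 : Lsq (fr (1 - a) * Ic * emb T f) by exact: LsqM.
have h2' : Lsq (Ic * emb T u) by exact: LsqM.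
have hV : Lsq V := LsqB (LsqD h1 h2) h3.
have [c cE] : exists c, V = cst_alg T c * Ic.
  apply: (Lsq_orthogonal T0 hV) => x hx x0.
  exact: ip_combination h1 h2' h3 hx (test hx x0).
pose W := emb T Du + cst_alg T lam * (fr (a / 2) * emb T u) - fr (1 - a / 2) * emb T f.
have hW : Lsq W.
  exact: LsqB (LsqD hD (LsqZ lam (LsqM (fr (a / 2)) hu))) (LsqM (fr (1 - a / 2)) hf).
have WE : Ic * W = Ic * (cst_alg T c * fr (a / 2)).
  have -> : Ic * (cst_alg T c * fr (a / 2)) = fr (a / 2) * V.
    by rewrite cE; move: (fr (a / 2)) (cst_alg T c) Ic => p q r; ring.
  rewrite /W /V mulrBr mulrDr -{1}F1 -F2.
  move: (fr (a / 2)) (fr (1 - a / 2)) (fr (1 - a)) Ic (emb T Du) (emb T u) (emb T f) (cst_alg T lam).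
  by move=> p q r s k l m n; ring.
have W1 : W = cst_alg T c * fr (a / 2).
  apply: (Ic_inj T0) WE; have z : cst_part (fr (a / 2)) = 0 by [].
  by rewrite hW.1 cst_partM z mulr0.
have cc : c = 0 := @fr_nLsq _ T T0 (a / 2) c W b0 b2 hW W1.
have W0 : W = 0 by rewrite W1 cc rmorph0 mul0r.
exact: (combine_modes W0 uE F1 F3).
Qed.

End identity.

End mode_equation.

Section time_norms.
Context {R : realType}.
Local Notation mu := (@lebesgue_measure R).
Implicit Types (T r s : R) (lam : nat -> R) (v : nat -> R -> R) (psi : R -> R).

Lemma H0_norm_ge0 T r psi : (0 <= H0_norm T r psi)%E.
Proof. by rewrite /H0_norm; case: ifP => _; [exact: H0int_norm_ge0|exact: sqrte_ge0]. Qed.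

Lemma H0_norm_sqT T psi : 0 < T -> (H0_norm T 0 psi < +oo)%E -> square_integrable mu `]0, T[ psi.
Proof. by move=> T0; rewrite (H0_norm_nat T 0) => h; have [] := H0int_normP T0 h. Qed.

Lemma H0_normL2 T psi : 0 < T -> square_integrable mu `]0, T[ psi ->
  H0_norm T 0 psi = (N (emb T psi))%:E.
Proof.
move=> T0 sp; rewrite (H0_norm_nat T 0).
have h : (H0int_norm T 0 psi <= (N (emb T psi))%:E)%E.
  by apply: (H0int_norm_le T0 sp (sqT_Lsq sp)); rewrite expr0 mul1r.
have [_ [x _ [E ->]]] := H0int_normP T0 (le_lt_trans h (ltry _)).
by rewrite E expr0 mul1r.
Qed.

(** The a priori estimate at eigenvalue 1, with the right-hand side manufactured as x + fr a x,
    doubles as a proof that primitives have fractional regularity. This is needed for the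
    admissibility of the test functions. *)
Lemma H0_norm_Ic T a : 0 < T -> 0 < a < 1 -> exists2 C : R, 0 < C &
  forall psi (x : calg T), square_integrable mu `]0, T[ psi -> Lsq x -> emb T psi = Ic T * x ->
  (H0_norm T (1 - a) psi <= (C * N (x + fr T a * x))%:E)%E.
Proof.
move=> T0 ha; have h0 : 0 <= (0 : R) <= 1 / 2 by rewrite lexx divr_ge0.
have [C C0 h] := scalar_estimate ha h0; exists C => // psi x sp hx E.
have hf : Lsq (x + fr T a * x) := LsqD hx (LsqM _ hx).
have sf := Lsq_sqi hf; have fE := emb_fun_part hf.1.
have n0 := H0_normL2 T0 sf; rewrite fE in n0.
have wE : x + cst_alg T 1 * (fr T a * x) = emb T (fun_part (x + fr T a * x)).
  by rewrite fE rmorph1 mul1r.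
have [_] := h T 1 _ psi x _ T0 ltr01 sf sp hx E wE n0.
have -> : (fun t => 1 * psi t)%R = psi by apply/funext => t; rewrite mul1r.
by rewrite addr0.
Qed.

Lemma H0_norm_fr0 T r : 0 < T -> 0 < r < 1 -> H0_norm T r (cst 0) = 0%E.
Proof.
move=> T0 /andP[r0 r1]; have ha : 0 < 1 - r < 1 by apply/andP; split; lra.
have [C _ h] := H0_norm_Ic T0 ha.
have z : emb T (cst (0 : R)) = 0 by have := embZ 0 (L1T_cst T (0 : R)); rewrite rmorph0 mul0r => ->;
  congr emb; apply/funext => t /=; rewrite mul0r.
have := h (cst 0) 0 (sqi_cst T 0) (Lsq0 T); rewrite mulr0 mulr0 addr0 subKr => /(_ z).
rewrite (_ : N 0 = 0) ?mulr0 => [le0|]; first by apply/eqP; rewrite eq_le le0 H0_norm_ge0.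
by have := NZ 0 (0 : calg T); rewrite mulr0 normr0 mul0r.
Qed.

Lemma H0_norm_L20 T : 0 < T -> H0_norm T 0 (cst 0) = 0%E.
Proof.
move=> T0; have z : emb T (cst (0 : R)) = cst_alg T 0 * emb T (cst (0 : R)).
  by rewrite (embZ 0 (L1T_cst T (0 : R))); congr emb; apply/funext => t /=; rewrite mul0r.
by rewrite (H0_normL2 T0 (sqi_cst T 0)) z NZ normr0 mul0r.
Qed.

Lemma H0X_term lam T r s v n :
  (H0_norm T r (fun t => (lam n `^ (s / 2) * v n t)%R) <= H0X_norm lam T r s v)%E.
Proof.
set x := (X in (X <= _)%E); have x0 : (0 <= x)%E by exact: H0_norm_ge0.
rewrite -[leLHS]gee0_abs// -sqrte_sqr lee_sqrt; last first.
  by apply: nneseries_ge0 => k _ _; exact: sqre_ge0.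
rewrite (@nneseriesD1 _ _ n xpredT)// => [|k _]; last exact: sqre_ge0.
by apply: leeDl; apply: nneseries_ge0 => k _ _; exact: sqre_ge0.
Qed.

Lemma L2X_sqT lam T s v n : 0 < T -> 0 < lam n -> L2X lam T s v ->
  square_integrable mu `]0, T[ (v n).
Proof.
move=> T0 l0 h; have := H0_norm_sqT T0 (le_lt_trans (H0X_term lam T 0 s v n) h).
move=> /(sqT_scale (lam n `^ (s / 2))^-1); congr square_integrable; apply/funext => t.
by rewrite mulKf// lt0r_neq0// powR_gt0.
Qed.

Lemma H0X_single lam T r s psi n : H0_norm T r (cst 0) = 0%E ->
  H0X_norm lam T r s (fun m => if m == n then psi else cst 0) =
  H0_norm T r (fun t => lam n `^ (s / 2) * psi t)%R.
Proof.
move=> z; rewrite /H0X_norm (@nneseriesD1 _ _ n xpredT)// => [|k _]; last exact: sqre_ge0.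
rewrite eqxx eseries0 ?adde0 => [|k _ /negbTE kn].
  by rewrite sqrte_sqr gee0_abs// H0_norm_ge0.
rewrite kn (_ : (fun t => _) = cst 0) ?z ?expe2 ?mule0//.
by apply/funext => t /=; rewrite mulr0.
Qed.

Lemma pairing_single (c : nat -> R) (e : nat -> R) n : (forall m, m != n -> e m = 0) ->
  pairing c e = c n * e n.
Proof.
move=> e0; apply: lim_near_cst => //; exists n.+1 => // m /= nm.
rewrite /series/= (bigD1_seq n) ?mem_index_iota ?iota_uniq//= big1 ?addr0//.
by move=> k kn; rewrite e0// mulr0.
Qed.

End time_norms.

(** * From the weak formulation to the modes *)

Section reduction.
Context {R : realType} {d : nat}.
Variables (d0 : (0 < d)%N) (Omega : set 'rV[R]_d) (mO : measurable Omega).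
Variables (phi : nat -> 'rV[R]_d -> R) (lam : nat -> R) (T : R) (T0 : 0 < T).
Hypothesis basis : dirichlet_eigenbasis Omega phi lam.
Variables (alpha : R) (ha : 0 < alpha < 1).
Local Notation mu := (@lebesgue_measure R).
Local Notation sqT := (square_integrable mu `]0, T[).
Local Notation Ic := (Ic T).
Local Notation fr := (fr T).
Local Opaque Gamma.

Let mDT : measurable (`]0, T[%classic : set (measurableTypeR R)) := measurable_itv _.
Let a0 : 0 < alpha. Proof. by have /andP[] := ha. Qed.
Let a1 : alpha < 1. Proof. by have /andP[] := ha. Qed.
Let b0 : 0 < alpha / 2. Proof. by rewrite divr_gt0. Qed.
Let b2 : alpha / 2 <= 2^-1. Proof. by rewrite -[leRHS]mul1r ler_wpM2r// ltW. Qed.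
Let b1 : 0 < 1 - alpha / 2.
Proof. by rewrite subr_gt0 (le_lt_trans b2)// invf_lt1// ltr1n. Qed.
Let c0 : 0 < 1 - alpha. Proof. by rewrite subr_gt0. Qed.

Let int0 (h : R -> R) : \int[mu]_(t in `]0, T[) (cst 0 t * h t) = 0.
Proof.
have -> : (fun t => cst 0 t * h t) = cst 0 by apply/funext => t /=; rewrite mul0r.
by rewrite Rintegral_cst// mul0r.
Qed.

Lemma IT0 g : IT g T (cst 0) = cst (0 : R).
Proof.
apply/funext => t; rewrite /IT.
have -> : (fun s => (s - t) `^ (g - 1) * cst 0 s) = cst 0 by apply/funext => s /=; rewrite mulr0.
by rewrite Rintegral_cst ?mul0r ?mulr0//; exact: measurable_itv.
Qed.

Lemma is_DT0 b : is_DT b T (cst 0) (cst 0).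
Proof.
rewrite /is_DT IT0 (_ : (fun t => - cst 0 t) = cst 0); last by apply/funext => t /=; rewrite oppr0.
by split=> [||psi _]; [exact: L1T_cst|exact: L1T_cst|rewrite !int0 oppr0].
Qed.

Lemma L2X_single s (psi : R -> R) n : sqT psi ->
  L2X lam T s (fun m => if m == n then psi else cst 0).
Proof.
move=> sp; rewrite /L2X (H0X_single lam s psi n (H0_norm_L20 T0)).
by rewrite (H0_normL2 T0 (sqT_scale _ sp)) ltry.
Qed.

(** All coefficients but one vanish, and the remaining one is a primitive, to which [H0_norm_Ic]
    applies with 1 - alpha/2 in the place of [a]. *)
Lemma XX_single (x : calg T) n : Lsq x ->
  XX lam alpha T (fun m => if m == n then fun_part (Ic * x) else cst 0).
Proof.
move=> hx; have hpsi : Lsq (Ic * x) := LsqM Ic hx; have sp := Lsq_sqi hpsi.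
split; last exact: L2X_single; split; first exact: L2X_single.
have r1 : 0 < alpha / 2 < 1.
  by rewrite b0 (le_lt_trans b2)// invf_lt1// ltr1n.
rewrite (H0X_single lam 0 _ n (H0_norm_fr0 T0 r1)).
have r2 : 0 < 1 - alpha / 2 < 1 by rewrite b1/= gtrDl oppr_lt0.
have [C _ h] := H0_norm_Ic T0 r2; rewrite subKr in h.
set k := lam n `^ _; have hk : Lsq (cst_alg T k * x) := LsqZ k hx.
apply: le_lt_trans (h _ (cst_alg T k * x) (sqT_scale k sp) hk _) (ltry _).
rewrite -(embZ k (sqT_L1T sp)) (emb_fun_part hpsi.1).
by move: (cst_alg T k) Ic x {h hk hx hpsi sp} => p q x; rewrite mulrCA.
Qed.

Let adjoint_Ic (k y x : calg T) : Lsq y -> Lsq x -> \int[mu]_t fun_part x t = 0 ->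
  ip y (refl (k * refl (Ic * x))) = - ip (k * Ic * y) x.
Proof.
move=> hy hx x0; rewrite (refl_Ic hx x0).2 mulrN reflN mulrA ipNr.
by rewrite (adjoint (k * Ic) hy hx).
Qed.

Variables (f u : nat -> R -> R) (s : R).
Hypotheses (hf : L2X lam T s f) (ws : weak_solution Omega phi lam alpha T f u).

(** The weak formulation is tested with psi phi_n, where psi = Ic x and x has mean 0, so psi
    vanishes at both ends of the interval. Moving all operators onto the first factor by [adjoint]
    produces the same minus sign in the three terms, and what remains is the hypothesis of
    [mode_equation_alg]. *)
Lemma weak_solution_mode n : [/\ sqT (f n), sqT (u n) &
  emb T (u n) + cst_alg T (lam n) * (fr alpha * emb T (u n)) = Ic * emb T (f n)].
Proof.
have [[H0u _] [Du [Gu [LDu D0u gu test]]]] := ws.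
have l0 m : 0 < lam m by case: basis.
have sf := L2X_sqT T0 (l0 n) hf; have su := L2X_sqT T0 (l0 n) H0u.1.
have sDu := L2X_sqT T0 (l0 n) LDu.
have uE := D0_alg T0 b0 b2 su sDu (D0u n).
split => //; apply: (mode_equation_alg T0 ha su sDu sf uE) => x hx x0.
pose psi := fun_part (Ic * x).
have hpsi : Lsq (Ic * x) := LsqM Ic hx; have spsi : sqT psi := Lsq_sqi hpsi.
have psiE : emb T psi = Ic * x := emb_fun_part hpsi.1.
have mpsi : measurable_fun setT psi := good_meas (good_fun (Ic * x)).
have [Gv [gv pv]] := separated_gradient d0 mO basis n mpsi spsi.
have [LIT EIT] := IT_alg T0 b1 (sqT_L1T spsi).
have [LIf EIf] := IT_alg T0 c0 (sqT_L1T spsi).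
have [I1 I2] := refl_Ic hx x0.
(* As psi vanishes at [T], its right-sided derivative of order alpha/2 is minus the right-sided
   integral of order 1 - alpha/2 of psi' = x, that is [- refl z]. *)
pose z := fr (1 - alpha / 2) * refl x; have hz : Lsq z := LsqM _ (Lsq_refl hx).
have hrz := Lsq_refl hz; have srz := Lsq_sqi hrz; have rzE := emb_fun_part hrz.1.
(* The constant is minus the total integral in [Ic_refl]; weak derivatives do not see it. *)
have [C EIT'] : exists C, emb T (IT (1 - alpha / 2) T psi) = Ic * emb T (fun_part (refl z)) + cst_alg T C * Ic.
  exists (- \int[mu]_t fun_part (refl z) t).
  have := Ic_refl hrz.1; rewrite reflK rzE => E.
  rewrite EIT psiE I2 mulrN reflN mulrCA -/z rmorphN mulNr -E opprD.
  move: (refl (Ic * z)) (Ic * refl z) => p q.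
  by rewrite addrA subrr add0r.
have sIT : sqT (IT (1 - alpha / 2) T psi).
  by apply: (sqi_of_Lsq LIT); rewrite EIT psiE; exact: Lsq_refl (LsqM _ (Lsq_refl hpsi)).
have sIf : sqT (IT (1 - alpha) T psi).
  by apply: (sqi_of_Lsq LIf); rewrite EIf psiE; exact: Lsq_refl (LsqM _ (Lsq_refl hpsi)).
pose Dv t := - fun_part (refl z) t.
have sDv : sqT Dv by have := sqT_scale (-1) srz; congr square_integrable; apply/funext => t; rewrite mulN1r.
have wd : is_DT (alpha / 2) T psi Dv.
  rewrite /is_DT (_ : (fun t => - Dv t) = fun_part (refl z)); last by apply/funext => t; rewrite /Dv opprK.
  exact: (weak_deriv_of_alg T0 sIT srz EIT').
have DvE : emb T Dv = - refl z by rewrite -rzE embN//; exact: sqT_L1T.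
pose v m := if m == n then psi else cst 0; pose Dv' m := if m == n then Dv else cst 0.
have isDT m : is_DT (alpha / 2) T (v m) (Dv' m).
  by rewrite /v /Dv'; case: ifP => // _; exact: is_DT0.
have := test v Dv' Gv (XX_single n hx) (L2X_single 0 n sDv) isDT gv.
rewrite (pv u Gu gu su) /time_pairing.
have -> : \int[mu]_(t in `]0, T[) pairing (Du^~ t) (Dv'^~ t) = \int[mu]_(t in `]0, T[) (Du n t * Dv t).
  apply: eq_Rintegral => t _; rewrite (@pairing_single _ _ _ n) /Dv' ?eqxx// => m /negbTE mn.
  by rewrite mn.
have -> : \int[mu]_(t in `]0, T[) pairing (f^~ t) (fun m => IT (1 - alpha) T (v m) t) =
    \int[mu]_(t in `]0, T[) (f n t * IT (1 - alpha) T psi t).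
  apply: eq_Rintegral => t _; rewrite (@pairing_single _ _ _ n) /v ?eqxx// => m /negbTE mn.
  by rewrite mn IT0.
rewrite (ip_embE sDu sDv) (ip_embE su spsi) (ip_embE sf sIf) DvE EIf psiE.
have hDu := sqT_Lsq sDu; have hu := sqT_Lsq su; have hff := sqT_Lsq sf.
rewrite (adjoint_Ic (fr (1 - alpha)) hff hx x0) ipNr -(adjoint (fr (1 - alpha / 2)) hDu hx).
rewrite I1 ipNr -(adjoint Ic hu hx) mulrN -opprD => /eqP; rewrite eqr_opp => /eqP; exact.
Qed.

End reduction.

(** * Summation over the modes *)

Section mode_sums.
Context {R : realType}.
Local Notation mu := (@lebesgue_measure R).
Implicit Types (T r s C : R) (lam : nat -> R) (v : nat -> R -> R).

Lemma H0X_norm_ge0 lam T r s v : (0 <= H0X_norm lam T r s v)%E.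
Proof. exact: sqrte_ge0. Qed.

Lemma sqrte_nneseries_le (x y : nat -> \bar R) C : 0 <= C -> (forall n, 0 <= x n)%E ->
  (forall n, 0 <= y n)%E -> (forall n, x n <= (C ^+ 2)%:E * y n)%E ->
  (sqrte (\sum_(0 <= n <oo) x n) <= C%:E * sqrte (\sum_(0 <= n <oo) y n))%E.
Proof.
move=> C0 x0 y0 xy; have c2 : (0 <= (C ^+ 2)%:E)%E by rewrite lee_fin sqr_ge0.
have -> : C%:E = sqrte (C ^+ 2)%:E by rewrite sqrte_EFinX2.
rewrite -sqrteM// -nneseriesZl// lee_sqrt; last by apply: nneseries_ge0 => n _ _; exact: mule_ge0.
by apply: lee_nneseries => // n _.
Qed.

Lemma H0X_norm_le lam T r s v lam' r' s' v' C : 0 <= C ->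
  (forall n, (H0_norm T r (fun t => (lam n `^ (s / 2) * v n t)%R) <=
    C%:E * H0_norm T r' (fun t => (lam' n `^ (s' / 2) * v' n t)%R))%E) ->
  (H0X_norm lam T r s v <= C%:E * H0X_norm lam' T r' s' v')%E.
Proof.
move=> C0 h; rewrite /H0X_norm.
apply: (@sqrte_nneseries_le (fun n => (H0_norm T r (fun t => (lam n `^ (s / 2) * v n t)%R)) ^+ 2)%E
  (fun n => (H0_norm T r' (fun t => (lam' n `^ (s' / 2) * v' n t)%R)) ^+ 2)%E C C0) => n;
  [exact: sqre_ge0|exact: sqre_ge0|].
set x := H0_norm T r _; set y := H0_norm T r' _.
have x0 : (0 <= x)%E by exact: H0_norm_ge0.
have y0 : (0 <= y)%E by exact: H0_norm_ge0.
have := h n; rewrite -/x -/y; move: x y x0 y0 {h} => x y x0 y0.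
have Cy : (0 <= C%:E * y)%E by apply: mule_ge0; rewrite ?lee_fin.
by rewrite -lee_sqr// [X in (_ <= X)%E -> _]expe2 muleACA -expe2 -EFin_expe.
Qed.

End mode_sums.

Section mode_solutions.
Context {R : realType} (T : R) (T0 : 0 < T) (alpha : R) (ha : 0 < alpha < 1).
Local Notation mu := (@lebesgue_measure R).
Local Notation sqT := (square_integrable mu `]0, T[).
Local Notation Ic := (Ic T).
Local Notation fr := (fr T).
Local Opaque Gamma.

Let a0 : 0 < alpha. Proof. by have /andP[] := ha. Qed.

(** Solve for the derivative first, w = y f with y the inverse of 1 + lam fr alpha. Since y also
    inverts the integrated equation, u = y Ic f = Ic w. *)
Lemma mode_derivative (lam : R) (f u : R -> R) : 0 < lam -> sqT f -> sqT u ->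
  emb T u + cst_alg T lam * (fr alpha * emb T u) = Ic * emb T f ->
  exists w : calg T, [/\ Lsq w, emb T u = Ic * w,
    w + cst_alg T lam * (fr alpha * w) = emb T f & N w <= N (emb T f)].
Proof.
move=> l0 sf su E; have hf := sqT_Lsq sf.
have [y hy] := resolvent_ex lam T0 a0.
have hw : Lsq (y * emb T f) := LsqM y hf.
have wE : y * emb T f + cst_alg T lam * (fr alpha * (y * emb T f)) = emb T f.
  rewrite -[RHS]mul1r -hy; move: y (emb T f) (fr alpha) (cst_alg T lam) {hy hf hw} => y f' r c; ring.
exists (y * emb T f); split; [exact: hw| |exact: wE|].
  have := congr1 (fun z => y * z) E; move: hy.
  move: (emb T u) y (emb T f) (fr alpha) (cst_alg T lam) Ic {E hf hw wE} => u' y f' r c i hy.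
  have -> : y * (u' + c * (r * u')) = (1 + c * r) * y * u' by ring.
  by rewrite hy mul1r => ->; ring.
exact: (@nrm_w R (time_calc T0) alpha lam ha l0 (emb T f) _ y hf wE hy).
Qed.

Section mode.
Variables (lam : R) (f u : R -> R) (w : calg T).
Hypotheses (sf : sqT f) (su : sqT u) (hw : Lsq w) (uE : emb T u = Ic * w)
  (wE : w + cst_alg T lam * (fr alpha * w) = emb T f).

Lemma mode_weak_deriv : weak_deriv T u (fun_part w).
Proof.
apply: (weak_deriv_of_alg T0 (c := 0) su (Lsq_sqi hw)).
by rewrite rmorph0 mul0r addr0 (emb_fun_part hw.1).
Qed.

Let qE : emb T (fun t => fun_part w t - f t) = w - emb T f.
Proof.
have L1 := sqT_L1T (Lsq_sqi hw); have L2 := L1TZ (-1) (sqT_L1T sf).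
have -> : (fun t => fun_part w t - f t) = (fun t => fun_part w t + -1 * f t).
  by apply/funext => t; rewrite mulN1r.
by rewrite -embD// (emb_fun_part hw.1) -embZ ?rmorphN ?rmorph1 ?mulN1r//; exact: sqT_L1T.
Qed.

Lemma sqT_mode : sqT (fun t => fun_part w t - f t).
Proof. exact: (sqTB (Lsq_sqi hw) sf). Qed.

Lemma N_mode_le : N (emb T (fun t => fun_part w t - f t)) <= N w + N (emb T f).
Proof. by rewrite qE; exact: N_triangleB hw (sqT_Lsq sf). Qed.

(** The fractional integral of order alpha of -lam u is -lam fr alpha Ic w, which by the equation
    for [w] is Ic (w - f). *)
Lemma mode_is_D0 : is_D0 (1 - alpha) T (fun t => - (lam * u t)) (fun t => fun_part w t - f t).
Proof.
rewrite /is_D0 subKr.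
have sl : sqT (fun t => - (lam * u t)).
  by have := sqT_scale (- lam) su; congr square_integrable; apply/funext => t; rewrite mulNr.
have [LI EI] := I0_alg T0 a0 (sqT_L1T sl).
have lE : emb T (fun t => - (lam * u t)) = - (cst_alg T lam * emb T u).
  by rewrite (embZ _ (sqT_L1T su)) embN//; exact: sqT_L1T (sqT_scale lam su).
have E : emb T (I0 alpha (fun t => - (lam * u t))) = Ic * (w - emb T f).
  rewrite EI lE uE -wE; move: w (fr alpha) (cst_alg T lam) Ic => x r c i; ring.
have sI : sqT (I0 alpha (fun t => - (lam * u t))).
  by apply: (sqi_of_Lsq LI); rewrite E; apply: LsqM; apply: LsqB; [exact: hw|exact: sqT_Lsq].
apply: (weak_deriv_of_alg T0 (c := 0) sI sqT_mode).
by rewrite rmorph0 mul0r addr0 qE.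
Qed.

Lemma mode_scaled k : [/\ sqT (fun t => k * f t), sqT (fun t => k * u t),
  Lsq (cst_alg T k * w), emb T (fun t => k * u t) = Ic * (cst_alg T k * w) &
  cst_alg T k * w + cst_alg T lam * (fr alpha * (cst_alg T k * w)) = emb T (fun t => k * f t)].
Proof.
split; [exact: sqT_scale|exact: sqT_scale|exact: LsqZ| |].
  by rewrite -(embZ _ (sqT_L1T su)) uE; move: w (cst_alg T k) Ic => x c i; rewrite mulrCA.
rewrite -(embZ _ (sqT_L1T sf)) -wE; move: w (fr alpha) (cst_alg T lam) (cst_alg T k) => x r c i; ring.
Qed.

End mode.

Section all_modes.
Variables (lam : nat -> R) (l0 : forall n, 0 < lam n) (f u : nat -> R -> R) (s : R).
Hypotheses (sf : forall n, sqT (f n)) (su : forall n, sqT (u n)) (hf : L2X lam T s f).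
Hypothesis mode : forall n,
  emb T (u n) + cst_alg T (lam n) * (fr alpha * emb T (u n)) = Ic * emb T (f n).

Let H0_norm_scale k v : sqT v -> H0_norm T 0 (fun t => k * v t)%R = (`|k| * N (emb T v))%:E.
Proof.
by move=> sv; rewrite (H0_normL2 T0 (sqT_scale k sv)) -(embZ _ (sqT_L1T sv)) NZ.
Qed.

Lemma modes_solve : solves_in_L2 lam alpha T s f u.
Proof.
have /choice[w hw] n := mode_derivative (l0 n) (sf n) (su n) (mode n).
exists (fun n => fun_part (w n)), (fun n t => fun_part (w n) t - f n t); split.
- split.
    apply: (@le_lt_trans _ _ (1%:E * H0X_norm lam T 0 s f)%E); last by rewrite mul1e.
    apply: H0X_norm_le => // n; have [h1 _ _ h4] := hw n; rewrite mul1e.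
    rewrite (H0_norm_scale _ (Lsq_sqi h1)) (H0_norm_scale _ (sf n)) lee_fin (emb_fun_part h1.1).
    by rewrite ler_wpM2l.
  apply: (@le_lt_trans _ _ (2%:E * H0X_norm lam T 0 s f)%E).
    apply: H0X_norm_le => // n; have [h1 _ _ h4] := hw n.
    rewrite (H0_norm_scale _ (sqT_mode (sf n) h1)) (H0_norm_scale _ (sf n)) lee_fin mulrCA ler_wpM2l//.
    have := N_mode_le (sf n) h1; move: (N _) (N _) (N _) h4 => p q r h4 h; lra.
  by apply: lte_mul_pinfty => //; rewrite lee_fin.
- by move=> n; have [h1 h2 _ _] := hw n; exact: mode_weak_deriv.
- by move=> n; have [h1 h2 h3 _] := hw n; exact: mode_is_D0.
- by move=> n; apply: ae_all => t _; rewrite subKr.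
Qed.

End all_modes.

End mode_solutions.

Section norm_bound.
Context {R : realType}.
Local Notation mu := (@lebesgue_measure R).

(** The equation of a mode is linear, so it may be multiplied by lam_n^(-beta/2) before
    [scalar_estimate] is applied. The constant is the same for all modes, and the squares can be
    summed. *)
Lemma modes_bound (alpha gam : R) : 0 < alpha < 1 -> 0 <= gam <= 1 / 2 ->
  exists2 C : R, 0 < C & forall (T beta : R) (lam : nat -> R) (f u : nat -> R -> R),
  0 < T -> (forall n, 0 < lam n) -> (H0X_norm lam T gam (- beta) f < +oo)%E ->
  (forall n, square_integrable mu `]0, T[ (f n)) -> (forall n, square_integrable mu `]0, T[ (u n)) ->
  (forall n, emb T (u n) + cst_alg T (lam n) * (fr T alpha * emb T (u n)) = Ic T * emb T (f n)) ->
  (H0X_norm lam T (1 + gam) (- beta) u + H0X_norm lam T (1 + gam - alpha) (2 - beta) u <=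
   C%:E * H0X_norm lam T gam (- beta) f)%E.
Proof.
move=> ha hg; have [C C0 h] := scalar_estimate ha hg.
exists (2 * C); first by rewrite mulr_gt0.
move=> T beta lam f u T0 l0 hf sf su mode.
have est n : (H0_norm T (1 + gam) (fun t => (lam n `^ (- beta / 2) * u n t)%R) <=
      C%:E * H0_norm T gam (fun t => (lam n `^ (- beta / 2) * f n t)%R))%E /\
    (H0_norm T (1 + gam - alpha) (fun t => (lam n `^ ((2 - beta) / 2) * u n t)%R) <=
      C%:E * H0_norm T gam (fun t => (lam n `^ (- beta / 2) * f n t)%R))%E.
  have [w [hw uE wE _]] := mode_derivative T0 ha (l0 n) (sf n) (su n) (mode n).
  have [sf' su' hw' uE' wE'] := mode_scaled (sf n) (su n) hw uE wE (lam n `^ (- beta / 2)).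
  have fin : H0_norm T gam (fun t => (lam n `^ (- beta / 2) * f n t)%R) \is a fin_num.
    by rewrite ge0_fin_numE ?H0_norm_ge0//; exact: le_lt_trans (H0X_term lam T gam (- beta) f n) hf.
  move: fin => /fineK/esym FE.
  have [h1 h2] := h T (lam n) _ _ _ _ T0 (l0 n) sf' su' hw' uE' wE' FE.
  rewrite EFinM -FE in h1; rewrite EFinM -FE in h2; split; first exact: h1.
  have -> : (fun t => lam n `^ ((2 - beta) / 2) * u n t) =
      (fun t => lam n * (lam n `^ (- beta / 2) * u n t)); last exact: h2.
  apply/funext => t; rewrite mulrA; congr (_ * _).
  have -> : (2 - beta) / 2 = 1 + - beta / 2 by field.
  rewrite powRD; last by apply/implyP => _; exact: lt0r_neq0.
  by rewrite powRr1// ltW.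
have X0 := H0X_norm_ge0 lam T gam (- beta) f.
have -> : ((2 * C)%:E * H0X_norm lam T gam (- beta) f =
    C%:E * H0X_norm lam T gam (- beta) f + C%:E * H0X_norm lam T gam (- beta) f)%E.
  have /fineK <- : H0X_norm lam T gam (- beta) f \is a fin_num by rewrite ge0_fin_numE.
  by rewrite -!EFinM -EFinD -mulrA mulr_natl mulr2n.
apply: leeD; apply: (H0X_norm_le (ltW C0)) => n; first exact: (est n).1.
exact: (est n).2.
Qed.

End norm_bound.

(** * Supremum bound *)

Section moving_average.
Context {R : realType} (T : R) (T0 : 0 < T).
Local Notation mu := (@lebesgue_measure R).
Local Notation DT := (`]0, T[%classic : set R).
Local Notation sqT := (square_integrable mu `]0, T[).
Local Notation Ic := (Ic T).
Local Notation fr := (fr T).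
Implicit Types (h rho t x th : R) (k m : R -> R).
Local Opaque Gamma.

Let mDT : measurable (DT : set (measurableTypeR R)) := measurable_itv _.

Lemma int_shifted_powR h th : 0 < h -> th != 0 ->
  (\int[mu]_(t in `]0%R, T[) ((t + h) `^ (th - 1))%:E <= (((T + h) `^ th - h `^ th) / th)%:E)%E.
Proof.
move=> h0 th0; pose F x : R := th^-1 * (x + h) `^ th.
have pos x : 0 < x -> 0 < x + h by move=> x0; rewrite addr_gt0.
have dG p x : 0 < x + h -> is_derive x 1 (fun y : R => (y + h) `^ p) (p * (x + h) `^ (p - 1)).
  move=> xh; have d1 : is_derive x 1 (fun y : R => y + h) 1.
    have : is_derive x 1 ((fun y : R => y) + cst h) (1 + 0) by apply: is_deriveD.
    by rewrite addr0.
  have d2 := is_derive1_powR p xh.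
  have := @is_derive1_comp R (fun y => y `^ p) (fun y => y + h) x _ _ d2 d1.
  by rewrite mulr1.
have cG p x : 0 < x + h -> {for x, continuous (fun y : R => (y + h) `^ p)}.
  move=> xh; apply: differentiable_continuous; apply/derivable1_diffP.
  by have [] := dG p x xh.
have E : (\int[mu]_(t in `]0%R, T]) ((t + h) `^ (th - 1))%:E = (F T - F 0)%:E)%E.
  apply: (@FTC_left_open R (fun t => (t + h) `^ (th - 1)) F T T0).
  - by move=> x _; exact: powR_ge0.
  - move=> x x0; have d := dG th x (pos x x0).
    have : is_derive x 1 (th^-1 \*: (fun y : R => (y + h) `^ th)) (th^-1 *: (th * (x + h) `^ (th - 1))).
      exact: is_deriveZ.
    by rewrite /GRing.scale/= mulKf.
  - by move=> x x0; apply: cG; exact: pos.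
  - apply: cvg_at_right_filter; apply: cvgM; first exact: cvg_cst.
    by apply: cG; rewrite add0r.
have mG : measurable_fun (`]0, T]%classic : set (measurableTypeR R)) (fun t => (t + h) `^ (th - 1)).
  apply: measurable_funTS; apply: (measurableT_comp (measurable_powR _)).
  by apply: measurable_funD => //; exact: measurable_cst.
rewrite (_ : (_ / _)%:E = (F T - F 0)%:E); last first.
  by congr EFin; rewrite /F add0r -mulrBr mulrC.
rewrite -E; apply: ge0_subset_integral => //; first by apply/measurable_EFinP.
  by move=> t _; rewrite lee_fin powR_ge0.
by move=> t /=; rewrite !in_itv/= => /andP[-> /ltW].
Qed.

Lemma N_sqr_le k m (M : R) : sqT k -> measurable_fun DT m -> (forall t, DT t -> k t ^+ 2 <= m t) ->
  (\int[mu]_(t in `]0%R, T[) (m t)%:E <= M%:E)%E -> N (emb T k) ^+ 2 <= M.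
Proof.
move=> sk mm km h; rewrite -lee_fin -N_emb//; apply: le_trans h; apply: ge0_le_integral => //.
- by move=> t _; rewrite lee_fin sqr_ge0.
- by apply/measurable_EFinP; apply: measurable_funX; exact: sk.1.
- by apply/measurable_EFinP.
Qed.

(** Convolution with it is the mean over (t-h, t). *)
Definition box h t : R := if 0 < t < h then h^-1 else 0.

Lemma measurable_box h : measurable_fun setT (box h).
Proof.
apply: measurable_fun_ifT => //; apply: measurable_and; exact: measurable_fun_ltr.
Qed.

Lemma L1T_box h : 0 < h -> L1T T (box h).
Proof.
move=> h0; apply: sqT_L1T; apply: (@sqi_bounded _ _ _ h^-1).
  by apply: measurable_funTS; exact: measurable_box.
move=> t _; rewrite /box; case: ifP => _; rewrite ?normr0 ?invr_ge0 ?(ltW h0)//.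
by rewrite ger0_norm// invr_ge0 ltW.
Qed.

Lemma int_box h t : 0 < h -> 0 < t -> \int[mu]_(s in `]0, t[) box h s = Num.min t h / h.
Proof.
move=> h0 t0; have m0 : 0 < Num.min t h by rewrite lt_min t0 h0.
have -> : \int[mu]_(s in `]0, t[) box h s = \int[mu]_(s in `]0, Num.min t h[) h^-1.
  rewrite Rintegral_mkcond [RHS]Rintegral_mkcond; apply: eq_Rintegral => s _.
  rewrite !patchE /box; have -> : (s \in `]0, Num.min t h[%classic) = (s \in `]0, t[%classic) && (0 < s < h).
    apply/idP/idP.
      by move/set_mem; rewrite /= in_itv/= lt_min => /and3P[h1 h2 h3]; rewrite h1 h3 !andbT; apply/mem_set; rewrite /= in_itv/= h1.
    move=> /andP[/set_mem]; rewrite /= in_itv/= => /andP[h1 h2] /andP[_ h3].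
    by apply/mem_set; rewrite /= in_itv/= h1 lt_min h2.
  by case: (s \in _) => //=; case: ifP.
rewrite Rintegral_cst//= lebesgue_measure_itv/= lte_fin m0 oppr0 adde0/=.
by rewrite mulrC.
Qed.

(** The kernel is 1 - min(t,h)/h: between 0 and 1, and 0 from h onwards. *)
Lemma N_1box_Ic h : 0 < h -> Lsq (Ic - emb T (box h) * Ic) /\
  N (Ic - emb T (box h) * Ic) ^+ 2 <= h.
Proof.
move=> h0; pose k t : R := 1 - \int[mu]_(s in `]0, t[) box h s.
have Lb := L1T_box h0; have Lp := L1T_primitive Lb.
have kE t : DT t -> k t = 1 - Num.min t h / h.
  by rewrite /= in_itv/= => /andP[t0 _]; rewrite /k int_box.
have Lk : L1T T k.
  have := L1TD (L1T_cst T 1) (L1TZ (-1) Lp); congr (_.-integrable _ _).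
  by apply/funext => t /=; rewrite mulN1r.
have E : Ic - emb T (box h) * Ic = emb T k.
  rewrite [emb T (box h) * _]mulrC Ic_emb// embN// /Ic embD//; first exact: L1T_cst.
  have := L1TZ (-1) Lp; congr (_.-integrable _ _).
  by apply/funext => t /=; rewrite mulN1r.
have k01 t : DT t -> 0 <= k t <= 1 /\ (h <= t -> k t = 0).
  move=> Dt; rewrite kE//; have /andP[t0 _] : 0 < t < T by move: Dt; rewrite /= in_itv.
  split; last by move=> ht; rewrite min_r// divff ?subrr// lt0r_neq0.
  rewrite subr_ge0 ler_pdivrMr// mul1r ge_min lexx orbT/= gerBl divr_ge0 ?(ltW h0)//.
  by rewrite le_min !ltW.
have mk : measurable_fun DT k by apply/measurable_EFinP; exact: measurable_int Lk.
have sk : sqT k.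
  by apply: (@sqi_bounded _ _ _ 1) => // t Dt; have [/andP[k0 k1] _] := k01 t Dt; rewrite ger0_norm.
rewrite E; split; first exact: sqT_Lsq.
pose A : set (measurableTypeR R) := `]0, h[%classic.
have mA : measurable A by exact: measurable_itv.
apply: (@N_sqr_le k (\1_A)) => //.
  move=> t Dt; have [/andP[k0 k1] kh] := k01 t Dt; rewrite indicE.
  have [th|ht] := ltP t h; last by rewrite kh// expr0n.
  rewrite mem_set ?expr_le1//; move: Dt; rewrite /A /= !in_itv/= th => /andP[-> _] //.
rewrite integral_indic//; apply: (@le_trans _ _ (mu A)).
  by apply: le_measure; rewrite ?inE//; first [exact: measurableI|exact: subIsetl].
by rewrite /A lebesgue_measure_itv/= lte_fin h0 oppr0 adde0.
Qed.

Let mrl rho : measurable_fun setT (rl rho : R -> R).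
Proof. by apply: measurable_funM; [exact: measurable_cst|exact: measurable_pw]. Qed.

Section power_kernel.
Variables (rho : R) (hr : 0 < rho < 1).
Let r0 : 0 < rho. Proof. by have /andP[] := hr. Qed.
Let r1 : rho < 1. Proof. by have /andP[] := hr. Qed.
Let r2 : 1 + rho <= 2. Proof. by have := r1; lra. Qed.
Let c : R := (Gamma (1 + rho))^-1.
Let c0 : 0 < c. Proof. by rewrite invr_gt0 Gamma_gt0// r2 andbT addr_gt0. Qed.
Let G0 : 0 < Gamma rho. Proof. by apply: Gamma_gt0; rewrite r0/=; have := r1; lra. Qed.

(** The case of first exponent 1 in [beta_integral], which yields the constant 1/Gamma(1 + rho)
    directly. *)
Lemma prim_rl x : 0 < x -> \int[mu]_(s in `]0, x[) rl rho s = c * x `^ rho.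
Proof.
move=> x0; have B := beta_integral ltr01 r0 r2 x0.
have e1 : 1 + rho - 1 = rho by rewrite addrC addKr.
rewrite e1 (@Gamma1 R) mul1r in B.
rewrite /rl RintegralZ//; last by apply: measurable_funTS; exact: measurable_pw.
have -> : \int[mu]_(s in `]0, x[) pw rho s = \int[mu]_y (pw 1 (x - y) * pw rho y).
  rewrite Rintegral_mkcond; apply: eq_Rintegral => s _; rewrite patchE /pw subr_gt0 subrr powRr0.
  case: ifPn.
    by move/set_mem; rewrite /= in_itv/= => /andP[-> ->]; rewrite mul1r.
  rewrite notin_setE/= in_itv/= => /negP; rewrite negb_and => /orP[/negbTE ->|/negbTE ->];
    by rewrite ?mulr0 ?mul0r.
rewrite /Rintegral B /c; move: (Gamma rho) (Gamma (1 + rho)) (x `^ rho) G0 => g g' z g0.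
by rewrite /= !mulrA mulVf ?mul1r// lt0r_neq0.
Qed.

Lemma conv_box h t : 0 < h -> DT t -> conv (tr T (box h)) (tr T (rl rho)) t =
  h^-1 * c * (t `^ rho - (if h < t then (t - h) `^ rho else 0)).
Proof.
move=> h0 Dt; rewrite (conv_trE _ _ Dt); have /andP[t0 tT] : 0 < t < T by move: Dt; rewrite /= in_itv.
case: ltP => [ht|th]; last first.
  rewrite subr0 -mulrA -prim_rl// -RintegralZ//; last by apply: measurable_funTS; exact: mrl.
  apply: eq_Rintegral => s /set_mem; rewrite /= in_itv/= => /andP[s0 st].
  by rewrite /box subr_gt0 st/= (_ : t - s < h)//; lra.
have LV := (good_tr (L1T_rl T0 r0)).1; have th0 : 0 < t - h by rewrite subr_gt0.
have VE x : 0 < x -> x < T -> \int[mu]_(s in `]0, x[) tr T (rl rho) s = c * x `^ rho.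
  move=> x0 xT; rewrite -prim_rl//; apply: eq_Rintegral => s /set_mem; rewrite /= in_itv/= => /andP[s0 sx].
  by rewrite trE//= in_itv/= s0 (lt_trans sx).
have tht : t - h < t by rewrite gtrDl oppr_lt0.
have := primitiveB LV (ltW th0) tht; rewrite !VE//; last by rewrite (lt_trans tht).
rewrite -mulrA mulrBr => ->; rewrite addrC addKr -RintegralZ//; last first.
  by apply: measurable_funTS; exact: L1_measurable LV.
rewrite Rintegral_mkcond [RHS]Rintegral_mkcond; apply: eq_Rintegral => s _; rewrite !patchE /box.
case: ifPn => [/set_mem|]; last first.
  rewrite notin_setE/= in_itv/= => /negP st; rewrite ifF//; apply/negbTE.
  rewrite notin_setE/= in_itv/= => /andP[s1 s2]; move/negP: st; apply.
  by rewrite s2 (lt_trans th0 s1).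
rewrite /= in_itv/= => /andP[s0 st]; rewrite subr_gt0 st/= ltrBlDr -ltrBlDl.
have -> : (s \in `]t - h, t[%classic) = (t - h < s).
  apply/idP/idP => [/set_mem|ths]; first by rewrite /= in_itv/= => /andP[].
  by apply/mem_set; rewrite /= in_itv/= ths.
by case: ifP => _; rewrite ?mul0r// trE//= in_itv/= s0 (lt_trans st).
Qed.

(** Averaging removes the singularity: t^(rho-1) becomes (t+h)^(rho-1) up to a constant. For t <= h
    the average is t^rho / h up to [c]; for t > h the difference of powers is of order h
    t^(rho-1). *)
Lemma conv_box_le h t : 0 < h -> DT t ->
  `|conv (tr T (box h)) (tr T (rl rho)) t| <= 2 * c * (t + h) `^ (rho - 1).
Proof.
move=> h0 Dt; rewrite conv_box//; have /andP[t0 tT] : 0 < t < T by move: Dt; rewrite /= in_itv.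
have th0 : 0 < t + h by rewrite addr_gt0.
have p0 : 0 <= (t + h) `^ (rho - 1) by exact: powR_ge0.
have tp : t `^ rho <= (t + h) `^ rho.
  by apply: ge0_ler_powR; rewrite ?nnegrE; [exact: ltW|exact: ltW|exact: ltW|rewrite lerDl ltW].
have E : (t + h) * (t + h) `^ (rho - 1) = (t + h) `^ rho by rewrite mulr_powRB1// ltW.
set p := (t + h) `^ (rho - 1) in p0 E *; rewrite -E in tp.
suff : 0 <= t `^ rho - (if h < t then (t - h) `^ rho else 0) <= 2 * h * p.
  move=> /andP[d0 d1]; rewrite ger0_norm; last by rewrite mulr_ge0// mulr_ge0 ?(ltW c0)// invr_ge0 ltW.
  have -> : 2 * c * p = h^-1 * c * (2 * h * p) by field; exact: lt0r_neq0.
  by rewrite ler_wpM2l// mulr_ge0 ?(ltW c0)// invr_ge0 ltW.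
case: ltP => [ht|th]; last first.
  rewrite subr0 powR_ge0/=; apply: le_trans tp _; rewrite ler_wpM2r//; lra.
have th1 : 0 < t - h by rewrite subr_gt0.
rewrite subr_ge0 ge0_ler_powR ?nnegrE ?(ltW r0) ?(ltW th1) ?(ltW t0)//=; last by rewrite gerBl ltW.
(* As q <= 1 and rho < 1, q^rho >= q; so the difference of the powers is at most (1 - q) t^rho =
   (h/t) t^rho, without a mean value theorem. *)
pose q := (t - h) / t.
have q01 : 0 < q <= 1 by rewrite divr_gt0//= ler_pdivrMr// mul1r gerBl ltW.
have qt : q * t = t - h by rewrite divfK// lt0r_neq0.
have h1 : q * t `^ rho <= (t - h) `^ rho.
  rewrite -qt powRM ?(ltW t0)//; last by rewrite ltW//; case/andP: q01.
  by rewrite ler_wpM2r ?powR_ge0// ger1_powR// ltW.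
have h2 : t `^ rho - (t - h) `^ rho <= (1 - q) * ((t + h) * p).
  apply: (@le_trans _ _ ((1 - q) * t `^ rho)); first by rewrite mulrBl mul1r lerD2l lerN2.
  by rewrite ler_wpM2l// subr_ge0; case/andP: q01.
apply: le_trans h2 _; rewrite mulrA ler_wpM2r//.
have -> : 1 - q = h / t by rewrite /q; field; exact: lt0r_neq0.
rewrite mulrAC ler_pdivrMr// mulrDr -mulrA mulrCA; nra.
Qed.

(** Part of the power of t + h is traded for a power of h, which leaves the integrable (t+h)^(th-1).
    The free exponent [th] covers both uses: th = 2 rho - 1 loses nothing, while a small positive
    [th] for rho = 1/2 replaces the logarithm by h^(-th)/th. *)
Lemma N_box_fr h th : 0 < h -> th != 0 -> 0 <= th + 1 - 2 * rho ->
  Lsq (emb T (box h) * fr rho) /\ N (emb T (box h) * fr rho) ^+ 2 <=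
    (2 * c) ^+ 2 * (h `^ (- (th + 1 - 2 * rho)) * (((T + h) `^ th - h `^ th) / th)).
Proof.
move=> h0 th0 k0; have Lb := L1T_box h0; have Lr := L1T_rl T0 r0.
rewrite /fr embM//; set k := conv _ _; have Lk : L1T T k by exact: L1T_conv.
have mk : measurable_fun DT k by apply/measurable_EFinP; exact: measurable_int Lk.
pose K := (2 * c) ^+ 2 * h `^ (- (th + 1 - 2 * rho)).
have K0 : 0 <= K by rewrite mulr_ge0 ?sqr_ge0 ?powR_ge0.
have km t : DT t -> k t ^+ 2 <= K * (t + h) `^ (th - 1).
  move=> Dt; have := conv_box_le h0 Dt; rewrite -/k => hk.
  have /andP[t0 tT] : 0 < t < T by move: Dt; rewrite /= in_itv.
  have th1 : 0 < t + h by rewrite addr_gt0.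
  have n0 : t + h != 0 by exact: lt0r_neq0.
  rewrite -real_normK ?num_real//.
  apply: (@le_trans _ _ ((2 * c * (t + h) `^ (rho - 1)) ^+ 2)).
    by apply: lerXn2r hk; rewrite ?nnegrE ?mulr_ge0 ?powR_ge0 ?(ltW c0).
  rewrite exprMn /K -[leRHS]mulrA ler_wpM2l ?sqr_ge0// expr2 -powRD; last by apply/implyP.
  have -> : rho - 1 + (rho - 1) = - (th + 1 - 2 * rho) + (th - 1) by ring.
  rewrite (@powRD _ (t + h) (- (th + 1 - 2 * rho)) (th - 1)); last by apply/implyP.
  rewrite ler_wpM2r ?powR_ge0// !powRN lef_pV2 ?posrE ?powR_gt0//.
  by apply: ge0_ler_powR; rewrite ?nnegrE ?(ltW h0) ?(ltW th1)// lerDr ltW.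
have mh p : measurable_fun DT (fun t => (t + h) `^ p).
  apply: measurable_funTS; apply: (measurableT_comp (measurable_powR _)).
  by apply: measurable_funD => //; exact: measurable_cst.
have I := int_shifted_powR h0 th0.
have I' : (\int[mu]_(t in `]0%R, T[) (K * (t + h) `^ (th - 1))%:E <=
    (K * (((T + h) `^ th - h `^ th) / th))%:E)%E.
  under eq_integral do rewrite EFinM.
  rewrite ge0_integralZl//; try by [apply/measurable_EFinP; exact: mh|move=> t _; rewrite lee_fin powR_ge0|rewrite lee_fin].
  rewrite [leRHS]EFinM; apply: lee_pmul => //.
  by apply: integral_ge0 => t _; rewrite lee_fin powR_ge0.
have mm : measurable_fun DT (fun t => K * (t + h) `^ (th - 1)).
  by apply: measurable_funM; [exact: measurable_cst|exact: mh].
have sk : sqT k.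
  split=> //; apply: le_lt_trans (ltry (K * (((T + h) `^ th - h `^ th) / th))).
  apply: le_trans I'; apply: ge0_le_integral => //.
  - by move=> t _; rewrite lee_fin sqr_ge0.
  - by apply/measurable_EFinP; exact: measurable_funX.
  - by apply/measurable_EFinP.
split; first exact: sqT_Lsq.
by rewrite [leRHS]mulrA; exact: N_sqr_le sk mm km I'.
Qed.

End power_kernel.

End moving_average.

(** * Supremum of a single mode *)

Section supremum_bound.
Context {R : realType} (T : R) (T0 : 0 < T).
Local Notation mu := (@lebesgue_measure R).
Local Notation Ic := (Ic T).
Local Notation fr := (fr T).
Implicit Types (x y F w : calg T) (lam h M eps alpha : R).
Local Opaque Gamma.

Lemma ae_mul_le x y : Lsq x -> Lsq y -> {ae mu, forall t, `|fun_part (x * y) t| <= N x * N y}.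
Proof.
move=> hx hy; move: (fun_part_mul x hy.1); apply: aeW => t ->.
rewrite hx.1 mul0r add0r /cv /tr patchE; case: ifP => _; last by rewrite normr0 mulr_ge0 ?sqrtr_ge0.
have sx : square_integrable mu setT (fun s => fun_part x (t - s)) := sqi_reflect t hx.2.
have := cauchy_schwarz measurableT sx hy.2.
rewrite (@Rintegral_reflect _ t (fun s => fun_part x s ^+ 2)); last by apply: measurable_funX; exact: hx.2.1.
have -> : \int[mu]_s (fun_part x s ^+ 2) = N x ^+ 2 by rewrite sqr_N.
have -> : \int[mu]_s (fun_part y s ^+ 2) = N y ^+ 2 by rewrite sqr_N.
have Nx := N_ge0 x; have Ny := N_ge0 y; move: (N x) (N y) Nx Ny => p q p0 q0.
by rewrite -exprMn -[X in X <= _ -> _]real_normK ?num_real// ler_sqr ?nnegrE ?mulr_ge0.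
Qed.

Section mode.
Variables (alpha lam : R) (ha : 0 < alpha < 1) (l0 : 0 < lam) (F w : calg T).
Hypotheses (hF : Lsq F) (hw : Lsq w) (wF : N w <= N F)
  (wE : w + cst_alg T lam * (fr alpha * w) = F).

Lemma mode_sup_Ic : {ae mu, forall t, `|fun_part (Ic * w) t| <= Num.sqrt T * N F}.
Proof.
have hI : Lsq Ic := Lsq_Ic T.
move: (ae_mul_le hI hw); apply: aeW => t h; apply: le_trans h _.
apply: ler_pM; rewrite ?N_ge0//; apply: ler_wsqrtr.
rewrite /Ic -ip_embE; [|exact: sqi_cst|exact: sqi_cst].
have -> : \int[mu]_(t in `]0, T[) (cst 1 t * cst 1 t) = \int[mu]_(t in `]0, T[) (1 : R).
  by apply: eq_Rintegral => s _ /=; rewrite mulr1.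
by rewrite Rintegral_cst//= lebesgue_measure_itv/= lte_fin T0 oppr0 adde0/= mul1r.
Qed.

Lemma mode_sup_box h M : 0 < h -> Lsq (emb T (box h) * fr (1 - alpha)) ->
  N (emb T (box h) * fr (1 - alpha)) <= M ->
  {ae mu, forall t, `|fun_part (Ic * w) t| <= (Num.sqrt h + 2 * (lam^-1 * M)) * N F}.
Proof.
have /andP[a0 a1] := ha; have r0 : 0 < 1 - alpha by rewrite subr_gt0.
move=> h0 hB BM; have [h1 N1] := N_1box_Ic T h0.
have k : 1 - alpha + alpha <= 2 by rewrite subrK ler1n.
have fE : fr (1 - alpha) * fr alpha = Ic by rewrite (frM T0 r0 a0 k) subrK fr1.
pose g := cst_alg T lam * (fr alpha * w).
have hg : Lsq g := LsqZ lam (LsqM (fr alpha) hw).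
have Ng : N g <= 2 * N F.
  have -> : g = F - w by rewrite -wE addrC addKr.
  by apply: le_trans (N_triangleB hF hw) _; rewrite mulr_natl mulr2n lerD2l.
(* The averaged part is rewritten through Ic w = lam^-1 fr(1-alpha) g, so that it gains lam^-1. *)
have E : Ic * w = (Ic - emb T (box h) * Ic) * w +
    cst_alg T lam^-1 * ((emb T (box h) * fr (1 - alpha)) * g).
  have c1 : cst_alg T lam^-1 * cst_alg T lam = 1 by rewrite -rmorphM mulVf ?rmorph1// lt0r_neq0.
  rewrite /g; move: c1 fE; move: (cst_alg T lam^-1) (cst_alg T lam) (emb T (box h)) Ic w.
  move: (fr (1 - alpha)) (fr alpha) => p q c1 c2 b i z c1E piE.
  have -> : c1 * (b * p * (c2 * (q * z))) = (c1 * c2) * (b * (p * q) * z) by ring.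
  rewrite c1E piE mul1r; ring.
move: (aeI (ae_mul_le h1 hw) (aeI (ae_mul_le hB hg) (aeI (fun_part_cst lam^-1 (emb T (box h) * fr (1 - alpha) * g))
  (fun_partD ((Ic - emb T (box h) * Ic) * w) (cst_alg T lam^-1 * ((emb T (box h) * fr (1 - alpha)) * g)))))).
apply: aeW => t [e1 [e2 [e3 e4]]]; rewrite E e4 e3 [leRHS]mulrDl.
apply: le_trans (ler_normD _ _) _; apply: lerD.
  apply: le_trans e1 _; apply: ler_pM; rewrite ?N_ge0//.
  by rewrite -[leLHS]ger0_norm ?N_ge0// -sqrtr_sqr ler_wsqrtr.
rewrite normrM gtr0_norm ?invr_gt0//.
have -> : 2 * (lam^-1 * M) * N F = lam^-1 * (M * (2 * N F)) by ring.
apply: ler_wpM2l; first by rewrite invr_ge0 ltW.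
by apply: le_trans e2 _; apply: ler_pM; rewrite ?N_ge0.
Qed.

End mode.

Lemma powR_sqrt lam (p : R) : 0 < lam -> Num.sqrt (lam `^ p) = lam `^ (p / 2).
Proof. by move=> l0; rewrite -powR12_sqrt ?powR_ge0// -powRrM. Qed.

Lemma mode_sup_gt alpha : 1 / 2 < alpha -> alpha < 1 -> exists2 C : R, 0 < C &
  forall lam F w, 1 <= lam -> Lsq F -> Lsq w -> N w <= N F ->
  w + cst_alg T lam * (fr alpha * w) = F ->
  {ae mu, forall t, lam `^ (1 / alpha / 2) * `|fun_part (Ic * w) t| <= C * N F}.
Proof.
move=> a2 a1; have a0 : 0 < alpha by lra.
have hr : 0 < 1 - alpha < 1 by apply/andP; split; lra.
have ha : 0 < alpha < 1 by rewrite a0.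
pose c : R := (Gamma (1 + (1 - alpha)))^-1.
have c0 : 0 < c by rewrite invr_gt0 Gamma_gt0//; apply/andP; split; lra.
pose th := 1 - 2 * alpha; have th0 : th < 0 by rewrite /th; lra.
pose D := 2 * c * Num.sqrt (- th)^-1.
have D0 : 0 <= D by rewrite mulr_ge0 ?sqrtr_ge0 ?mulr_ge0// ltW.
exists (1 + 2 * D) => [|lam F w l1 hF hw wF wE]; first by lra.
have l0 : 0 < lam by exact: lt_le_trans l1.
(* The window that balances the two terms: sqrt h and lam^-1 h^(th/2) are the same power of the
   eigenvalue. *)
pose h := lam `^ (- (1 / alpha)); have h0 : 0 < h by exact: powR_gt0.
have th1 : th != 0 by exact: ltr0_neq0.
have k0 : 0 <= th + 1 - 2 * (1 - alpha) by rewrite /th; lra.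
have [hB NB] := N_box_fr T0 hr h0 th1 k0.
have NB' : N (emb T (box h) * fr (1 - alpha)) <= D * h `^ (th / 2).
  rewrite -[leLHS]ger0_norm ?N_ge0// -sqrtr_sqr -powR_sqrt// /D -mulrA -sqrtrM; last first.
    by rewrite invr_ge0 oppr_ge0 ltW.
  rewrite -[2 * c]gtr0_norm; last by rewrite mulr_gt0.
  rewrite -sqrtr_sqr -sqrtrM ?sqr_ge0//; apply: ler_wsqrtr; apply: le_trans NB _.
  rewrite -/c ler_wpM2l ?sqr_ge0//.
  have -> : th + 1 - 2 * (1 - alpha) = 0 by rewrite /th; ring.
  rewrite oppr0 powRr0 mul1r.
  have -> : ((T + h) `^ th - h `^ th) / th = (- th)^-1 * (h `^ th - (T + h) `^ th).
    by rewrite invrN; ring.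
  by rewrite ler_wpM2l ?invr_ge0 ?oppr_ge0 ?(ltW th0)// gerBl powR_ge0.
move: (mode_sup_box ha l0 hF hw wF wE h0 hB NB'); apply: aeW => t; rewrite -/h => ht.
have L0 : 0 <= lam `^ (1 / alpha / 2) by exact: powR_ge0.
apply: le_trans (ler_wpM2l L0 ht) _; rewrite [leLHS]mulrA; apply: ler_wpM2r; first exact: N_ge0.
have n0 : lam != 0 by exact: lt0r_neq0.
have e1 : lam `^ (1 / alpha / 2) * Num.sqrt h = 1.
  rewrite /h powR_sqrt// -powRD; last by apply/implyP.
  by rewrite mulNr subrr powRr0.
have e2 : lam `^ (1 / alpha / 2) * (lam^-1 * h `^ (th / 2)) = 1.
  rewrite -(powR_inv1 (ltW l0)) /h -powRrM -!powRD; try by apply/implyP.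
  have -> : 1 / alpha / 2 + (-1 + - (1 / alpha) * (th / 2)) = 0.
    by rewrite /th; field; exact: lt0r_neq0.
  by rewrite powRr0.
have -> : lam `^ (1 / alpha / 2) * (Num.sqrt h + 2 * (lam^-1 * (D * h `^ (th / 2)))) =
    lam `^ (1 / alpha / 2) * Num.sqrt h + 2 * D * (lam `^ (1 / alpha / 2) * (lam^-1 * h `^ (th / 2))) by ring.
by rewrite e1 e2 mulr1.
Qed.

Lemma mode_sup_half alpha : alpha = 1 / 2 -> exists2 C : R, 0 < C &
  forall lam eps F w, 1 <= lam -> 0 < eps <= 2 -> Lsq F -> Lsq w -> N w <= N F ->
  w + cst_alg T lam * (fr alpha * w) = F ->
  {ae mu, forall t, lam `^ ((1 / alpha - eps) / 2) * `|fun_part (Ic * w) t| <=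
    C / eps `^ (1 / 2) * N F}.
Proof.
move=> aE; have ha : 0 < alpha < 1 by rewrite aE; apply/andP; split; lra.
have hr : 0 < 1 - alpha < 1 by rewrite aE; apply/andP; split; lra.
pose c : R := (Gamma (1 + (1 - alpha)))^-1.
have c0 : 0 < c by rewrite invr_gt0 Gamma_gt0//; rewrite aE; apply/andP; split; lra.
have T1 : 0 <= 2 * (T + 1) by have := T0; lra.
pose D := 2 * c * Num.sqrt (2 * (T + 1)).
have D0 : 0 <= D by rewrite mulr_ge0 ?sqrtr_ge0 ?mulr_ge0// ltW.
exists (2 + 2 * D) => [|lam eps F w l1 /andP[eps0 eps2] hF hw wF wE]; first by lra.
have l0 : 0 < lam by exact: lt_le_trans l1.
have n0 : lam != 0 by exact: lt0r_neq0.
pose h := lam `^ (-2); have h0 : 0 < h by exact: powR_gt0.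
have m2 : (-2 : R) <= 0 by lra.
have h1 : h <= 1 by rewrite /h -[leRHS](powRr0 lam) ler_powR.
(* With h = lam^-2 the loss h^(-th) is lam^eps. Its square root lam^th is absorbed by the weight
   lam^(1-th), and 1/th = 2/eps accounts for eps^(-1/2). *)
pose th := eps / 2; have th0 : 0 < th by rewrite divr_gt0.
have th1 : th <= 1 by rewrite ler_pdivrMr// mul1r.
have k0 : 0 <= th + 1 - 2 * (1 - alpha) by rewrite aE; lra.
have [hB NB] := N_box_fr T0 hr h0 (lt0r_neq0 th0) k0.
have eE : Num.sqrt eps = eps `^ (1 / 2) by rewrite -powR12_sqrt ?(ltW eps0)// mul1r.
have se0 : 0 < Num.sqrt eps by rewrite sqrtr_gt0.
have NB' : N (emb T (box h) * fr (1 - alpha)) <= D / Num.sqrt eps * lam `^ th.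
  have -> : D / Num.sqrt eps * lam `^ th = 2 * c * Num.sqrt (lam `^ eps * ((T + 1) / th)).
    rewrite sqrtrM ?powR_ge0// (powR_sqrt _ l0) -/th /D.
    have -> : (T + 1) / th = 2 * (T + 1) / eps by rewrite /th; field; exact: lt0r_neq0.
    rewrite [Num.sqrt (_ / eps)]sqrtrM// sqrtrV ?(ltW eps0)//; move: (Num.sqrt _) (Num.sqrt _) => p q; ring.
  rewrite -[2 * c]gtr0_norm; last by rewrite mulr_gt0.
  rewrite -[leLHS]ger0_norm ?N_ge0// -!sqrtr_sqr -sqrtrM ?sqr_ge0//; apply: ler_wsqrtr; apply: le_trans NB _.
  rewrite -/c ler_wpM2l ?sqr_ge0//.
  have -> : h `^ (- (th + 1 - 2 * (1 - alpha))) = lam `^ eps.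
    by rewrite /h -powRrM; congr (_ `^ _); rewrite aE /th; field.
  rewrite ler_wpM2l ?powR_ge0// ler_wpM2r ?invr_ge0 ?(ltW th0)//.
  apply: le_trans (_ : (T + h) `^ th <= _); first by rewrite gerBl powR_ge0.
  apply: (@le_trans _ _ ((T + 1) `^ th)).
    apply: ge0_ler_powR; rewrite ?nnegrE ?(ltW th0)// ?addr_ge0 ?(ltW T0) ?(ltW h0)//.
    by rewrite lerD2l.
  by apply: ler1_powR => //; rewrite lerDr ltW.
move: (mode_sup_box ha l0 hF hw wF wE h0 hB NB'); apply: aeW => t; rewrite -/h => ht.
have pE : (1 / alpha - eps) / 2 = 1 - th by rewrite aE /th; field.
rewrite pE; have L0 : 0 <= lam `^ (1 - th) by exact: powR_ge0.
apply: le_trans (ler_wpM2l L0 ht) _; rewrite [leLHS]mulrA; apply: ler_wpM2r; first exact: N_ge0.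
have e1 : lam `^ (1 - th) * Num.sqrt h <= 1.
  rewrite /h powR_sqrt// -powRD; last by apply/implyP.
  have -> : 1 - th + -2 / 2 = - th by field.
  by rewrite -(powRr0 lam) ler_powR// oppr_le0 ltW.
have e2 : lam `^ (1 - th) * (lam^-1 * lam `^ th) = 1.
  rewrite -(powR_inv1 (ltW l0)) -!powRD; try by apply/implyP.
  have -> : 1 - th + (-1 + th) = 0 by ring.
  by rewrite powRr0.
have -> : lam `^ (1 - th) * (Num.sqrt h + 2 * (lam^-1 * (D / Num.sqrt eps * lam `^ th))) =
    lam `^ (1 - th) * Num.sqrt h + 2 * D / Num.sqrt eps * (lam `^ (1 - th) * (lam^-1 * lam `^ th)) by ring.
rewrite e2 mulr1 -eE [leRHS]mulrDl; apply: lerD => //; apply: le_trans e1 _; rewrite ler_pdivlMr// mul1r.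
by rewrite -(@ger0_norm _ 2)// -sqrtr_sqr ler_wsqrtr// (le_trans eps2)// expr2 ler_peMr// ler1n.
Qed.

(** For eigenvalues below 1 the window h would be long, and averaging is pointless. There the weight
    is at most 1, its exponent being nonnegative as [eps <= 2], and the crude bound sqrt T |F|
    suffices; the factor 2 in the constant covers eps^(sigma/2) <= 2. *)
Lemma mode_sup alpha : 1 / 2 <= alpha -> alpha < 1 ->
  let sigma : R := if alpha == 1 / 2 then 1 else 0 in exists2 C : R, 0 < C &
  forall lam eps F w, 0 < lam -> 0 < eps <= 2 -> Lsq F -> Lsq w -> N w <= N F ->
  w + cst_alg T lam * (fr alpha * w) = F ->
  {ae mu, forall t, lam `^ ((1 / alpha - sigma * eps) / 2) * `|fun_part (Ic * w) t| <=
    C / eps `^ (sigma / 2) * N F}.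
Proof.
move=> a2 a1 sigma; have a0 : 0 < alpha by lra.
have [C C0 hC] : exists2 C : R, 0 < C & forall lam eps F w, 1 <= lam -> 0 < eps <= 2 ->
    Lsq F -> Lsq w -> N w <= N F -> w + cst_alg T lam * (fr alpha * w) = F ->
    {ae mu, forall t, lam `^ ((1 / alpha - sigma * eps) / 2) * `|fun_part (Ic * w) t| <=
      C / eps `^ (sigma / 2) * N F}.
  rewrite /sigma; have [aE|an] := eqVneq alpha (1 / 2).
    have [C C0 h] := mode_sup_half aE; exists C => // lam eps F w l1 he hF hw wF wE.
    by rewrite [1 * eps]mul1r; exact: h.
  have lt : 1 / 2 < alpha by rewrite lt_neqAle eq_sym an.
  have [C C0 h] := mode_sup_gt lt a1; exists C => // lam eps F w l1 he hF hw wF wE.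
  by rewrite [0 * eps]mul0r subr0 [0 / 2]mul0r powRr0 divr1; exact: h.
have s01 : 0 <= sigma <= 1 by rewrite /sigma; case: ifP => _; rewrite ?lexx ?ler01.
exists (C + 2 * Num.sqrt T) => [|lam eps F w l0 he hF hw wF wE].
  by rewrite ltr_pwDl// mulr_ge0 ?sqrtr_ge0.
have /andP[eps0 eps2] := he; have NF := N_ge0 F.
have e0 : 0 < eps `^ (sigma / 2) by exact: powR_gt0.
have sT : 0 <= Num.sqrt T by exact: sqrtr_ge0.
have [l1|l1] := leP 1 lam.
  move: (hC lam eps F w l1 he hF hw wF wE); apply: aeW => t h; apply: le_trans h _.
  by rewrite ler_wpM2r// ler_wpM2r ?invr_ge0 ?(ltW e0)// lerDl mulr_ge0.
move: (mode_sup_Ic hw wF); apply: aeW => t h.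
have L1 : lam `^ ((1 / alpha - sigma * eps) / 2) <= 1.
  rewrite -[leRHS](powRr0 lam) ger_powR//; first by rewrite l0 ltW.
  rewrite divr_ge0// subr_ge0 /sigma; case: ifP => [/eqP ->|_]; last by rewrite mul0r divr_ge0// ltW.
  by rewrite mul1r (_ : 1 / (1 / 2) = 2)//; field.
apply: (@le_trans _ _ (1 * (Num.sqrt T * N F))).
  by apply: ler_pM; rewrite ?powR_ge0.
rewrite mul1r ler_wpM2r// ler_pdivlMr//.
have E2 : eps `^ (sigma / 2) <= 2.
  rewrite /sigma; case: ifP => _; last by rewrite mul0r powRr0 ler1n.
  apply: (@le_trans _ _ (2 `^ (1 / 2))).
    by apply: ge0_ler_powR; rewrite ?nnegrE ?(ltW eps0)// divr_ge0.
  by apply: ler1_powR; rewrite ?ler1n//; lra.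
apply: le_trans (ler_wpM2l sT E2) _; rewrite mulrC lerDr; exact: ltW.
Qed.

End supremum_bound.

(** * Continuous representatives *)

Section continuous_versions.
Context {R : realType} (T : R) (T0 : 0 < T).
Local Notation mu := (@lebesgue_measure R).
Local Notation sqT := (square_integrable mu `]0, T[).
Local Notation Ic := (Ic T).

Lemma cvg_to0 (F : set_system R) (FF : Filter F) (g : R -> \bar R) : (forall x, 0 <= g x)%E ->
  (forall e, 0 < e -> \forall x \near F, (g x <= e%:E)%E) -> g x @[x --> F] --> 0%E.
Proof.
move=> g0 h; apply/fine_cvgP; split.
  apply: filterS (h 1 ltr01) => x gx; rewrite ge0_fin_numE//; exact: (le_lt_trans gx (ltry _)).
apply/cvgrPdist_le => e e0; apply: filterS (h e e0) => x.
rewrite sub0r normrN /=; move: (g0 x); case: (g x) => [r| |]//=.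
by rewrite !lee_fin => r0 re; rewrite ger0_norm.
Qed.

Section all_modes.
Variables (lam : nat -> R) (l0 : forall n, 0 < lam n) (f u : nat -> R -> R) (w : nat -> calg T).
Variables (p beta K : R).
Hypotheses (sf : forall n, sqT (f n)) (su : forall n, sqT (u n)) (hw : forall n, Lsq (w n)).
Hypotheses (uE : forall n, emb T (u n) = Ic * w n) (K0 : 0 <= K) (hf : L2X lam T (- beta) f).
Hypothesis sup_ae : forall n, {ae mu, forall t,
  lam n `^ (p / 2) * `|fun_part (Ic * w n) t| <= K * N (emb T (f n))}.

Let W n t := \int[mu]_(s in `]0, t[) fun_part (w n) s.

Let W_continuous n : {within `[0, T], continuous (W n)}.
Proof. exact: continuous_primitive (good_L1 (good_fun (w n))) (ltW T0). Qed.

Let W_cvg n t : t \in `[0, T] -> W n t' @[t' --> within `[0, T] (nbhs t)] --> W n t.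
Proof. by move=> tT; have /subspace_continuousP := @W_continuous n; apply. Qed.

Let W_ae n : {ae mu, forall t, 0 < t < T -> W n t = fun_part (Ic * w n) t}.
Proof. by move: (fun_part_Ic (hw n).1); apply: aeW => t h tT; rewrite h//= in_itv. Qed.

Let W_sup n t : t \in `[0, T] -> lam n `^ (p / 2) * `|W n t| <= K * N (emb T (f n)).
Proof.
rewrite in_itv/= => tT; pose B := K * N (emb T (f n)).
(* The function v is twice the positive part of x. It is continuous and vanishes almost everywhere,
   hence everywhere, which turns the almost sure bound into a pointwise one. *)
pose x t := lam n `^ (p / 2) * `|W n t| - B; pose v t := `|x t| + x t.
have cv : {within `[0, T], continuous v}.
  have cx : {within `[0, T], continuous x}.
    move=> s; apply: cvgB; last exact: cvg_cst.
    by apply: cvgM; [exact: cvg_cst|apply: cvg_norm; exact: W_continuous].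
  by move=> s; apply: cvgD; [apply: cvg_norm; exact: cx|exact: cx].
have := @within_ae_cst _ v 0 T 0 T0 cv _ t tT; rewrite /v => vt.
suff : `|x t| + x t = 0.
  by rewrite -subr_le0 -/B -/(x t) => e; rewrite -(opprK (x t)) -(addr0_eq e) oppr_le0.
apply: vt; move: (aeI (W_ae n) (sup_ae n)); apply: aeW => s [h1 h2] sT.
have xs : x s <= 0 by rewrite /x subr_le0 h1.
by rewrite ler0_norm// addNr.
Qed.

Let y n : R := (lam n `^ (- beta / 2) * N (emb T (f n))) ^+ 2.

Let yE n : (H0_norm T 0 (fun t => (lam n `^ (- beta / 2) * f n t)%R) ^+ 2 = (y n)%:E)%E.
Proof.
rewrite (H0_normL2 T0 (sqT_scale _ (sf n))) -(embZ _ (sqT_L1T (sf n))) NZ.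
by rewrite ger0_norm ?powR_ge0// -EFin_expe.
Qed.

Let y0 n : 0 <= y n. Proof. exact: sqr_ge0. Qed.

Let powRp n : lam n `^ (p - beta) = (lam n `^ (p / 2) * lam n `^ (- beta / 2)) ^+ 2.
Proof.
have n0 : lam n != 0 by exact: lt0r_neq0.
rewrite expr2 -!powRD; try by apply/implyP.
by congr (_ `^ _); field.
Qed.

Let term_le n z C : 0 <= C -> lam n `^ (p / 2) * `|z| <= C * N (emb T (f n)) ->
  lam n `^ (p - beta) * z ^+ 2 <= C ^+ 2 * y n.
Proof.
move=> C0 h; rewrite powRp -exprMn /y -exprMn -[leLHS]real_normK ?num_real//.
apply: lerXn2r; rewrite ?nnegrE ?normr_ge0 ?mulr_ge0 ?powR_ge0 ?N_ge0//.
rewrite !normrM !(ger0_norm (powR_ge0 _ _)) mulrAC [leRHS]mulrCA.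
by rewrite [leRHS]mulrC ler_wpM2r ?powR_ge0.
Qed.

Let x0 c n : (0 <= (lam n `^ (p - beta) * (c n) ^+ 2)%:E)%E.
Proof. by rewrite lee_fin mulr_ge0 ?powR_ge0 ?sqr_ge0. Qed.

Let dotH_le t : t \in `[0, T] ->
  (dotH_norm lam (p - beta) (W^~ t) <= K%:E * H0X_norm lam T 0 (- beta) f)%E.
Proof.
move=> tT; apply: (@sqrte_nneseries_le _ _ _ K K0) => n; [exact: (x0 (W^~ t))|exact: sqre_ge0|].
by rewrite yE -EFinM lee_fin; apply: term_le => //; exact: W_sup.
Qed.

Let W_diff_cvg N t : t \in `[0, T] ->
  \sum_(0 <= n < N) lam n `^ (p - beta) * (W n t' - W n t) ^+ 2
    @[t' --> within `[0, T] (nbhs t)] --> (0 : R).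
Proof.
move=> tT; elim: N => [|N IH].
  rewrite (_ : (fun t' => _) = cst 0); first exact: cvg_cst.
  by apply/funext => t'; rewrite big_geq.
rewrite (_ : (fun t' => _) = (fun t' => \sum_(0 <= n < N) lam n `^ (p - beta) * (W n t' - W n t) ^+ 2 +
    lam N `^ (p - beta) * ((W N t' - W N t) * (W N t' - W N t)))); last first.
  by apply/funext => t'; rewrite big_nat_recr//= expr2.
rewrite -[X in _ --> X](addr0 (0 : R)); apply: cvgD => //.
rewrite -[X in _ --> X](mulr0 (lam N `^ (p - beta))); apply: cvgM; first exact: cvg_cst.
have d : (W N t' - W N t) @[t' --> within `[0, T] (nbhs t)] --> (0 : R).
  by rewrite -[X in _ --> X](subrr (W N t)); apply: cvgB; [exact: W_cvg|exact: cvg_cst].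
by rewrite -[X in _ --> X](mulr0 (0 : R)); exact: cvgM.
Qed.

(** The primitives [W] are the continuous representatives of the modes. Finitely many modes converge
    by continuity, and the tail is small uniformly in time because [W_sup] dominates it by the tail
    of the series for [f]. *)
Lemma continuous_modes : exists2 v : nat -> R -> R, continuous_version lam T (p - beta) u v &
  (CX_norm lam T (p - beta) v <= K%:E * H0X_norm lam T 0 (- beta) f)%E.
Proof.
exists W; last by apply: ge_ereal_sup => _ [t tT <-]; exact: dotH_le.
split.
- move=> n; move: (aeI (W_ae n) (embE (sqT_L1T (su n)))); apply: aeW => t [h1 h2] tT.
  have tT' : 0 < t < T by move: tT; rewrite in_itv.
  by rewrite h1// -uE h2.
- by move=> t tT; apply: le_lt_trans (dotH_le tT) _; apply: lte_mul_pinfty; rewrite ?lee_fin.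
move=> t tT; apply: cvg_to0 => [t'|e e0]; first exact: sqrte_ge0.
(* The factor 2 arises because the tail involves differences of two values, each bounded by
   [W_sup]. *)
have fin : (\sum_(0 <= n <oo) ((2 * K) ^+ 2 * y n)%:E < +oo)%E.
  under eq_eseriesr do rewrite EFinM.
  rewrite nneseriesZl => [|n _]; last by rewrite lee_fin.
  apply: lte_mul_pinfty; rewrite ?lee_fin ?sqr_ge0//.
  have := hf; rewrite /L2X /H0X_norm.
  under eq_eseriesr do rewrite yE.
  move=> h; have s0 : (0 <= \sum_(0 <= n <oo) (y n)%:E)%E.
    by apply: nneseries_ge0 => n _ _; rewrite lee_fin.
  by rewrite -ge0_fin_numE// -sqrte_fin_num// ge0_fin_numE// sqrte_ge0.
have e2 : 0 < e ^+ 2 / 2 by rewrite divr_gt0// exprn_gt0.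
have yy0 k : xpredT k -> (0 <= ((2 * K) ^+ 2 * y k)%:E)%E by rewrite lee_fin mulr_ge0// sqr_ge0.
have [M hM] : exists M, (\sum_(M <= n <oo) ((2 * K) ^+ 2 * y n)%:E <= (e ^+ 2 / 2)%:E)%E.
  have /fine_cvgP[[M1 _ h1]] := nneseries_tail_cvg fin yy0.
  move=> /cvgrPdist_le/(_ _ e2)[M2 _ h2]; exists (maxn M1 M2).
  have := h2 (maxn M1 M2) (leq_maxr _ _); rewrite sub0r normrN => h3.
  rewrite -(fineK (h1 (maxn M1 M2) (leq_maxl _ _))) lee_fin.
  by apply: le_trans h3; exact: ler_norm.
have := W_diff_cvg M tT => /cvgrPdist_le/(_ _ e2).
rewrite !near_withinE; apply: filterS => t' h t'T; have {}h := h t'T.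
have -> : e%:E = sqrte (e ^+ 2)%:E by rewrite sqrte_EFinX2// ltW.
rewrite lee_sqrt ?lee_fin ?sqr_ge0// (nneseries_split 0 M) => [|k _]; last exact: (x0 (fun n => W n t' - W n t)).
rewrite [e ^+ 2]splitr EFinD; apply: leeD.
  rewrite add0n sumEFin lee_fin; apply: le_trans h; rewrite sub0r normrN; exact: ler_norm.
rewrite add0n; apply: le_trans hM; apply: lee_nneseries => [n _ _|n _].
  exact: (x0 (fun n => W n t' - W n t)).
rewrite lee_fin; apply: term_le; first by rewrite mulr_ge0.
have t1 : t' \in `[0, T] by [].
apply: le_trans (ler_wpM2l (powR_ge0 _ _) (ler_normB _ _)) _.
by rewrite mulrDr -mulrA mulr_natl mulr2n; apply: lerD; exact: W_sup.
Qed.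

End all_modes.

End continuous_versions.

Theorem theorem3p2 (R : realType) (alpha : R) (halpha : 0 < alpha < 1) :
  (forall gamma : R, 0 <= gamma <= 1 / 2 ->
   exists2 C : R, 0 < C &
   forall (T : R) (d : nat) (Omega : set 'rV[R]_d)
     (phi : nat -> 'rV[R]_d -> R) (lam : nat -> R) (beta : R)
     (f u : nat -> R -> R),
   0 < T -> (1 <= d <= 3)%N -> convex_polyhedral_domain Omega ->
   dirichlet_eigenbasis Omega phi lam ->
   0 <= beta <= 1 ->
   H0X lam T gamma (- beta) f ->
   weak_solution Omega phi lam alpha T f u ->
   solves_in_L2 lam alpha T (- beta) f u /\
   (H0X_norm lam T (1 + gamma) (- beta) u +
    H0X_norm lam T (1 + gamma - alpha) (2 - beta) u <=
    C%:E * H0X_norm lam T gamma (- beta) f)%E) /\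
  (1 / 2 <= alpha ->
   let sigma : R := if alpha == 1 / 2 then 1 else 0 in
   forall T : R, 0 < T ->
   exists2 C : R, 0 < C &
   forall (d : nat) (Omega : set 'rV[R]_d)
     (phi : nat -> 'rV[R]_d -> R) (lam : nat -> R) (beta eps : R)
     (f u : nat -> R -> R),
   (1 <= d <= 3)%N -> convex_polyhedral_domain Omega ->
   dirichlet_eigenbasis Omega phi lam ->
   0 <= beta <= 1 -> 0 < eps <= 2 ->
   L2X lam T (- beta) f ->
   weak_solution Omega phi lam alpha T f u ->
   let s := 1 / alpha - sigma * eps - beta in
   exists2 w : nat -> R -> R, continuous_version lam T s u w &
     (CX_norm lam T s w <=
      (C / eps `^ (sigma / 2))%:E * H0X_norm lam T 0 (- beta) f)%E).
Proof.
have /andP[a0 a1] := halpha; split.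
  move=> gamma hg; have [C C0 hC] := modes_bound halpha hg.
  exists C => // T d Omega phi lam beta f u T0 /andP[d0 _] cpd basis _ [hf hfg] ws.
  have mO := measurable_polyhedron cpd.
  have l0 n : 0 < lam n by case: basis.
  have red n := weak_solution_mode d0 mO T0 basis halpha hf ws n.
  have sf n : square_integrable lebesgue_measure `]0, T[ (f n) by have [] := red n.
  have su n : square_integrable lebesgue_measure `]0, T[ (u n) by have [] := red n.
  have mode n : emb T (u n) + cst_alg T (lam n) * (fr T alpha * emb T (u n)) =
      Ic T * emb T (f n) by have [] := red n.
  split; first exact: (modes_solve T0 halpha l0 sf su hf mode).
  exact: hC T beta lam f u T0 l0 hfg sf su mode.
move=> a2 sigma T T0; have [C C0 hC] := mode_sup T0 a2 a1.
exists C => // d Omega phi lam beta eps f u /andP[d0 _] cpd basis _ he hf ws s.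
have mO := measurable_polyhedron cpd.
have l0 n : 0 < lam n by case: basis.
have red n := weak_solution_mode d0 mO T0 basis halpha hf ws n.
have sf n : square_integrable lebesgue_measure `]0, T[ (f n) by have [] := red n.
have su n : square_integrable lebesgue_measure `]0, T[ (u n) by have [] := red n.
have /choice[w hw] n : exists w : calg T, [/\ Lsq w, emb T (u n) = Ic T * w,
    w + cst_alg T (lam n) * (fr T alpha * w) = emb T (f n) & N w <= N (emb T (f n))].
  by have [_ _ mode] := red n; exact: (mode_derivative T0 halpha (l0 n) (sf n) (su n) mode).
have K0 : 0 <= C / eps `^ (sigma / 2) by rewrite divr_ge0 ?powR_ge0// ltW.
apply: (continuous_modes T0 l0 sf su _ _ K0 hf (w := w)) => n; have [h1 h2 h3 h4] := hw n => //.
exact: (hC (lam n) eps (emb T (f n)) (w n) (l0 n) he (sqT_Lsq (sf n)) h1 h4 h3).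
Qed.
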